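(* (Hecke operator tempered distribution eigenspace) Let $N$ be a nonzero integer, and let $\chi$ be a Dirichlet character modulo $d$, with $d\mid N$. (1) For each fixed $s\in\mathbb{C}$, let $\mathcal{E}_s(\mathcal{H}_{N,d}(\chi))$ be the vector space of tempered distributions $\Delta\in\mathcal{S}'(\mathcal{H}_{N,d}(\chi))$ such that $$T_m(\Delta)=\chi(m)m^{-s}\Delta\quad\text{for all } m\ge1 \text{ with }\gcd(m,N)=1.$$ Then $\mathcal{E}_s(\mathcal{H}_{N,d}(\chi))$ is a two-dimensional vector space, and is spanned by an even homogeneous tempered distribution of homogeneity $|t|^{1-s}$ and an odd homogeneous tempered distribution of homogeneity $\mathrm{sgn}(t)|t|^{1-s}$. (2) For all non-integer $s\in\mathbb{C}$ the two Lerch $L$-distributions $L^{\pm}_{N,d}(\chi,s,a,c,z)$ are nonzero even and odd homogeneous distributions spanning $\mathcal{E}_s(\mathcal{H}_{N,d}(\chi))$, respectively. For $0<\mathrm{Re}(s)<1$ these two distributions are induced by the Lerch $L$-functions $L^{\pm}_{N,d}(\chi,s,a,c,z)$, which both lie in $L^1(\mathcal{H}_{N,d}(\chi))$.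
   Context: $H(\mathbb{R})$ is the real Heisenberg group of triples $[a,c,z]\in\mathbb{R}^3$ with law $[a,c,z]\circ[a',c',z']=[a+a',c+c',z+z'+ca']$; $H(\mathbb{Z})$ is the subgroup of integer triples. $\mathcal{H}_N$ is the Hilbert space of left $H(\mathbb{Z})$-invariant functions $F$ on $H(\mathbb{R})$, square-integrable over $[0,1]^3$ for $da\,dc\,dz$, with $F(a,c,z)=e^{2\pi i Nz}F(a,c,0)$ almost everywhere. Divisors are positive, and $d\mid N$ means that $d$ divides $|N|$. The twisted Weil–Brezin map $\mathcal{W}_{N,d}(\chi):L^2(\mathbb{R},dx)\to\mathcal{H}_N$ is the isometric extension of $$\mathcal{W}_{N,d}(\chi)(f)(a,c,z)=\sqrt{C_{N,d}}\,e^{2\pi i Nz}\sum_{n\in\mathbb{Z}}\chi\Big(\frac{nd}{N}\Big)f(n+Nc)e^{2\pi i na},\qquad C_{N,d}=\frac{N}{\phi(d)}$$ ($f$ Schwartz; $\phi$ Euler's function; $\chi(r)=0$ if $r\notin\mathbb{Z}$), and $\mathcal{H}_{N,d}(\chi)$ is its closed image. $\mathcal{S}(\mathcal{H}_{N,d}(\chi))$ is the image of the Schwartz space $\mathcal{S}(\mathbb{R})$ with the induced topology, and $\mathcal{S}'(\mathcal{H}_{N,d}(\chi))$, the space of tempered distributions on $\mathcal{H}_{N,d}(\chi)$, is its topological dual. The isomorphism $\mathcal{W}_{N,d}(\chi)^{\sharp}:\mathcal{S}'(\mathbb{R})\to\mathcal{S}'(\mathcal{H}_{N,d}(\chi))$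 is given by $\langle\mathcal{W}_{N,d}(\chi)^{\sharp}(\Delta'),\mathcal{W}_{N,d}(\chi)(\varphi)\rangle=\langle\Delta',\varphi\rangle$ (pairings linear in both arguments). On $\mathcal{S}'(\mathbb{R})$ put $\langle U(t)\Delta',\varphi\rangle=\langle\Delta',|t|^{-1/2}\varphi(x/t)\rangle$ for $t\in\mathbb{R}^*$. $\Delta'$ is even (odd) if $U(-1)\Delta'=\Delta'$ (respectively $=-\Delta'$), and is homogeneous of homogeneity $\psi$ ($\psi$ a quasicharacter of $\mathbb{R}^*$) if $U(t)\Delta'=\psi(t)|t|^{-1/2}\Delta'$ for all $t\in\mathbb{R}^*$. These notions are carried to $\mathcal{S}'(\mathcal{H}_{N,d}(\chi))$ through $\mathcal{W}_{N,d}(\chi)^{\sharp}$. On functions the two-variable Hecke operators are $T_m(F)(a,c,z)=\frac1m\sum_{j=0}^{m-1}F(\frac{a+j}{m},mc,z)$; for $\gcd(m,N/d)=1$ they satisfy $T_m(\mathcal{W}_{N,d}(\chi)(f))=\chi(m)\,\mathcal{W}_{N,d}(\chi)(T_m^{\chi_0}f)$ with $T_m^{\chi_0}f(x)=f(mx)$. The operator $T_m^{\chi_0}$ extends uniquely to a continuous operator on $\mathcal{S}'(\mathbb{R})$, with $T_m^{\chi_0}=|m|^{-1/2}U(m)$, and on tempered distributions $T_m(\mathcal{W}_{N,d}(\chi)^{\sharp}(\Delta'))=\chi(m)\,\mathcal{W}_{N,d}(\chi)^{\sharp}(T_m^{\chi_0}\Delta')$ for $\gcd(m,N/d)=1$.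 For $\mathrm{Re}(s)>0$, $\Delta_s^{\pm}$ is the tempered distribution given by the locally integrable function $(\mathrm{sgn}\,x)^k|x|^{s-1}$, $(-1)^k=\pm$; it continues to a meromorphic family in $s\in\mathbb{C}$ whose poles lie in a subset of $\mathbb{Z}$. For $s\in\mathbb{C}$ the Lerch $L$-distribution $L^{\pm}_{N,d}(\chi,s,a,c,z)$ is the image of $\Delta_{1-s}^{\pm}$ in $\mathcal{S}'(\mathcal{H}_{N,d}(\chi))$ under the twisted Weil–Brezin map on tempered distributions. For $0<\mathrm{Re}(s)<1$ and non-integer $a$ and $c$, the Lerch $L$-function (denoted by the same symbol) is given by the conditionally convergent series $L^{\pm}_{N,d}(\chi,s,a,c,z)=e^{2\pi i Nz}\sum_{n\in\mathbb{Z}}\chi(\frac{nd}{N})(\mathrm{sgn}(n+Nc))^k e^{2\pi i na}|n+Nc|^{-s}$, $(-1)^k=\pm$. $L^1(\mathcal{H}_{N,d}(\chi))$ is the space of locally $L^1$ functions on $H(\mathbb{R})$ which transform according to the relations holding in $\mathcal{H}_{N,d}(\chi)$. To each such function $G$ there is naturally associated (induced) a tempered distribution, by $\langle G,\mathcal{W}_{N,d}(\chi)(\varphi)\rangle=\int_0^1\int_0^1\int_0^1 G\cdot\overline{\mathcal{W}_{N,d}(\chi)(\bar\varphi)}\,da\,dc\,dz$.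
   Formalization: The Lerch L-distributions are shown to be induced by sqrt(C_{N,d}) times the Lerch L-functions: with the stated definitions the L-functions themselves induce C_{N,d}^{-1/2} times the distributions, so the literal equality fails unless C_{N,d}=1 (for example N=2, d=1). *)

(* Defs.v *)
From HB Require Import structures.
From mathcomp Require Import all_boot all_order all_algebra.
From mathcomp Require Import all_classical all_reals all_analysis.
From mathcomp.real_closed Require Import complex.
From mathcomp Require Import ring lra.

Set Implicit Arguments.
Unset Strict Implicit.
Unset Printing Implicit Defensive.

Import Order.TTheory GRing.Theory Num.Theory numFieldNormedType.Exports.
Import Normc.

Local Notation Re := complex.Re.
Local Notation Im := complex.Im.

Local Open Scope classical_set_scope.
Local Open Scope ring_scope.
Local Open Scope complex_scope.

Section ComplexAnalysis.
Context {R : realType}.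
Local Notation C := R[i].

Definition cexp (z : C) : C := (expR (Re z))%:C * (cos (Im z) +i* sin (Im z)).

(* e2pi x = e^(2 pi i x) *)
Definition e2pi (x : R) : C := cexp ((2 * pi * x) *i).

(* x^s for a real x > 0; the value at x = 0 is a convention that only matters
   on null sets *)
Definition cpow (x : R) (s : C) : C :=
  if x == 0 then 0 else cexp (s * (ln x)%:C).

(* sgn(x)^k, where k = false (even) or k = true (odd) *)
Definition sgnpow (k : bool) (x : R) : C := (Num.sg x ^+ k)%:C.

Definition is_integer (s : C) : Prop := exists n : int, s = n%:~R.

(* Limits in C are taken componentwise, so that only the topology of R is
   involved; `clim` is meaningful when `ccvg` holds for some l *)
Definition ccvg (u : nat -> C) (l : C) : Prop :=
  (Re (u n) @[n --> \oo] --> Re l) /\ (Im (u n) @[n --> \oo] --> Im l).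

Definition clim (u : nat -> C) : C :=
  lim (Re (u n) @[n --> \oo]) +i* lim (Im (u n) @[n --> \oo]).

(* Two-sided series: each half converges separately (possibly only
   conditionally); Negz n is -(n+1) *)
Definition zseries (u : int -> C) : C :=
  clim (fun m => \sum_(0 <= n < m) u (Posz n)) +
  clim (fun m => \sum_(0 <= n < m) u (Negz n)).

(* Analyticity and meromorphy in the sense of Weierstrass: power series, resp.
   Laurent series with finite principal part *)
Definition analytic_at (F : C -> C) (s0 : C) : Prop :=
  exists (a : nat -> C) (r : R), 0 < r /\
    forall s, normc (s - s0) < r ->
      ccvg (fun m => \sum_(0 <= n < m) a n * (s - s0) ^+ n) (F s).

Definition meromorphic_at (F : C -> C) (s0 : C) : Prop :=
  exists (k : nat) (a : nat -> C) (r : R), 0 < r /\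
    forall s, 0 < normc (s - s0) < r ->
      ccvg (fun m => \sum_(0 <= n < m) a n * (s - s0) ^+ n)
           (F s * (s - s0) ^+ k).

Section Integration.
Context {d : measure_display} {T : measurableType d}.
Variable mu : {measure set T -> \bar R}.

Definition cintegrable (D : set T) (f : T -> C) : Prop :=
  mu.-integrable D (EFin \o (fun x => Re (f x))) /\
  mu.-integrable D (EFin \o (fun x => Im (f x))).

Definition cintegral (D : set T) (f : T -> C) : C :=
  Rintegral mu D (fun x => Re (f x)) +i* Rintegral mu D (fun x => Im (f x)).

Definition cmeasurable (f : T -> C) : Prop :=
  measurable_fun setT (fun x => Re (f x)) /\
  measurable_fun setT (fun x => Im (f x)).

End Integration.

(* k-th derivative of a complex-valued function of a real variable *)
Definition cderiv (k : nat) (f : R -> C) : R -> C :=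
  fun x => derive1n k (fun y => Re (f y)) x +i* derive1n k (fun y => Im (f y)) x.

Definition csmooth (f : R -> C) : Prop :=
  forall k x, derivable (derive1n k (fun y => Re (f y))) x 1 /\
              derivable (derive1n k (fun y => Im (f y))) x 1.

Definition is_schwartz (f : R -> C) : Prop :=
  csmooth f /\
  forall j k : nat, exists M : R,
    forall x, `|x| ^+ j * normc (cderiv k f x) <= M.

End ComplexAnalysis.

Section SchwartzSpace.
Context {R : realType}.
Local Notation C := R[i].
Implicit Types (f g : R -> C) (a z w : C).

Let smooth (f : R -> R) := forall k (x : R), derivable (derive1n k f) x 1.

Let derive1nD (f g : R -> R) : smooth f -> smooth g -> forall k,
  derive1n k (fun y => f y + g y) = (fun y => derive1n k f y + derive1n k g y).
Proof.
move=> sf sg; elim=> [//|k IH]; apply/funext => x.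
by rewrite derive1nS IH derive1E (deriveD (sf k x) (sg k x)) -!derive1E.
Qed.

Let derive1nZ (c : R) (f : R -> R) : smooth f -> forall k,
  derive1n k (fun y => c * f y) = (fun y => c * derive1n k f y).
Proof.
move=> sf; elim=> [//|k IH]; apply/funext => x.
by rewrite derive1nS IH (derive1Ml _ (sf k x)).
Qed.

Let smoothD (f g : R -> R) : smooth f -> smooth g ->
  smooth (fun y => f y + g y).
Proof. by move=> sf sg k x; rewrite derive1nD//; exact: derivableD. Qed.

Let smoothZ (c : R) (f : R -> R) : smooth f -> smooth (fun y => c * f y).
Proof.
move=> sf k x; rewrite derive1nZ//.
by have := @derivableZ R R R _ c x 1 (sf k x).
Qed.

Lemma normcD z w : normc (z + w) <= normc z + normc w.
Proof. exact: le_normcD. Qed.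

Lemma csmooth_smooth f : csmooth f ->
  smooth (fun y => Re (f y)) /\ smooth (fun y => Im (f y)).
Proof. by move=> sf; split=> k x; [exact: (sf k x).1|exact: (sf k x).2]. Qed.

Let ReD z w : Re (z + w) = Re z + Re w.
Proof. by case: z; case: w. Qed.
Let ImD z w : Im (z + w) = Im z + Im w.
Proof. by case: z; case: w. Qed.
Let ReM z w : Re (z * w) = Re z * Re w + (- Im z) * Im w.
Proof. by case: z => a b; case: w => c d /=; rewrite mulNr. Qed.
Let ImM z w : Im (z * w) = Re z * Im w + Im z * Re w.
Proof. by case: z; case: w. Qed.

Lemma csmoothD f g : csmooth f -> csmooth g -> csmooth (f + g).
Proof.
move=> /csmooth_smooth[rf jf] /csmooth_smooth[rg jg] k x; split.
- have -> : (fun y => Re ((f + g) y)) = (fun y => Re (f y) + Re (g y)).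
    by apply/funext => y; rewrite -ReD.
  exact: smoothD.
- have -> : (fun y => Im ((f + g) y)) = (fun y => Im (f y) + Im (g y)).
    by apply/funext => y; rewrite -ImD.
  exact: smoothD.
Qed.

Lemma csmoothZ a f : csmooth f -> csmooth (a *: f).
Proof.
move=> /csmooth_smooth[rf jf] k x; split.
- have -> : (fun y => Re ((a *: f) y)) =
      (fun y => Re a * Re (f y) + (- Im a) * Im (f y)).
    by apply/funext => y; rewrite -ReM.
  by apply: smoothD; apply: smoothZ.
- have -> : (fun y => Im ((a *: f) y)) =
      (fun y => Re a * Im (f y) + Im a * Re (f y)).
    by apply/funext => y; rewrite -ImM.
  by apply: smoothD; apply: smoothZ.
Qed.

Lemma cderivD f g : csmooth f -> csmooth g -> forall k x,
  cderiv k (f + g) x = cderiv k f x + cderiv k g x.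
Proof.
move=> /csmooth_smooth[rf jf] /csmooth_smooth[rg jg] k x.
rewrite /cderiv.
have -> : (fun y => Re ((f + g) y)) = (fun y => Re (f y) + Re (g y)).
  by apply/funext => y; rewrite -ReD.
have -> : (fun y => Im ((f + g) y)) = (fun y => Im (f y) + Im (g y)).
  by apply/funext => y; rewrite -ImD.
by rewrite (derive1nD rf rg) (derive1nD jf jg).
Qed.

Lemma cderivZ a f : csmooth f -> forall k x,
  cderiv k (a *: f) x = a * cderiv k f x.
Proof.
move=> /csmooth_smooth[rf jf] k x; rewrite /cderiv.
have -> : (fun y => Re ((a *: f) y)) =
    (fun y => Re a * Re (f y) + (- Im a) * Im (f y)).
  by apply/funext => y; rewrite -ReM.
have -> : (fun y => Im ((a *: f) y)) =
    (fun y => Re a * Im (f y) + Im a * Re (f y)).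
  by apply/funext => y; rewrite -ImM.
rewrite (derive1nD (smoothZ rf) (smoothZ jf)).
rewrite (derive1nD (smoothZ jf) (smoothZ rf)).
rewrite !(derive1nZ _ rf) !(derive1nZ _ jf).
by apply/eqP; rewrite eq_complex ReM ImM /= !eqxx.
Qed.

Let smooth0 : smooth (fun=> 0).
Proof.
move=> k x; suff -> : derive1n k (fun=> 0 : R) = cst 0 by exact: derivable_cst.
elim: k => [//|k IH]; apply/funext => y.
by rewrite derive1nS IH derive1_cst.
Qed.

Definition schwartz_pred : {pred R -> C} := mem [set f | is_schwartz f].

Lemma schwartz_submod_closed : submod_closed schwartz_pred.
Proof.
have sZ a f : is_schwartz f -> is_schwartz (a *: f).
  move=> [sf df]; split; first exact: csmoothZ.
  move=> j k; have [M hM] := df j k; exists (normc a * M) => x.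
  rewrite cderivZ// normcM mulrCA; apply: ler_wpM2l => //.
  by case: a => ? ? /=; exact: sqrtr_ge0.
have sD f g : is_schwartz f -> is_schwartz g -> is_schwartz (f + g).
  move=> [sf df] [sg dg]; split; first exact: csmoothD.
  move=> j k; have [M hM] := df j k; have [M' hM'] := dg j k.
  exists (M + M') => x; rewrite cderivD//.
  apply: (le_trans _ (lerD (hM x) (hM' x))); rewrite -mulrDr.
  by apply: ler_wpM2l; [exact: exprn_ge0|exact: normcD].
have cs0 : csmooth (0 : R -> C) by move=> k x; split; exact: smooth0.
have s0 : is_schwartz (0 : R -> C).
  split=> // j k; exists 0 => x; rewrite -(scale0r (0 : R -> C)).
  by rewrite (cderivZ 0 cs0) mul0r normc0 mulr0.
split; first by rewrite inE.
by move=> a f g; rewrite !inE => sf sg; apply: sD => //; exact: sZ.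
Qed.

HB.instance Definition _ := GRing.isSubmodClosed.Build C (R -> C)
  schwartz_pred schwartz_submod_closed.

Record schwartz := Schwartz {
  schwartz_fun :> R -> C;
  _ : schwartz_fun \in schwartz_pred
}.

HB.instance Definition _ := [isSub for schwartz_fun].
HB.instance Definition _ := [Choice of schwartz by <:].
HB.instance Definition _ := [SubChoice_isSubLmodule of schwartz by <:].

(* Neighbourhoods for the seminorms sup |x^j f^(k)(x)|, j, k <= n *)
Definition schwartz_ball (n : nat) (e : R) (f : schwartz) : set schwartz :=
  [set g | forall j k x, (j <= n)%N -> (k <= n)%N ->
             `|x| ^+ j * normc (cderiv k (g - f) x) < e].

Definition schwartz_nbhs (f : schwartz) : set_system schwartz :=
  [set A | exists n e, 0 < e /\ schwartz_ball n e f `<=` A].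

HB.instance Definition _ := hasNbhs.Build schwartz schwartz_nbhs.

Lemma schwartzP (f : schwartz) : is_schwartz f.
Proof. by case: f => f /=; rewrite inE. Qed.

Lemma schwartz_ballxx n (e : R) (f : schwartz) : 0 < e -> schwartz_ball n e f f.
Proof.
move=> e0 j k x _ _.
have -> : (f - f : schwartz) = (0 : C) *: f :> (R -> C).
  by rewrite subrr scale0r.
by rewrite (cderivZ 0 (schwartzP f).1) mul0r normc0 mulr0.
Qed.

Lemma schwartz_ball_triangle n (e e' : R) (f g h : schwartz) :
  schwartz_ball n e f g -> schwartz_ball n e' g h ->
  schwartz_ball n (e + e') f h.
Proof.
move=> fg gh j k x jn kn.
have -> : (h - f : schwartz) = (h - g) + (g - f) :> (R -> C).
  by rewrite addrA subrK.
rewrite cderivD; [|exact: (schwartzP (h - g)).1|exact: (schwartzP (g - f)).1].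
apply: le_lt_trans (ltrD (fg j k x jn kn) (gh j k x jn kn)).
rewrite [leRHS]addrC -mulrDr; apply: ler_wpM2l; last exact: normcD.
exact: exprn_ge0.
Qed.

Let schwartz_nbhs_filter (f : schwartz) : ProperFilter (schwartz_nbhs f).
Proof.
apply: Build_ProperFilter_ex.
  by move=> A [n [e [e0 fA]]]; exists f; apply: fA; exact: schwartz_ballxx.
split.
- by exists 0%N, 1; split=> //.
- move=> A B [n [e [e0 fA]]] [n' [e' [e'0 fB]]].
  exists (maxn n n'), (Num.min e e'); split; first by rewrite lt_min e0.
  move=> g fg; split; [apply: fA|apply: fB] => j k x jn kn.
    have := fg j k x (leq_trans jn (leq_maxl _ _)) (leq_trans kn (leq_maxl _ _)).
    by rewrite lt_min => /andP[].
  have := fg j k x (leq_trans jn (leq_maxr _ _)) (leq_trans kn (leq_maxr _ _)).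
  by rewrite lt_min => /andP[].
- move=> A B AB [n [e [e0 fA]]].
  by exists n, e; split=> //; exact: subset_trans fA AB.
Qed.

Let schwartz_nbhs_singleton (f : schwartz) A : schwartz_nbhs f A -> A f.
Proof. by move=> [n [e [e0]]]; apply; exact: schwartz_ballxx. Qed.

Let schwartz_nbhs_nbhs (f : schwartz) A :
  schwartz_nbhs f A -> schwartz_nbhs f (schwartz_nbhs^~ A).
Proof.
move=> [n [e [e0 fA]]]; have e20 : 0 < e / 2 by rewrite divr_gt0.
exists n, (e / 2); split=> // g fg; exists n, (e / 2); split=> // h gh.
by apply: fA; rewrite (splitr e); exact: schwartz_ball_triangle gh.
Qed.

HB.instance Definition _ := Nbhs_isNbhsTopological.Build schwartz
  schwartz_nbhs_filter schwartz_nbhs_singleton schwartz_nbhs_nbhs.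

End SchwartzSpace.
Arguments schwartz : clear implicits.



Section Distributions.
Context {R : realType}.
Local Notation C := R[i].

Let derive1n_comp (g : R -> R) (c : R) :
    (forall k (x : R), derivable (derive1n k g) x 1) ->
  forall k, derive1n k (fun y => g (y * c)) =
            (fun y => c ^+ k * derive1n k g (y * c)).
Proof.
move=> sg; have dc (x : R) : derivable (fun y : R => y * c) x 1.
  exact: derivableM.
elim=> [|k IH]; first by apply/funext => x; rewrite !derive1n0 expr0 mul1r.
apply/funext => x; rewrite derive1nS IH.
have dgc : derivable (derive1n k g \o (fun y => y * c)) x 1.
  by apply/derivable1_diffP/differentiable_comp; apply/derivable1_diffP.
rewrite (derive1Ml (c ^+ k) dgc) (derive1_comp (dc x) (sg k (x * c))).
have -> : derive1 (fun y : R => y * c) x = c.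
  by rewrite derive1Mr// derive1_id mul1r.
by rewrite -derive1nS exprSr -mulrA; congr (_ * _); exact: mulrC.
Qed.

Let derivable_comp_scale (g : R -> R) (c : R) :
    (forall k (x : R), derivable (derive1n k g) x 1) ->
  forall k (x : R), derivable (derive1n k (fun y => g (y * c))) x 1.
Proof.
move=> sg k x; rewrite (derive1n_comp _ sg).
have dc : derivable (fun y : R => y * c) x 1 by exact: derivableM.
have dgc : derivable (derive1n k g \o (fun y => y * c)) x 1.
  by apply/derivable1_diffP/differentiable_comp; apply/derivable1_diffP.
by have := @derivableZ R R R _ (c ^+ k) x 1 dgc.
Qed.

Lemma is_schwartz_scale (f : schwartz R) (t : R) : t != 0 ->
  is_schwartz (fun x => f (x / t)).
Proof.
move=> t0; have [sf df] := schwartzP f; have [rf jf] := csmooth_smooth sf.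
split=> [k x|j k].
  split; first exact: (@derivable_comp_scale _ t^-1 rf k x).
  exact: (@derivable_comp_scale _ t^-1 jf k x).
have [M hM] := df j k; exists (`|t| ^+ j * `|t^-1 ^+ k| * M) => x.
rewrite /cderiv (derive1n_comp _ rf) (derive1n_comp _ jf).
set z := cderiv k f (x / t).
rewrite -[X in normc X]/((t^-1 ^+ k * Re z) +i* (t^-1 ^+ k * Im z)).
have -> : (t^-1 ^+ k * Re z) +i* (t^-1 ^+ k * Im z) = (t^-1 ^+ k)%:C * z.
  by apply/eqP; rewrite eq_complex; case: z => u v /=;
    rewrite !mul0r subr0 addr0 !eqxx.
rewrite normcM.
have -> : normc (t^-1 ^+ k)%:C = `|t^-1 ^+ k|.
  by rewrite /normc /= expr0n /= addr0 sqrtr_sqr.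
have -> : `|x| ^+ j = `|t| ^+ j * `|x / t| ^+ j.
  by rewrite -exprMn -normrM mulrC divfK.
rewrite -!mulrA [X in _ * X]mulrCA; do 2!apply: ler_wpM2l => //.
Qed.

(* |t|^(-1/2) f(x / t); the default value is used only for t = 0, see dilateE *)
Definition dilate (t : R) (f : schwartz R) : schwartz R :=
  insubd 0 (fun x => (`|t| `^ (- 2^-1))%:C * f (x / t)).

Lemma dilateE (t : R) (f : schwartz R) (x : R) : t != 0 ->
  dilate t f x = (`|t| `^ (- 2^-1))%:C * f (x / t).
Proof.
move=> t0; rewrite /dilate.
suff h : (fun x => (`|t| `^ (- 2^-1))%:C * f (x / t)) \in schwartz_pred.
  by have := congr1 (fun g => g x) (insubdK (0 : schwartz R) h).
apply: (@rpredZ _ _ schwartz_pred (`|t| `^ (- 2^-1))%:C (fun x => f (x / t))).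
by rewrite inE; exact: is_schwartz_scale.
Qed.


End Distributions.

(* A Dirichlet character modulo d, as a function on the integers *)
Record dirichlet_character (R : realType) (d : nat) := DirichletCharacter {
  dchar :> int -> R[i];
  dcharM : forall m n : int, dchar (m * n) = dchar m * dchar n;
  dchar_periodic : forall m : int, dchar (m + d%:Z) = dchar m;
  dchar_neq0 : forall m : int, (dchar m != 0) = coprimez m d
}.

Section WeilBrezin.
Context {R : realType}.
Local Notation C := R[i].

(* chi extended by 0 to the rationals that are not integers *)
Definition chiQ d (chi : dirichlet_character R d) (r : rat) : C :=
  if denq r == 1 then chi (numq r) else 0.

(* A point [a, c, z] is ((a, c), z) *)
Definition heisenberg : Type := (R * R * R)%type.

Definition hmul (p q : heisenberg) : heisenberg :=
  (p.1.1 + q.1.1, p.1.2 + q.1.2, p.2 + q.2 + p.1.2 * q.1.1).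

Definition heisenberg_int : set heisenberg :=
  [set p | exists i j k : int, p = (i%:~R, j%:~R, k%:~R)].

(* For N < 0 the principal square root is purely imaginary; its modulus is
   still sqrt(|N| / phi(d)), which makes the Weil-Brezin map isometric *)
Definition wb_const (N : int) (d : nat) : C :=
  sqrtc ((N%:~R / (totient d)%:R)%:C).

Definition weil_brezin (N : int) d (chi : dirichlet_character R d)
    (f : R -> C) (p : heisenberg) : C :=
  wb_const N d * e2pi (N%:~R * p.2) *
  zseries (fun n : int => chiQ chi (n%:Q * (d%:Z)%:Q / N%:Q) *
    f (n%:~R + N%:~R * p.1.2) * e2pi (n%:~R * p.1.1)).

End WeilBrezin.
Arguments heisenberg : clear implicits.

Section WeilBrezinImage.
Context {R : realType}.
Local Notation C := R[i].

Lemma normc_ge0 (z : C) : 0 <= normc z.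
Proof. by case: z => a b; exact: sqrtr_ge0. Qed.

Lemma normc_Re (z : C) : `|Re z| <= normc z.
Proof.
case: z => a b /=; rewrite -sqrtr_sqr ler_sqrt ?lerDl ?sqr_ge0//.
by rewrite addr_ge0 ?sqr_ge0.
Qed.

Lemma normc_Im (z : C) : `|Im z| <= normc z.
Proof.
case: z => a b /=; rewrite -sqrtr_sqr ler_sqrt ?lerDr ?sqr_ge0//.
by rewrite addr_ge0 ?sqr_ge0.
Qed.

Lemma normc_e2pi (x : R) : normc (e2pi x) = 1.
Proof.
rewrite /e2pi /cexp normcM /= expR0 expr1n expr0n /= addr0 sqrtr1 mul1r.
by rewrite cos2Dsin2 sqrtr1.
Qed.

Lemma dchar_bounded d (chi : dirichlet_character R d) :
  exists M : R, forall n, normc (chi n) <= M.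
Proof.
have per (k : nat) n : chi (n + (k * d)%:Z) = chi n.
  elim: k n => [|k IH] n; first by rewrite mul0n addr0.
  by rewrite mulSn PoszD addrA IH dchar_periodic.
case: (posnP d) => [d0|d0].
  exists (normc (chi 1) + normc (chi (-1))) => n.
  have [->|] := eqVneq (chi n) 0; first by rewrite normc0 addr_ge0 ?normc_ge0.
  rewrite dchar_neq0 => nd.
  have [->|->] : n = 1 \/ n = -1.
    by move: nd; rewrite d0; case: n => [[|[|]]|[|]] //=; auto.
  - by rewrite lerDl normc_ge0.
  - by rewrite lerDr normc_ge0.
exists (\sum_(i < d) normc (chi i)) => n.
have dz : d%:Z != 0 by rewrite eqz_nat -lt0n.
have -> : chi n = chi (n %% d)%Z.
  have := divz_eq n d; move: (n %/ d)%Z => [q|q] {1}->.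
    by rewrite -PoszM addrC per.
  rewrite -(per q.+1 (_ + _)); congr (chi _).
  by rewrite NegzE mulNr -PoszM addrAC addNr add0r.
have mlt : (`|(n %% d)%Z| < d)%N.
  by rewrite -ltz_nat gez0_abs ?modz_ge0// ltz_pmod.
have -> : (n %% d)%Z = Ordinal mlt by rewrite /= gez0_abs// modz_ge0.
rewrite (bigD1 (Ordinal mlt))//= lerDl.
by apply: sumr_ge0 => i _; exact: normc_ge0.
Qed.

Let inv_sq (n : nat) : R := (1 + n%:R ^+ 2)^-1.

Let inv_sq_ge0 n : 0 <= inv_sq n.
Proof. by rewrite invr_ge0 addr_ge0// sqr_ge0. Qed.

Let inv_sq_cvg : cvgn (series inv_sq).
Proof.
apply: nondecreasing_is_cvgn; first exact: nondecreasing_series.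
exists 4 => _ [n _ <-].
suff : series inv_sq n <= 4 - 4 / n.+1%:R.
  by move=> /le_trans; apply; rewrite gerBl divr_ge0.
elim: n => [|n IH]; first by rewrite /series /= big_geq// divr1 subrr.
rewrite /series /= big_nat_recr//=; apply: (le_trans (lerD IH (lexx _))).
have n0 : 0 <= n%:R :> R by [].
rewrite /inv_sq -(natr1 n.+1) -(natr1 n); move: (n%:R) n0 => y y0.
rewrite -lerBrDl.
have -> : 4 - 4 / (y + 1 + 1) - (4 - 4 / (y + 1)) = 4 / ((y + 1) * (y + 1 + 1)).
  by field; apply/andP; split; apply: lt0r_neq0; lra.
rewrite ler_pdivlMr; last by apply: mulr_gt0; lra.
rewrite mulrC ler_pdivrMr; last by rewrite -[ltLHS](addr0 0); apply: ltr_leD => //; exact: sqr_ge0.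
nra.
Qed.

Let cvg_dominated (u : nat -> R) (M : R) :
  (forall n, `|u n| <= M * inv_sq n) -> cvgn (series u).
Proof.
move=> uM; apply: normed_cvg.
apply: (@series_le_cvg R _ (M *: inv_sq)) => [n|n|n|].
- exact: normr_ge0.
- exact: le_trans (normr_ge0 _) (uM n).
- exact: uM.
- exact: is_cvg_seriesZ.
Qed.

Let Re_sum (u : nat -> C) m :
  Re (\sum_(0 <= n < m) u n) = \sum_(0 <= n < m) Re (u n).
Proof.
elim: m => [|m IH]; first by rewrite !big_geq.
by rewrite !big_nat_recr//= -IH; case: (bigop _ _ _) => ? ?; case: (u m).
Qed.

Let Im_sum (u : nat -> C) m :
  Im (\sum_(0 <= n < m) u n) = \sum_(0 <= n < m) Im (u n).
Proof.
elim: m => [|m IH]; first by rewrite !big_geq.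
by rewrite !big_nat_recr//= -IH; case: (bigop _ _ _) => ? ?; case: (u m).
Qed.

Let ccvg_dominated (u : nat -> C) (M : R) :
  (forall n, normc (u n) <= M * inv_sq n) ->
  ccvg (fun m => \sum_(0 <= n < m) u n)
       (clim (fun m => \sum_(0 <= n < m) u n)).
Proof.
move=> uM; split=> /=.
  under eq_fun do rewrite Re_sum.
  have : cvgn (series (fun n => Re (u n))).
    by apply: (@cvg_dominated _ M) => n; apply: le_trans (normc_Re _) (uM n).
  exact.
under eq_fun do rewrite Im_sum.
have : cvgn (series (fun n => Im (u n))).
  by apply: (@cvg_dominated _ M) => n; apply: le_trans (normc_Im _) (uM n).
exact.
Qed.

Lemma ccvg_lim (u : nat -> C) (l : C) : ccvg u l -> clim u = l.
Proof.
move=> [ul vl]; apply/eqP; rewrite eq_complex /=.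
by rewrite (cvg_lim _ ul)// (cvg_lim _ vl)// !eqxx.
Qed.

Lemma ccvg_lin (a : C) (u v : nat -> C) (l l' : C) :
  ccvg u l -> ccvg v l' -> ccvg (fun n => a * u n + v n) (a * l + l').
Proof.
have RE (z w : C) : Re (a * z + w) = Re a * Re z - Im a * Im z + Re w.
  by case: (a) => ? ?; case: z => ? ?; case: w.
have IM (z w : C) : Im (a * z + w) = Re a * Im z + Im a * Re z + Im w.
  by case: (a) => ? ?; case: z => ? ?; case: w.
move=> [ru iu] [rv iv]; split.
  under eq_fun do rewrite RE.
  rewrite RE; apply: cvgD => //; apply: cvgB; apply: cvgMr => //.
under eq_fun do rewrite IM.
rewrite IM; apply: cvgD => //; apply: cvgD; apply: cvgMr => //.
Qed.

(* A sufficient condition for absolute convergence of a two-sided series *)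
Definition zdominated (u : int -> C) : Prop :=
  exists M : R, forall n : int, normc (u n) <= M / (1 + n%:~R ^+ 2).

Lemma zseries_lin (a : C) (u v : int -> C) : zdominated u -> zdominated v ->
  zseries (fun n => a * u n + v n) = a * zseries u + zseries v.
Proof.
have P w : zdominated w ->
    ccvg (fun m => \sum_(0 <= n < m) w (Posz n))
         (clim (fun m => \sum_(0 <= n < m) w (Posz n))).
  by move=> [M wM]; apply: (@ccvg_dominated _ M) => n; exact: wM.
have N w : zdominated w ->
    ccvg (fun m => \sum_(0 <= n < m) w (Negz n))
         (clim (fun m => \sum_(0 <= n < m) w (Negz n))).
  move=> [M wM]; apply: (@ccvg_dominated _ M) => n.
  have M0 : 0 <= M.
    have := wM 0; rewrite expr0n /= addr0 divr1; exact/le_trans/normc_ge0.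
  apply: (le_trans (wM _)); apply: ler_wpM2l => //.
  rewrite /inv_sq lef_pV2 ?posrE ?ltr_pwDl ?sqr_ge0// lerD2l.
  by rewrite NegzE mulrNz sqrrN ler_sqr ?nnegrE// ler_nat.
move=> du dv; rewrite /zseries mulrDr addrACA; congr (_ + _).
  under [X in clim X]funext => m do rewrite big_split -mulr_sumr/=.
  by apply: ccvg_lim; apply: ccvg_lin; exact: P.
under [X in clim X]funext => m do rewrite big_split -mulr_sumr/=.
by apply: ccvg_lim; apply: ccvg_lin; exact: N.
Qed.

Lemma schwartz_decay (f : schwartz R) :
  exists M : R, forall x, normc (f x) <= M / (1 + x ^+ 2).
Proof.
have [_ df] := schwartzP f.
have [M0 h0] := df 0%N 0%N; have [M2 h2] := df 2%N 0%N.
exists (M0 + M2) => x; rewrite ler_pdivlMr ?ltr_pwDl ?sqr_ge0//.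
have fE : cderiv 0 f x = f x by rewrite /cderiv !derive1n0; case: (f x).
have := lerD (h0 x) (h2 x); rewrite fE expr0 mul1r -normrX ger0_norm ?sqr_ge0//.
by rewrite mulrDr mulr1 [_ * normc _]mulrC.
Qed.

Lemma weil_brezin_dominated (N : int) d (chi : dirichlet_character R d)
    (f : schwartz R) (x y : R) :
  zdominated (fun n : int => chiQ chi (n%:Q * (d%:Z)%:Q / N%:Q) *
    f (n%:~R + x) * e2pi (n%:~R * y)).
Proof.
have [K hK] := dchar_bounded chi; have [M hM] := schwartz_decay f.
have K0 : 0 <= K := le_trans (normc_ge0 _) (hK 0).
have M0 : 0 <= M.
  by have := hM 0; rewrite expr0n /= addr0 divr1; exact/le_trans/normc_ge0.
exists (K * (M * (2 * (1 + x ^+ 2)))) => n.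
rewrite normcM normc_e2pi mulr1 normcM -[leRHS]mulrA; apply: ler_pM; rewrite ?normc_ge0//.
  rewrite /chiQ; case: ifP => _; first exact: hK. rewrite normc0. exact: K0.
apply: (le_trans (hM _)); rewrite -mulrA; apply: ler_wpM2l => //.
have p (t : R) : 0 < 1 + t ^+ 2 by rewrite ltr_pwDl ?sqr_ge0.
rewrite ler_pdivlMr// ler_pdivrMl//; move: (n%:~R : R) => m.
have := sqr_ge0 (m + 2 * x); have := sqr_ge0 (x * (m + x)); nra.
Qed.

Lemma weil_brezin_lin (N : int) d (chi : dirichlet_character R d) (a : C)
    (f g : schwartz R) :
  weil_brezin N chi (a *: f + g : schwartz R) =
  a *: weil_brezin N chi f + weil_brezin N chi g.
Proof.
apply/funext => p; rewrite /weil_brezin.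
set u := fun n : int => chiQ chi (n%:Q * (d%:Z)%:Q / N%:Q) *
  f (n%:~R + N%:~R * p.1.2) * e2pi (n%:~R * p.1.1).
set v := fun n : int => chiQ chi (n%:Q * (d%:Z)%:Q / N%:Q) *
  g (n%:~R + N%:~R * p.1.2) * e2pi (n%:~R * p.1.1).
rewrite (_ : (fun n : int => _) = (fun n => a * u n + v n)); last first.
  apply/funext => n; rewrite /u /v.
  rewrite -[(a *: f + g : schwartz R) _]/(a * f _ + g _).
  by rewrite mulrDr mulrDl; congr (_ + _); rewrite !mulrA [_ * a]mulrC.
rewrite zseries_lin; try exact: weil_brezin_dominated.
rewrite mulrDr mulrCA //.
Qed.

End WeilBrezinImage.

(* Topological dual; functionals are compared as elements of the vector space
   V -> C *)
Definition top_dual (R : realType) (V : preTopologicalLmodType R[i]) :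
    set (V -> R[i]) :=
  [set D | scalar D /\ continuous (D : V -> (R[i] : numClosedFieldType))].

Arguments top_dual {R} V.

Section Dimension.
Context {K : fieldType} {V : lmodType K}.

Definition span2 (u v : V) : set V :=
  [set w | exists a b : K, w = a *: u + b *: v].

Definition has_dimension (n : nat) (E : set V) : Prop :=
  exists b : 'I_n -> V,
    (forall c : 'I_n -> K, \sum_i c i *: b i = 0 -> forall i, c i = 0) /\
    E = [set w | exists c : 'I_n -> K, w = \sum_i c i *: b i].

End Dimension.

(* The space S(H_{N,d}(chi)), with the topology transported from S(R) *)
Section SchwartzImage.
Context {R : realType} (N : int) (d : nat) (chi : dirichlet_character R d).
Local Notation C := R[i].

Definition wb_pred : {pred heisenberg R -> C} :=
  mem [set F | exists f : schwartz R, F = weil_brezin N chi f].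

Lemma wb_submod_closed : submod_closed wb_pred.
Proof.
split; first rewrite inE.
  exists 0; have := weil_brezin_lin N chi (-1) 0 0.
  by rewrite scaler0 addr0 scaleN1r addNr.
move=> a F G; rewrite !inE => -[f ->] [g ->].
by exists (a *: f + g); rewrite weil_brezin_lin.
Qed.

HB.instance Definition _ := GRing.isSubmodClosed.Build C (heisenberg R -> C)
  wb_pred wb_submod_closed.

Record schwartzH := SchwartzH {
  schwartzH_fun :> heisenberg R -> C;
  _ : schwartzH_fun \in wb_pred
}.

HB.instance Definition _ := [isSub for schwartzH_fun].
HB.instance Definition _ := [Choice of schwartzH by <:].
HB.instance Definition _ := [SubChoice_isSubLmodule of schwartzH by <:].

Lemma wb_map_subproof (f : schwartz R) : weil_brezin N chi f \in wb_pred.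
Proof. by rewrite inE; exists f. Qed.

Definition wb_map (f : schwartz R) : schwartzH :=
  SchwartzH (wb_map_subproof f).

Lemma wb_map_surj (F : schwartzH) : exists f, wb_map f = F.
Proof.
case: F => F F0; have : F \in wb_pred := F0; rewrite inE => -[f Ff].
by exists f; exact: val_inj.
Qed.

Definition wb_inv (F : schwartzH) : schwartz R := sval (cid (wb_map_surj F)).

Definition schwartzH_open : set_system schwartzH :=
  [set U | open (wb_map @^-1` U)].

Let schwartzH_openT : schwartzH_open setT.
Proof. exact: openT. Qed.

Let schwartzH_openI : setI_closed schwartzH_open.
Proof. by move=> A B oA oB; exact: openI. Qed.

Let schwartzH_open_bigU (I : Type) (f : I -> set schwartzH) :
  (forall i, schwartzH_open (f i)) -> schwartzH_open (\bigcup_i f i).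
Proof.
move=> fo; rewrite /schwartzH_open /= preimage_bigcup.
by apply: bigcup_open => i _; exact: fo.
Qed.

HB.instance Definition _ := isOpenTopological.Build schwartzH
  schwartzH_openT schwartzH_openI schwartzH_open_bigU.

(* W^sharp and its inverse: <W^sharp D, W f> = <D, f>; wb_inv F is the Schwartz
   function with image F, unique when N != 0 and 0 < d because weil_brezin is
   then injective *)
Definition wb_sharp (D : schwartz R -> C) : schwartzH -> C :=
  fun F => D (wb_inv F).

Definition wb_flat (D : schwartzH -> C) : schwartz R -> C :=
  fun f => D (wb_map f).

End SchwartzImage.

Section Homogeneity.
Context {R : realType}.
Local Notation C := R[i].
Implicit Types (D : schwartz R -> C) (t : R).

Definition dist_U t D : schwartz R -> C := fun f => D (dilate t f).

Definition even_dist D : Prop := dist_U (-1) D = D.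

Definition odd_dist D : Prop := dist_U (-1) D = - D.

Definition homogeneous (psi : R -> C) D : Prop :=
  forall t, t != 0 -> dist_U t D = (psi t * (`|t| `^ (- 2^-1))%:C) *: D.

(* sgn(t)^k |t|^w *)
Definition quasichar (k : bool) (w : C) (t : R) : C :=
  sgnpow k t * cpow `|t| w.

(* The function sgn(x)^k |x|^(s-1) defining Delta_s for Re s > 0 *)
Definition delta_density (k : bool) (s : C) (x : R) : C :=
  sgnpow k x * cpow `|x| (s - 1).

(* The meromorphic continuation in s of the family Delta_s, holomorphic outside
   the integers; its values there are determined by uniqueness of the
   continuation, and its values at a pole are unspecified *)
Definition is_delta_family (k : bool) (D : C -> schwartz R -> C) : Prop :=
  [/\ forall s f, 0 < Re s ->
        D s f = cintegral lebesgue_measure setT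
                  (fun x => delta_density k s x * f x),
      forall s, ~ is_integer s -> top_dual (schwartz R) (D s),
      forall f s, ~ is_integer s -> analytic_at (fun w => D w f) s
    & forall f s, meromorphic_at (fun w => D w f) s].

Definition delta (k : bool) : C -> schwartz R -> C :=
  xget (fun _ _ => 0) [set D | is_delta_family k D].

End Homogeneity.

Section LerchDistributions.
Context {R : realType} (N : int) (d : nat) (chi : dirichlet_character R d).
Local Notation C := R[i].
Local Notation SH := (schwartzH N chi).

Definition temperedH : set (SH -> C) := top_dual SH.

(* Transport of a property of tempered distributions along W^sharp *)
Definition transported (P : set (schwartz R -> C)) : set (SH -> C) :=
  [set D | exists D', [/\ top_dual (schwartz R) D', P D' & D = wb_sharp D']].

(* T_m^{chi_0} = m^(-1/2) U(m) *)
Definition hecke0 (m : nat) (D : schwartz R -> C) : schwartz R -> C :=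
  (m%:R `^ (- 2^-1))%:C *: dist_U m%:R D.

(* T_m on distributions, as the extension of its action on functions:
   T_m (W^sharp D) = chi(m) W^sharp (T_m^{chi_0} D), for gcd(m, N/d) = 1 *)
Definition hecke (m : nat) (D : SH -> C) : SH -> C :=
  chi m *: wb_sharp (hecke0 m (wb_flat D)).

Definition hecke_eigenspace (s : C) : set (SH -> C) :=
  [set D | temperedH D /\
    forall m : nat, (0 < m)%N -> coprime m `|N|%N ->
      hecke m D = (chi m * cpow m%:R (- s)) *: D].

Definition lerch_dist (k : bool) (s : C) : SH -> C :=
  wb_sharp (delta k (1 - s)).

(* The series carries no factor sqrt(C_{N,d}), unlike weil_brezin. It converges
   when N a and N c are not integers; elsewhere the value is a convention, and
   these points form a null set *)
Definition lerch_fun (k : bool) (s : C) (p : heisenberg R) : C :=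
  e2pi (N%:~R * p.2) *
  zseries (fun n : int => chiQ chi (n%:Q * (d%:Z)%:Q / N%:Q) *
    sgnpow k (n%:~R + N%:~R * p.1.2) * e2pi (n%:~R * p.1.1) *
    cpow `|n%:~R + N%:~R * p.1.2| (- s)).

Local Notation T3 :=
  (measurableTypeR R * measurableTypeR R * measurableTypeR R)%type.

Definition leb3 : {measure set T3 -> \bar R} :=
  (lebesgue_measure \x lebesgue_measure \x lebesgue_measure)%E.

Definition unit_cube : set T3 := `[0, 1] `*` `[0, 1] `*` `[0, 1].

Definition box (M : R) : set T3 := `[- M, M] `*` `[- M, M] `*` `[- M, M].

Definition locally_L1 (F : T3 -> C) : Prop :=
  cmeasurable F /\ forall M : R, cintegrable leb3 (box M) F.

(* The transformation laws of H_N *)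
Definition left_invariant (F : T3 -> C) : Prop :=
  forall g, heisenberg_int g -> {ae leb3, forall p, F (hmul g p) = F p}.

Definition central_law (F : T3 -> C) : Prop :=
  {ae leb3, forall p, F p = e2pi (N%:~R * p.2) * F (p.1, 0)}.

Definition sq_dist (F G : T3 -> C) : \bar R :=
  (\int[leb3]_(p in unit_cube) (normc (F p - G p) ^+ 2)%:E)%E.

Definition in_HN (F : T3 -> C) : Prop :=
  [/\ cmeasurable F, left_invariant F, central_law F
    & (sq_dist F (cst 0%R) < +oo)%E].

(* H_{N,d}(chi), the closure of the image of S(R) *)
Definition in_HNd (F : T3 -> C) : Prop :=
  in_HN F /\ exists f : nat -> schwartz R,
    sq_dist F (weil_brezin N chi (f n)) @[n --> \oo] --> 0%E.

(* A finite linear relation sum_i lambda_i F(g_i o p) = 0 between left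
   translates of F *)
Definition satisfies (rel : seq (C * heisenberg R)) (F : T3 -> C) : Prop :=
  {ae leb3, forall p, \sum_(x <- rel) x.1 * F (hmul x.2 p) = 0}.

(* L^1(H_{N,d}(chi)): besides the laws of H_N, the function satisfies every
   relation between left translates that holds on all of H_{N,d}(chi) *)
Definition in_L1HNd (F : T3 -> C) : Prop :=
  [/\ locally_L1 F, left_invariant F, central_law F
    & forall rel, (forall G, in_HNd G -> satisfies rel G) -> satisfies rel F].

Definition induced_dist (G : T3 -> C) : SH -> C :=
  fun F => cintegral leb3 unit_cube
    (fun p => G p * conjc (weil_brezin N chi (fun x => conjc (wb_inv F x)) p)).

End LerchDistributions.

Arguments hecke_eigenspace {R} N {d} chi s.
Arguments lerch_dist {R} N {d} chi k s.
Arguments lerch_fun {R} N {d} chi k s p.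
Arguments in_L1HNd {R} N {d} chi F.
Arguments induced_dist {R} N {d} chi G.

(* Main.v *)
(* Pulled back along W^sharp, the eigenvalue equation for T_m says that a
   tempered distribution D on R is homogeneous of degree w = 1 - s under the
   dilation by m. The ratios (1 + (n+1)|N|) / (1 + n|N|) of integers prime to N
   have logarithms that are positive and tend to 0, so by continuity D is
   homogeneous under all positive dilations, and it remains to see that for
   each parity these D form a line.

   Uniqueness. Differentiating in the dilation gives Euler's equation
   D(x f') = - w D(f). For Re w > 1, if g has the given parity and is
   annihilated by |x|^(w-1), then h(x) = int_0^1 u^(w-1) g(xu) du is a Schwartz
   function with x h' + w h = g, hence D(g) = 0 and D is a multiple of the
   integral against |x|^(w-1). Multiplication by x carries degree w to w + 1
   and is injective except at w = 0 in even parity, where the kernel is spanned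
   by the Dirac mass; this descends to all w.

   Existence. Start from |x|^(w-1) for Re w > 0 and use f |-> D(f') to go from
   w + 1 to w; this preserves nonvanishing for w <> 0 by Euler's equation, and
   w = 0 is covered by the Dirac mass and the principal value of 1/x. Dividing
   by - w instead produces a meromorphic continuation of Delta_w, which by the
   identity theorem is the chosen one off the integers.

   Lerch functions. Summation by parts bounds the partial sums at (a, c) by
   finitely many |n + Nc|^(- sigma) plus a multiple of
   |1 - e(Na)|^(- 1 / (1 + sigma)), sigma = Re s, which is locally integrable.
   So dominated convergence and orthogonality of the characters e(na) identify
   the pairing over the unit cube with the integral of the density against the
   test function; the same computation shows that W is injective. A linear
   relation between translates that holds on H_{N,d}(chi) holds coefficient by
   coefficient, as one sees by testing it on the images of narrow Gaussians, so
   it holds for Lerch functions. *)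
Require Import Defs.
From HB Require Import structures.
From mathcomp Require Import all_boot all_order all_algebra.
From mathcomp Require Import all_classical all_reals all_analysis.
From mathcomp.real_closed Require Import complex.
From mathcomp Require Import measurable_realfun ring lra zify.

Set Implicit Arguments.
Unset Strict Implicit.
Unset Printing Implicit Defensive.

Import Order.TTheory GRing.Theory Num.Theory numFieldNormedType.Exports.
Import Normc.

Local Notation Re := complex.Re.
Local Notation Im := complex.Im.

Local Open Scope classical_set_scope.
Local Open Scope ring_scope.
Local Open Scope complex_scope.

(** In the uniqueness argument smoothness of the average is automatic, because its derivatives are
    averages of derivatives of g with w raised; decay at infinity is the obstacle, and it is what
    the vanishing pairing of g provides. The descent in w breaks down where multiplication by x has
    a kernel; there Euler's equation, tested on the derivative of a Gaussian, forces D to vanish on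
    multiples of x. The logarithm enters because its dilates differ from it by multiples of Lebesgue
    measure, so that its derivative is homogeneous. The exponent 1 / (1 + sigma) balances the
    trivial bound T on T terms against the bound T^(-sigma) / |1 - e(Na)| on the tail; it lies below
    1, whence integrability. The constants of the Weil-Brezin map cancel because a non-integer x
    lies between n and n + N for exactly |N| consecutive n, whose weights |chi|^2 add up to phi(d).
    Narrow Gaussians can isolate a coefficient because finitely many translates of the integers form
    a uniformly discrete set. *)

(** * Complex numbers, complex powers and limits of complex sequences *)

Section ComplexToolkit.
Context {R : realType}.
Local Notation C := R[i].
Implicit Types (x y t : R) (z w s : C).

Lemma complex_eqP z w : Re z = Re w -> Im z = Im w -> z = w.
Proof. by move=> h1 h2; apply/eqP; rewrite eq_complex h1 h2 !eqxx. Qed.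

Lemma ReD z w : Re (z + w) = Re z + Re w.
Proof. by case: z; case: w. Qed.

Lemma ImD z w : Im (z + w) = Im z + Im w.
Proof. by case: z; case: w. Qed.

Lemma ReN z : Re (- z) = - Re z.
Proof. by case: z. Qed.

Lemma ImN z : Im (- z) = - Im z.
Proof. by case: z. Qed.

Lemma ReB z w : Re (z - w) = Re z - Re w.
Proof. by rewrite ReD ReN. Qed.

Lemma ImB z w : Im (z - w) = Im z - Im w.
Proof. by rewrite ImD ImN. Qed.

Lemma ReM z w : Re (z * w) = Re z * Re w - Im z * Im w.
Proof. by case: z; case: w. Qed.

Lemma ImM z w : Im (z * w) = Re z * Im w + Im z * Re w.
Proof. by case: z; case: w. Qed.

Lemma Re_sum (I : Type) (r : seq I) (P : pred I) (F : I -> C) :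
  Re (\sum_(i <- r | P i) F i) = \sum_(i <- r | P i) Re (F i).
Proof. by elim/big_rec2: _ => // i x z _ <-; rewrite ReD. Qed.

Lemma Im_sum (I : Type) (r : seq I) (P : pred I) (F : I -> C) :
  Im (\sum_(i <- r | P i) F i) = \sum_(i <- r | P i) Im (F i).
Proof. by elim/big_rec2: _ => // i x z _ <-; rewrite ImD. Qed.

Lemma ReMl x z : Re (x%:C * z) = x * Re z.
Proof. by rewrite ReM /= mul0r subr0. Qed.

Lemma ImMl x z : Im (x%:C * z) = x * Im z.
Proof. by rewrite ImM /= mul0r addr0. Qed.

Lemma Re_nat n : Re (n%:R : C) = n%:R.
Proof. by rewrite -(rmorph_nat (real_complex R)). Qed.

Lemma Im_int (n : int) : Im (n%:~R : C) = 0.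
Proof. by rewrite -(rmorph_int (real_complex R)). Qed.

Lemma Re_conj z : Re (conjc z) = Re z.
Proof. by case: z. Qed.

Lemma Im_conj z : Im (conjc z) = - Im z.
Proof. by case: z. Qed.

Lemma normc_real x : normc x%:C = `|x|.
Proof. by rewrite /normc /= expr0n /= addr0 sqrtr_sqr. Qed.

Lemma normc_conj z : normc (conjc z) = normc z.
Proof. by case: z => a b /=; rewrite sqrrN. Qed.

Lemma sqr_normcE z : normc z ^+ 2 = Re z ^+ 2 + Im z ^+ 2.
Proof. by case: z => a b /=; rewrite sqr_sqrtr// addr_ge0 ?sqr_ge0. Qed.

Lemma mulc_conj z : z * conjc z = (normc z ^+ 2)%:C.
Proof.
rewrite sqr_normcE; apply: complex_eqP.
  by rewrite ReM Re_conj Im_conj /= mulrN opprK !expr2.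
by rewrite ImM Re_conj Im_conj /= mulrN mulrC addNr.
Qed.

Lemma normc_eq0 z : (normc z == 0) = (z == 0).
Proof. by apply/eqP/eqP => [/eq0_normc//|->]; rewrite normc0. Qed.

Lemma normc_gt0 z : (0 < normc z) = (z != 0).
Proof. by rewrite lt_def normc_eq0 normc_ge0 andbT. Qed.

Lemma normcX z n : normc (z ^+ n) = normc z ^+ n.
Proof. by elim: n => [|n IH]; rewrite ?normc1// !exprS normcM IH. Qed.

Lemma normc_distC z w : normc (z - w) = normc (w - z).
Proof. by rewrite -normcN opprB. Qed.

Lemma normc_sum (I : Type) (r : seq I) (P : pred I) (F : I -> C) :
  normc (\sum_(i <- r | P i) F i) <= \sum_(i <- r | P i) normc (F i).
Proof.
elim/big_rec2: _ => [|i x z _ h]; first by rewrite normc0.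
by apply: (le_trans (normcD _ _)); rewrite lerD2l.
Qed.

Lemma normc_le_ReIm z : normc z <= `|Re z| + `|Im z|.
Proof.
have -> : z = (Re z)%:C + 'i * (Im z)%:C.
  by apply: complex_eqP; rewrite ?ReD ?ImD ?ReM ?ImM /=; ring.
apply: (le_trans (normcD _ _)); rewrite normcM !normc_real /=.
rewrite /normc expr0n /= add0r expr1n sqrtr1 mul1r.
by rewrite !(mul0r, mul1r, mulr0, subr0, addr0, add0r).
Qed.

Lemma normC_normc z : `|z| = (normc z)%:C.
Proof. by []. Qed.

Lemma cexpD z w : cexp (z + w) = cexp z * cexp w.
Proof.
rewrite /cexp ReD ImD expRD cosD sinD.
by apply: complex_eqP; rewrite !(ReM, ImM) /=; ring.
Qed.

Lemma cexp0 : cexp (0 : C) = 1.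
Proof. by rewrite /cexp /= expR0 cos0 sin0 mul1r. Qed.

Lemma normc_cexp z : normc (cexp z) = expR (Re z).
Proof.
rewrite /cexp normcM normc_real ger0_norm ?expR_ge0//.
by rewrite /normc cos2Dsin2 sqrtr1 mulr1.
Qed.

Lemma cexp_neq0 z : cexp z != 0.
Proof. by rewrite -normc_gt0 normc_cexp expR_gt0. Qed.

Lemma cexpN z : cexp (- z) = (cexp z)^-1.
Proof.
by apply: (mulfI (cexp_neq0 z)); rewrite mulfV ?cexp_neq0// -cexpD subrr cexp0.
Qed.

Lemma cexp_real x : cexp x%:C = (expR x)%:C.
Proof. by rewrite /cexp /= cos0 sin0 mulr1. Qed.

Lemma cpow0 s : cpow (0 : R) s = 0.
Proof. by rewrite /cpow eqxx. Qed.

Lemma cpowE x s : x != 0 -> cpow x s = cexp (s * (ln x)%:C).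
Proof. by rewrite /cpow => /negPf ->. Qed.

Lemma cpowMl x y s : 0 < x -> 0 < y -> cpow (x * y) s = cpow x s * cpow y s.
Proof.
move=> x0 y0; rewrite !cpowE ?lt0r_neq0 ?mulr_gt0// lnM ?posrE//.
by rewrite rmorphD/= mulrDr cexpD.
Qed.

Lemma cpowD x s w : x != 0 -> cpow x (s + w) = cpow x s * cpow x w.
Proof. by move=> x0; rewrite !cpowE// mulrDl cexpD. Qed.

Lemma cpowN x s : x != 0 -> cpow x (- s) = (cpow x s)^-1.
Proof. by move=> x0; rewrite !cpowE// mulNr cexpN. Qed.

Lemma cpowV x s : 0 < x -> cpow x^-1 s = (cpow x s)^-1.
Proof.
move=> x0; rewrite !cpowE ?lt0r_neq0 ?invr_gt0// lnV ?posrE//.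
by rewrite rmorphN/= mulrN cexpN.
Qed.

Lemma cpow_1l s : cpow (1 : R) s = 1.
Proof. by rewrite cpowE ?oner_neq0// ln1 mulr0 cexp0. Qed.

Lemma cpow_real x t : x > 0 -> cpow x t%:C = (x `^ t)%:C.
Proof.
move=> x0; rewrite cpowE ?lt0r_neq0// -rmorphM/= cexp_real.
by rewrite /powR gt_eqF.
Qed.

Lemma cpow_s0 x : x != 0 -> cpow x 0 = 1.
Proof. by move=> x0; rewrite cpowE// mul0r cexp0. Qed.

Lemma cpow_s1 x : 0 <= x -> cpow x 1 = x%:C.
Proof.
rewrite le_eqVlt => /predU1P[<-|x0]; first by rewrite cpow0.
by rewrite (cpow_real 1 x0) powRr1// ltW.
Qed.

Lemma normc_cpow x s : 0 < x -> normc (cpow x s) = x `^ Re s.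
Proof.
move=> x0; rewrite cpowE ?lt0r_neq0// normc_cexp ReM /= mulr0 subr0.
by rewrite /powR gt_eqF.
Qed.

Lemma normc_cpow_le x s : 0 <= x -> normc (cpow x s) <= x `^ Re s.
Proof.
rewrite le_eqVlt => /predU1P[<-|x0]; last by rewrite normc_cpow.
by rewrite cpow0 normc0 powR_ge0.
Qed.

Lemma e2piD x y : e2pi (x + y) = e2pi x * e2pi y.
Proof. by rewrite /e2pi mulrDr -cexpD; congr cexp; apply: complex_eqP; rewrite ?ReD ?ImD /= ?addr0. Qed.

Lemma e2pi0 : e2pi (0 : R) = 1.
Proof. by rewrite /e2pi mulr0 cexp0. Qed.

Lemma e2piN x : e2pi (- x) = conjc (e2pi x).
Proof.
rewrite /e2pi /cexp /= mulrN cosN sinN.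
by apply: complex_eqP; rewrite ?Re_conj ?Im_conj ?ReM ?ImM /=; ring.
Qed.

Lemma e2pi_int (n : int) : e2pi (n%:~R : R) = 1.
Proof.
have h (m : nat) : e2pi (m%:R : R) = 1.
  elim: m => [|m IH]; first exact: e2pi0.
  rewrite -natr1 e2piD IH mul1r /e2pi mulr1 /cexp /= expR0 mul1r.
  by rewrite mulr_natl cos2pi sin2pi.
case: n => n; first by rewrite -pmulrn h.
by rewrite NegzE mulrNz e2piN -pmulrn h conjc1.
Qed.

Lemma e2piE x : e2pi x = cos (2 * pi * x) +i* sin (2 * pi * x).
Proof. by rewrite /e2pi /cexp /= expR0 mul1r. Qed.

Lemma sgnpow_mul k x y : sgnpow k (x * y) = sgnpow k x * sgnpow k y.
Proof. by rewrite /sgnpow sgrM exprMn rmorphM. Qed.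

Lemma sgnpow_pos k x : 0 < x -> sgnpow k x = 1.
Proof. by move=> x0; rewrite /sgnpow gtr0_sg// expr1n. Qed.

Lemma sgnpowN k x : sgnpow k (- x) = (-1) ^+ k * sgnpow k x.
Proof.
by case: k; rewrite /sgnpow ?expr0 ?expr1 ?mul1r// sgrN rmorphN/= mulN1r.
Qed.

Lemma normc_sgnpow_le k x : normc (sgnpow k x) <= 1.
Proof.
rewrite /sgnpow normc_real normrX; case: k; rewrite ?expr0// expr1.
by rewrite normr_sg; case: eqP.
Qed.

Lemma sgnpow_negb k x : x != 0 -> sgnpow (~~ k) x * x%:C = sgnpow k x * `|x|%:C.
Proof.
move=> x0; rewrite /sgnpow -!rmorphM/=; congr (_%:C).
case: k; first by rewrite expr0 mul1r expr1 -numEsg.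
by rewrite expr0 mul1r expr1 -normrEsg.
Qed.

Lemma ccvg_normc (u : nat -> C) (l : C) :
  ccvg u l <-> (normc (u n - l) @[n --> \oo] --> 0).
Proof.
split=> [[h1 h2]|h].
  apply: (@squeeze_cvgr _ _ _ _ (fun=> 0)
    (fun n => `|Re (u n) - Re l| + `|Im (u n) - Im l|)).
  - near=> n; rewrite normc_ge0/= -ReB -ImB; exact: normc_le_ReIm.
  - exact: cvg_cst.
  - rewrite -[X in _ --> X](addr0 0); apply: cvgD; rewrite -(normr0 R);
      apply: cvg_norm; exact/subr_cvg0.
split; apply/subr_cvg0; apply/norm_cvg0P => /=;
  apply: (@squeeze_cvgr _ _ _ _ (fun=> 0) (fun n => normc (u n - l))) => //;
  try exact: cvg_cst.
  by near=> n; rewrite normr_ge0/= -ReB; exact: normc_Re.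
by near=> n; rewrite normr_ge0/= -ImB; exact: normc_Im.
Unshelve. all: by end_near. Qed.

Lemma ccvg_cst (l : C) : ccvg (fun=> l) l.
Proof. by split; exact: cvg_cst. Qed.

Lemma ccvgD (u v : nat -> C) l l' : ccvg u l -> ccvg v l' ->
  ccvg (fun n => u n + v n) (l + l').
Proof.
move=> hu hv; have := ccvg_lin 1 hu hv; rewrite mul1r.
by under eq_fun do rewrite mul1r.
Qed.

Lemma ccvgM (u v : nat -> C) l l' : ccvg u l -> ccvg v l' ->
  ccvg (fun n => u n * v n) (l * l').
Proof.
move=> [u1 u2] [v1 v2]; split.
  by under eq_fun do rewrite ReM; rewrite ReM; apply: cvgB; apply: cvgM.
by under eq_fun do rewrite ImM; rewrite ImM; apply: cvgD; apply: cvgM.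
Qed.

Lemma ccvg_conj (u : nat -> C) l : ccvg u l ->
  ccvg (fun n => conjc (u n)) (conjc l).
Proof.
move=> [u1 u2]; split.
  by under eq_fun do rewrite Re_conj; rewrite Re_conj.
by under eq_fun do rewrite Im_conj; rewrite Im_conj; exact: cvgN.
Qed.

Lemma ccvg_unique (u : nat -> C) l l' : ccvg u l -> ccvg u l' -> l = l'.
Proof. by move=> /ccvg_lim <- /ccvg_lim <-. Qed.

Lemma ccvgS (u : nat -> C) l : ccvg u l -> ccvg (fun n => u n.+1) l.
Proof. by move=> [h1 h2]; split; rewrite -?(cvg_shiftS (fun n => Re (u n))) -?(cvg_shiftS (fun n => Im (u n))) in h1 h2 *. Qed.

Lemma ccvg_le (u : nat -> C) l (M : R) : ccvg u l ->
  (forall n, normc (u n) <= M) -> normc l <= M.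
Proof.
move=> /ccvg_normc h uM; apply/ler_addgt0Pr => e e0.
have /cvgr0Pnorm_lt/(_ e e0)[n _ /(_ n (leqnn _))]/= := h.
rewrite ger0_norm ?normc_ge0// => he.
have := normcD (u n) (l - u n); rewrite [_ + (_ - _)]addrC subrK => /le_trans; apply.
by apply: lerD; rewrite ?uM// normc_distC ltW.
Qed.

End ComplexToolkit.

(** * Measurability of complex-valued functions *)

Section ComplexMeasurable.
Context {R : realType} {dT : measure_display} {T : measurableType dT}.
Local Notation C := R[i].
Implicit Types (f g : T -> C) (h : T -> R).

Lemma measurable_comp1 (F : R -> R) h : measurable_fun setT F ->
  measurable_fun setT h -> measurable_fun setT (fun x => F (h x)).
Proof. by move=> mF mh; exact: (measurableT_comp mF mh). Qed.

Lemma cmeasurable_cst (z : C) : cmeasurable ((fun=> z) : T -> C).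
Proof. by split; exact: measurable_cst. Qed.

Lemma cmeasurableD f g : cmeasurable f -> cmeasurable g ->
  cmeasurable (fun x => f x + g x).
Proof.
move=> [f1 f2] [g1 g2]; split; rewrite /cmeasurable.
  by under eq_fun do rewrite ReD; exact: measurable_funD.
by under eq_fun do rewrite ImD; exact: measurable_funD.
Qed.

Lemma cmeasurableM f g : cmeasurable f -> cmeasurable g ->
  cmeasurable (fun x => f x * g x).
Proof.
move=> [f1 f2] [g1 g2]; split; rewrite /cmeasurable.
  by under eq_fun do rewrite ReM; apply: measurable_funB; exact: measurable_funM.
by under eq_fun do rewrite ImM; apply: measurable_funD; exact: measurable_funM.
Qed.

Lemma cmeasurable_sum I (r : seq I) (P : pred I) (F : I -> T -> C) :
  (forall i, cmeasurable (F i)) ->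
  cmeasurable (fun x => \sum_(i <- r | P i) F i x).
Proof.
move=> mF; elim: r => [|i r IH].
  by under eq_fun do rewrite big_nil; exact: cmeasurable_cst.
under eq_fun do rewrite big_cons; case: (P i) => //.
exact: cmeasurableD.
Qed.

Lemma cmeasurable_real h : measurable_fun setT h ->
  cmeasurable (fun x => (h x)%:C).
Proof. by move=> mh; split => //=; exact: measurable_cst. Qed.

Lemma cmeasurable_conj f : cmeasurable f -> cmeasurable (fun x => conjc (f x)).
Proof.
move=> [f1 f2]; split.
  by under eq_fun do rewrite Re_conj.
by under eq_fun do rewrite Im_conj; exact: (measurable_funN f2).
Qed.

Lemma cmeasurable_cexp f : cmeasurable f -> cmeasurable (fun x => cexp (f x)).
Proof.
move=> [f1 f2]; apply: cmeasurableM.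
  by apply: cmeasurable_real; exact: measurableT_comp.
split => /=.
  apply: (measurableT_comp _ f2); apply: continuous_measurable_fun.
  exact: continuous_cos.
apply: (measurableT_comp _ f2); apply: continuous_measurable_fun.
exact: continuous_sin.
Qed.

Lemma cmeasurable_e2pi h : measurable_fun setT h ->
  cmeasurable (fun x => e2pi (h x)).
Proof.
move=> mh; apply: cmeasurable_cexp; split => /=; first exact: measurable_cst.
exact: measurable_funM.
Qed.

Lemma cmeasurable_cpow h s : measurable_fun setT h ->
  cmeasurable (fun x => cpow (h x) s).
Proof.
move=> mh.
have -> : (fun x => cpow (h x) s) = (fun x =>
    (\1_(~` [set 0 : R]) (h x))%:C * cexp (s * (ln (h x))%:C)).
  apply/funext => x; rewrite /cpow; case: eqP => hx; rewrite indicE.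
    by rewrite memNset ?mul0r// => /(_ hx).
  by rewrite mem_set ?mul1r// => /hx.
apply: cmeasurableM; last first.
  apply: cmeasurable_cexp; apply: cmeasurableM; first exact: cmeasurable_cst.
  by apply: cmeasurable_real; exact: measurableT_comp.
apply: cmeasurable_real; apply: (measurableT_comp _ mh).
by apply: measurable_indic; apply: measurableC; exact: measurable_set1.
Qed.

Lemma cmeasurable_sgnpow k h : measurable_fun setT h ->
  cmeasurable (fun x => sgnpow k (h x)).
Proof.
move=> mh; apply: cmeasurable_real.
apply: (@measurable_comp1 (fun y : R => Num.sg y ^+ k) h) => // {mh h}.
case: k => /=; last by under eq_fun do rewrite expr0; exact: measurable_cst.
under eq_fun do rewrite expr1.
have -> : (fun x : R => Num.sg x) =
    (fun x => \1_(`]0, +oo[ : set R) x - \1_(`]-oo, 0[ : set R) x).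
  apply/funext => x; rewrite !indicE.
  have [x0|x0|->] := ltgtP x 0.
  - rewrite ltr0_sg// memNset ?mem_set/= ?in_itv//= ?sub0r//.
    by rewrite andbT => /(lt_trans x0); rewrite ltxx.
  - rewrite gtr0_sg// mem_set ?memNset/= ?in_itv/= ?subr0//=.
      by move=> /(lt_trans x0); rewrite ltxx.
    by rewrite andbT.
  - by rewrite sgr0 !memNset/= ?in_itv/= ?ltxx ?subr0.
by apply: measurable_funB; apply: measurable_indic; exact: measurable_itv.
Qed.

Lemma measurable_normc f : cmeasurable f ->
  measurable_fun setT (fun x => normc (f x)).
Proof.
move=> [f1 f2].
have -> : (fun x => normc (f x)) =
    (fun x => Num.sqrt (Re (f x) ^+ 2 + Im (f x) ^+ 2)).
  by apply/funext => x; case: (f x).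
apply: (@measurable_comp1 (fun y : R => Num.sqrt y)
  (fun x => Re (f x) ^+ 2 + Im (f x) ^+ 2)).
  by apply: continuous_measurable_fun; exact: sqrt_continuous.
by apply: measurable_funD; exact: measurable_funX.
Qed.

End ComplexMeasurable.

(** * Integrals of complex-valued functions *)

Section ComplexIntegral.
Context {R : realType} {dT : measure_display} {T : measurableType dT}.
Variable mu : {measure set T -> \bar R}.
Local Notation C := R[i].
Variable D : set T.
Hypothesis mD : measurable D.
Implicit Types (f : T -> C) (g : T -> R).

Lemma cintegrable_le f g : cmeasurable f ->
  (forall x, D x -> normc (f x) <= g x) -> mu.-integrable D (EFin \o g) ->
  cintegrable mu D f.
Proof.
move=> [m1 m2] fg ig; split; apply: (le_integrable mD _ _ ig).
- by apply: measurable_funTS; exact/measurable_EFinP.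
- move=> x Dx /=; rewrite lee_fin; apply: (le_trans (normc_Re _)).
  exact: le_trans (fg x Dx) (ler_norm _).
- by apply: measurable_funTS; exact/measurable_EFinP.
- move=> x Dx /=; rewrite lee_fin; apply: (le_trans (normc_Im _)).
  exact: le_trans (fg x Dx) (ler_norm _).
Qed.

Lemma cintegrable_ext f1 f2 : (forall x, D x -> f1 x = f2 x) ->
  cintegrable mu D f1 -> cintegrable mu D f2.
Proof.
move=> h [i1 i2]; split.
  by apply: eq_integrable i1 => // x /set_mem Dx /=; rewrite h.
by apply: eq_integrable i2 => // x /set_mem Dx /=; rewrite h.
Qed.

Lemma cintegral_ext f1 f2 : (forall x, D x -> f1 x = f2 x) ->
  cintegral mu D f1 = cintegral mu D f2.
Proof.
move=> h; apply: complex_eqP; apply: eq_Rintegral => x /set_mem Dx;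
  by rewrite h.
Qed.

Lemma cintegrableD f1 f2 : cintegrable mu D f1 -> cintegrable mu D f2 ->
  cintegrable mu D (fun x => f1 x + f2 x).
Proof.
move=> [i1 i2] [j1 j2]; split.
  have -> : EFin \o (fun x => Re (f1 x + f2 x)) =
    (EFin \o (fun x => Re (f1 x))) \+ (EFin \o (fun x => Re (f2 x))).
    by apply/funext => x /=; rewrite ReD.
  exact: integrableD.
have -> : EFin \o (fun x => Im (f1 x + f2 x)) =
  (EFin \o (fun x => Im (f1 x))) \+ (EFin \o (fun x => Im (f2 x))).
  by apply/funext => x /=; rewrite ImD.
exact: integrableD.
Qed.

Lemma integrable_lin2 (a b : R) g1 g2 :
  mu.-integrable D (EFin \o g1) -> mu.-integrable D (EFin \o g2) ->
  mu.-integrable D (EFin \o (fun x => a * g1 x + b * g2 x)).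
Proof.
move=> i1 i2.
have -> : EFin \o (fun x => a * g1 x + b * g2 x) =
    (fun x => a%:E * (EFin \o g1) x)%E \+ (fun x => b%:E * (EFin \o g2) x)%E.
  by apply/funext => x.
by apply: integrableD => //; exact: integrableZl.
Qed.

Lemma Rintegral_lin2 (a b : R) g1 g2 :
  mu.-integrable D (EFin \o g1) -> mu.-integrable D (EFin \o g2) ->
  Rintegral mu D (fun x => a * g1 x + b * g2 x) =
  a * Rintegral mu D g1 + b * Rintegral mu D g2.
Proof.
move=> i1 i2; rewrite RintegralD//; first by rewrite !RintegralZl.
  exact: (integrableZl mD a i1).
exact: (integrableZl mD b i2).
Qed.

Lemma cintegrableZ (z : C) f : cintegrable mu D f ->
  cintegrable mu D (fun x => z * f x).
Proof.
move=> [i1 i2]; split.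
  have -> : (fun x => Re (z * f x)) =
      (fun x => Re z * Re (f x) + - Im z * Im (f x)).
    by apply/funext => x; rewrite ReM mulNr.
  exact: integrable_lin2.
have -> : (fun x => Im (z * f x)) = (fun x => Re z * Im (f x) + Im z * Re (f x)).
  by apply/funext => x; rewrite ImM.
exact: integrable_lin2.
Qed.

Lemma cintegralD f1 f2 : cintegrable mu D f1 -> cintegrable mu D f2 ->
  cintegral mu D (fun x => f1 x + f2 x) = cintegral mu D f1 + cintegral mu D f2.
Proof.
move=> [i1 i2] [j1 j2]; apply: complex_eqP; rewrite ?ReD ?ImD/= -RintegralD//;
  by apply: eq_Rintegral => x _; rewrite ?ReD ?ImD.
Qed.

Lemma cintegralZ (z : C) f : cintegrable mu D f ->
  cintegral mu D (fun x => z * f x) = z * cintegral mu D f.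
Proof.
move=> [i1 i2]; apply: complex_eqP; rewrite ?ReM ?ImM/=.
  rewrite -mulNr -Rintegral_lin2//; apply: eq_Rintegral => x _.
  by rewrite ReM mulNr.
by rewrite -Rintegral_lin2//; apply: eq_Rintegral => x _; rewrite ImM.
Qed.

Lemma cintegrable0 : cintegrable mu D (fun=> 0 : C).
Proof. by split; exact: integrable0. Qed.

Lemma cintegral0 : cintegral mu D (fun=> 0 : C) = 0.
Proof.
rewrite -[RHS](mul0r (cintegral mu D (fun=> 0))) -(cintegralZ 0 cintegrable0).
by apply: cintegral_ext => x _; rewrite mul0r.
Qed.

Lemma cintegrableB f1 f2 : cintegrable mu D f1 -> cintegrable mu D f2 ->
  cintegrable mu D (fun x => f1 x - f2 x).
Proof.
move=> i1 i2; have := cintegrableD i1 (cintegrableZ (-1) i2).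
by apply: cintegrable_ext => x _; rewrite mulN1r.
Qed.

Lemma cintegralB f1 f2 : cintegrable mu D f1 -> cintegrable mu D f2 ->
  cintegral mu D (fun x => f1 x - f2 x) = cintegral mu D f1 - cintegral mu D f2.
Proof.
move=> i1 i2; rewrite -[X in _ - X]mul1r -mulNr -cintegralZ//.
rewrite -cintegralD//; last exact: cintegrableZ.
by apply: cintegral_ext => x _; rewrite mulN1r.
Qed.

Lemma cintegrable_sum (I : Type) (r : seq I) (P : pred I) (F : I -> T -> C) :
  (forall i, P i -> cintegrable mu D (F i)) ->
  cintegrable mu D (fun x => \sum_(i <- r | P i) F i x).
Proof.
move=> iF; elim: r => [|i r IH].
  by apply: cintegrable_ext cintegrable0 => x _; rewrite big_nil.
have [Pi|Pi] := boolP (P i).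
  apply: cintegrable_ext (cintegrableD (iF i Pi) IH) => x _.
  by rewrite big_cons Pi.
by apply: cintegrable_ext IH => x _; rewrite big_cons (negPf Pi).
Qed.

Lemma cintegral_sum (I : Type) (r : seq I) (P : pred I) (F : I -> T -> C) :
  (forall i, P i -> cintegrable mu D (F i)) ->
  cintegral mu D (fun x => \sum_(i <- r | P i) F i x) =
  \sum_(i <- r | P i) cintegral mu D (F i).
Proof.
move=> iF; elim: r => [|i r IH].
  by rewrite big_nil -[RHS]cintegral0; apply: cintegral_ext => x _; rewrite big_nil.
rewrite big_cons -IH; have [Pi|Pi] := boolP (P i).
  rewrite -cintegralD//; [|exact: iF|exact: cintegrable_sum].
  by apply: cintegral_ext => x _; rewrite big_cons Pi.
by apply: cintegral_ext => x _; rewrite big_cons (negPf Pi).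
Qed.

(* The factor 2 comes from estimating real and imaginary parts separately. *)
Lemma normc_cintegral_le f g : cintegrable mu D f ->
  mu.-integrable D (EFin \o g) -> (forall x, D x -> normc (f x) <= g x) ->
  normc (cintegral mu D f) <= 2 * Rintegral mu D g.
Proof.
move=> [i1 i2] ig fg; apply: (le_trans (normc_le_ReIm _)).
rewrite /= mulr_natl mulr2n; apply: lerD.
  apply: (le_trans (le_normr_Rintegral _ _)) => //.
  apply: le_Rintegral => //; first exact: integrable_norm.
  by move=> x Dx; exact: le_trans (normc_Re _) (fg x Dx).
apply: (le_trans (le_normr_Rintegral _ _)) => //.
apply: le_Rintegral => //; first exact: integrable_norm.
by move=> x Dx; exact: le_trans (normc_Im _) (fg x Dx).
Qed.

Lemma Rintegral_dominated_cvg (u : nat -> T -> R) (v : T -> R) g :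
  (forall n, measurable_fun D (u n)) -> measurable_fun D v ->
  {ae mu, forall x, D x -> u n x @[n --> \oo] --> v x} ->
  mu.-integrable D (EFin \o g) ->
  {ae mu, forall x, D x -> forall n, `|u n x| <= g x} ->
  Rintegral mu D (u n) @[n --> \oo] --> Rintegral mu D v.
Proof.
move=> mu_ mv uv ig ug.
have [] := @dominated_convergence _ _ _ mu D mD
  (fun n => EFin \o u n) (EFin \o v) (EFin \o g).
- by move=> n; exact/measurable_EFinP.
- exact/measurable_EFinP.
- apply: filterS uv => x h Dx; apply/fine_cvgP; split; first exact: nearW.
  exact: h.
- by [].
- by apply: filterS ug => x h n Dx /=; rewrite lee_fin; exact: h.
move=> iv _ h.
apply: fine_cvg; rewrite /Rintegral fineK//.
exact: integrable_fin_num.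
Qed.

Lemma cintegral_dominated_cvg (u : nat -> T -> C) (v : T -> C) g :
  (forall n, cmeasurable (u n)) -> cmeasurable v ->
  {ae mu, forall x, D x -> ccvg (u^~ x) (v x)} ->
  mu.-integrable D (EFin \o g) ->
  {ae mu, forall x, D x -> forall n, normc (u n x) <= g x} ->
  ccvg (fun n => cintegral mu D (u n)) (cintegral mu D v).
Proof.
move=> mu_ mv uv ig ug; split => /=.
  apply: (@Rintegral_dominated_cvg _ _ g) => //.
  - by move=> n; apply: measurable_funTS; exact: (mu_ n).1.
  - by apply: measurable_funTS; exact: mv.1.
  - by apply: filterS uv => x h Dx; exact: (h Dx).1.
  - by apply: filterS ug => x h Dx n; exact: le_trans (normc_Re _) (h Dx n).
apply: (@Rintegral_dominated_cvg _ _ g) => //.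
- by move=> n; apply: measurable_funTS; exact: (mu_ n).2.
- by apply: measurable_funTS; exact: mv.2.
- by apply: filterS uv => x h Dx; exact: (h Dx).2.
- by apply: filterS ug => x h Dx n; exact: le_trans (normc_Im _) (h Dx n).
Qed.

End ComplexIntegral.

(** * Affine changes of variable in Lebesgue integrals *)

Section AffineSubstitution.
Context {R : realType}.
Local Notation C := R[i].
Local Notation mu := (@lebesgue_measure R).
Variables (a b : R).
Hypothesis a0 : a != 0.

Let phi : measurableTypeR R -> measurableTypeR R := fun x => a * x + b.

Let mphi : measurable_fun setT phi.
Proof. by apply: measurable_funD => //; exact: measurable_funM. Qed.

(** The scaled pushforward is a measure with the right value on half-open intervals, which
    determines Lebesgue measure. For negative a the preimage is half-open at the opposite end,
    without effect on its length. *)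
Lemma lebesgue_measure_affine (A : set R) : measurable A ->
  mu A = (`|a|%:E * pushforward mu phi A)%E.
Proof.
pose k : {nonneg R} := NngNum (normr_ge0 a).
pose mphi_mixin := isMeasurableFun.Build _ _ _ _ _ mphi.
pose mphi_pack : {mfun _ >-> _} := HB.pack phi mphi_mixin.
move=> mA.
rewrite (lebesgue_measure_unique (mu := mscale k (pushforward mu mphi_pack)))//.
move=> _ [[x y]] _ <-.
rewrite -[RHS]/(`|a|%:E * mu (phi @^-1` `]x, y]))%E.
have [a_lt0|a_gt0|/eqP] := ltgtP a 0; last by rewrite (negPf a0).
  rewrite (_ : phi @^-1` _ = `[(y - b) / a, (x - b) / a[%classic); last first.
    apply/seteqP; split => z; rewrite /= !in_itv/= /phi;
      by rewrite ler_ndivrMr// ltr_ndivlMr// lerBrDr ltrBlDr mulrC andbC.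
  rewrite !lebesgue_measure_itv/= !lte_fin.
  rewrite ltr_nM2r ?invr_lt0// ltrD2r; case: ifPn => xy; last by rewrite mule0.
  rewrite -!EFinD -EFinM; congr (_%:E); rewrite ltr0_norm//.
  by field.
rewrite (_ : phi @^-1` _ = `](x - b) / a, (y - b) / a]%classic); last first.
  apply/seteqP; split => z; rewrite /= !in_itv/= /phi;
    by rewrite ler_pdivlMr// ltr_pdivrMr// lerBrDr ltrBlDr mulrC.
rewrite !lebesgue_measure_itv/= !lte_fin.
rewrite ltr_pM2r ?invr_gt0// ltrD2r; case: ifPn => xy; last by rewrite mule0.
rewrite -!EFinD -EFinM; congr (_%:E); rewrite gtr0_norm//.
by field.
Qed.

Lemma ge0_integral_affine (f : R -> \bar R) : measurable_fun setT f ->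
  (forall x, 0 <= f x)%E ->
  (\int[mu]_x f x = `|a|%:E * \int[mu]_x f (a * x + b)%R)%E.
Proof.
move=> mf f0.
pose k : {nonneg R} := NngNum (normr_ge0 a).
have := @ge0_integral_pushforward _ _ _ _ R phi mphi mu setT f measurableT mf.
rewrite preimage_setT => <- //.
rewrite -[RHS](@ge0_integral_mscale _ _ _ _ _ measurableT k)//.
apply: eq_measure_integral => A mA _ /=.
exact: lebesgue_measure_affine.
Qed.

Lemma integrable_affine (f : R -> R) :
  mu.-integrable setT (EFin \o f) ->
  mu.-integrable setT (EFin \o (fun x => f (a * x + b))).
Proof.
move=> /integrableP[/measurable_EFinP mf fi]; apply/integrableP; split.
  by apply/measurable_EFinP; exact: measurableT_comp.
move: fi; rewrite ge0_integral_affine//=; last first.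
  by apply/measurable_EFinP; exact: measurableT_comp.
move=> fi; rewrite ltNge leye_eq; apply/negP => /eqP h.
by move: fi; rewrite h gt0_muley ?ltxx// lte_fin normr_gt0.
Qed.

Lemma Rintegral_affine (f : R -> R) : mu.-integrable setT (EFin \o f) ->
  Rintegral mu setT f = `|a| * Rintegral mu setT (fun x => f (a * x + b)).
Proof.
move=> fi; have gi := integrable_affine fi.
have mf : measurable_fun setT (EFin \o f) by case/integrableP : fi.
apply: EFin_inj; rewrite EFinM /Rintegral !fineK; last 2 first.
- exact: integrable_fin_num.
- exact: integrable_fin_num.
rewrite integralE [in RHS]integralE.
rewrite ge0_integral_affine//; last exact: measurable_funepos.
rewrite [X in (_ - X)%E]ge0_integral_affine//; last exact: measurable_funeneg.
have gE : (fun x => (f (a * x + b))%:E) = (EFin \o f) \o phi by [].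
have := integrable_add_def measurableT gi.
rewrite [EFin \o _]gE gE funepos_comp funeneg_comp => gd.
by rewrite -muleBr.
Qed.

Lemma cintegrable_affine (f : R -> C) : cintegrable mu setT f ->
  cintegrable mu setT (fun x => f (a * x + b)).
Proof.
move=> [i1 i2]; split; first exact: (integrable_affine i1).
exact: (integrable_affine i2).
Qed.

Lemma cintegral_affine (f : R -> C) : cintegrable mu setT f ->
  cintegral mu setT f =
  `|a|%:C * cintegral mu setT (fun x => f (a * x + b)).
Proof.
move=> [i1 i2]; apply: complex_eqP; rewrite ?ReMl ?ImMl /=.
  by rewrite (Rintegral_affine i1).
by rewrite (Rintegral_affine i2).
Qed.

End AffineSubstitution.

(** * Operations on Schwartz functions, and the Gaussian *)

Section SchwartzOperations.
Context {R : realType}.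
Local Notation C := R[i].
Implicit Types (f g : R -> C) (x y : R).

(** [is_derive] records existence and value of the derivative together, whereas the iterated
    derivatives inside [cderiv] are total and say nothing about existence. *)
Definition cder f g : Prop := forall x,
  is_derive x 1 (fun y => Re (f y)) (Re (g x)) /\
  is_derive x 1 (fun y => Im (f y)) (Im (g x)).

Lemma cderD f f' g g' : cder f f' -> cder g g' ->
  cder (fun x => f x + g x) (fun x => f' x + g' x).
Proof.
move=> hf hg x; have [f1 f2] := hf x; have [g1 g2] := hg x; split.
  by under eq_fun do rewrite ReD; rewrite ReD; exact: is_deriveD.
by under eq_fun do rewrite ImD; rewrite ImD; exact: is_deriveD.
Qed.

Lemma cder_rmul (a a' : R -> R) f f' : (forall x, is_derive x 1 a (a' x)) ->
  cder f f' ->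
  cder (fun x => (a x)%:C * f x) (fun x => (a' x)%:C * f x + (a x)%:C * f' x).
Proof.
move=> ha hf x; have [f1 f2] := hf x; have ax := ha x; split.
  under eq_fun do rewrite ReMl.
  apply: is_derive_eq; rewrite ReD !ReMl /GRing.scale /=; ring.
under eq_fun do rewrite ImMl.
apply: is_derive_eq; rewrite ImD !ImMl /GRing.scale /=; ring.
Qed.

Lemma cderZ (c : C) f f' : cder f f' ->
  cder (fun x => c * f x) (fun x => c * f' x).
Proof.
move=> hf x; have [f1 f2] := hf x; split.
  under eq_fun do rewrite ReM.
  apply: is_derive_eq; rewrite ReM /GRing.scale /=; ring.
under eq_fun do rewrite ImM.
apply: is_derive_eq; rewrite ImM /GRing.scale /=; ring.
Qed.

Lemma is_derive_affine (a b x : R) : is_derive x 1 (fun y => a * y + b) a.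
Proof. by apply: is_derive_eq; rewrite /GRing.scale /=; ring. Qed.

Lemma cder_affine (a b : R) f f' : cder f f' ->
  cder (fun x => f (a * x + b)) (fun x => a%:C * f' (a * x + b)).
Proof.
move=> hf x; have [f1 f2] := hf (a * x + b); have ax := is_derive_affine a b x.
split.
  rewrite ReMl mulrC.
  exact: (@is_derive1_comp _ (fun y => Re (f y)) (fun y => a * y + b)).
rewrite ImMl mulrC.
exact: (@is_derive1_comp _ (fun y => Im (f y)) (fun y => a * y + b)).
Qed.

Lemma cder_eq f f1 g g1 : f =1 f1 -> g =1 g1 -> cder f g -> cder f1 g1.
Proof. by move=> /funext <- /funext <-. Qed.

Lemma cderiv_family (F : nat -> R -> C) : (forall k, cder (F k) (F k.+1)) ->
  forall k, cderiv k (F 0%N) = F k.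
Proof.
move=> hF k.
suff [h1 h2] : derive1n k (fun y => Re (F 0%N y)) = (fun y => Re (F k y)) /\
    derive1n k (fun y => Im (F 0%N y)) = (fun y => Im (F k y)).
  by apply/funext => x; rewrite /cderiv h1 h2; case: (F k x).
elim: k => [//|k [IH1 IH2]]; rewrite !derive1nS IH1 IH2; split;
  apply/funext => x; rewrite derive1E; have [h1 h2] := hF k x; exact: derive_val.
Qed.

Lemma csmooth_family (F : nat -> R -> C) : (forall k, cder (F k) (F k.+1)) ->
  csmooth (F 0%N).
Proof.
move=> hF k x; have := cderiv_family hF k; rewrite /cderiv => h.
have -> : derive1n k (fun y => Re (F 0%N y)) = (fun y => Re (F k y)).
  by apply/funext => y; rewrite -h.
have -> : derive1n k (fun y => Im (F 0%N y)) = (fun y => Im (F k y)).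
  by apply/funext => y; rewrite -h.
by have [h1 h2] := hF k x; split; exact: ex_derive.
Qed.

Lemma csmooth_cder f : csmooth f -> forall k, cder (cderiv k f) (cderiv k.+1 f).
Proof.
move=> sf k x; have [s1 s2] := sf k x; rewrite /cderiv /=; split.
  by constructor; [exact: s1|rewrite -derive1E].
by constructor; [exact: s2|rewrite -derive1E].
Qed.

Lemma schwartz_cder (f : schwartz R) k : cder (cderiv k f) (cderiv k.+1 f).
Proof. by apply: csmooth_cder; case: (schwartzP f). Qed.

Lemma cderiv0 f : cderiv 0 f = f.
Proof. by apply/funext => x; rewrite /cderiv !derive1n0; case: (f x). Qed.

Lemma schwartz_bound (f : schwartz R) j k : exists M : R, 0 <= M /\
  forall x, `|x| ^+ j * normc (cderiv k f x) <= M.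
Proof.
have [M hM] := (schwartzP f).2 j k; exists M; split => //.
by apply: le_trans (hM 0); rewrite mulr_ge0 ?exprn_ge0 ?normc_ge0.
Qed.

Definition mkS f (h : is_schwartz f) : schwartz R :=
  Schwartz (mem_set h : f \in schwartz_pred).

(** Guessing all derivatives at once as a sequence F with F(k)' = F(k+1) settles smoothness and
    identifies [cderiv k], so only the decay of each F(k) is left. Every Schwartz function below is
    built in this way. *)
Lemma is_schwartz_family (F : nat -> R -> C) :
  (forall k, cder (F k) (F k.+1)) ->
  (forall j k, exists M : R, forall x, `|x| ^+ j * normc (F k x) <= M) ->
  is_schwartz (F 0%N).
Proof.
move=> hF hd; split; first exact: csmooth_family.
by move=> j k; have [M hM] := hd j k; exists M => x; rewrite cderiv_family.
Qed.

Section Operations.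
Variable f : schwartz R.

Lemma is_schwartz_deriv : is_schwartz (cderiv 1 f).
Proof.
apply: (@is_schwartz_family (fun k => cderiv k.+1 f)) => [k|j k].
  exact: schwartz_cder.
by have [M [_ hM]] := schwartz_bound f j k.+1; exists M.
Qed.

Definition sderiv : schwartz R := mkS is_schwartz_deriv.

Lemma cderiv_sderiv k : cderiv k sderiv = cderiv k.+1 f.
Proof.
exact: (@cderiv_family (fun k => cderiv k.+1 f) (fun k => schwartz_cder f k.+1) k).
Qed.

(** Leibniz' rule for x f. At k = 0 the index [k.-1] is a dummy, since its coefficient vanishes. *)
Let mulx_fam k x : C := x%:C * cderiv k f x + k%:R * cderiv k.-1 f x.

Let mulx_famP k : cder (mulx_fam k) (mulx_fam k.+1).
Proof.
have h1 : cder (fun x => x%:C * cderiv k f x)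
    (fun x => (1 : R)%:C * cderiv k f x + x%:C * cderiv k.+1 f x).
  by apply: cder_rmul; exact: schwartz_cder.
have h2 : cder (fun x => k%:R * cderiv k.-1 f x) (fun x => k%:R * cderiv k f x).
  case: k h1 => [_|k _]; last by apply: cderZ; exact: schwartz_cder.
  by apply: (@cder_eq (fun=> 0) _ (fun=> 0)) => // x; rewrite ?mul0r//; split;
    exact: is_derive_cst.
apply: cder_eq (cderD h1 h2) => // x; rewrite /mulx_fam /= mul1r.
by rewrite -natr1; ring.
Qed.

Let mulx_fam_bound j k : exists M : R, forall x, `|x| ^+ j * normc (mulx_fam k x) <= M.
Proof.
have [M1 [M10 h1]] := schwartz_bound f j.+1 k.
have [M2 [M20 h2]] := schwartz_bound f j k.-1.
exists (M1 + k%:R * M2) => x; rewrite /mulx_fam.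
apply: (@le_trans _ _ (`|x| ^+ j * (`|x| * normc (cderiv k f x) +
    k%:R * normc (cderiv k.-1 f x)))).
  apply: ler_wpM2l; first exact: exprn_ge0.
  apply: (le_trans (normcD _ _)); rewrite !normcM normc_real lerD2l.
  by rewrite -(rmorph_nat (real_complex R)) normc_real normr_nat.
rewrite mulrDr; apply: lerD; first by rewrite mulrA -exprSr.
by rewrite mulrCA; apply: ler_wpM2l.
Qed.

Lemma is_schwartz_mulx : is_schwartz (fun x => x%:C * f x).
Proof.
have := is_schwartz_family mulx_famP mulx_fam_bound.
by congr is_schwartz; apply/funext => x; rewrite /mulx_fam mul0r addr0 cderiv0.
Qed.

Definition smulx : schwartz R := mkS is_schwartz_mulx.

Lemma cderiv_smulx k x :
  cderiv k smulx x = x%:C * cderiv k f x + k%:R * cderiv k.-1 f x.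
Proof.
rewrite -[RHS]/(mulx_fam k x) -(cderiv_family mulx_famP).
congr (cderiv k _ x); apply/funext => y.
by rewrite /mulx_fam mul0r addr0 cderiv0.
Qed.

Let affine_fam (a b : R) k x : C := (a ^+ k)%:C * cderiv k f (a * x + b).

Let affine_famP (a b : R) k : cder (affine_fam a b k) (affine_fam a b k.+1).
Proof.
apply: cder_eq (cderZ (a ^+ k)%:C (cder_affine a b (schwartz_cder f k))) => // x.
by rewrite /affine_fam mulrA -rmorphM exprSr.
Qed.

Let affine_fam_bound (a b : R) (a0 : a != 0) j k :
  exists M : R, forall x, `|x| ^+ j * normc (affine_fam a b k x) <= M.
Proof.
have [M1 [M10 h1]] := schwartz_bound f j k.
have [M2 [M20 h2]] := schwartz_bound f 0 k.
exists (`|a| ^+ k * (2 ^+ j * `|a^-1| ^+ j * (M1 + `|b| ^+ j * M2))) => x.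
rewrite /affine_fam normcM normc_real normrX mulrCA.
apply: ler_wpM2l; first exact: exprn_ge0.
set z := a * x + b.
have -> : x = a^-1 * (z - b) by rewrite /z addrK mulKf.
rewrite normrM exprMn -mulrA [leRHS]mulrAC -[leRHS]mulrC; apply: ler_wpM2l; first exact: exprn_ge0.
have zb : `|z - b| ^+ j <= 2 ^+ j * (`|z| ^+ j + `|b| ^+ j).
  apply: (@le_trans _ _ ((2 * Num.max `|z| `|b|) ^+ j)).
    rewrite lerXn2r ?nnegrE ?mulr_ge0 ?le_max ?normr_ge0//.
    apply: (le_trans (ler_normB _ _)); rewrite mulr_natl mulr2n.
    by apply: lerD; rewrite le_max lexx ?orbT.
  rewrite exprMn ler_wpM2l// maxEle; case: ifP => _.
    by rewrite lerDr exprn_ge0.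
  by rewrite lerDl exprn_ge0.
apply: (@le_trans _ _ (2 ^+ j * (`|z| ^+ j + `|b| ^+ j) * normc (cderiv k f z))).
  by apply: ler_wpM2r => //; exact: normc_ge0.
rewrite -mulrA ler_wpM2l// mulrDl; apply: lerD; first exact: h1.
by apply: ler_wpM2l => //; have := h2 z; rewrite expr0 mul1r.
Qed.

Lemma is_schwartz_affine (a b : R) : a != 0 ->
  is_schwartz (fun x => f (a * x + b)).
Proof.
move=> a0; have := is_schwartz_family (affine_famP a b) (affine_fam_bound b a0).
congr is_schwartz; apply/funext => x.
by rewrite /affine_fam expr0 mul1r cderiv0.
Qed.

Lemma cderiv_affine (a b : R) k x :
  cderiv k (fun x => f (a * x + b)) x = (a ^+ k)%:C * cderiv k f (a * x + b).
Proof.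
rewrite -[RHS]/(affine_fam a b k x) -(cderiv_family (affine_famP a b)).
congr (cderiv k _ x); apply/funext => y.
by rewrite /affine_fam expr0 mul1r cderiv0.
Qed.

Lemma is_schwartz_sdil y : is_schwartz (fun x => f (expR y * x)).
Proof.
have := is_schwartz_affine 0 (lt0r_neq0 (expR_gt0 y)).
by congr is_schwartz; apply/funext => x; rewrite addr0.
Qed.

(** Dilations are written with [expR y] so that the positive ones form an additive one-parameter
    group, whose generator is x d/dx. *)
Definition sdil y : schwartz R := mkS (is_schwartz_sdil y).

Lemma cderiv_sdil y k x :
  cderiv k (sdil y) x = (expR y ^+ k)%:C * cderiv k f (expR y * x).
Proof.
have := cderiv_affine (expR y) 0 k x; rewrite addr0 => <-.
by congr (cderiv k _ x); apply/funext => z; rewrite addr0.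
Qed.

Lemma is_schwartz_sneg : is_schwartz (fun x => f (- x)).
Proof.
have N1 : (-1 : R) != 0 by rewrite oppr_eq0 oner_eq0.
have := is_schwartz_affine 0 N1.
by congr is_schwartz; apply/funext => x; rewrite addr0 mulN1r.
Qed.

Definition sneg : schwartz R := mkS is_schwartz_sneg.

Lemma cderiv_sneg k x : cderiv k sneg x = ((-1) ^+ k)%:C * cderiv k f (- x).
Proof.
have := cderiv_affine (-1) 0 k x; rewrite addr0 mulN1r => <-.
by congr (cderiv k _ x); apply/funext => z; rewrite addr0 mulN1r.
Qed.

End Operations.

Lemma schwartz_eqP (f g : schwartz R) : (forall x, f x = g x) -> f = g.
Proof. by move=> h; apply: val_inj; apply/funext. Qed.

Lemma schwartzD_cderiv (f g : schwartz R) k x :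
  cderiv k (f + g : schwartz R) x = cderiv k f x + cderiv k g x.
Proof.
by rewrite -cderivD; [|exact: (schwartzP f).1|exact: (schwartzP g).1].
Qed.

Lemma schwartzZ_cderiv c (f : schwartz R) k x :
  cderiv k (c *: f : schwartz R) x = c * cderiv k f x.
Proof. by rewrite -cderivZ; last exact: (schwartzP f).1. Qed.

Lemma schwartzB_cderiv (f g : schwartz R) k x :
  cderiv k (f - g : schwartz R) x = cderiv k f x - cderiv k g x.
Proof. by rewrite schwartzD_cderiv -scaleN1r schwartzZ_cderiv mulN1r. Qed.

Lemma is_derive_gauss_fun (x : R) :
  is_derive x 1 gauss_fun (- (2 * x) * gauss_fun x).
Proof.
rewrite /gauss_fun.
have h : is_derive x 1 (fun y : R => - y ^+ 2) (- (2 * x)).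
  by apply: is_derive_eq; rewrite /GRing.scale /=; ring.
rewrite mulrC.
exact: (@is_derive1_comp _ expR (fun y => - y ^+ 2) _ _ _ (is_derive_expR _) h).
Qed.

(** The k-th derivative of exp(-x^2) is this polynomial times exp(-x^2): it is the physicists'
    Hermite polynomial up to the sign (-1)^k. *)
Fixpoint hermite (k : nat) : {poly R} :=
  if k is k'.+1 then (hermite k')^`() - 2%:P * 'X * hermite k' else 1.

Lemma gauss_poly_bound (p : {poly R}) i : exists M : R, forall x,
  `|x| ^+ i * `|p.[x] * gauss_fun x| <= M.
Proof.
have mono m : exists M : R, forall x : R, `|x| ^+ m * gauss_fun x <= M.
  (* The term 1 covers |x| <= 1. Beyond, |x|^m <= (x^2)^m, and exp(x^2) = exp(x^2 / m)^m >= (x^2 /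
     m)^m for m > 0. *)
  exists (1 + m%:R ^+ m) => x; have g0 := @gauss_fun_ge0 R x.
  have e1 := @gauss_fun_le1 R x.
  have [x1|x1] := lerP `|x| 1.
    apply: (@le_trans _ _ 1); last by rewrite lerDl exprn_ge0.
    rewrite -[leRHS]mulr1; apply: ler_pM => //.
    exact: exprn_ile1.
  apply: (@le_trans _ _ (m%:R ^+ m)); last by rewrite lerDr.
  case: m => [|m]; first by rewrite !expr0 mul1r.
  rewrite /gauss_fun expRN ler_pdivrMr ?expR_gt0//.
  apply: (@le_trans _ _ ((x ^+ 2) ^+ m.+1)).
    rewrite -(real_normK (num_real x)) -exprM ler_eXn2l//.
    by rewrite mul2n -addnn leq_addl.
  have -> : expR (x ^+ 2) = expR (x ^+ 2 / m.+1%:R) ^+ m.+1.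
    by rewrite -expRM_natl mulrC divfK.
  rewrite -exprMn lerXn2r ?nnegrE ?sqr_ge0 ?mulr_ge0 ?expR_ge0//.
  rewrite -ler_pdivrMl// mulrC; apply: le_trans (expR_ge1Dx _).
  by rewrite lerDr.
elim/poly_ind: p i => [|p c IH] i.
  by exists 0 => x; rewrite horner0 mul0r normr0 mulr0.
have [M1 h1] := IH i.+1; have [M2 h2] := mono i.
exists (M1 + `|c| * M2) => x; rewrite hornerMXaddC mulrDl.
apply: (@le_trans _ _ (`|x| ^+ i * (`|p.[x] * x * gauss_fun x| + `|c * gauss_fun x|))).
  by apply: ler_wpM2l; [exact: exprn_ge0|exact: ler_normD].
rewrite mulrDr; apply: lerD.
  by apply: le_trans (h1 x); rewrite mulrAC normrM exprSr -mulrA [_ * `|x|]mulrC.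
rewrite normrM mulrCA (ger0_norm (gauss_fun_ge0 _)).
exact: ler_wpM2l.
Qed.

Lemma is_schwartz_gauss : is_schwartz (fun x : R => (gauss_fun x)%:C).
Proof.
pose F k x : C := ((hermite k).[x] * gauss_fun x)%:C.
have hF k : cder (F k) (F k.+1).
  move=> x; split; last exact: is_derive_cst.
  have h1 : is_derive x 1 (fun y => (hermite k).[y]) (hermite k)^`().[x].
    exact: is_derive_poly.
  have h2 := is_derive_gauss_fun x.
  apply: (is_derive_eq (is_deriveM h1 h2)).
  have sE (a b : R) : a *: (b : R^o) = a * b by [].
  have hE : (hermite k.+1).[x] = (hermite k)^`().[x] - 2 * x * (hermite k).[x].
    by rewrite /= !hornerE.
  transitivity ((hermite k.+1).[x] * gauss_fun x); last by [].
  by rewrite hE !sE; ring.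
have hb j k : exists M : R, forall x, `|x| ^+ j * normc (F k x) <= M.
  have [M hM] := gauss_poly_bound (hermite k) j; exists M => x.
  by rewrite normc_real.
have := is_schwartz_family hF hb.
by congr is_schwartz; apply/funext => x; rewrite /F /= hornerE mul1r.
Qed.

Definition sgauss : schwartz R := mkS is_schwartz_gauss.

Lemma sderiv_gauss (x : R) : sderiv sgauss x = - 2%:R * (x%:C * sgauss x).
Proof.
rewrite /= /cderiv !derive1n1 !derive1E; apply: complex_eqP => /=.
  have h := is_derive_gauss_fun x; rewrite derive_val; ring.
rewrite derive_cst; ring.
Qed.

End SchwartzOperations.

(** * Tempered distributions and Schwartz seminorms *)

Section Tempered.
Context {R : realType}.
Local Notation C := R[i].
Implicit Types (f g : schwartz R) (D : schwartz R -> C).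

Definition sbounded n (B : R) f : Prop := forall j k x, (j <= n)%N ->
  (k <= n)%N -> `|x| ^+ j * normc (cderiv k f x) <= B.

Lemma sboundedW n m (B B' : R) f : (m <= n)%N -> B <= B' ->
  sbounded n B f -> sbounded m B' f.
Proof.
move=> mn BB h j k x jm km; apply: le_trans BB.
by apply: h; [exact: leq_trans mn|exact: leq_trans mn].
Qed.

Lemma sbounded_ge0 n B f : sbounded n B f -> 0 <= B.
Proof.
move=> /(_ 0%N 0%N 0 isT isT); apply: le_trans.
by rewrite mulr_ge0 ?exprn_ge0 ?normc_ge0.
Qed.

Lemma sbounded_ex n f : exists B : R, 0 <= B /\ sbounded n B f.
Proof.
have /(_ _)/cid-/all_sig[M hM] : forall p : nat * nat, exists M : R, 0 <= M /\
    forall x, `|x| ^+ p.1 * normc (cderiv p.2 f x) <= M.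
  by move=> p; exact: schwartz_bound.
exists (\sum_(j < n.+1) \sum_(k < n.+1) M (val j, val k)).
have M0 (p : nat * nat) : 0 <= M p by have [] := hM p.
split; first by do 2!apply: sumr_ge0 => ? _.
move=> j k x jn kn; apply: (le_trans ((hM (j, k)).2 x)).
rewrite (bigD1 (Ordinal (jn : (j < n.+1)%N)))//= (bigD1 (Ordinal (kn : (k < n.+1)%N)))//=.
rewrite -addrA lerDl addr_ge0//; apply: sumr_ge0 => ? _ //.
by apply: sumr_ge0 => ? _.
Qed.

Definition tempered D : Prop := top_dual (schwartz R) D.

Lemma scalar_add D : scalar D -> forall f g, D (f + g) = D f + D g.
Proof. by move=> sD f g; have := sD 1 f g; rewrite scale1r mul1r. Qed.

Lemma scalar0 D : scalar D -> D 0 = 0.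
Proof.
move=> sD; have := sD 1 0 0; rewrite scale1r mul1r addr0 => /eqP.
by rewrite -subr_eq0 opprD addrA subrr sub0r oppr_eq0 => /eqP.
Qed.

Lemma scalar_scale D : scalar D -> forall c f, D (c *: f) = c * D f.
Proof. by move=> sD c f; have := sD c f 0; rewrite addr0 scalar0 ?addr0. Qed.

Lemma scalar_sub D : scalar D -> forall f g, D (f - g) = D f - D g.
Proof.
by move=> sD f g; rewrite scalar_add// -scaleN1r scalar_scale// mulN1r.
Qed.

(** Continuity at 0 gives a seminorm ball on which D is bounded, and rescaling f into that ball
    turns this into an inequality. It replaces the topology in all that follows. *)
Lemma temperedP D : tempered D <-> scalar D /\
  exists (n : nat) (M : R), 0 <= M /\
    forall f B, sbounded n B f -> normc (D f) <= M * B.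
Proof.
split=> [[sD cD]|[sD [n [M [M0 hM]]]]]; split=> //.
  have := cD 0; rewrite /continuous_at scalar0//.
  move=> /(_ (ball (0 : R[i] : numClosedFieldType) 1)).
  have : nbhs (0 : R[i] : numClosedFieldType) (ball 0 1) by exact: nbhsx_ballx.
  move=> h /(_ h) [n [e [e0 he]]].
  exists n, (2 / e); split; first by rewrite divr_ge0// ltW.
  move=> f B hB; apply/ler_addgt0Pr => eps eps0.
  have B0 := sbounded_ge0 hB.
  (* The bound B may be 0, so it is enlarged before dividing by it; the enlargement costs exactly
     eps in the final estimate. *)
  pose b := B + eps * e / 2; have b0 : 0 < b by rewrite ltr_wpDl ?divr_gt0 ?mulr_gt0.
  have -> : 2 / e * B + eps = 2 * b / e by rewrite /b; field; rewrite lt0r_neq0.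
  pose c : R := e / (2 * b); have c0 : 0 < c by rewrite divr_gt0 ?mulr_gt0.
  have /he : schwartz_ball n e 0 (c%:C *: f).
    move=> j k x jn kn; rewrite subr0 schwartzZ_cderiv normcM normc_real.
    rewrite (gtr0_norm c0) mulrCA; apply: (@le_lt_trans _ _ (c * B)).
      by rewrite ler_pM2l//; exact: hB.
    rewrite /c mulrAC ltr_pdivrMr ?mulr_gt0// ltr_pM2l// /b.
    by have := mulr_gt0 eps0 e0; lra.
  rewrite /preimage /= scalar_scale// -ball_normE /ball_ /= sub0r normrN.
  rewrite normC_normc normcM normc_real gtr0_norm// -(rmorph1 (real_complex R)) ltcR /c.
  by rewrite mulrC mulrA ltr_pdivrMr ?mulr_gt0// mul1r ler_pdivlMr// => /ltW.
move=> f; apply/(@cvgrPdist_lt _ _ _ (nbhs f) (nbhs_filter f)) => e e0.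
have [er e1] : (Re e)%:C = e /\ 0 < Re e.
  by move: e0; rewrite ltcE => /andP[/eqP /= h1 h2]; split => //; case: e h1 h2 => ? ? /= ->.
have e2 : 0 < Re e / (M + 1) by rewrite divr_gt0// ltr_wpDl.
exists n, (Re e / (M + 1)); split => // g hg /=.
rewrite normC_normc -er ltcR normc_distC -scalar_sub//.
apply: (@le_lt_trans _ _ (M * (Re e / (M + 1)))).
  by apply: hM => j k x jn kn; apply/ltW/hg.
by rewrite mulrA ltr_pdivrMr ?ltr_wpDl// mulrC ltr_pM2l// ltrDl.
Qed.

End Tempered.

(** * The dilation group on Schwartz space and Euler's equation *)

Section Euler.
Context {R : realType}.
Local Notation C := R[i].
Implicit Types (f g : schwartz R) (D : schwartz R -> C).

Lemma cder_comp (f f' : R -> C) (h h' : R -> R) : cder f f' ->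
  (forall x : R, is_derive x 1 h (h' x)) ->
  cder (fun x => f (h x)) (fun x => (h' x)%:C * f' (h x)).
Proof.
move=> hf hh x; have [f1 f2] := hf (h x); split.
  by rewrite ReMl mulrC; exact: (@is_derive1_comp _ (fun y => Re (f y)) h).
by rewrite ImMl mulrC; exact: (@is_derive1_comp _ (fun y => Im (f y)) h).
Qed.

Lemma cder_unique (f f' f'' : R -> C) x : cder f f' -> cder f f'' ->
  f' x = f'' x.
Proof.
move=> h1 h2; have [a1 a2] := h1 x; have [b1 b2] := h2 x.
apply: complex_eqP.
  by rewrite -(@derive_val _ _ _ _ _ _ _ a1) -(@derive_val _ _ _ _ _ _ _ b1).
by rewrite -(@derive_val _ _ _ _ _ _ _ a2) -(@derive_val _ _ _ _ _ _ _ b2).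
Qed.

Lemma scaleRE (a b : R) : a *: (b : R^o) = a * b.
Proof. by []. Qed.

Lemma cder_cexp (c : C) :
  cder (fun y : R => cexp (c * y%:C)) (fun y => c * cexp (c * y%:C)).
Proof.
move=> x; pose a := Re c; pose b := Im c.
have hl (d : R) : is_derive x 1 (fun y => d * y) d.
  by have := is_derive_affine d 0 x; under eq_fun do rewrite addr0.
have hE : is_derive x 1 (fun y => expR (a * y)) (expR (a * x) * a).
  exact: (@is_derive1_comp _ expR (fun y => a * y)).
have hC : is_derive x 1 (fun y => cos (b * y)) (- sin (b * x) * b).
  exact: (@is_derive1_comp _ (@cos R) (fun y => b * y)).
have hS : is_derive x 1 (fun y => sin (b * y)) (cos (b * x) * b).
  exact: (@is_derive1_comp _ (@sin R) (fun y => b * y)).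
have rE y : Re (c * y%:C) = a * y by rewrite ReM /= mulr0 subr0.
have iE y : Im (c * y%:C) = b * y by rewrite ImM /= mulr0 add0r.
rewrite /cexp; split.
  under eq_fun do rewrite ReMl /= rE iE.
  apply: (is_derive_eq (is_deriveM hE hC)).
  by rewrite !scaleRE ReM ReMl ImMl /= rE iE -/a -/b; ring.
under eq_fun do rewrite ImMl /= rE iE.
apply: (is_derive_eq (is_deriveM hE hS)).
by rewrite !scaleRE ImM ReMl ImMl /= rE iE -/a -/b; ring.
Qed.

Lemma MVT_zero (u u1 : R -> R) : (forall y : R, is_derive y 1 u (u1 y)) ->
  forall y, exists2 c, `|c| <= `|y| & u y - u 0 = u1 c * y.
Proof.
move=> du y.
have cu a b : {within `[a, b], continuous u}.
  by apply: derivable_within_continuous => z _; exact: ex_derive.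
have [y0|y0] := leP 0 y.
  have [c /andP[c0 cy] h] := @MVT_segment R u u1 0 y y0 (fun z _ => du z) (cu _ _).
  by exists c; [rewrite !ger0_norm|rewrite h subr0].
have [c /andP[c0 cy] h] := @MVT_segment R u u1 y 0 (ltW y0) (fun z _ => du z) (cu _ _).
exists c; first by rewrite !ler0_norm ?lerN2// ltW.
by rewrite -opprB h sub0r mulrN opprK.
Qed.

Lemma taylor2 (u u1 u2 : R -> R) (B : R) :
  (forall y : R, is_derive y 1 u (u1 y)) -> (forall y : R, is_derive y 1 u1 (u2 y)) ->
  (forall y, `|y| <= 1 -> `|u2 y| <= B) ->
  forall y, `|y| <= 1 -> `|u y - u 0 - y * u1 0| <= B * y ^+ 2.
Proof.
move=> d1 d2 hB y y1.
have [c cy ->] := MVT_zero d1 y.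
have [c' cc' h] := MVT_zero d2 c.
have B0 : 0 <= B by apply: le_trans (hB 0 _); rewrite ?normr0.
have -> : u1 c * y - y * u1 0 = u2 c' * c * y by rewrite -h; ring.
rewrite !normrM -real_normK ?num_real// expr2 mulrA.
apply: ler_wpM2r => //; apply: ler_pM => //.
by apply: hB; apply: le_trans (le_trans cc' cy) y1.
Qed.

(** A second-order remainder bound passes through functionals and integrals, whereas a limit of
    difference quotients would have to be interchanged with them. This is how derivatives in a
    parameter are taken here. *)
Lemma is_derive_quadratic (u : R -> R) (x d K : R) :
  (forall h, `|h| <= 1 -> `|u (x + h) - u x - h * d| <= K * h ^+ 2) ->
  is_derive x 1 u d.
Proof.
move=> hu.
have K0 : 0 <= K.
  by have := hu 1; rewrite normr1 expr1n mulr1 => /(_ (lexx _)); exact: le_trans.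
have H : h^-1 *: ((u \o shift x) (h *: (1 : R^o)) - u x) @[h --> 0^'] --> d.
  apply/cvgrPdist_le => e e0.
  near=> h.
  have h0 : h != 0 by near: h; exact: nbhs_dnbhs_neq.
  have h1 : `|h| <= 1.
    near: h; apply: dnbhs0_le; exact: ltr01.
  have h2 : `|h| <= e / (K + 1).
    by near: h; apply: dnbhs0_le; rewrite divr_gt0// ltr_wpDl.
  rewrite /= [h%:A]mulr1 [h + x]addrC distrC /GRing.scale /=.
  have -> : h^-1 * (u (x + h) - u x) - d = h^-1 * (u (x + h) - u x - h * d).
    by rewrite [RHS]mulrBr mulKf.
  rewrite normrM normfV ler_pdivrMl ?normr_gt0//.
  apply: (le_trans (hu h h1)).
  rewrite -real_normK ?num_real// expr2 mulrCA ler_wpM2l//.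
  apply: (@le_trans _ _ (K * (e / (K + 1)))); first by rewrite ler_wpM2l.
  by rewrite mulrA ler_pdivrMr ?ltr_wpDl// mulrC ler_pM2l// lerDl.
by apply: DeriveDef; [apply: (cvgP _ H)|exact: (cvg_lim _ H)].
Unshelve. all: by end_near. Qed.

Definition stheta f : schwartz R := smulx (sderiv f).

Lemma cderiv_stheta f k x :
  cderiv k (stheta f) x = x%:C * cderiv k.+1 f x + k%:R * cderiv k f x.
Proof. by rewrite cderiv_smulx !cderiv_sderiv; case: k => //; rewrite !mul0r. Qed.

(** Differentiating in y reproduces the same expression with [stheta f] for f, so the second
    derivative needed for a Taylor estimate comes from a second application. *)
Lemma sdil_cder f k x :
  cder (fun y => cderiv k (sdil f y) x) (fun y => cderiv k (sdil (stheta f) y) x).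
Proof.
have h1 (y : R) : is_derive y 1 (fun y => expR y * x) (expR y * x).
  by apply: is_derive_eq; rewrite /GRing.scale /=; ring.
have h2 (y : R) : is_derive y 1 (fun y => expR y ^+ k) (k%:R * expR y ^+ k).
  have hl : is_derive y 1 (fun y => k%:R * y) (k%:R : R).
    by have := is_derive_affine k%:R 0 y; under eq_fun do rewrite addr0.
  under eq_fun do rewrite -expRM_natl; rewrite -expRM_natl mulrC.
  exact: (@is_derive1_comp _ expR (fun y => k%:R * y)).
have := cder_rmul h2 (cder_comp (schwartz_cder f k) h1).
apply: cder_eq => y; first by rewrite cderiv_sdil.
rewrite cderiv_sdil cderiv_stheta !rmorphM /= rmorph_nat; ring.
Qed.

Lemma sdil0 f : sdil f 0 = f.
Proof. by apply: schwartz_eqP => x /=; rewrite expR0 mul1r. Qed.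

Lemma sdilD f y z : sdil (sdil f y) z = sdil f (y + z).
Proof. by apply: schwartz_eqP => x /=; rewrite mulrA expRD. Qed.

Lemma sdil_bound f n B y : sbounded n B f -> `|y| <= 1 ->
  sbounded n (expR n%:R ^+ 2 * B) (sdil f y).
Proof.
move=> hB y1 j k x jn kn; have B0 := sbounded_ge0 hB.
rewrite cderiv_sdil normcM normc_real (ger0_norm (exprn_ge0 k (expR_ge0 y))).
have -> : `|x| ^+ j = expR (- y) ^+ j * `|expR y * x| ^+ j.
  rewrite -exprMn; congr (_ ^+ _).
  by rewrite normrM (ger0_norm (expR_ge0 _)) mulrA -expRD addNr expR0 mul1r.
rewrite mulrACA expr2 -mulrA -mulrA; apply: ler_pM.
- by rewrite exprn_ge0 ?expR_ge0.
- by rewrite mulr_ge0 ?exprn_ge0 ?expR_ge0// mulr_ge0 ?normc_ge0// exprn_ge0.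
- rewrite -expRM_natl ler_expR; apply: (@le_trans _ _ j%:R); last by rewrite ler_nat.
  rewrite -[leRHS]mulr1 ler_wpM2l//.
  by apply: le_trans y1; rewrite -normrN ler_norm.
apply: ler_pM.
- by rewrite exprn_ge0 ?expR_ge0.
- by rewrite mulr_ge0 ?normc_ge0// exprn_ge0.
- rewrite -expRM_natl ler_expR; apply: (@le_trans _ _ k%:R); last by rewrite ler_nat.
  by rewrite -[leRHS]mulr1 ler_wpM2l//; apply: le_trans y1; exact: ler_norm.
exact: hB.
Qed.

(* The curve y |-> f(e^y x) has velocity x f' at y = 0. *)
Lemma sdil_taylor f n : exists K : R, 0 <= K /\ forall y, `|y| <= 1 ->
  sbounded n (K * y ^+ 2) (sdil f y - f - y%:C *: stheta f).
Proof.
have [B [B0 hB]] := sbounded_ex n (stheta (stheta f)).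
pose B' := expR n%:R ^+ 2 * B.
have B'0 : 0 <= B' by rewrite mulr_ge0// exprn_ge0// expR_ge0.
exists (2 * B'); split; first by rewrite mulr_ge0.
move=> y y1 j k x jn kn.
rewrite 2!schwartzB_cderiv schwartzZ_cderiv.
have d1 := sdil_cder f k x; have d2 := sdil_cder (stheta f) k x.
have bd z : `|z| <= 1 ->
    `|x| ^+ j * normc (cderiv k (sdil (stheta (stheta f)) z) x) <= B'.
  by move=> z1; exact: (sdil_bound hB z1).
have x0 : 0 <= `|x| ^+ j by rewrite exprn_ge0.
have part (p : C -> R) : (forall z w, p (z - w) = p z - p w) ->
    (forall (a : R) z, p (a%:C * z) = a * p z) -> (forall z, `|p z| <= normc z) ->
    (forall h h' (t : R), cder h h' -> is_derive t 1 (fun y => p (h y)) (p (h' t))) ->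
    `|x| ^+ j * `|p (cderiv k (sdil f y) x - cderiv k f x -
                y%:C * cderiv k (stheta f) x)| <= B' * y ^+ 2.
  move=> pB pZ pn pd.
  have := @taylor2 (fun y => `|x| ^+ j * p (cderiv k (sdil f y) x))
    (fun y => `|x| ^+ j * p (cderiv k (sdil (stheta f) y) x))
    (fun y => `|x| ^+ j * p (cderiv k (sdil (stheta (stheta f)) y) x)) B'.
  move=> /(_ _ _ _ y y1); rewrite !sdil0 !pB pZ.
  have -> (a b c' : R) : `|x| ^+ j * `|a - b - y * c'| =
      `| `|x| ^+ j * a - `|x| ^+ j * b - y * (`|x| ^+ j * c')|.
    by rewrite -{1}(ger0_norm x0) -normrM; congr (`| _ |); ring.
  apply.
  - move=> t; have := pd _ _ t d1 => dt.
    by apply: is_derive_eq; rewrite /GRing.scale /= ; ring.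
  - move=> t; have := pd _ _ t d2 => dt.
    by apply: is_derive_eq; rewrite /GRing.scale /= ; ring.
  - move=> t t1; rewrite normrM (ger0_norm x0); apply: le_trans (bd t t1).
    exact: ler_wpM2l.
apply: (@le_trans _ _ (B' * y ^+ 2 + B' * y ^+ 2)); last by rewrite -mulrDl mulr_natl mulr2n.
apply: (le_trans (ler_wpM2l x0 (normc_le_ReIm _))); rewrite mulrDr; apply: lerD.
  apply: part; [exact: ReB|exact: ReMl|exact: normc_Re|].
  by move=> h h' t ht; have [] := ht t.
apply: part; [exact: ImB|exact: ImMl|exact: normc_Im|].
by move=> h h' t ht; have [] := ht t.
Qed.

(** The Taylor bound [sdil_taylor] is available in the seminorm that controls D, so linearity of D
    turns it into a second-order bound for the scalar function of y. *)
Lemma tempered_cder D f : tempered D ->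
  cder (fun y => D (sdil f y)) (fun y => D (stheta (sdil f y))).
Proof.
move=> /temperedP[sD [n [M [M0 hM]]]] y.
have [K [K0 hK]] := sdil_taylor (sdil f y) n.
have key h : `|h| <= 1 -> normc (D (sdil f (y + h)) - D (sdil f y) -
    h%:C * D (stheta (sdil f y))) <= M * K * h ^+ 2.
  move=> h1; have := hM _ _ (hK h h1).
  by rewrite !scalar_sub// scalar_scale// sdilD mulrA.
split; apply: is_derive_quadratic => h h1; apply: le_trans (key h h1).
  by rewrite -ReMl -!ReB; exact: normc_Re.
by rewrite -ImMl -!ImB; exact: normc_Im.
Qed.

Lemma tempered_sdil_cvg D f (u : nat -> R) y : tempered D ->
  u n @[n --> \oo] --> y ->
  ccvg (fun n => D (sdil f (u n))) (D (sdil f y)).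
Proof.
move=> tD uy; have [d1 d2] := tempered_cder f tD y.
have c1 : {for y, continuous (fun y => Re (D (sdil f y)))}.
  by apply: differentiable_continuous; apply/derivable1_diffP; exact: ex_derive.
have c2 : {for y, continuous (fun y => Im (D (sdil f y)))}.
  by apply: differentiable_continuous; apply/derivable1_diffP; exact: ex_derive.
by split; [exact: (cvg_comp _ _ uy c1)|exact: (cvg_comp _ _ uy c2)].
Qed.

(* hom w D is homogeneity under positive dilations x |-> x / t, t = e^(-y). *)
Definition hom (w : C) D : Prop :=
  forall y f, D (sdil f y) = cexp (- w * y%:C) * D f.

Definition parity (k : bool) D : Prop := forall f, D (sneg f) = (-1) ^+ k * D f.

Definition homdist (w : C) (k : bool) D : Prop :=
  [/\ tempered D, hom w D & parity k D].

Lemma hom_euler w D : tempered D -> hom w D ->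
  forall f, D (stheta f) = - w * D f.
Proof.
move=> tD hD f; have := cder_unique 0 (tempered_cder f tD).
have h : cder (fun y => D (sdil f y)) (fun y => D f * (- w * cexp (- w * y%:C))).
  apply: cder_eq (cderZ (D f) (cder_cexp (- w))) => // y.
  by rewrite hD mulrC.
by move=> /(_ _ h); rewrite sdil0 mulr0 cexp0 mulr1 mulrC.
Qed.

End Euler.

(** * Integrable majorants built from powers *)

Section PowerIntegrals.
Context {R : realType}.
Local Notation mu := (@lebesgue_measure R).
Implicit Types (x y s : R).

Lemma FTC2_is_derive (F f : R -> R) (a b : R) : a < b ->
  (forall x, a <= x <= b -> is_derive x 1 F (f x)) ->
  {within `[a, b], continuous f} ->
  (\int[mu]_(x in `[a, b]) (f x)%:E = (F b)%:E - (F a)%:E)%E.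
Proof.
move=> ab dF cf.
have cF x : a <= x <= b -> {for x, continuous F}.
  move=> /dF ?; apply: differentiable_continuous; apply/derivable1_diffP.
  exact: ex_derive.
apply: continuous_FTC2 => //.
  split.
  - move=> x; rewrite in_itv/= => /andP[/ltW ax /ltW xb].
    by have := dF x; rewrite ax xb => /(_ isT) ?; exact: ex_derive.
  - by apply: cvg_at_right_filter; apply: cF; rewrite lexx ltW.
  - by apply: cvg_at_left_filter; apply: cF; rewrite lexx ltW.
move=> x; rewrite in_itv/= => /andP[/ltW ax /ltW xb].
by rewrite derive1E; have := dF x; rewrite ax xb => /(_ isT) ?; exact: derive_val.
Qed.

Lemma continuous_powR_gt0 s x : 0 < x -> {for x, continuous (@powR R ^~ s)}.
Proof.
move=> x0; apply: differentiable_continuous; apply/derivable1_diffP.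
by apply: derivable_powR; rewrite in_itv/= x0.
Qed.

Lemma integral_powR_itv (s a : R) : 0 < s -> 0 < a -> a < 1 ->
  (\int[mu]_(x in `[a, 1%R]) (x `^ (s - 1))%:E <= (s^-1)%:E)%E.
Proof.
move=> s0 a0 a1.
have dF x : a <= x <= 1 -> is_derive x 1 (fun x => s^-1 * x `^ s) (x `^ (s - 1)).
  move=> /andP[ax _]; have x0 : 0 < x by exact: lt_le_trans ax.
  have h := is_derive1_powR s x0.
  apply: (is_derive_eq (is_deriveZ s^-1 h)).
  by rewrite scaleRE mulKf// lt0r_neq0.
rewrite (FTC2_is_derive a1 dF).
  by rewrite -EFinB lee_fin powR1 mulr1 gerBl mulr_ge0 ?powR_ge0// invr_ge0 ltW.
apply: continuous_in_subspaceT => x; rewrite inE/= in_itv/= => /andP[ax _].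
by apply: continuous_powR_gt0; exact: lt_le_trans ax.
Qed.

Lemma integral_powR_01 s : 0 < s ->
  (\int[mu]_(x in `]0%R, 1%R]) (x `^ (s - 1))%:E <= (s^-1)%:E)%E.
Proof.
(* The left end 1 / (n + 2) is below 1 already for n = 0, as [integral_powR_itv] requires. *)
move=> s0; pose F (n : nat) : set (measurableTypeR R) := `[(n.+2%:R : R)^-1, 1]%classic.
have FU : `]0%R, 1%R]%classic = \bigcup_n F n.
  apply/seteqP; split => x; rewrite /F /= in_itv/=.
    move=> /andP[x0 x1]; exists (Num.trunc x^-1) => //=; rewrite in_itv/= x1 andbT.
    rewrite invf_ple ?posrE//; apply/ltW; apply: (lt_trans (truncnS_gt _)).
    by rewrite ltr_nat.
  move=> [n _]; rewrite /= in_itv/= => /andP[nx ->]; rewrite andbT.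
  by apply: lt_le_trans nx; rewrite invr_gt0.
rewrite FU.
have h := @ge0_nondecreasing_set_cvg_integral _ _ R F
  (fun x => (x `^ (s - 1))%:E) mu.
have {}h := h _ _ _ _; apply: (cvge_to_le (h _ _ _ _)).
- apply/nondecreasing_seqP => n; rewrite subsetEset => x; rewrite /F /= !in_itv/=.
  move=> /andP[nx ->]; rewrite andbT; apply: le_trans nx.
  by rewrite lef_pV2 ?posrE// ler_nat.
- by move=> n; exact: measurable_itv.
- move=> n; apply/measurable_EFinP; apply: measurable_funTS.
  exact: measurable_powR.
- by move=> n x _; rewrite lee_fin powR_ge0.
- apply: nearW => n; apply: integral_powR_itv => //.
  by rewrite invf_lt1// ltr1n.
Qed.

Lemma integral_powR_1y :
  (\int[mu]_(x in `[1%R, +oo[) (x ^- 2)%:E = 1%:E)%E.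
Proof.
rewrite (@ge0_continuous_FTC2y R (fun x => x ^- 2) (fun x => - x^-1) 1 0).
- by rewrite invr1 -EFinB opprK add0r.
- by move=> x _; rewrite invr_ge0 sqr_ge0.
- apply: continuous_in_subspaceT => x; rewrite inE/= in_itv/= andbT => x1.
  have x0 : x != 0 by rewrite lt0r_neq0// (lt_le_trans ltr01).
  by apply: cvgV; [rewrite expf_neq0|exact: exprn_continuous].
- rewrite -oppr0; apply: cvgN; apply/cvgrPdist_le => e e0; near=> x.
  have x0 : 0 < x by near: x; exact: nbhs_pinfty_gt.
  rewrite sub0r normrN gtr0_norm ?invr_gt0// invf_ple ?posrE//.
- move=> x x1; apply: derivableN; apply: derivableV => //.
  by rewrite lt0r_neq0// (lt_trans ltr01).
- apply: cvg_at_right_filter; apply: cvgN; apply: cvgV; [exact: oner_neq0|exact: cvg_id].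
- move=> x; rewrite in_itv/= andbT => x1; have x0 : x != 0 by rewrite lt0r_neq0// (lt_trans ltr01).
  rewrite derive1E deriveN; last exact: derivableV.
  by rewrite deriveV// derive_id scaleRE mulr1 opprK.
Unshelve. all: by end_near. Qed.

Definition jhalf s x : R := x `^ (s - 1) * \1_(`]0, 1]%classic : set R) x +
  x ^- 2 * \1_(`[1, +oo[%classic : set R) x.

(* An integrable majorant of |x|^(s-1) times a rapidly decreasing function. *)
Definition jfun s x : R := jhalf s x + jhalf s (- x).

Lemma jhalf_ge0 s x : 0 <= jhalf s x.
Proof.
by rewrite addr_ge0// mulr_ge0 ?powR_ge0 ?invr_ge0 ?sqr_ge0// indicE.
Qed.

Lemma jfun_ge0 s x : 0 <= jfun s x.
Proof. by rewrite addr_ge0 ?jhalf_ge0. Qed.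

Lemma integrable_indic_of_integral (f : R -> R) (A : set R) (M : \bar R) :
  measurable A -> measurable_fun setT f -> (forall x, A x -> 0 <= f x) ->
  (\int[mu]_(x in A) (f x)%:E <= M)%E -> (M < +oo)%E ->
  mu.-integrable setT (EFin \o (fun x => f x * \1_A x)).
Proof.
move=> mA mf f0 fM My; apply/integrableP; split.
  by apply/measurable_EFinP; apply: measurable_funM => //; exact: measurable_indic.
apply: le_lt_trans My; apply: le_trans fM.
rewrite [leRHS]integral_mkcond; apply: ge0_le_integral => //=.
- by apply/measurable_EFinP; apply: measurableT_comp => //;
    apply: measurable_funM => //; exact: measurable_indic.
- by apply/(measurable_restrictT _ mA); apply/measurable_EFinP; exact: measurable_funTS.
- move=> x _; rewrite patchE indicE; case: ifPn => xA.
    by rewrite mulr1 ger0_norm// f0// -inE.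
  by rewrite mulr0 normr0.
Qed.

Lemma integrable_jhalf s : 0 < s -> mu.-integrable setT (EFin \o jhalf s).
Proof.
move=> s0.
have -> : EFin \o jhalf s =
    (EFin \o (fun x => x `^ (s - 1) * \1_(`]0, 1]%classic : set R) x)) \+
    (EFin \o (fun x => x ^- 2 * \1_(`[1, +oo[%classic : set R) x)).
  by apply/funext.
apply: integrableD => //.
  apply: integrable_indic_of_integral (integral_powR_01 s0) _ => //.
  - by move=> x _; exact: powR_ge0.
  - exact: ltry.
apply: (integrable_indic_of_integral (M := 1%:E)) => //.
- have -> : (fun x : R => x ^- 2) = (fun x => (x ^+ 2) `^ (-1)).
    by apply/funext => x; rewrite powR_inv1// sqr_ge0.
  apply: (measurable_comp1 (measurable_powR _)); exact: measurable_funX.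
- by move=> x _; rewrite invr_ge0 sqr_ge0.
- by rewrite integral_powR_1y.
- exact: ltry.
Qed.

Lemma integrable_jfun s : 0 < s -> mu.-integrable setT (EFin \o jfun s).
Proof.
move=> s0; have i1 := integrable_jhalf s0.
have N1 : (-1 : R) != 0 by rewrite oppr_eq0 oner_eq0.
have i2 := integrable_affine 0 N1 i1.
have -> : EFin \o jfun s = (EFin \o jhalf s) \+
    (EFin \o (fun x => jhalf s (-1 * x + 0))).
  by apply/funext => x /=; rewrite addr0 mulN1r.
exact: integrableD.
Qed.

Lemma jfun_ge s x (c b : R) : x != 0 -> 0 <= c -> c <= b ->
  c * `|x| ^+ (Num.trunc s).+2 <= b ->
  `|x| `^ (s - 1) * c <= b * jfun s x.
Proof.
move=> x0 c0 cb h; have b0 := le_trans c0 cb.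
have ax0 : 0 < `|x| by rewrite normr_gt0.
apply: (@le_trans _ _ (b * jhalf s `|x|)); last first.
  apply: ler_wpM2l => //; rewrite /jfun; case: (ger0P x) => _.
    by rewrite lerDl jhalf_ge0.
  by rewrite lerDr jhalf_ge0.
move: (`|x|) ax0 h => y y0 h.
have [y1|y1] := leP y 1.
  apply: (@le_trans _ _ (b * y `^ (s - 1))).
    by rewrite mulrC ler_wpM2r// powR_ge0.
  apply: ler_wpM2l => //; rewrite /jhalf indicE mem_set/=; last first.
    by rewrite in_itv/= y0.
  by rewrite mulr1 lerDl mulr_ge0 ?invr_ge0 ?sqr_ge0// indicE.
apply: (@le_trans _ _ (b * y ^- 2)).
  rewrite ler_pdivlMr ?exprn_gt0//; apply: le_trans h.
  rewrite mulrAC mulrC; apply: ler_wpM2l => //.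
  rewrite -!(powR_mulrn _ (ltW y0)) -powRD; last by rewrite (gt_eqF y0) implybT.
  apply: ler_powR; first exact: ltW.
  have := truncnS_gt s; rewrite -[_.+2]addn1 natrD; lra.
apply: ler_wpM2l => //; rewrite /jhalf [X in _ <= _ + _ * X]indicE mem_set/=; last first.
  by rewrite in_itv/= andbT ltW.
by rewrite mulr1 lerDr mulr_ge0 ?powR_ge0// indicE.
Qed.

End PowerIntegrals.

(** * Distributions given by locally integrable kernels *)

Section KernelDistributions.
Context {R : realType}.
Local Notation C := R[i].
Local Notation mu := (@lebesgue_measure R).
Implicit Types (phi : R -> C) (f g : schwartz R).

Lemma continuous_cmeasurable (f : R -> C) :
  continuous (fun x => Re (f x)) -> continuous (fun x => Im (f x)) ->
  cmeasurable f.
Proof. by move=> h1 h2; split; exact: continuous_measurable_fun. Qed.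

Lemma cder_continuous (f f' : R -> C) : cder f f' ->
  continuous (fun x => Re (f x)) /\ continuous (fun x => Im (f x)).
Proof.
move=> h; split => x; have [h1 h2] := h x.
  by apply: differentiable_continuous; apply/derivable1_diffP; exact: ex_derive.
by apply: differentiable_continuous; apply/derivable1_diffP; exact: ex_derive.
Qed.

Lemma cmeasurable_schwartz f : cmeasurable (f : R -> C).
Proof.
have := schwartz_cder f 0; rewrite cderiv0 => /cder_continuous[h1 h2].
exact: continuous_cmeasurable.
Qed.

(** Two exponents are allowed because a logarithmic factor is absorbed by lowering the exponent near
    0 and raising it at infinity. With value 0 at 0 the majorant of [kernel_le] is valid at every
    point. *)
Definition kernel phi (K s1 s2 : R) : Prop :=
  [/\ cmeasurable phi, 0 < s1, 0 < s2, 0 <= K & phi 0 = 0 /\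
    forall x, x != 0 -> normc (phi x) <= K * (`|x| `^ (s1 - 1) + `|x| `^ (s2 - 1))].

Definition kint phi f : C := cintegral mu setT (fun x => phi x * f x).

Section Kernel.
Variables (phi : R -> C) (K s1 s2 : R).
Hypothesis hphi : kernel phi K s1 s2.

Let n := maxn (Num.trunc s1).+2 (Num.trunc s2).+2.

Lemma kernel_le f B : sbounded n B f -> forall x,
  normc (phi x * f x) <= B * K * (jfun s1 x + jfun s2 x).
Proof.
case: hphi => _ s10 s20 K0 [phi0 hK] hB x; have B0 := sbounded_ge0 hB.
have j0 s : 0 <= jfun s x by rewrite addr_ge0 ?jhalf_ge0.
have [->|x0] := eqVneq x 0.
  by rewrite phi0 mul0r normc0 mulr_ge0 ?mulr_ge0 ?addr_ge0 ?jhalf_ge0.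
rewrite normcM; apply: (le_trans (ler_wpM2r (normc_ge0 _) (hK x x0))).
rewrite [B * K]mulrC -!mulrA; apply: ler_wpM2l => //.
rewrite mulrDl mulrDr.
have b0 : normc (f x) <= B.
  by have := hB 0%N 0%N x isT isT; rewrite expr0 mul1r cderiv0.
have bk m : (m <= n)%N -> normc (f x) * `|x| ^+ m <= B.
  by move=> mn; have := hB m 0%N x mn isT; rewrite mulrC cderiv0.
apply: lerD; apply: jfun_ge => //; rewrite ?normc_ge0//; apply: bk.
  exact: leq_maxl.
exact: leq_maxr.
Qed.

Let integrable_j B : mu.-integrable setT (EFin \o (fun x => B * K * (jfun s1 x + jfun s2 x))).
Proof.
case: hphi => _ s10 s20 _ _.
have -> : (fun x => B * K * (jfun s1 x + jfun s2 x)) =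
    (fun x => B * K * jfun s1 x + B * K * jfun s2 x).
  by apply/funext => x; rewrite mulrDr.
exact: (integrable_lin2 measurableT (B * K) (B * K)
  (integrable_jfun s10) (integrable_jfun s20)).
Qed.

Lemma kernel_cmeasurable f : cmeasurable (fun x => phi x * f x).
Proof.
apply: cmeasurableM; last exact: cmeasurable_schwartz.
by case: hphi.
Qed.

Lemma kernel_integrable f : cintegrable mu setT (fun x => phi x * f x).
Proof.
have [B [B0 hB]] := sbounded_ex n f.
apply: (@cintegrable_le _ _ _ mu setT measurableT _ _ (kernel_cmeasurable f)
  (fun x _ => kernel_le hB x)).
exact: integrable_j.
Qed.

Lemma tempered_kint : tempered (kint phi).
Proof.
apply/temperedP; split.
  move=> a f g; rewrite /kint -cintegralZ; [|by []|exact: kernel_integrable].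
  rewrite -cintegralD; [|by []| |exact: kernel_integrable]; last first.
    by apply: cintegrableZ => //; exact: kernel_integrable.
  by apply: cintegral_ext => x _; rewrite /= mulrDr mulrCA.
pose I := Rintegral mu setT (fun x => jfun s1 x + jfun s2 x).
have I0 : 0 <= I by apply: Rintegral_ge0 => x _; apply: addr_ge0; exact: jfun_ge0.
case: (hphi) => _ s10 s20 K0 _.
exists n, (2 * (K * I)); split; first by rewrite !mulr_ge0.
move=> f B hB.
apply: (le_trans (normc_cintegral_le measurableT (kernel_integrable f)
  (integrable_j B) (fun x _ => kernel_le hB x))).
rewrite -mulrA ler_wpM2l// RintegralZl//.
  by rewrite -/I [B * K]mulrC mulrAC.
have -> : (fun x => jfun s1 x + jfun s2 x) =
    (fun x => 1 * jfun s1 x + 1 * jfun s2 x).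
  by apply/funext => x; rewrite !mul1r.
exact: (integrable_lin2 measurableT 1 1
  (integrable_jfun s10) (integrable_jfun s20)).
Qed.

End Kernel.

Lemma kernel_delta k (w : C) : 0 < Re w ->
  kernel (delta_density k w) 1 (Re w) (Re w).
Proof.
move=> w0; split => //.
  apply: cmeasurableM; first by apply: cmeasurable_sgnpow; exact: measurable_id.
  by apply: cmeasurable_cpow; apply: continuous_measurable_fun; exact: norm_continuous.
split; first by rewrite /delta_density normr0 cpow0 mulr0.
move=> x x0; rewrite /delta_density normcM mul1r.
apply: (@le_trans _ _ (`|x| `^ (Re w - 1))); last by rewrite lerDl powR_ge0.
rewrite -[leRHS]mul1r; apply: ler_pM; rewrite ?normc_ge0 ?normc_sgnpow_le//.
by apply: (le_trans (normc_cpow_le _ (normr_ge0 _))); rewrite ReB.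
Qed.

End KernelDistributions.

Lemma ae_imp (R : realType) (dT : measure_display) (T : measurableType dT)
  (mu : set T -> \bar R) (P Q : T -> Prop) : (forall x, P x -> Q x) ->
  {ae mu, forall x, P x} -> {ae mu, forall x, Q x}.
Proof.
by move=> PQ [A [mA A0 PA]]; exists A; split => // x nQ; apply: PA => /PQ.
Qed.

(** * The distributions sgn(x)^k |x|^(w-1) for Re w > 0 *)

Section DeltaDistribution.
Context {R : realType}.
Local Notation C := R[i].
Local Notation mu := (@lebesgue_measure R).
Implicit Types (f g : schwartz R) (w : C) (k : bool).

Definition sdelta k w : schwartz R -> C := kint (delta_density k w).

Lemma measurable_affine (a b : R) : measurable_fun setT (fun x : R => a * x + b).
Proof. by apply: measurable_funD => //; exact: measurable_funM. Qed.

Lemma cmeasurable_delta_density k w (h : R -> R) : measurable_fun setT h ->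
  cmeasurable (fun x => delta_density k w (h x)).
Proof.
move=> mh; apply: cmeasurableM; first exact: cmeasurable_sgnpow.
apply: cmeasurable_cpow; apply: measurable_comp1 mh.
by apply: continuous_measurable_fun; exact: norm_continuous.
Qed.

Lemma delta_densityM k w (a x : R) : 0 < a ->
  delta_density k w (a * x) = cpow a (w - 1) * delta_density k w x.
Proof.
move=> a0; have [->|x0] := eqVneq x 0.
  by rewrite mulr0 /delta_density normr0 cpow0 !mulr0.
rewrite /delta_density sgnpow_mul sgnpow_pos// mul1r normrM gtr0_norm//.
by rewrite cpowMl ?normr_gt0// mulrCA.
Qed.

Lemma delta_densityN k w (x : R) :
  delta_density k w (- x) = (-1) ^+ k * delta_density k w x.
Proof. by rewrite /delta_density sgnpowN normrN mulrA. Qed.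

Lemma delta_densityS k w (x : R) : w != 0 ->
  delta_density k w x * x%:C = delta_density (~~ k) (w + 1) x.
Proof.
move=> w0; have [->|x0] := eqVneq x 0.
  by rewrite /delta_density normr0 !cpow0 !mulr0.
rewrite /delta_density mulrAC -{1}(negbK k) sgnpow_negb//.
have -> : w + 1 - 1 = (w - 1) + 1 by rewrite addrK subrK.
by rewrite (@cpowD _ `|x| (w - 1) 1) ?normr_eq0// cpow_s1// mulrA mulrAC.
Qed.

Lemma homdist_sdelta k w : 0 < Re w -> homdist w k (sdelta k w).
Proof.
move=> w0; have kd := kernel_delta k w0; split.
- exact: tempered_kint kd.
- move=> y f; pose a := expR y; have a0 : 0 < a by exact: expR_gt0.
  have i1 := kernel_integrable kd f; have i2 := kernel_integrable kd (sdil f y).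
  rewrite /sdelta /kint (cintegral_affine 0 (lt0r_neq0 a0) i1).
  have -> : cintegral mu setT (fun x => delta_density k w (a * x + 0) * f (a * x + 0)) =
      cpow a (w - 1) * cintegral mu setT (fun x => delta_density k w x * sdil f y x).
    rewrite -cintegralZ//; apply: cintegral_ext => x _.
    by rewrite addr0 delta_densityM// mulrA.
  rewrite mulrA gtr0_norm// mulrA cpowD ?lt0r_neq0// cpowN ?lt0r_neq0// cpow_s1 ?ltW//.
  rewrite -[LHS]mul1r; congr (_ * _).
  rewrite cpowE ?lt0r_neq0// /a expRK mulNr cexpN.
  rewrite mulrACA mulVf ?cexp_neq0// mul1r mulfV//.
  by rewrite -normc_eq0 normc_real gtr0_norm// lt0r_neq0.
- move=> f.
  have N1 : (-1 : R) != 0 by rewrite oppr_eq0 oner_eq0.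
  rewrite /sdelta /kint (cintegral_affine 0 N1 (kernel_integrable kd (sneg f))).
  rewrite normrN1 mul1r -cintegralZ//; last exact: kernel_integrable kd f.
  apply: cintegral_ext => x _.
  by rewrite addr0 mulN1r delta_densityN -mulrA /= opprK.
Qed.

Lemma sdelta_smulx k w f : w != 0 -> sdelta k w (smulx f) = sdelta (~~ k) (w + 1) f.
Proof.
by move=> w0; apply: cintegral_ext => x _; rewrite mulrA delta_densityS.
Qed.

Lemma delta_density_cvg k w (u : nat -> R) (x : R) : 0 < x ->
  u n @[n --> \oo] --> x ->
  ccvg (fun n => delta_density k w (u n)) (delta_density k w x).
Proof.
move=> x0 ux.
have dE y : 0 < y -> delta_density k w y = cexp ((w - 1) * (ln y)%:C).
  by move=> y0; rewrite /delta_density sgnpow_pos// mul1r gtr0_norm// cpowE// lt0r_neq0.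
have un0 : \forall n \near \oo, 0 < u n by apply: (cvgr_gt _ ux).
have lu : ln (u n) @[n --> \oo] --> ln x.
  by apply: (cvg_comp _ _ ux); exact: continuous_ln.
have [c1 c2] := cder_continuous (cder_cexp (w - 1)).
rewrite dE//; split.
  have := cvg_comp _ _ lu (c1 (ln x)).
  apply: cvg_trans; apply: near_eq_cvg; near=> n.
  by rewrite /= dE//; near: n.
have := cvg_comp _ _ lu (c2 (ln x)).
apply: cvg_trans; apply: near_eq_cvg; near=> n.
by rewrite /= dE//; near: n.
Unshelve. all: by end_near. Qed.

Lemma cintegral_gauss : cintegral mu setT (sgauss : R -> C) = (Num.sqrt pi)%:C.
Proof.
apply: complex_eqP => /=; first by rewrite /Rintegral integralT_gauss.
by rewrite /Rintegral integral0.
Qed.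

Lemma ae_neq0 : {ae mu, forall x : R, x != 0}.
Proof.
exists [set 0]; split; [exact: measurable_set1|exact: lebesgue_measure_set1|].
by move=> x /=; have [->|//] := eqVneq x 0.
Qed.

(** Gaussians concentrating at x = 1 are tested: after rescaling, the pairings converge to the
    density at 1 times the Gaussian integral, that is to the square root of pi. For Re w >= 1 the
    density has no singularity, so the rescaled integrands have a common majorant. *)
Lemma sdelta_neq0_ge1 k w : 1 <= Re w -> exists f, sdelta k w f != 0.
Proof.
move=> w1; have w0 : 0 < Re w by exact: lt_le_trans w1.
have kd := kernel_delta k w0.
apply: contrapT => /forallNP h.
have n0 n : (n.+1%:R : R) != 0 by rewrite pnatr_eq0.
pose fn n : schwartz R := mkS (is_schwartz_affine sgauss (- n.+1%:R) (n0 n)).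
pose u (n : nat) := cintegral mu setT (fun y =>
    delta_density k w (n.+1%:R^-1 * y + 1) * sgauss y).
have z n : u n = 0.
  have /negP := h (fn n); rewrite negbK => /eqP.
  rewrite /sdelta /kint (cintegral_affine 1 (invr_neq0 (n0 n)) (kernel_integrable kd (fn n))).
  move=> /eqP; rewrite mulf_eq0 -normc_eq0 normc_real normr_id normr_eq0 invr_eq0 (negPf (n0 n)) /=.
  move=> /eqP <-; apply: cintegral_ext => x _; congr (_ * _).
  by rewrite /fn /= mulrDr mulr1 mulrA mulfV// mul1r addrK.
(* The polynomial (2 + 2 y^2)^m dominates (1 + |y|)^(Re w - 1). The exponents 0 and 3 below are the
   ones that [jfun_ge] asks for at s = 1. *)
pose m := (Num.trunc (Re w)).+1.
pose p : {poly R} := (2%:P + 2%:P * 'X^2) ^+ m.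
have [M1 h1] := gauss_poly_bound p 0; have [M2 h2] := gauss_poly_bound p 3.
pose b := Num.max M1 M2.
have pE y : p.[y] = (2 + 2 * y ^+ 2) ^+ m by rewrite /p !hornerE.
have p0 y : 0 <= p.[y] by rewrite pE exprn_ge0// addr_ge0// mulr_ge0// sqr_ge0.
have jb y : y != 0 -> p.[y] * gauss_fun y <= b * jfun 1 y.
  move=> y0; have c0 : 0 <= p.[y] * gauss_fun y by rewrite mulr_ge0// gauss_fun_ge0.
  have := @jfun_ge R 1 y _ b y0 c0; rewrite subrr powRr0 mul1r; apply.
    by rewrite /b le_max -{1}(ger0_norm c0); have := h1 y; rewrite expr0 mul1r => ->.
  rewrite [X in _ ^+ X.+2](_ : _ = 1%N) ?truncn1//.
  by rewrite /b le_max mulrC -{2}(ger0_norm c0) h2 orbT.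
have : ccvg u (cintegral mu setT (sgauss : R -> C)).
  apply: (@cintegral_dominated_cvg _ _ _ mu setT measurableT _ _ (fun y => b * jfun 1 y)).
  - move=> n; apply: cmeasurableM; last exact: cmeasurable_schwartz.
    apply: cmeasurable_delta_density; exact: measurable_affine.
  - exact: cmeasurable_schwartz.
  - apply: nearW => y _; rewrite -[X in ccvg _ X]mul1r; apply: ccvgM; last exact: ccvg_cst.
    have -> : 1 = delta_density k w 1.
      by rewrite /delta_density normr1 cpow_1l sgnpow_pos// mulr1.
    apply: delta_density_cvg => //.
    rewrite -[X in _ --> X]add0r; apply: cvgD; last exact: cvg_cst.
    rewrite -[X in _ --> X](mul0r y); apply: cvgMl.
    exact: cvg_harmonic.
  - have := @integrable_lin2 R _ _ mu setT measurableT b 0 _ _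
      (integrable_jfun ltr01) (integrable_jfun ltr01).
    by under eq_fun do rewrite mul0r addr0.
  - apply: (ae_imp _ ae_neq0) => y y0 _ n; apply: le_trans (jb y y0).
    rewrite normcM normc_real (ger0_norm (gauss_fun_ge0 _)).
    apply: ler_wpM2r; first exact: gauss_fun_ge0.
    rewrite /delta_density normcM.
    apply: (@le_trans _ _ (1 * (1 + `|y|) `^ (Re w - 1))).
      apply: ler_pM; rewrite ?normc_ge0 ?normc_sgnpow_le//.
      apply: (le_trans (normc_cpow_le _ (normr_ge0 _))); rewrite ReB.
      apply: ge0_ler_powR; rewrite ?nnegrE ?subr_ge0 ?addr_ge0//.
      apply: (le_trans (ler_normD _ _)); rewrite normr1 addrC lerD2l.
      by rewrite normrM normfV normr_nat ler_pdivrMl ?ltr0Sn// ler_peMl ?normr_ge0 ?ler1n.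
    rewrite mul1r pE; apply: (@le_trans _ _ ((1 + `|y|) `^ m%:R)).
      apply: ler_powR; first by rewrite lerDl.
      by have := truncnS_gt (Re w); rewrite /m; lra.
    have q0 : 0 <= 2 + 2 * y ^+ 2 by have := sqr_ge0 y; lra.
    have s0 : 0 <= 1 + `|y : R| by rewrite addr_ge0.
    have s1 : 1 + `|y : R| <= 2 + 2 * y ^+ 2.
      rewrite -(real_normK (num_real (y : R))).
      move: (`|y : R|) (normr_ge0 (y : R)) => t t0.
      by have := sqr_ge0 (t - 1); have := sqr_ge0 t; lra.
    rewrite powR_mulrn; last exact: s0.
    by apply: lerXn2r; rewrite ?nnegrE.
have -> : u = fun=> 0 by apply/funext.
move=> /ccvg_unique/(_ (ccvg_cst 0)) /eqP; apply/negP.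
by rewrite cintegral_gauss -normc_eq0 normc_real normr_eq0 sqrtr_eq0 -ltNge pi_gt0.
Qed.

(** Testing on x f raises w by 1 and flips the parity, which reduces the claim to real part at least
    1. *)
Lemma sdelta_neq0 k w : 0 < Re w -> exists f, sdelta k w f != 0.
Proof.
move=> w0; have [f hf] := @sdelta_neq0_ge1 (~~ k) (w + 1) ltac:(by rewrite ReD /= lerDr ltW).
exists (smulx f); rewrite sdelta_smulx//.
by apply: contraTneq w0 => ->; rewrite /= ltxx.
Qed.

End DeltaDistribution.

(** * Radial averages and the solution of Euler's equation *)

Section RadialAverage.
Context {R : realType}.
Local Notation C := R[i].
Local Notation mu := (@lebesgue_measure R).
Implicit Types (f g : schwartz R) (w : C) (x u : R).

(** A pointwise form of [cder], needed because u^w is differentiated only at u > 0. *)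
Definition cderat (f : R -> C) (l : C) x : Prop :=
  is_derive x 1 (fun y => Re (f y)) (Re l) /\
  is_derive x 1 (fun y => Im (f y)) (Im l).

Lemma cderatM (f g : R -> C) l m x : cderat f l x -> cderat g m x ->
  cderat (fun y => f y * g y) (l * g x + f x * m) x.
Proof.
move=> [f1 f2] [g1 g2]; split.
  under eq_fun do rewrite ReM.
  apply: (is_derive_eq (is_deriveB (is_deriveM f1 g1) (is_deriveM f2 g2))).
  by rewrite !scaleRE ReD !ReM; ring.
under eq_fun do rewrite ImM.
apply: (is_derive_eq (is_deriveD (is_deriveM f1 g2) (is_deriveM f2 g1))).
by rewrite !scaleRE ImD !ImM; ring.
Qed.

Lemma cderat_comp (f : R -> C) l (h : R -> R) d x : cderat f l (h x) ->
  is_derive x 1 h d -> cderat (fun y => f (h y)) (d%:C * l) x.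
Proof.
move=> [f1 f2] hh; split.
  by rewrite ReMl mulrC; exact: (@is_derive1_comp _ (fun y => Re (f y)) h).
by rewrite ImMl mulrC; exact: (@is_derive1_comp _ (fun y => Im (f y)) h).
Qed.

Lemma cderat_continuous (f : R -> C) l x : cderat f l x ->
  {for x, continuous (fun y => Re (f y))} /\
  {for x, continuous (fun y => Im (f y))}.
Proof.
move=> [h1 h2]; split; apply: differentiable_continuous;
  apply/derivable1_diffP; exact: ex_derive.
Qed.

Lemma cderat_eq (f : R -> C) l l' x : l = l' -> cderat f l x -> cderat f l' x.
Proof. by move=> ->. Qed.

Lemma cderat_lnpow w u : 0 < u ->
  cderat (fun y => cexp (w * (ln y)%:C)) (w * cpow u (w - 1)) u.
Proof.
move=> u0; have dl := is_derive1_ln u0.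
apply: cderat_eq (cderat_comp (cder_cexp w (ln u)) dl).
rewrite mulrCA; congr (_ * _).
rewrite cpowD ?lt0r_neq0// cpowN ?lt0r_neq0// cpow_s1 ?ltW// cpowE ?lt0r_neq0//.
by rewrite mulrC; congr (_ * _); rewrite fmorphV.
Qed.

Lemma cFTC2 (F f : R -> C) (a b : R) : a < b ->
  (forall u, a <= u <= b -> cderat F (f u) u) ->
  (forall u, a <= u <= b -> exists l, cderat f l u) ->
  cintegral mu `[a, b] f = F b - F a.
Proof.
move=> ab dF df.
have c1 : {within `[a, b], continuous (fun u => Re (f u))}.
  apply: continuous_in_subspaceT => u; rewrite inE/= in_itv/= => /df[l].
  by move=> /cderat_continuous[].
have c2 : {within `[a, b], continuous (fun u => Im (f u))}.
  apply: continuous_in_subspaceT => u; rewrite inE/= in_itv/= => /df[l].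
  by move=> /cderat_continuous[].
have d1 u : a <= u <= b -> is_derive u 1 (fun y => Re (F y)) (Re (f u)).
  by move=> /dF[].
have d2 u : a <= u <= b -> is_derive u 1 (fun y => Im (F y)) (Im (f u)).
  by move=> /dF[].
have h1 := FTC2_is_derive ab d1 c1; have h2 := FTC2_is_derive ab d2 c2.
by apply: complex_eqP; rewrite ?ReB ?ImB /cintegral /= /Rintegral ?h1 ?h2.
Qed.

Definition pdens w u : C := (\1_(`]0, 1]%classic : set R) u)%:C * cpow u (w - 1).

Lemma cmeasurable_pdens w : cmeasurable (pdens w).
Proof.
apply: cmeasurableM; first by apply: cmeasurable_real; exact: measurable_indic.
by apply: cmeasurable_cpow; exact: measurable_id.
Qed.

Lemma pdens_le w u : normc (pdens w u) <= jfun (Re w) u.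
Proof.
rewrite /pdens indicE; case: (boolP (u \in _)) => [|_]; last by rewrite mul0r normc0 jfun_ge0.
rewrite inE/= in_itv/= => /andP[u0 u1]; rewrite mul1r normc_cpow//.
rewrite ReB; apply: (@le_trans _ _ (jhalf (Re w) u)).
  rewrite /jhalf indicE mem_set/= ?in_itv/= ?u0// mulr1 lerDl.
  by rewrite mulr_ge0 ?invr_ge0 ?sqr_ge0// indicE.
by rewrite lerDl jhalf_ge0.
Qed.

Lemma integrable_Bjfun (B s : R) : 0 < s ->
  mu.-integrable setT (EFin \o (fun u => B * jfun s u)).
Proof.
move=> s0; have := @integrable_lin2 R _ _ mu setT measurableT B 0 _ _
  (integrable_jfun s0) (integrable_jfun s0).
by under eq_fun do rewrite mul0r addr0.
Qed.

Lemma pdens_le_bounded w (q : R -> C) (B : R) :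
  (forall u, normc (q u) <= B) ->
  forall u, normc (pdens w u * q u) <= B * jfun (Re w) u.
Proof.
move=> qB u; rewrite normcM mulrC; apply: ler_pM; rewrite ?normc_ge0//.
exact: pdens_le.
Qed.

Lemma cintegrable_pdens w (q : R -> C) (B : R) : 0 < Re w -> cmeasurable q ->
  (forall u, normc (q u) <= B) -> cintegrable mu setT (fun u => pdens w u * q u).
Proof.
move=> w0 mq qB.
apply: (@cintegrable_le _ _ _ mu setT measurableT _ _ _
  (fun u _ => pdens_le_bounded w qB u)); last exact: integrable_Bjfun.
by apply: cmeasurableM => //; exact: cmeasurable_pdens.
Qed.

Lemma normc_cintegral_pdens w : 0 < Re w -> exists J : R, 0 <= J /\
  forall (q : R -> C) (B : R), cmeasurable q -> (forall u, normc (q u) <= B) ->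
    normc (cintegral mu setT (fun u => pdens w u * q u)) <= J * B.
Proof.
move=> w0; exists (2 * Rintegral mu setT (jfun (Re w))); split.
  by rewrite mulr_ge0//; apply: Rintegral_ge0 => u _; exact: jfun_ge0.
move=> q B mq qB.
have := normc_cintegral_le measurableT (cintegrable_pdens w0 mq qB)
  (integrable_Bjfun B w0) (fun u _ => pdens_le_bounded w qB u).
rewrite RintegralZl//; last exact: integrable_jfun.
by rewrite [B * _]mulrC mulrA.
Qed.

Definition av w (g : R -> C) x : C :=
  cintegral mu setT (fun u => pdens w u * g (x * u)).

Lemma schwartz_bounded g : exists B : R, 0 <= B /\ forall x, normc (g x) <= B.
Proof.
have [B [B0 hB]] := schwartz_bound g 0 0; exists B; split => // x.
by have := hB x; rewrite expr0 mul1r cderiv0.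
Qed.

Lemma cmeasurable_schwartz_scale g x : cmeasurable (fun u => g (x * u)).
Proof.
have := schwartz_cder g 0; rewrite cderiv0 => d.
have h (u : R) : is_derive u 1 (fun u => x * u) x.
  by have := is_derive_affine x 0 u; under eq_fun do rewrite addr0.
have [h1 h2] := cder_continuous (cder_comp d h).
exact: continuous_cmeasurable.
Qed.

Lemma av_integrable w g x : 0 < Re w ->
  cintegrable mu setT (fun u => pdens w u * g (x * u)).
Proof.
move=> w0; have [B [B0 hB]] := schwartz_bounded g.
apply: (cintegrable_pdens (B := B)) => //.
exact: cmeasurable_schwartz_scale.
Qed.

Lemma av_bounded w g : 0 < Re w -> exists M : R, 0 <= M /\
  forall x, normc (av w g x) <= M.
Proof.
move=> w0; have [B [B0 hB]] := schwartz_bounded g.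
have [J [J0 hJ]] := normc_cintegral_pdens w0.
exists (J * B); split; first exact: mulr_ge0.
by move=> x; apply: hJ => //; exact: cmeasurable_schwartz_scale.
Qed.

Lemma pdensS w u : pdens (w + 1) u = pdens w u * u%:C.
Proof.
rewrite /pdens indicE; case: (boolP (u \in _)) => [|_]; last by rewrite !mul0r.
rewrite inE/= in_itv/= => /andP[u0 _]; rewrite !mul1r.
have -> : w + 1 - 1 = (w - 1) + 1 by rewrite addrK subrK.
by rewrite cpowD ?lt0r_neq0// cpow_s1// ltW.
Qed.

Lemma Re_gt0S w : 0 < Re w -> 0 < Re (w + 1).
Proof. by move=> w0; rewrite ReD /= addr_gt0. Qed.

Lemma av_stheta w g x : 0 < Re w ->
  av w (stheta g) x = x%:C * av (w + 1) (sderiv g) x.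
Proof.
move=> w0; rewrite /av -cintegralZ//; last exact: av_integrable (Re_gt0S w0).
apply: cintegral_ext => u _; rewrite pdensS /=.
by rewrite [(x * u)%:C]rmorphM /=; ring.
Qed.

(** The chain rule for g(xu) in x produces a factor u, which raises w by 1 in the density.
    Differentiation under the integral is justified by a Taylor bound in x that is uniform for u in
    (0, 1]. *)
Lemma av_cder w g : 0 < Re w -> cder (av w g) (av (w + 1) (sderiv g)).
Proof.
move=> w0 x.
have [B [B0 hB]] := schwartz_bound g 0 2.
have [J [J0 hJ]] := normc_cintegral_pdens w0.
have key h : `|h| <= 1 -> normc (av w g (x + h) - av w g x -
    h%:C * av (w + 1) (sderiv g) x) <= J * (2 * B) * h ^+ 2.
  move=> h1.
  (* The remainder is cut off where [pdens] vanishes anyway; on (0, 1] it is bounded by a multiple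
     of h^2, hence now everywhere. *)
  pose q u := if u \in (`]0, 1]%classic : set R) then g ((x + h) * u) - g (x * u) - (h * u)%:C * sderiv g (x * u) else 0.
  have -> : av w g (x + h) - av w g x - h%:C * av (w + 1) (sderiv g) x =
      cintegral mu setT (fun u => pdens w u * q u).
    rewrite /av -cintegralB//; [|exact: av_integrable|exact: av_integrable].
    have i1 := av_integrable (sderiv g) x (Re_gt0S w0).
    rewrite -cintegralZ// -cintegralB//; last 2 first.
    - by apply: cintegrableB => //; exact: av_integrable.
    - exact: cintegrableZ.
    apply: cintegral_ext => u _; rewrite pdensS /q /pdens indicE; case: (boolP (u \in _)) => _.
      by rewrite rmorphM /= mul1r; ring.
    by rewrite !mul0r mulr0 !subr0.
  rewrite -mulrA; apply: hJ.
    have -> : q = fun u => (\1_(`]0, 1]%classic : set R) u)%:C *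
        (g ((x + h) * u) + (-1) * g (x * u) + (-1) * ((h * u)%:C * sderiv g (x * u))).
      apply/funext => u; rewrite /q indicE; case: (boolP (u \in _)) => _; last by rewrite mul0r.
      by rewrite mul1r !mulN1r.
    apply: cmeasurableM; first by apply: cmeasurable_real; exact: measurable_indic.
    apply: cmeasurableD; first apply: cmeasurableD.
    - exact: cmeasurable_schwartz_scale.
    - apply: cmeasurableM; first exact: cmeasurable_cst.
      exact: cmeasurable_schwartz_scale.
    - apply: cmeasurableM; first exact: cmeasurable_cst.
      apply: cmeasurableM; last exact: cmeasurable_schwartz_scale.
      by apply: cmeasurable_real; exact: measurable_funM.
  move=> u; rewrite /q; case: ifPn => [|_]; last by rewrite normc0 mulr_ge0 ?sqr_ge0// mulr_ge0.
  rewrite inE/= in_itv/= => /andP[u0 u1].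
  have d1 := cder_affine u (x * u) (schwartz_cder g 0).
  have d2 := cderZ u%:C (cder_affine u (x * u) (schwartz_cder g 1)).
  have cE : g ((x + h) * u) - g (x * u) - (h * u)%:C * sderiv g (x * u) =
      cderiv 0 g (u * h + x * u) - cderiv 0 g (u * 0 + x * u) -
      h%:C * (u%:C * cderiv 1 g (u * 0 + x * u)).
    by rewrite cderiv0 mulr0 add0r mulrDl [x * u + _]addrC [u * h]mulrC rmorphM /= mulrA.
  have b2 y : normc (u%:C * (u%:C * cderiv 2 g (u * y + x * u))) <= B.
    rewrite !normcM normc_real gtr0_norm// mulrA.
    apply: (@le_trans _ _ (1 * normc (cderiv 2 g (u * y + x * u)))).
      apply: ler_wpM2r; first exact: normc_ge0.
      by rewrite -[leRHS]mulr1; apply: ler_pM => //; exact: ltW.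
    by have := hB (u * y + x * u); rewrite expr0.
  rewrite cE; apply: (le_trans (normc_le_ReIm _)).
  rewrite [2 * B]mulr_natl mulr2n mulrDl; apply: lerD.
    rewrite 2!ReB ReMl.
    apply: (@taylor2 _ (fun y => Re (cderiv 0 g (u * y + x * u)))
      (fun y => Re (u%:C * cderiv 1 g (u * y + x * u)))
      (fun y => Re (u%:C * (u%:C * cderiv 2 g (u * y + x * u)))) B) => //.
    - by move=> y; have [] := d1 y.
    - by move=> y; have [] := d2 y.
    - by move=> y _; exact: le_trans (normc_Re _) (b2 y).
  rewrite 2!ImB ImMl.
  apply: (@taylor2 _ (fun y => Im (cderiv 0 g (u * y + x * u)))
    (fun y => Im (u%:C * cderiv 1 g (u * y + x * u)))
    (fun y => Im (u%:C * (u%:C * cderiv 2 g (u * y + x * u)))) B) => //.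
  - by move=> y; have [] := d1 y.
  - by move=> y; have [] := d2 y.
  - by move=> y _; exact: le_trans (normc_Im _) (b2 y).
split; apply: is_derive_quadratic => h h1; apply: le_trans (key h h1).
  by rewrite -ReMl -!ReB; exact: normc_Re.
by rewrite -ImMl -!ImB; exact: normc_Im.
Qed.

Lemma cvg_eventually (u : nat -> R) n0 l :
  (forall n, (n0 <= n)%N -> u n = l) -> u n @[n --> \oo] --> l.
Proof.
move=> h; apply/cvgrPdist_le => e e0; exists n0 => // n /= /h ->.
by rewrite subrr normr0 ltW.
Qed.

(* The integrand is the derivative of u^w g(xu). *)
Lemma av_euler w g x : 0 < Re w ->
  x%:C * av (w + 1) (sderiv g) x + w * av w g x = g x.
Proof.
move=> w0; have i0 := av_integrable g x w0.
have i1 := av_integrable (stheta g) x w0.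
rewrite -av_stheta// /av -cintegralZ// -cintegralD//; last exact: cintegrableZ.
pose g2 : schwartz R := stheta g + w *: g.
pose f u := cexp ((w - 1) * (ln u)%:C) * g2 (x * u).
pose A (n : nat) : set R := `[(n.+2%:R : R)^-1, 1]%classic.
pose fn n u := (\1_(A n) u)%:C * (cpow u (w - 1) * g2 (x * u)).
have an n : 0 < (n.+2%:R : R)^-1 < 1.
  by rewrite invr_gt0 ltr0n invf_lt1 ?ltr0n// ltr1n.
have dS (h : schwartz R) (u : R) : cderat (fun u => h (x * u)) (x%:C * sderiv h (x * u)) u.
  have hx : is_derive u 1 (fun u => x * u) x.
    by have := is_derive_affine x 0 u; under eq_fun do rewrite addr0.
  have := schwartz_cder h 0 (x * u); rewrite cderiv0 => d.
  exact: (cderat_comp d hx).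
have FE n : cintegral mu setT (fn n) =
    g x - cpow (n.+2%:R^-1) w * g (x * n.+2%:R^-1).
  have [a0 a1] := andP (an n).
  transitivity (cintegral mu (A n) f).
    have -> : cintegral mu (A n) f = cintegral mu (A n) (fun u => cpow u (w - 1) * g2 (x * u)).
      apply: cintegral_ext => u; rewrite /A /= in_itv/= => /andP[au _].
      by rewrite /f cpowE// lt0r_neq0// (lt_le_trans a0).
    apply: complex_eqP; rewrite /cintegral /= [RHS]Rintegral_mkcond;
      apply: eq_Rintegral => u _; rewrite patchE /fn indicE;
      by case: ifPn => _; rewrite ?mul1r ?mul0r.
  rewrite /A (@cFTC2 (fun u => cexp (w * (ln u)%:C) * g (x * u)) f) //.
  - by rewrite ln1 mulr0 cexp0 mul1r mulr1 cpowE// lt0r_neq0.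
  - move=> u /andP[au _]; have u0 : 0 < u by exact: lt_le_trans au.
    apply: cderat_eq (cderatM (cderat_lnpow w u0) (dS g u)).
    have uE : cexp (w * (ln u)%:C) = cexp ((w - 1) * (ln u)%:C) * u%:C.
      by rewrite -{1}(subrK 1 w) mulrDl cexpD mul1r cexp_real lnK.
    rewrite /f /g2 uE cpowE ?lt0r_neq0//.
    rewrite -[(stheta g + w *: g) _]/(stheta g (x * u) + w * g (x * u)) /=.
    by rewrite rmorphM /=; ring.
  - move=> u /andP[au _]; have u0 : 0 < u by exact: lt_le_trans au.
    eexists; exact: (cderatM (cderat_lnpow (w - 1) u0) (dS g2 u)).
have c1 : ccvg (fun n => cintegral mu setT (fn n))
    (cintegral mu setT (fun u => pdens w u * g2 (x * u))).
  have [B [B0 hB]] := schwartz_bounded g2.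
  apply: (@cintegral_dominated_cvg _ _ _ mu setT measurableT _ _ (fun u => B * jfun (Re w) u)).
  - move=> n; apply: cmeasurableM.
      by apply: cmeasurable_real; apply: measurable_indic; exact: measurable_itv.
    apply: cmeasurableM; last exact: cmeasurable_schwartz_scale.
    by apply: cmeasurable_cpow; exact: measurable_id.
  - by apply: cmeasurableM; [exact: cmeasurable_pdens|exact: cmeasurable_schwartz_scale].
  - apply: nearW => u _; rewrite /fn /pdens; under eq_fun do rewrite mulrA.
    apply: ccvgM; last exact: ccvg_cst.
    apply: ccvgM; last exact: ccvg_cst.
    suff h : (\1_(A n) u : R) @[n --> \oo] --> (\1_(`]0, 1]%classic : set R) u : R).
      by split => //; exact: cvg_cst.
    have [u01|u01] := boolP (u \in (`]0, 1]%classic : set R)).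
      have := u01; rewrite inE/= in_itv/= => /andP[u0 u1].
      apply: (@cvg_eventually _ (Num.trunc (u : R)^-1)) => n hn.
      rewrite [RHS]indicE u01 indicE mem_set// /A /= in_itv/= u1 andbT.
      rewrite invf_ple ?posrE//; apply: (le_trans (ltW (truncnS_gt _))).
      by rewrite ler_nat ltnS (leq_trans hn).
    apply: (@cvg_eventually _ 0%N) => n _; rewrite [RHS]indicE (negPf u01).
    rewrite indicE memNset// /A /= in_itv/= => /andP[nu u1].
    move/negP: u01; apply; rewrite inE/= in_itv/= u1 andbT.
    by apply: lt_le_trans nu; rewrite invr_gt0.
  - exact: integrable_Bjfun.
  - apply: nearW => u _ n; apply: le_trans (pdens_le_bounded w (q := fun u => g2 (x * u)) _ u).
      rewrite /fn /pdens mulrA !normcM; apply: ler_wpM2r; first exact: normc_ge0.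
      apply: ler_wpM2r; first exact: normc_ge0.
      rewrite !normc_real !indicE; case: (boolP (u \in A n)); last by rewrite normr0.
      rewrite inE /A /= in_itv/= => /andP[nu u1].
      suff -> : u \in (`]0, 1]%classic : set R) by [].
      rewrite inE/= in_itv/= u1 andbT.
      by apply: lt_le_trans nu; rewrite invr_gt0.
    by move=> v; exact: hB.
have c2 : ccvg (fun n => cintegral mu setT (fn n)) (g x).
  rewrite (_ : (fun n => _) = fun n => g x - cpow (n.+2%:R^-1) w * g (x * n.+2%:R^-1)); last first.
    by apply/funext => n; exact: FE.
  apply/ccvg_normc.
  have [B [B0 hB]] := schwartz_bounded g.
  have h0 : B * (n.+2%:R^-1 `^ (Re w)) @[n --> \oo] --> (0 : R).
    rewrite -(mulr0 B); apply: cvgMr.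
    have /cvg_at_rightP/(_ (fun n => n.+2%:R^-1)) := powR_cvg0 w0; apply.
    split; first by move=> n; rewrite invr_gt0.
    have h : (n.+1%:R^-1 : R) @[n --> \oo] --> (0 : R) := @cvg_harmonic R.
    by rewrite -(cvg_shiftS (fun n => n.+1%:R^-1 : R)) in h.
  apply: (@squeeze_cvgr _ _ _ _ (fun=> 0) (fun n => B * (n.+2%:R^-1 `^ (Re w)))) => //; last exact: cvg_cst.
  apply: nearW => n; rewrite normc_ge0 /= addrC addKr normcN normcM mulrC.
  apply: ler_pM; rewrite ?normc_ge0//.
  by rewrite normc_cpow// invr_gt0.
rewrite -(ccvg_unique c1 c2).
apply: cintegral_ext => u _.
by rewrite -[g2 _]/(stheta g (x * u) + w * g (x * u)) mulrDr [w * (_ * _)]mulrCA.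
Unshelve. all: by end_near. Qed.

Lemma Re_addn w n : Re (w + n%:R) = Re w + n%:R.
Proof. by rewrite ReD Re_nat. Qed.

(** The k-th derivative is the average of the k-th derivative of g with w + k. It is bounded for |x|
    <= 1, and for |x| >= 1 the identity [av_euler] expresses x times the next derivative through the
    current one and g, so decay of the average itself propagates to all derivatives. *)
Lemma is_schwartz_av w g : 0 < Re w ->
  (forall j : nat, exists M : R, forall x, 1 <= `|x| ->
     `|x| ^+ j * normc (av w g x) <= M) ->
  is_schwartz (av w g).
Proof.
move=> w0 hdec.
pose gk k := iter k (@sderiv R) g.
pose F k := av (w + k%:R) (gk k).
have wk k : 0 < Re (w + k%:R) by rewrite Re_addn ltr_wpDr.
have FS k x : x%:C * F k.+1 x + (w + k%:R) * F k x = gk k x.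
  by rewrite /F -natr1 addrA; exact: av_euler.
have -> : av w g = F 0%N by rewrite /F addr0.
apply: is_schwartz_family => [k|j k].
  by rewrite {2}/F -natr1 addrA; exact: av_cder.
suff [M hM] : exists M : R, forall x, 1 <= `|x| -> `|x| ^+ j * normc (F k x) <= M.
  have [M' [M'0 hM']] := av_bounded (gk k) (wk k).
  exists (Num.max M M') => x; rewrite le_max.
  have [x1|/ltW x1] := leP 1 `|x|; first by rewrite hM.
  apply/orP; right; rewrite -[leRHS]mul1r; apply: ler_pM; rewrite ?normc_ge0 ?hM'//.
  exact: exprn_ile1.
elim: k j => [|k IH] j.
  by have [M hM] := hdec j; exists M; rewrite /F addr0.
have [M hM] := IH j.
have [B [B0 hB]] := schwartz_bound (gk k) j 0.
exists (B + normc (w + k%:R) * M) => x x1.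
have x0 : x != 0 by apply: contraTneq x1 => ->; rewrite normr0 ler10.
have -> : F k.+1 x = x^-1%:C * (gk k x - (w + k%:R) * F k x).
  rewrite -FS addrK mulrA -rmorphM /= mulVf// rmorph1 mul1r//.
rewrite normcM normc_real normfV mulrCA.
apply: (@le_trans _ _ (1 * (`|x| ^+ j * normc (gk k x - (w + k%:R) * F k x)))).
  apply: ler_wpM2r; first by rewrite mulr_ge0 ?exprn_ge0 ?normc_ge0.
  by rewrite invf_le1// (lt_le_trans ltr01).
rewrite mul1r; apply: (@le_trans _ _ (`|x| ^+ j * (normc (gk k x) + normc (w + k%:R) * normc (F k x)))).
  apply: ler_wpM2l; first exact: exprn_ge0.
  by apply: (le_trans (normcD _ _)); rewrite normcN normcM.
rewrite mulrDr; apply: lerD; first by have := hB x; rewrite cderiv0.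
by rewrite mulrCA; apply: ler_wpM2l; [exact: normc_ge0|exact: hM].
Qed.

Lemma cder0_cst (f : R -> C) : cder f (fun=> 0) -> forall x, f x = f 0.
Proof.
move=> h x; apply: complex_eqP.
  by apply: (@is_derive_0_is_cst _ (fun y => Re (f y))) => y; have [] := h y.
by apply: (@is_derive_0_is_cst _ (fun y => Im (f y))) => y; have [] := h y.
Qed.

(** The quotient f(x) / x is the integral of f'(xu) over u in (0, 1], that is the radial average
    with w = 1. By [av_euler], x times this average has derivative f', and both functions vanish at
    0. The decay of f gives that of the quotient. *)
Lemma hadamard f : f 0 = 0 -> exists g, f = smulx g.
Proof.
move=> f0; have r1 : 0 < Re (1 : C) by [].
pose h := av 1 (sderiv f).
have hE x : x%:C * h x = f x.
  have d1 : cder (fun x => x%:C * h x) (fun x => (1 : R)%:C * h x + x%:C * av (1 + 1) (sderiv (sderiv f)) x).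
    by apply: cder_rmul => //; exact: av_cder.
  have d2 := cderZ (-1) (schwartz_cder f 0).
  have d : cder (fun x => x%:C * h x + -1 * cderiv 0 f x) (fun=> 0).
    apply: cder_eq (cderD d1 d2) => // y.
    by rewrite addrC [_%:C * _ + _]addrC -[1%:C]/(1 : C) av_euler// mulN1r addNr.
  have := cder0_cst d x; rewrite !cderiv0 f0 mulr0 mul0r addr0 mulN1r => /eqP.
  by rewrite subr_eq0 => /eqP.
have sh : is_schwartz h.
  apply: is_schwartz_av => // j.
  have [B [B0 hB]] := schwartz_bound f j 0.
  exists B => x x1; apply: le_trans (hB x); rewrite cderiv0 -hE normcM normc_real.
  apply: ler_wpM2l; first exact: exprn_ge0.
  by rewrite ler_peMl// normc_ge0.
by exists (mkS sh); apply: schwartz_eqP => x /=; rewrite hE.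
Qed.

Lemma normc_av_parity w g (k : bool) x : 0 < Re w -> (forall x, g (- x) = (-1) ^+ k * g x) ->
  normc (av w g (- x)) = normc (av w g x).
Proof.
move=> w0 gk; have -> : av w g (- x) = (-1) ^+ k * av w g x.
  rewrite /av -cintegralZ//; last exact: av_integrable.
  by apply: cintegral_ext => u _; rewrite mulNr gk mulrCA.
by rewrite normcM normcX normcN normc1 expr1n mul1r.
Qed.

(** The density usually written x_+^(w-1). The substitution v = xu carries [pdens] to its
    restriction to (0, x], up to the factor x^(1-w). *)
Definition hdens w u : C := (\1_(`]0, +oo[%classic : set R) u)%:C * cpow u (w - 1).

Lemma hdens_pdens w (x v : R) : 0 < x ->
  pdens w (x^-1 * v) = (\1_(`]0, x]%classic : set R) v)%:C * (cpow x (1 - w) * hdens w v).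
Proof.
move=> x0; rewrite /pdens /hdens !indicE.
have -> : (x^-1 * v \in (`]0, 1]%classic : set R)) = (v \in (`]0, x]%classic : set R)).
  apply/idP/idP; rewrite !inE/= !in_itv/= pmulr_rgt0 ?invr_gt0// mulrC;
    by rewrite ler_pdivrMr// mul1r.
case: (boolP (v \in `]0, x]%classic)); rewrite ?mul0r// inE/= in_itv/= => /andP[v0 vx].
rewrite mem_set/= ?in_itv/= ?v0// !mul1r cpowMl ?invr_gt0// cpowV//.
by rewrite -opprB cpowN ?invrK// lt0r_neq0.
Qed.

Lemma hdens_delta k w u : delta_density k w u = hdens w u + (-1) ^+ k * hdens w (- u).
Proof.
rewrite /delta_density /hdens !indicE.
have [u0|u0|->] := ltgtP u 0.
- rewrite memNset/= ?in_itv/= ?andbT ?lt_asym ?u0//=; last by apply/negP; rewrite -leNgt ltW.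
  rewrite mem_set/= ?in_itv/= ?andbT ?oppr_gt0// mul0r add0r mul1r ltr0_norm//.
  by rewrite -[in sgnpow _ _](opprK u) sgnpowN sgnpow_pos ?oppr_gt0// mulr1.
- rewrite mem_set/= ?in_itv/= ?andbT// memNset/=; last first.
    by rewrite in_itv/= andbT oppr_gt0; apply/negP; rewrite -leNgt ltW.
  by rewrite mul1r !mul0r mulr0 addr0 gtr0_norm// sgnpow_pos// mul1r.
- by rewrite normr0 oppr0 cpow0 !mulr0 addr0.
Qed.

Lemma hdens_le w g n B : 0 < Re w -> sbounded n B g ->
  ((Num.trunc (Re w)).+2 <= n)%N ->
  forall u, normc (hdens w u * g u) <= B * jfun (Re w) u.
Proof.
move=> w0 hB hn u; have B0 := sbounded_ge0 hB.
rewrite /hdens indicE; case: (boolP (u \in _)) => [|_]; last first.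
  by rewrite !mul0r normc0 mulr_ge0// jfun_ge0.
rewrite inE/= in_itv/= andbT => u0; rewrite mul1r normcM normc_cpow// ReB.
have := @jfun_ge R (Re w) u (normc (g u)) B (lt0r_neq0 u0) (normc_ge0 _).
rewrite gtr0_norm//; apply.
  by have := hB 0%N 0%N u isT isT; rewrite expr0 mul1r cderiv0.
by have := hB _ 0%N u hn isT; rewrite cderiv0 mulrC gtr0_norm.
Qed.

Lemma cmeasurable_hdens w : cmeasurable (hdens w).
Proof.
apply: cmeasurableM; first by apply: cmeasurable_real; exact: measurable_indic.
by apply: cmeasurable_cpow; exact: measurable_id.
Qed.

Lemma hdens_integrable w g : 0 < Re w ->
  cintegrable mu setT (fun u => hdens w u * g u).
Proof.
move=> w0; have [B [B0 hB]] := sbounded_ex (Num.trunc (Re w)).+2 g.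
apply: (@cintegrable_le _ _ _ mu setT measurableT _ _ _
  (fun u _ => hdens_le w0 hB (leqnn _) u)); last exact: integrable_Bjfun.
by apply: cmeasurableM; [exact: cmeasurable_hdens|exact: cmeasurable_schwartz].
Qed.

Lemma sdelta_hdens (k : bool) w g : 0 < Re w -> (forall x, g (- x) = (-1) ^+ k * g x) ->
  sdelta k w g = 2%:R * cintegral mu setT (fun u => hdens w u * g u).
Proof.
move=> w0 gk; have i1 := hdens_integrable g w0.
have N1 : (-1 : R) != 0 by rewrite oppr_eq0 oner_eq0.
have i2 := cintegrable_affine 0 N1 i1.
rewrite mulr_natl mulr2n {2}(cintegral_affine 0 N1 i1) normrN1 mul1r -cintegralD//.
apply: cintegral_ext => u _; rewrite addr0 mulN1r hdens_delta gk mulrDl.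
by congr (_ + _); rewrite -mulrA mulrCA.
Qed.

(* When the moment of g vanishes, the integral over (0, x] is minus the integral
   over (x, oo), which gives the decay. *)
Lemma av_decay w g (k : bool) : 0 < Re w -> (forall x, g (- x) = (-1) ^+ k * g x) ->
  sdelta k w g = 0 ->
  forall j : nat, exists M : R, forall x, 1 <= `|x| -> `|x| ^+ j * normc (av w g x) <= M.
Proof.
move=> w0 gk dg j.
have z : cintegral mu setT (fun u => hdens w u * g u) = 0.
  move/eqP: dg; rewrite (sdelta_hdens w0 gk) mulf_eq0 => /orP[|/eqP//].
  by rewrite pnatr_eq0.
pose gj := iter j (@smulx R) g.
have gjE x : gj x = x%:C ^+ j * g x.
  rewrite /gj; elim: (j) => [|i IH]; first by rewrite expr0 mul1r.
  by rewrite /= IH exprS mulrA.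
have [B [B0 hB]] := sbounded_ex (Num.trunc (Re w)).+2 gj.
pose I := Rintegral mu setT (fun u => B * jfun (Re w) u).
have I0 : 0 <= I by apply: Rintegral_ge0 => u _; rewrite mulr_ge0// jfun_ge0.
exists (2 * I).
suff pos x : 1 <= x -> `|x| ^+ j * normc (av w g x) <= 2 * I.
  move=> x; have [x0|x0] := leP 0 x.
    by move=> x1; apply: pos; rewrite ger0_norm in x1.
  move=> x1; have := pos (- x); rewrite (normc_av_parity _ w0 gk) normrN; apply.
  by rewrite ltr0_norm in x1.
move=> x1; have x0 : 0 < x by exact: lt_le_trans x1.
have ix0 : x^-1 != 0 by rewrite invr_neq0 ?lt0r_neq0.
have i1 := av_integrable g x w0.
have i2 : cintegrable mu setT (fun v => (\1_(`]0, x]%classic : set R) v)%:C * (hdens w v * g v)).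
  apply: (@cintegrable_le _ _ _ mu setT measurableT _ (fun v => normc (hdens w v * g v))).
  - apply: cmeasurableM; first by apply: cmeasurable_real; exact: measurable_indic.
    by apply: cmeasurableM; [exact: cmeasurable_hdens|exact: cmeasurable_schwartz].
  - move=> v _; rewrite normcM normc_real indicE; case: (boolP (v \in _)) => _.
      by rewrite normr1 mul1r.
    by rewrite normr0 mul0r normc_ge0.
  - have [B' [B'0 hB']] := sbounded_ex (Num.trunc (Re w)).+2 g.
    apply: (le_integrable measurableT _ _ (integrable_Bjfun B' w0)).
      apply/measurable_EFinP; apply: measurable_normc.
      by apply: cmeasurableM; [exact: cmeasurable_hdens|exact: cmeasurable_schwartz].
    move=> v _ /=; rewrite lee_fin ger0_norm ?normc_ge0//.
    exact: le_trans (hdens_le w0 hB' (leqnn _) v) (ler_norm _).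
have E : av w g x = x^-1%:C * (cpow x (1 - w) *
    cintegral mu setT (fun v => (\1_(`]0, x]%classic : set R) v)%:C * (hdens w v * g v))).
  rewrite /av (cintegral_affine 0 ix0 i1) gtr0_norm ?invr_gt0//; congr (_ * _).
  rewrite -cintegralZ//; apply: cintegral_ext => v _.
  by rewrite addr0 hdens_pdens// mulVKf ?lt0r_neq0//; ring.
pose t v : C := (\1_(`]x, +oo[%classic : set R) v)%:C * (hdens w v * g v).
have tE v : (\1_(`]0, x]%classic : set R) v)%:C * (hdens w v * g v) = hdens w v * g v - t v.
  rewrite /t /hdens !indicE !mem_setE !in_itv/= !andbT.
  have [v0|v0] := leP v 0; first by rewrite !mul0r !mulr0 subr0.
  have [vx|vx] := leP v x; first by rewrite !mul1r mul0r subr0.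
  by rewrite mul0r !mul1r subrr.
have tb v : `|x| ^+ j * normc (t v) <= B * jfun (Re w) v.
  rewrite /t indicE; case: (boolP (v \in _)); last first.
    by rewrite mul0r normc0 mulr0 mulr_ge0// jfun_ge0.
  rewrite inE/= in_itv/= andbT => xv; have v0 := lt_trans x0 xv; rewrite mul1r.
  apply: le_trans (hdens_le w0 hB (leqnn _) v); rewrite gjE.
  rewrite [hdens w v * (_ * _)]mulrCA [in leRHS]normcM normcX normc_real.
  apply: ler_wpM2r; first exact: normc_ge0.
  by apply: lerXn2r; rewrite ?nnegrE// !gtr0_norm// ltW.
have it : cintegrable mu setT t.
  have h := cintegrableB measurableT (hdens_integrable g w0) i2.
  apply: (cintegrable_ext measurableT _ h) => v _.
  by rewrite tE opprB addrC subrK.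
have -> := E; under [X in cintegral _ _ X]eq_fun do rewrite tE.
rewrite cintegralB//; last exact: hdens_integrable.
rewrite z sub0r mulrA normcM normcN.
(* The prefactor x^(-1) x^(1-w) has modulus x^(- Re w), which is at most 1 for x >= 1. *)
apply: (@le_trans _ _ (1 * (`|x| ^+ j * normc (cintegral mu setT t)))).
  rewrite mulrCA; apply: ler_wpM2r; first by rewrite mulr_ge0 ?exprn_ge0 ?normc_ge0.
  rewrite normcM normc_real normc_cpow// gtr0_norm ?invr_gt0// ReB /=.
  rewrite -(powR_inv1 (ltW x0)) -powRD; last by rewrite (gt_eqF x0) implybT.
  have -> : -1 + (1 - Re w) = - Re w by ring.
  by rewrite -[leRHS](powRr0 x); apply: ler_powR => //; rewrite oppr_le0 ltW.
rewrite mul1r.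
have := @normc_cintegral_le _ _ _ mu setT measurableT (fun v => (`|x| ^+ j)%:C * t v) (fun v => B * jfun (Re w) v).
rewrite cintegralZ// normcM normc_real (ger0_norm (exprn_ge0 j (normr_ge0 x))); apply.
- exact: cintegrableZ.
- exact: integrable_Bjfun.
- by move=> v _; rewrite normcM normc_real (ger0_norm (exprn_ge0 j (normr_ge0 x))).
Qed.

Lemma euler_solve w g (k : bool) : 0 < Re w -> (forall x, g (- x) = (-1) ^+ k * g x) ->
  sdelta k w g = 0 -> exists h : schwartz R, g = stheta h + w *: h.
Proof.
move=> w0 gk dg.
have sh := is_schwartz_av w0 (av_decay w0 gk dg).
exists (mkS sh); apply: schwartz_eqP => x.
rewrite -[RHS]/(x%:C * cderiv 1 (av w g) x + w * av w g x) -[LHS](av_euler g x w0).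
congr (_ * _ + _).
have d1 := schwartz_cder (mkS sh) 0; rewrite cderiv0 /= in d1.
exact: cder_unique (av_cder g w0) d1.
Qed.

End RadialAverage.

(** * Integrals of functions that agree almost everywhere *)

Section AlmostEverywhere.
Context {R : realType} {dT : measure_display} {T : measurableType dT}.
Local Notation C := R[i].
Variable mu : {measure set T -> \bar R}.

Lemma ae_and (P Q : T -> Prop) : {ae mu, forall x, P x} ->
  {ae mu, forall x, Q x} -> {ae mu, forall x, P x /\ Q x}.
Proof.
move=> [A [mA A0 PA]] [B [mB B0 QB]]; exists (A `|` B); split.
- exact: measurableU.
- by apply: (null_set_setU mA mB A0 B0).
- move=> x /not_andP[nP|nQ]; [left; exact: PA|right; exact: QB].
Qed.

Variables (D : set T) (mD : measurable D).

Lemma ae_cintegral (f1 f2 : T -> C) : cmeasurable f1 -> cmeasurable f2 ->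
  {ae mu, forall x, D x -> f1 x = f2 x} ->
  cintegral mu D f1 = cintegral mu D f2.
Proof.
move=> m1 m2 e.
apply: complex_eqP; rewrite /cintegral /= /Rintegral; congr fine;
    apply: ae_eq_integral => //.
- by apply/measurable_EFinP; apply: measurable_funTS; exact: m1.1.
- by apply/measurable_EFinP; apply: measurable_funTS; exact: m2.1.
- by apply: (ae_imp _ e) => x h /h /= ->.
- by apply/measurable_EFinP; apply: measurable_funTS; exact: m1.2.
- by apply/measurable_EFinP; apply: measurable_funTS; exact: m2.2.
- by apply: (ae_imp _ e) => x h /h /= ->.
Qed.

Lemma ae_cintegrable (f1 f2 : T -> C) : cmeasurable f2 ->
  {ae mu, forall x, D x -> f1 x = f2 x} ->
  cintegrable mu D f1 -> cintegrable mu D f2.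
Proof.
move=> m2 e.
have key (u1 u2 : T -> R) : measurable_fun setT u2 ->
    {ae mu, forall x, D x -> u1 x = u2 x} ->
    mu.-integrable D (EFin \o u1) -> mu.-integrable D (EFin \o u2).
  move=> mu2 eu /integrableP[mu1 iu1]; apply/integrableP.
  have mu2' : measurable_fun D (EFin \o u2).
    by apply/measurable_EFinP; exact: measurable_funTS.
  split=> //; rewrite -(@ae_eq_integral _ _ R mu D (fun x => `|(EFin \o u2) x|)%E
    (fun x => `|(EFin \o u1) x|)%E) //.
  - exact: measurableT_comp.
  - exact: measurableT_comp.
  - by apply: (ae_imp _ eu) => x h /h /= ->.
move=> [i1 i2]; split.
  by apply: key i1; [exact: m2.1|apply: (ae_imp _ e) => x h /h ->].
by apply: key i2; [exact: m2.2|apply: (ae_imp _ e) => x h /h ->].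
Qed.

End AlmostEverywhere.

(** * Homogeneous distributions of given parity form a line *)

Section Classification.
Context {R : realType}.
Local Notation C := R[i].
Local Notation mu := (@lebesgue_measure R).
Implicit Types (f g : schwartz R) (D : schwartz R -> C) (w : C) (k : bool).

Lemma tempered_comp (A : schwartz R -> schwartz R) D :
  (forall (a : C) f g, A (a *: f + g) = a *: A f + A g) ->
  (forall n, exists (m : nat) (c : R), 0 <= c /\
    forall f B, sbounded m B f -> sbounded n (c * B) (A f)) ->
  tempered D -> tempered (fun f => D (A f)).
Proof.
move=> linA bA /temperedP[sD [n [M [M0 hM]]]]; apply/temperedP; split.
  by move=> a f g /=; rewrite linA; exact: sD.
have [m [c [c0 hc]]] := bA n.
exists m, (M * c); split; first exact: mulr_ge0.
by move=> f B hB; rewrite -mulrA; apply: hM; exact: hc.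
Qed.

Lemma schwartz_linE (a : C) f g (x : R) : (a *: f + g : schwartz R) x = a * f x + g x.
Proof. by []. Qed.

Lemma smulx_lin (a : C) f g : smulx (a *: f + g) = a *: smulx f + smulx g.
Proof.
apply: schwartz_eqP => x; rewrite -[RHS]/(a * (x%:C * f x) + x%:C * g x).
by rewrite -[LHS]/(x%:C * (a * f x + g x)); ring.
Qed.

Lemma sderiv_lin (a : C) f g : sderiv (a *: f + g) = a *: sderiv f + sderiv g.
Proof.
apply: schwartz_eqP => x; rewrite -[RHS]/(a * cderiv 1 f x + cderiv 1 g x).
by rewrite -[LHS]/(cderiv 1 (a *: f + g : schwartz R) x) schwartzD_cderiv schwartzZ_cderiv.
Qed.

Lemma sneg_lin (a : C) f g : sneg (a *: f + g) = a *: sneg f + sneg g.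
Proof. by apply: schwartz_eqP => x; rewrite !schwartz_linE. Qed.

Lemma tempered_smulx D : tempered D -> tempered (fun f => D (smulx f)).
Proof.
apply: tempered_comp; first exact: smulx_lin.
move=> n; exists n.+1, (1 + n%:R); split; first by rewrite addr_ge0.
move=> f B hB j k x jn kn; have B0 := sbounded_ge0 hB.
rewrite cderiv_smulx; apply: (le_trans (ler_wpM2l (exprn_ge0 j (normr_ge0 x)) (normcD _ _))).
rewrite mulrDr mulrDl mul1r !normcM normc_real mulrA -exprSr; apply: lerD.
  by apply: hB => //; exact: leqW.
rewrite -(rmorph_nat (real_complex R)) normc_real normr_nat mulrCA.
apply: ler_pM => //; first by rewrite mulr_ge0 ?exprn_ge0 ?normc_ge0.
  by rewrite ler_nat.
apply: hB; first exact: leqW.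
by apply: (leq_trans (leq_pred _)); exact: leqW.
Qed.

Lemma tempered_sderiv D : tempered D -> tempered (fun f => D (sderiv f)).
Proof.
apply: tempered_comp; first exact: sderiv_lin.
move=> n; exists n.+1, 1; split => // f B hB j k x jn kn.
by rewrite cderiv_sderiv mul1r; apply: hB; [exact: leqW|rewrite ltnS].
Qed.

Lemma tempered_lin (a : C) D1 D2 : tempered D1 -> tempered D2 ->
  tempered (fun f => a * D1 f + D2 f).
Proof.
move=> /temperedP[s1 [n1 [M1 [M10 h1]]]] /temperedP[s2 [n2 [M2 [M20 h2]]]].
apply/temperedP; split.
  by move=> b f g /=; rewrite s1 s2; ring.
exists (maxn n1 n2), (normc a * M1 + M2); split.
  by rewrite addr_ge0 ?mulr_ge0 ?normc_ge0.
move=> f B hB; apply: (le_trans (normcD _ _)); rewrite normcM mulrDl -mulrA.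
apply: lerD.
  apply: ler_wpM2l; first exact: normc_ge0.
  by apply: h1; apply: sboundedW hB; rewrite ?leq_maxl.
by apply: h2; apply: sboundedW hB; rewrite ?leq_maxr.
Qed.

Lemma tempered_sneg D : tempered D -> tempered (fun f => D (sneg f)).
Proof.
apply: tempered_comp; first exact: sneg_lin.
move=> n; exists n, 1; split => // f B hB j k x jn kn.
rewrite cderiv_sneg normcM normc_real normrX normrN1 expr1n !mul1r -normrN.
exact: hB.
Qed.

Lemma sign_negb k : (-1) ^+ (~~ k) = - (-1) ^+ k :> C.
Proof. by case: k; rewrite ?expr0 ?expr1 ?opprK. Qed.

Lemma smulx_sdil f y : smulx (sdil f y) = (expR (- y))%:C *: sdil (smulx f) y.
Proof.
apply: schwartz_eqP => x; rewrite -[RHS]/(_ * sdil (smulx f) y x) /=.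
by rewrite mulrA -rmorphM /= mulrA -expRD addNr expR0 mul1r.
Qed.

Lemma sderiv_sdil f y : sderiv (sdil f y) = (expR y)%:C *: sdil (sderiv f) y.
Proof.
by apply: schwartz_eqP => x; rewrite [LHS]cderiv_sdil expr1.
Qed.

Lemma smulx_sneg f : smulx (sneg f) = (-1) *: sneg (smulx f).
Proof.
apply: schwartz_eqP => x; rewrite -[RHS]/(-1 * ((- x)%:C * f (- x))).
by rewrite -[LHS]/(x%:C * f (- x)) rmorphN /= mulN1r mulNr opprK.
Qed.

Lemma sderiv_sneg f : sderiv (sneg f) = (-1) *: sneg (sderiv f).
Proof.
apply: schwartz_eqP => x; rewrite [LHS]cderiv_sneg expr1.
by rewrite -[RHS]/(_ * sneg (sderiv f) x) rmorphN rmorph1.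
Qed.

Lemma homdist_smulx w k D : homdist w k D ->
  homdist (w + 1) (~~ k) (fun f => D (smulx f)).
Proof.
move=> [tD hD pD]; have [sD _] := tD; split; first exact: tempered_smulx.
  move=> y f; rewrite smulx_sdil scalar_scale// hD mulrA; congr (_ * _).
  by rewrite -cexp_real -cexpD; congr cexp; rewrite rmorphN /=; ring.
move=> f; rewrite smulx_sneg scalar_scale// pD sign_negb mulrA mulN1r.
by rewrite mulNr.
Qed.

Lemma homdist_sderiv w k D : homdist (w + 1) (~~ k) D ->
  homdist w k (fun f => D (sderiv f)).
Proof.
move=> [tD hD pD]; have [sD _] := tD; split; first exact: tempered_sderiv.
  move=> y f; rewrite sderiv_sdil scalar_scale// hD mulrA; congr (_ * _).
  by rewrite -cexp_real -cexpD; congr cexp; ring.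
move=> f; rewrite sderiv_sneg scalar_scale// pD sign_negb mulrA mulN1r.
by rewrite opprK.
Qed.

Lemma homdist_lin w k (a : C) D1 D2 : homdist w k D1 -> homdist w k D2 ->
  homdist w k (fun f => a * D1 f + D2 f).
Proof.
move=> [t1 h1 p1] [t2 h2 p2]; split; first exact: tempered_lin.
  by move=> y f; rewrite h1 h2; ring.
by move=> f; rewrite p1 p2; ring.
Qed.

Definition spart k f : schwartz R := 2%:R^-1 *: (f + (-1) ^+ k *: sneg f).

Lemma spart_parity k f (x : R) : spart k f (- x) = (-1) ^+ k * spart k f x.
Proof.
rewrite -[LHS]/(2%:R^-1 * (f (- x) + (-1) ^+ k * f (- - x))).
rewrite -[spart k f x]/(2%:R^-1 * (f x + (-1) ^+ k * f (- x))) opprK.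
by case: k; rewrite ?expr0 ?expr1; ring.
Qed.

Lemma parity_spart k D f : scalar D -> parity k D -> D (spart k f) = D f.
Proof.
move=> sD pD; rewrite /spart scalar_scale// scalar_add// scalar_scale// pD.
have -> : (-1) ^+ k * ((-1) ^+ k * D f) = D f.
  by case: k pD => _; rewrite ?expr0 ?expr1 ?mul1r ?mulN1r ?opprK.
by rewrite -mulr2n -[D f *+ 2]mulr_natl mulKf// pnatr_eq0.
Qed.

Lemma scalar_comb D (a b : C) f g : scalar D ->
  D (a *: f - b *: g) = a * D f - b * D g.
Proof. by move=> sD; rewrite (scalar_sub sD) !(scalar_scale sD). Qed.

(** For the parts of parity k of f and of a fixed f0 with nonzero moment, the combination g with
    vanishing moment is of the form x h' + w h, and Euler's equation says that D kills every such
    function. This makes D(f) proportional to the moment of f. *)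
Lemma homdist_pos w k D : 0 < Re w -> homdist w k D ->
  exists c, D = fun f => c * sdelta k w f.
Proof.
move=> w0 [tD hD pD]; have [f0 hf0] := sdelta_neq0 k w0.
have [tE _ pE] := homdist_sdelta k w0.
have [sD _] := tD; have [sE _] := tE.
exists (D (spart k f0) / sdelta k w f0); apply/funext => f.
pose g := sdelta k w f0 *: spart k f - sdelta k w f *: spart k f0.
have gp (x : R) : g (- x) = (-1) ^+ k * g x.
  rewrite -[LHS]/(sdelta k w f0 * spart k f (- x) - sdelta k w f * spart k f0 (- x)).
  rewrite -[g x]/(sdelta k w f0 * spart k f x - sdelta k w f * spart k f0 x).
  by rewrite !spart_parity; ring.
have g0 : sdelta k w g = 0.
  rewrite /g (scalar_comb _ _ _ _ sE) !(parity_spart _ sE pE).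
  by rewrite mulrC subrr.
have [h gh] := euler_solve w0 gp g0.
have : D g = 0.
  by rewrite gh scalar_add// scalar_scale// (hom_euler tD hD) mulNr addNr.
rewrite /g (scalar_comb _ _ _ _ sD) (parity_spart _ sD pD) => /eqP.
rewrite subr_eq0 => /eqP e.
by apply: (mulfI hf0); rewrite e; field.
Qed.

Lemma sgauss0 : sgauss (0 : R) = 1.
Proof. by rewrite /= /gauss_fun expr0n /= oppr0 expR0. Qed.

Lemma sneg_gauss : sneg (sgauss : schwartz R) = sgauss.
Proof. by apply: schwartz_eqP => x; rewrite /= /gauss_fun sqrrN. Qed.

(** The function f - f(0) times the Gaussian vanishes at 0, hence is a multiple of x by [hadamard].
    So D is a multiple of the Dirac mass. *)
Lemma smulx_kernel D : scalar D -> (forall f, D (smulx f) = 0) ->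
  forall f, D f = f 0 * D sgauss.
Proof.
move=> sD h f; have : (f - f 0 *: sgauss : schwartz R) 0 = 0.
  by rewrite -[LHS]/(f 0 - f 0 * sgauss 0) sgauss0 mulr1 subrr.
move=> /hadamard[g fg].
have := h g; rewrite -fg scalar_sub// scalar_scale// => /eqP.
by rewrite subr_eq0 => /eqP.
Qed.

(** Such a D is a nonzero multiple of the Dirac mass. On the Gaussian, x f' vanishes at 0, so
    Euler's equation gives w = 0; the Gaussian is even, so the parity is even. *)
Lemma homdist_smulx_eq0 w k D : homdist w k D -> (forall f, D (smulx f) = 0) ->
  (exists f, D f != 0) -> w = 0 /\ k = false.
Proof.
move=> [tD hD pD] h [f hf]; have [sD _] := tD.
have DE := smulx_kernel sD h.
have G0 : D sgauss != 0 by apply: contraNneq hf => e; rewrite DE e mulr0.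
split.
  have := hom_euler tD hD sgauss; rewrite DE.
  rewrite -[stheta sgauss 0]/((0 : R)%:C * sderiv sgauss 0) mul0r mul0r => /eqP.
  by rewrite eq_sym mulf_eq0 (negPf G0) orbF oppr_eq0 => /eqP.
have := pD sgauss; rewrite sneg_gauss; case: k pD => // _.
rewrite expr1 mulN1r => /eqP; rewrite -subr_eq0 opprK -mulr2n mulrn_eq0.
by rewrite (negPf G0).
Qed.

(** The integrand equals -2 |x| exp(-x^2) and is negative off 0. The value serves in the exceptional
    case w = 0 of [homdist_unique], where Euler's equation makes a multiple of it vanish. *)
Lemma sdelta_gauss_neq0 : sdelta true 1 (sderiv (sgauss : schwartz R)) != 0.
Proof.
have kd := @kernel_delta R true 1 ltr01.
have i := (kernel_integrable kd (sderiv sgauss)).1.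
apply/eqP => /(congr1 (fun z : C => Re z)) /=.
pose F (x : R) : R := 2 * `|x| * gauss_fun x.
have FE x : Re (delta_density true 1 x * sderiv sgauss x) = - F x.
  have [->|x0] := eqVneq x 0.
    by rewrite /delta_density normr0 cpow0 mulr0 mul0r /F normr0 mulr0 mul0r oppr0.
  rewrite /delta_density subrr cpow_s0 ?normr_eq0// mulr1 sderiv_gauss.
  have -> : sgnpow true x * (- 2%:R * (x%:C * sgauss x)) =
      (Num.sg x * (- 2%:R * (x * gauss_fun x)))%:C.
    by rewrite /sgnpow expr1 [sgauss x]/= !rmorphM rmorphN /= rmorph_nat.
  by rewrite /F normrEsg /=; ring.
have iF : mu.-integrable setT (EFin \o F).
  have -> : EFin \o F = -%E \o (EFin \o (fun x => Re (delta_density true 1 x * sderiv sgauss x))).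
    by apply/funext => x /=; rewrite FE opprK.
  exact: integrableN.
have F0 x : 0 <= F x by rewrite !mulr_ge0// gauss_fun_ge0.
rewrite /Rintegral; under eq_integral do rewrite FE.
move=> h; have : (\int[mu]_x (F x)%:E = 0)%E.
  have fi := integrable_fin_num measurableT iF.
  apply/eqP; rewrite -(fineK fi) eqe; apply/eqP.
  move: h; rewrite (_ : (fun x => _) = (fun x => (- (F x)%:E)%E)); last by apply/funext.
  rewrite integralN ?fineN ?oppr0; last first.
    by apply: integrable_add_def => //; exact: iF.
  by move=> /eqP; rewrite oppr_eq0 => /eqP.
have mF : measurable_fun setT (EFin \o F) by case/integrableP : iF.
have := @ae_eq_integral_abs _ _ R mu setT measurableT (EFin \o F) mF.
under eq_integral do rewrite /= ger0_norm ?F0//.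
move=> hiff h0; have /hiff ae0 := h0.
have : {ae mu, forall x : R, False}.
  apply: (@ae_imp _ _ _ _ (fun x => (setT x -> (EFin \o F) x = 0%E) /\ x != 0)).
    move=> x [/(_ Logic.I)/= /eqP]; rewrite eqe => /eqP.
    rewrite /F => /eqP; rewrite !mulf_eq0 pnatr_eq0 /= normr_eq0 => /orP[->//|].
    by rewrite /gauss_fun gt_eqF ?expR_gt0.
  exact: ae_and ae0 ae_neq0.
move=> [A [mA A0 hA]].
have : A = setT by apply/seteqP; split => // x _; apply: hA.
move=> AT; move: A0; rewrite AT => muT.
have : (mu `[0%R, 1%R] <= mu setT)%E by apply: le_measure; rewrite ?inE.
by rewrite muT lebesgue_measure_itv /= lte_fin ltr01 oppr0 adde0 lee_fin ler10.
Qed.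

(** The number n counts the multiplications by x that carry w into the right half-plane, where
    [homdist_pos] applies. *)
Lemma homdist_unique n w k D1 D2 : 0 < Re w + n%:R -> homdist w k D1 ->
  homdist w k D2 -> (exists f, D1 f != 0) -> exists c, D2 = fun f => c * D1 f.
Proof.
elim: n w k D1 D2 => [|n IH] w k D1 D2.
  rewrite addr0 => w0 /(homdist_pos w0)[c1 ->] /(homdist_pos w0)[c2 ->] [f hf].
  exists (c2 / c1); apply/funext => g; rewrite mulrA divfK//.
  by apply: contraNneq hf => ->; rewrite mul0r.
rewrite -natr1 => hw h1 h2 [f hf].
have t1 : scalar D1 by case: h1 => -[].
have t2 : scalar D2 by case: h2 => -[].
have x1 := homdist_smulx h1; have x2 := homdist_smulx h2.
have hw' : 0 < Re (w + 1) + n%:R by rewrite ReD /= addrAC -addrA.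
(* In the exceptional case the functional f -> D(x f) is c times the sign distribution, and D(x f')
   = 0 by Euler's equation at w = 0. Taking f Gaussian gives c = 0, so that D is a multiple of the
   Dirac mass. *)
have [[w0 k0]|wk] := pselect (w = 0 /\ k = false).
  have main D : homdist w k D -> forall g, D g = g 0 * D sgauss.
    move=> h; have sD : scalar D by case: h => -[].
    apply: smulx_kernel => //.
    have xh := homdist_smulx h; rewrite w0 k0 add0r in xh.
    have [c hc] := @homdist_pos 1 true _ ltr01 xh.
    have [tD hD _] := h.
    have := hom_euler tD hD sgauss; rewrite w0 oppr0 mul0r /stheta.
    have -> : D (smulx (sderiv sgauss)) = c * sdelta true 1 (sderiv sgauss).
      exact: (congr1 (fun F => F (sderiv sgauss)) hc).
    move/eqP; rewrite mulf_eq0 (negPf sdelta_gauss_neq0) orbF => /eqP c0 g.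
    by rewrite (congr1 (fun F => F g) hc) c0 mul0r.
  have e1 := main _ h1; have e2 := main _ h2.
  exists (D2 sgauss / D1 sgauss); apply/funext => g; rewrite (e2 g) (e1 g).
  rewrite mulrCA divfK//; apply: contraNneq hf => e.
  by rewrite e1 e mulr0.
have [g hg] : exists g, D1 (smulx g) != 0.
  apply: contrapT => /forallNP h; apply: wk.
  apply: (homdist_smulx_eq0 h1); last by exists f.
  by move=> g; have /negP := h g; rewrite negbK => /eqP.
have [|c hc] := IH _ _ _ _ hw' x1 x2; first by exists g.
(* The difference D2 - c D1 has the same degree and parity and vanishes on multiples of x, so
   outside the exceptional case it is 0. *)
exists c; apply/funext => u; apply/eqP; rewrite -subr_eq0 addrC -mulNr.
apply: contraT => hu; exfalso; apply: wk.
apply: (homdist_smulx_eq0 (homdist_lin (- c) h1 h2)); last by exists u.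
by move=> v; rewrite (congr1 (fun F => F v) hc) mulNr addNr.
Qed.

Lemma sderiv_smulx f : sderiv (smulx f) = f + stheta f.
Proof.
apply: schwartz_eqP => x; rewrite [LHS]cderiv_smulx cderiv0 mul1r addrC.
by rewrite -[RHS]/(f x + x%:C * sderiv f x).
Qed.

(** The inequality ln z = 2 ln(z^(1/2)) <= 2 z^(1/2), used at y and at 1/y, bounds |ln y| by 2
    (y^(-1/2) + y^(1/2)). Hence the exponents 1/2 and 3/2. *)
Lemma kernel_ln : kernel (fun x : R => (ln `|x|)%:C) 2 2^-1 (3 / 2).
Proof.
split; rewrite ?divr_gt0//.
  apply: cmeasurable_real; apply: measurable_comp1; first exact: measurable_ln.
  by apply: continuous_measurable_fun; exact: norm_continuous.
split; first by rewrite normr0 ln0.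
move=> x; rewrite -normr_gt0 normc_real; move: `|x| => y y0.
have -> : (2^-1 - 1 : R) = - 2^-1 by lra.
have -> : (3 / 2 - 1 : R) = 2^-1 by lra.
have key (z : R) : 0 < z -> ln z <= 2 * z `^ 2^-1.
  move=> z0; have -> : ln z = 2 * ln (z `^ 2^-1).
    by rewrite ln_powR mulrA mulfV ?mul1r// pnatr_eq0.
  rewrite ler_pM2l//; have := @ln_sublinear R (z `^ 2^-1) (powR_gt0 _ z0).
  exact: ltW.
have := key _ y0; have := key y^-1; rewrite invr_gt0 => /(_ y0).
rewrite lnV ?posrE// -(powR_inv1 (ltW y0)) -powRrM mulN1r => h1 h2.
rewrite ler_norml mulrDr; apply/andP; split.
  by have := powR_ge0 y 2^-1; lra.
by have := powR_ge0 y (- 2^-1); lra.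
Qed.

Lemma sdelta_even1 f : sdelta false 1 f = cintegral mu setT (f : R -> C).
Proof.
have kd := @kernel_delta R false 1 ltr01.
have i1 := kernel_integrable kd f.
have e : ae_eq mu setT (fun x => delta_density false 1 x * f x) (f : R -> C).
  apply: (ae_imp _ ae_neq0) => x x0 _.
  by rewrite /delta_density subrr cpow_s0 ?normr_eq0// mulr1 /sgnpow expr0 mul1r.
apply: ae_cintegral => //.
  exact: kernel_cmeasurable kd f.
exact: cmeasurable_schwartz.
Qed.

(** Write f as f(0) times the Gaussian plus x g. The derivative of the Gaussian is odd, and (x g)' =
    g + x g' integrates to 0 by Euler's equation for Lebesgue measure, which has degree 1. *)
Lemma sdelta_even1_sderiv f : sdelta false 1 (sderiv f) = 0.
Proof.
have [tD hD pD] := @homdist_sdelta R false 1 ltr01.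
have [sD _] := tD.
have hx g : sdelta false 1 (sderiv (smulx g)) = 0.
  by rewrite sderiv_smulx scalar_add// (hom_euler tD hD) mulN1r subrr.
have hG : sdelta false 1 (sderiv (sgauss : schwartz R)) = 0.
  have := pD (sderiv sgauss); rewrite expr0 mul1r.
  have -> : sneg (sderiv (sgauss : schwartz R)) = (-1) *: sderiv sgauss.
    by apply: schwartz_eqP => x; rewrite -[RHS]/(-1 * sderiv sgauss x) -[LHS]/(sderiv sgauss (- x)) !sderiv_gauss /= /gauss_fun sqrrN rmorphN /=; ring.
  rewrite scalar_scale// mulN1r => /eqP; rewrite eq_sym -subr_eq0 opprK -mulr2n mulrn_eq0 /=.
  by move=> /eqP.
have : (f - f 0 *: sgauss : schwartz R) 0 = 0.
  by rewrite -[LHS]/(f 0 - f 0 * sgauss 0) sgauss0 mulr1 subrr.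
move=> /hadamard[g fg]; have -> : f = f 0 *: sgauss + smulx g.
  by rewrite -fg addrC subrK.
by rewrite sderiv_lin scalar_add// scalar_scale// hG hx mulr0 addr0.
Qed.

Lemma cintegrable_schwartz f : cintegrable mu setT (f : R -> C).
Proof.
have i1 := kernel_integrable (@kernel_delta R false 1 ltr01) f.
have e : ae_eq mu setT (fun x => delta_density false 1 x * f x) (f : R -> C).
  apply: (ae_imp _ ae_neq0) => x x0 _.
  by rewrite /delta_density subrr cpow_s0 ?normr_eq0// mulr1 /sgnpow expr0 mul1r.
by apply: ae_cintegrable e i1 => //; exact: cmeasurable_schwartz.
Qed.

(** Since ln |e^(-y) x| = ln |x| - y, the logarithm fails to be homogeneous only by a multiple of
    Lebesgue measure. That defect disappears on derivatives. *)
Lemma kint_ln_sdil f y : kint (fun x => (ln `|x|)%:C) (sdil f y) =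
  (expR (- y))%:C * (kint (fun x => (ln `|x|)%:C) f - y%:C * sdelta false 1 f).
Proof.
pose a := expR (- y); have a0 : 0 < a by exact: expR_gt0.
have i1 := kernel_integrable kernel_ln (sdil f y).
have i2 := kernel_integrable kernel_ln f.
have i3 : cintegrable mu setT (fun x => y%:C * f x).
  by apply: cintegrableZ => //; exact: cintegrable_schwartz.
rewrite sdelta_even1 /kint (cintegral_affine 0 (lt0r_neq0 a0) i1) gtr0_norm//.
congr (_ * _); rewrite -cintegralZ//; last exact: cintegrable_schwartz.
rewrite -cintegralB//.
have e : ae_eq mu setT (fun x => (ln `|a * x + 0|)%:C * sdil f y (a * x + 0))
    (fun x => (ln `|x|)%:C * f x - y%:C * f x).
  apply: (ae_imp _ ae_neq0) => x x0 _.
  rewrite addr0 normrM gtr0_norm// lnM ?posrE ?normr_gt0// expRK.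
  rewrite -[sdil f y _]/(f (expR y * (a * x))) mulrA -expRD subrr expR0 mul1r.
  by rewrite rmorphD rmorphN /= mulrDl mulNr addrC.
have i4 := cintegrable_affine 0 (lt0r_neq0 a0) i1.
have i5 := cintegrableB measurableT i2 i3.
by apply: ae_cintegral => //; split; apply/measurable_EFinP;
  [exact: measurable_int i4.1|exact: measurable_int i4.2|
   exact: measurable_int i5.1|exact: measurable_int i5.2].
Qed.

Lemma cder_cst_fun (c : C) : cder (fun=> c) (fun=> 0).
Proof. by move=> x; split; exact: is_derive_cst. Qed.

Lemma tempered_kint_ln : tempered (kint (fun x : R => (ln `|x|)%:C)).
Proof. exact: tempered_kint kernel_ln. Qed.

(** This functional is minus the principal value of 1/x. The defect of homogeneity of the logarithm
    is multiplied by the integral of f', which is 0. *)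
Lemma homdist_ln : homdist 0 true (fun f => kint (fun x => (ln `|x|)%:C) (sderiv f)).
Proof.
have [sL _] := tempered_kint_ln.
split; first exact: tempered_sderiv tempered_kint_ln.
  move=> y f; rewrite sderiv_sdil (scalar_scale sL) kint_ln_sdil.
  rewrite sdelta_even1_sderiv mulr0 subr0 mulrA -rmorphM /= -expRD subrr expR0.
  by rewrite oppr0 mul0r cexp0.
move=> f.
have n1 : (-1 : R) != 0 by rewrite oppr_eq0 oner_eq0.
have i1 := kernel_integrable kernel_ln (sneg (sderiv f)).
have e : kint (fun x => (ln `|x|)%:C) (sneg (sderiv f)) =
    kint (fun x => (ln `|x|)%:C) (sderiv f).
  rewrite {1}/kint (cintegral_affine 0 n1 i1) normrN1 mul1r.
  apply: cintegral_ext => x _; rewrite addr0 mulN1r normrN.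
  by rewrite -[sneg _ _]/(sderiv f (- - x)) opprK.
by rewrite sderiv_sneg (scalar_scale sL) e expr1.
Qed.

(** If the derivative of ln |x| vanished, the pairings L of ln |x| with f would satisfy L(x f') = -
    L(f). Differentiating [kint_ln_sdil] at y = 0 gives - L(f) minus the integral of f instead, a
    contradiction for the Gaussian. *)
Lemma kint_ln_sderiv_neq0 :
  exists f : schwartz R, kint (fun x => (ln `|x|)%:C) (sderiv f) != 0.
Proof.
apply: contrapT => /forallNP h.
have h0 f : kint (fun x => (ln `|x|)%:C) (sderiv f) = 0.
  by have /negP := h f; rewrite negbK => /eqP.
have [sL _] := tempered_kint_ln.
have hT f : kint (fun x => (ln `|x|)%:C) (stheta f) =
    - kint (fun x => (ln `|x|)%:C) f.
  have := h0 (smulx f); rewrite sderiv_smulx (scalar_add sL) addrC => /eqP.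
  by rewrite addr_eq0 => /eqP.
have d1 := tempered_cder (sgauss : schwartz R) tempered_kint_ln.
pose L := kint (fun x => (ln `|x|)%:C) (sgauss : schwartz R).
pose I := sdelta false 1 (sgauss : schwartz R).
have d2 : cder (fun y => kint (fun x => (ln `|x|)%:C) (sdil (sgauss : schwartz R) y))
    (fun y => (- expR (- y))%:C * (L + (- y)%:C * I) +
      (expR (- y))%:C * (0 + ((-1)%:C * I + (- y)%:C * 0))).
  have dN (x : R) : is_derive x 1 (fun y : R => - y) (-1).
    by apply: is_derive_eq.
  have dE (x : R) : is_derive x 1 (fun y : R => expR (- y)) (- expR (- x)).
    by apply: is_derive_eq; rewrite mulrN1.
  apply: (cder_eq _ (fun=> erefl) (cder_rmul dE (cderD (cder_cst_fun L)
    (cder_rmul dN (cder_cst_fun I))))).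
  by move=> y; rewrite /= kint_ln_sdil rmorphN mulNr.
have := cder_unique 0 d1 d2; rewrite sdil0 hT oppr0 expR0 rmorph0 !mul0r !addr0 add0r.
rewrite !rmorphN !rmorph1 !mulN1r mul1r -/L -[LHS]addr0 => /addrI /esym /eqP.
rewrite oppr_eq0 /I sdelta_even1 cintegral_gauss.
by rewrite eq_complex /= eqxx andbT sqrtr_eq0 leNgt pi_gt0.
Qed.

Lemma homdist_dirac : homdist 0 false (fun f : schwartz R => f 0).
Proof.
split.
- apply/temperedP; split=> //; exists 0%N, 1; split=> // f B hB.
  by have := hB 0%N 0%N 0 isT isT; rewrite expr0 !mul1r cderiv0.
- by move=> y f; rewrite -[sdil f y 0]/(f (expR y * 0)) mulr0 oppr0 mul0r cexp0 mul1r.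
- by move=> f; rewrite -[sneg f 0]/(f (- 0)) oppr0 expr0 mul1r.
Qed.

(** The number n counts derivatives taken from a degree in the right half-plane. At w = 0 a
    derivative may kill the distribution, so there the Dirac mass and the principal value are
    inserted. *)
Lemma homdist_exists n w k : 0 < Re w + n%:R ->
  exists D, homdist w k D /\ exists f, D f != 0.
Proof.
elim: n w k => [|n IH] w k.
  rewrite addr0 => w0; exists (sdelta k w); split; first exact: homdist_sdelta.
  by have [f hf] := sdelta_neq0 k w0; exists f.
rewrite -natr1 => hw; have hw' : 0 < Re (w + 1) + n%:R by rewrite ReD /= addrAC -addrA.
have [->|w0] := eqVneq w 0.
  case: k; first by eexists; split; [exact: homdist_ln|exact: kint_ln_sderiv_neq0].
  exists (fun f => f 0); split; first exact: homdist_dirac.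
  by exists sgauss; rewrite sgauss0 oner_neq0.
have [D [hD [f hf]]] := IH _ (~~ k) hw'.
exists (fun f => D (sderiv f)); split; first exact: homdist_sderiv.
have [tD eD _] := hD; have [sD _] := tD.
(* On x f the new functional takes the value D(f) + D(x f') = D(f) - (w + 1) D(f) = - w D(f). *)
exists (smulx f); rewrite sderiv_smulx (scalar_add sD) (hom_euler tD eD).
rewrite -[X in X + _]mul1r -mulrDl opprD addrCA subrr addr0.
by rewrite mulf_neq0// oppr_eq0.
Qed.

End Classification.

(** * Homogeneity from dilations by integers prime to N *)

Section Homogeneity.
Context {R : realType}.
Local Notation C := R[i].
Implicit Types (f g : schwartz R) (D : schwartz R -> C) (w : C) (k : bool) (t : R).

Lemma dilate_pos t f : 0 < t ->
  dilate t f = (t `^ (- 2^-1))%:C *: sdil f (- ln t).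
Proof.
move=> t0; apply: schwartz_eqP => x; rewrite dilateE ?gt_eqF// gtr0_norm//.
rewrite -[RHS]/(_ * f (expR (- ln t) * x)); congr (_ * f _).
by rewrite expRN lnK ?posrE// mulrC.
Qed.

Lemma dilate_neg t f : t < 0 ->
  dilate t f = ((- t) `^ (- 2^-1))%:C *: sneg (sdil f (- ln (- t))).
Proof.
move=> t0; apply: schwartz_eqP => x; rewrite dilateE ?lt_eqF// ltr0_norm//.
rewrite -[RHS]/(_ * f (expR (- ln (- t)) * - x)); congr (_ * f _).
by rewrite expRN lnK ?posrE ?oppr_gt0// invrN mulrNN mulrC.
Qed.

Lemma dilateN1 f : dilate (-1) f = sneg f.
Proof.
rewrite dilate_neg ?oppr_lt0// opprK powR1 ln1 oppr0 sdil0.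
exact: scale1r.
Qed.

Lemma homdist_even w D : homdist w false D -> even_dist D.
Proof.
by move=> [_ _ pD]; apply/funext => f; rewrite /dist_U dilateN1 pD expr0 mul1r.
Qed.

Lemma homdist_odd w D : homdist w true D -> odd_dist D.
Proof.
by move=> [_ _ pD]; apply/funext => f; rewrite /dist_U dilateN1 pD expr1 mulN1r.
Qed.

Lemma homdist_homogeneous w k D : homdist w k D -> homogeneous (quasichar k w) D.
Proof.
move=> [[sD _] hD pD] t t0; apply/funext => f.
rewrite -[RHS]/(quasichar k w t * (`|t| `^ (- 2^-1))%:C * D f) /dist_U.
rewrite /quasichar /sgnpow /cpow normr_eq0 (negPf t0).
have [tp|tn|/eqP] := ltgtP t 0; last by rewrite (negPf t0).
  rewrite dilate_neg// (scalar_scale sD) pD hD ltr0_norm// ltr0_sg//.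
  rewrite rmorphN mulNr mulrN opprK rmorphXn rmorphN rmorph1 /=.
  by ring.
rewrite dilate_pos// (scalar_scale sD) hD gtr0_norm// gtr0_sg// expr1n.
by rewrite rmorphN mulNr mulrN opprK mul1r mulrCA mulrA.
Qed.

(** Homogeneity at a single y. For tempered D the admissible y form a closed subgroup of the real
    line, which is what the lemmas below establish. *)
Definition homat w D y := forall f, D (sdil f y) = cexp (- w * y%:C) * D f.

Lemma homatD w D y z : homat w D y -> homat w D z -> homat w D (y + z).
Proof.
move=> hy hz f; rewrite -sdilD hz hy mulrA -cexpD rmorphD.
by congr (cexp _ * _); rewrite /=; ring.
Qed.

Lemma homatN w D y : homat w D y -> homat w D (- y).
Proof.
move=> hy f; have := hy (sdil f (- y)); rewrite sdilD addNr sdil0 => ->.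
rewrite mulrA -cexpD -mulrDr -rmorphD addNr rmorph0 mulr0 cexp0.
by rewrite mul1r.
Qed.

Lemma homat0 w D : homat w D 0.
Proof. by move=> f; rewrite sdil0 mulr0 cexp0 mul1r. Qed.

Lemma homat_int w D y (n : int) : homat w D y -> homat w D (n%:~R * y).
Proof.
move=> hy; have hn (m : nat) : homat w D (m%:R * y).
  elim: m => [|m IH]; first by rewrite mul0r; exact: homat0.
  by rewrite -natr1 mulrDl mul1r; exact: homatD.
case: n => m; first exact: hn.
by rewrite NegzE mulrNz mulNr; apply: homatN; exact: hn.
Qed.

Lemma homat_closed w D (u : nat -> R) y : tempered D ->
  (forall n, homat w D (u n)) -> u n @[n --> \oo] --> y -> homat w D y.
Proof.
move=> tD hu uy f; apply: ccvg_unique (tempered_sdil_cvg f tD uy) _.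
rewrite (_ : (fun n => D (sdil f (u n))) = fun n => cexp (- w * (u n)%:C) * D f); last first.
  by apply/funext => n; rewrite hu.
apply: ccvgM (ccvg_cst _).
have cu := cvg_comp u _ uy.
have dc (x : R) : {for x, continuous (fun y : R => Re (cexp (- w * y%:C)))} /\
    {for x, continuous (fun y : R => Im (cexp (- w * y%:C)))}.
  have [d1 d2] := cder_cexp (- w) x.
  by split; apply: differentiable_continuous; apply/derivable1_diffP.
by split; [exact: cu (dc y).1|exact: cu (dc y).2].
Qed.

(* The logarithms of the ratios (1 + (n+1)M)/(1 + nM) are positive and tend to
   0, so the closed subgroup they generate is all of R. *)
Lemma homat_coprime w D (M : nat) : tempered D -> (0 < M)%N ->
  (forall m : nat, (0 < m)%N -> coprime m M -> homat w D (- ln m%:R)) -> hom w D.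
Proof.
move=> tD M0 h y.
pose b (n : nat) : R := (1 + n * M)%N%:R.
have b0 n : 0 < b n by rewrite ltr0n.
have hb n : homat w D (- ln (b n)).
  by apply: h => //; rewrite /coprime gcdnC addnC gcdnMDl gcdn1.
pose e n := ln (b n.+2 / b n.+1).
have he n : homat w D (e n).
  rewrite /e ln_div ?posrE// -[ln (b n.+2)]opprK.
  by apply: homatD (hb _); apply: homatN.
have bS n : b n.+1 = b n + M%:R by rewrite /b mulSn addnCA natrD addrC.
have e0 n : 0 < e n.
  by rewrite ln_gt0// ltr_pdivlMr// mul1r [ltRHS]bS ltrDl ltr0n.
(* From ln(1 + t) <= t with t = M / b(n+1), where b(n+1) = 1 + (n+1) M. *)
have eb n : e n <= n.+1%:R^-1.
  have -> : e n = ln (1 + M%:R / b n.+1).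
    by rewrite /e [b n.+2]bS mulrDl divff// gt_eqF.
  apply: (le_trans (le_ln1Dx _)).
    by apply: lt_le_trans (divr_ge0 _ _); rewrite ?ltrN10// ltW.
  rewrite ler_pdivrMr// mulrC ler_pdivlMr ?ltr0n//.
  by rewrite -natrM ler_nat mulnC leq_addl.
(* The largest integer multiple of e(n) not above y; it misses y by less than e(n). *)
pose u n : R := (Num.floor (y / e n))%:~R * e n.
apply: (homat_closed (u := u) tD); first by move=> n; exact: homat_int.
apply/cvgrPdist_le => /= eps eps0.
have : n.+1%:R^-1 @[n --> \oo] --> (0 : R) by exact: cvg_harmonic.
move=> /cvgrPdist_le /(_ eps eps0) [n0 _ hn0]; exists n0 => // n /= n0n.
have := hn0 n n0n; rewrite /= sub0r normrN ger0_norm// => hn.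
have en := e0 n.
have f1 : (Num.floor (y / e n))%:~R * e n <= y by rewrite -ler_pdivlMr// floor_le.
have f2 : y < ((Num.floor (y / e n))%:~R + 1) * e n.
  by rewrite -ltr_pdivrMr// -(intrD _ _ 1) floorD1_gt.
rewrite /u ger0_norm ?subr_ge0//.
apply: (le_trans _ (le_trans (eb n) hn)).
by rewrite lerBlDr; apply/ltW; move: f2; rewrite mulrDl mul1r addrC.
Qed.

Lemma spart_sum f : spart false f + spart true f = f.
Proof.
apply: schwartz_eqP => x.
rewrite -[LHS]/(2%:R^-1 * (f x + (-1) ^+ false * f (- x)) +
  2%:R^-1 * (f x + (-1) ^+ true * f (- x))).
by rewrite expr0 expr1; field.
Qed.

Lemma spart_sneg k f : spart k (sneg f) = (-1) ^+ k *: spart k f.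
Proof.
apply: schwartz_eqP => x; rewrite -[RHS]/((-1) ^+ k * spart k f x) -spart_parity.
by rewrite -[LHS]/(2%:R^-1 * (f (- x) + (-1) ^+ k * f (- - x))).
Qed.

Lemma spart_sdil k f y : spart k (sdil f y) = sdil (spart k f) y.
Proof.
apply: schwartz_eqP => x.
rewrite -[LHS]/(2%:R^-1 * (f (expR y * x) + (-1) ^+ k * f (expR y * - x))).
by rewrite mulrN.
Qed.

Lemma parity_spart_negb k D f : scalar D -> parity k D -> D (spart (~~ k) f) = 0.
Proof.
move=> sD pD; rewrite /spart (scalar_scale sD) (scalar_add sD) (scalar_scale sD) pD.
by case: k pD => _; rewrite ?expr0 ?expr1; ring.
Qed.

Lemma tempered_comb (a b : C) D1 D2 : tempered D1 -> tempered D2 ->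
  tempered (fun f => a * D1 f + b * D2 f).
Proof.
move=> t1 t2; have t0 : tempered (fun _ : schwartz R => 0 : C).
  apply/temperedP; split; first by move=> c f g /=; rewrite mulr0 addr0.
  by exists 0%N, 0; split => // f B _; rewrite normc0 mul0r.
have := tempered_lin a t1 (tempered_lin b t2 t0).
by congr tempered; apply/funext => f; rewrite addr0.
Qed.

Lemma homdist_spart w k D : tempered D -> hom w D ->
  homdist w k (fun f => D (spart k f)).
Proof.
move=> tD hD; have [sD _] := tD; split.
- have -> : (fun f => D (spart k f)) =
      fun f => 2%:R^-1 * D f + 2%:R^-1 * (-1) ^+ k * D (sneg f).
    apply/funext => f; rewrite /spart (scalar_scale sD) (scalar_add sD).
    by rewrite (scalar_scale sD); ring.
  exact: (tempered_comb _ _ tD (tempered_sneg tD)).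
- by move=> y f; rewrite spart_sdil hD.
- by move=> f; rewrite spart_sneg (scalar_scale sD).
Qed.

Lemma hom_span w D E0 E1 : tempered D -> hom w D ->
  homdist w false E0 -> (exists f, E0 f != 0) ->
  homdist w true E1 -> (exists f, E1 f != 0) ->
  exists c0 c1 : C, D = fun f => c0 * E0 f + c1 * E1 f.
Proof.
move=> tD hD h0 n0 h1 n1.
have [n hn] : exists n : nat, 0 < Re w + n%:R.
  exists (Num.bound `|Re w|); have := archi_boundP (normr_ge0 (Re w)).
  by have := ler_norm (- Re w); rewrite normrN; lra.
have [c0 e0] := homdist_unique hn h0 (homdist_spart false tD hD) n0.
have [c1 e1] := homdist_unique hn h1 (homdist_spart true tD hD) n1.
exists c0, c1; apply/funext => f; have [sD _] := tD.
rewrite -{1}(spart_sum f) (scalar_add sD).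
by rewrite (congr1 (fun F => F f) e0) (congr1 (fun F => F f) e1).
Qed.

End Homogeneity.

(** * Transport of the Hecke eigenspace to the real line *)

Section EigenspaceTransport.
Context {R : realType} (N : int) (d : nat) (chi : dirichlet_character R d).
Local Notation C := R[i].
Local Notation SH := (schwartzH N chi).
Hypotheses (hN : N != 0) (hd : (d %| `|N|)%N).
Hypothesis (injW : injective (@wb_map R N d chi)).
Implicit Types (D : schwartz R -> C) (f g : schwartz R) (s w : C).

Lemma wb_invK f : wb_inv (wb_map N chi f) = f.
Proof. by apply: injW; rewrite /wb_inv; case: cid. Qed.

Lemma wb_mapK (F : SH) : wb_map N chi (wb_inv F) = F.
Proof. by rewrite /wb_inv; case: cid. Qed.

Lemma wb_sharpE D f : wb_sharp D (wb_map N chi f) = D f.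
Proof. by rewrite /wb_sharp wb_invK. Qed.

Lemma wb_flatK (D : SH -> C) : wb_sharp (wb_flat D) = D.
Proof. by apply/funext => F; rewrite /wb_sharp /wb_flat wb_mapK. Qed.

Lemma wb_map_lin (a : C) f g :
  wb_map N chi (a *: f + g) = a *: wb_map N chi f + wb_map N chi g.
Proof. by apply: val_inj; rewrite /= weil_brezin_lin. Qed.

Lemma temperedH_sharp D : tempered D -> temperedH (wb_sharp D : SH -> C).
Proof.
move=> [sD cD]; split.
  move=> a F G; rewrite -[F]wb_mapK -[G]wb_mapK -wb_map_lin !wb_sharpE.
  exact: sD.
apply/continuousP => A oA.
change (open (wb_map N chi @^-1` (wb_sharp D @^-1` A))).
rewrite (_ : _ @^-1` _ = D @^-1` A); first by move/continuousP : cD; apply.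
by apply/seteqP; split=> f; rewrite /= wb_sharpE.
Qed.

Lemma temperedH_flat (D : SH -> C) : temperedH D -> tempered (wb_flat D).
Proof.
move=> [sD cD]; split.
  by move=> a f g; rewrite /wb_flat wb_map_lin; exact: sD.
apply/continuousP => A oA.
by have /continuousP /(_ _ oA) := cD.
Qed.

Lemma cpow_half (m : nat) : (0 < m)%N ->
  (m%:R `^ (- 2^-1))%:C * (m%:R `^ (- 2^-1))%:C * m%:R = 1 :> C.
Proof.
move=> m0; have mR : 0 < m%:R :> R by rewrite ltr0n.
rewrite -(rmorph_nat (real_complex R)) -!rmorphM /= -powRD; last first.
  by apply/implyP => _; rewrite gt_eqF.
have -> : - 2^-1 + - 2^-1 = -1 :> R by field.
by rewrite powR_inv1 ?ltW// mulVf ?gt_eqF.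
Qed.

(** The factors m^(-1/2) of [hecke0] and of [dilate] combine to 1/m. An m prime to N is prime to d,
    so chi(m) cancels, and what remains is homogeneity under x -> x/m with factor m^(1-s). *)
Lemma hecke_eigenP s (D : SH -> C) (m : nat) : scalar (wb_flat D) ->
  (0 < m)%N -> coprime m `|N|%N ->
  hecke m D = (chi m * cpow m%:R (- s)) *: D <->
  homat (1 - s) (wb_flat D) (- ln m%:R).
Proof.
move=> sD m0 mN; have mR : 0 < m%:R :> R by rewrite ltr0n.
have cm : chi m != 0.
  by rewrite dchar_neq0; exact: coprime_dvdr hd mN.
have E f : hecke m D (wb_map N chi f) =
    chi m * (m%:R^-1 * wb_flat D (sdil f (- ln m%:R))).
  rewrite -[LHS]/(chi m * ((m%:R `^ (- 2^-1))%:C *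
    wb_flat D (dilate m%:R (wb_inv (wb_map N chi f))))).
  rewrite wb_invK dilate_pos// (scalar_scale sD); congr (_ * _).
  rewrite mulrA; congr (_ * _).
  have mC : m%:R != 0 :> C by rewrite pnatr_eq0 -lt0n.
  by apply: (mulIf mC); rewrite cpow_half// mulVf.
have pE f : cexp (- (1 - s) * (- ln m%:R)%:C) * wb_flat D f =
    m%:R * (cpow m%:R (- s) * wb_flat D f).
  rewrite mulrA; congr (_ * _).
  rewrite /cpow gt_eqF// -(rmorph_nat (real_complex R)).
  rewrite -[in X in real_complex _ X * _](lnK mR).
  have -> : real_complex R (expR (ln m%:R)) = cexp (ln m%:R)%:C by rewrite cexp_real.
  rewrite -cexpD.
  by congr cexp; rewrite rmorphN /=; ring.
split=> [h f|h].
  have := congr1 (fun G => G (wb_map N chi f)) h; rewrite E.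
  rewrite -[X in _ = X]/(chi m * cpow m%:R (- s) * wb_flat D f) -mulrA.
  move=> /(mulfI cm) => e; rewrite pE -e mulrA mulfV ?mul1r//.
  by rewrite pnatr_eq0 -lt0n.
apply/funext => F; rewrite -[F]wb_mapK E h pE mulKf ?pnatr_eq0 -?lt0n//.
by rewrite mulrA.
Qed.

Lemma hecke_eigenspaceP s (D : SH -> C) : hecke_eigenspace N chi s D <->
  tempered (wb_flat D) /\ hom (1 - s) (wb_flat D).
Proof.
split=> [[tD eD]|[tD hD]].
  have tF := temperedH_flat tD; split=> //; have [sF _] := tF.
  apply: (homat_coprime (M := `|N|%N) tF); first by rewrite absz_gt0.
  by move=> m m0 mN; apply/hecke_eigenP => //; exact: eD.
split; first by rewrite -(wb_flatK D); exact: temperedH_sharp.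
move=> m m0 mN; apply/(hecke_eigenP s _ m0 mN); first by case: tD.
by move=> f; exact: hD.
Qed.

Lemma eigenspace_span s E0 E1 :
  homdist (1 - s) false E0 -> (exists f, E0 f != 0) ->
  homdist (1 - s) true E1 -> (exists f, E1 f != 0) ->
  hecke_eigenspace N chi s = span2 (wb_sharp E0 : SH -> C) (wb_sharp E1).
Proof.
move=> h0 n0 h1 n1; apply/seteqP; split=> D.
  move=> /hecke_eigenspaceP[tD hD].
  have [c0 [c1 e]] := hom_span tD hD h0 n0 h1 n1.
  exists c0, c1; apply/funext => F; rewrite -[F]wb_mapK.
  rewrite -[LHS]/(wb_flat D (wb_inv F)) e.
  by rewrite -[RHS]/(c0 * wb_sharp E0 _ + c1 * wb_sharp E1 _) !wb_sharpE.
move=> [a [b ->]]; apply/hecke_eigenspaceP.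
have -> : wb_flat (a *: (wb_sharp E0 : SH -> C) + b *: (wb_sharp E1 : SH -> C)) =
    fun f => a * E0 f + b * E1 f.
  apply/funext => f.
  rewrite -[LHS]/(a * wb_sharp E0 (wb_map N chi f) + b * wb_sharp E1 (wb_map N chi f)).
  by rewrite !wb_sharpE.
have [t0 e0 _] := h0; have [t1 e1 _] := h1; split.
  exact: tempered_comb.
by move=> y f; rewrite e0 e1; ring.
Qed.

Lemma eigenspace_dim s E0 E1 :
  homdist (1 - s) false E0 -> (exists f, E0 f != 0) ->
  homdist (1 - s) true E1 -> (exists f, E1 f != 0) ->
  has_dimension 2 (hecke_eigenspace N chi s).
Proof.
move=> h0 n0 h1 n1; rewrite (eigenspace_span h0 n0 h1 n1).
exists (fun i : 'I_2 => wb_sharp (if i == ord0 then E0 else E1)); split.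
  move=> c; rewrite big_ord_recl big_ord1 /= => e.
  have e' f : c ord0 * E0 f + c (lift ord0 ord0) * E1 f = 0.
    have := congr1 (fun G => G (wb_map N chi f)) e.
    by rewrite -[LHS]/(c ord0 * wb_sharp E0 _ + c (lift ord0 ord0) * wb_sharp E1 _) !wb_sharpE.
  have [[s0 _] _ p0] := h0; have [[s1 _] _ p1] := h1.
  have [f0 nf0] := n0; have [f1 nf1] := n1.
  (* The odd distribution vanishes on the even part of f0, while the even one takes the value E0(f0)
     there. *)
  have c0 : c ord0 = 0.
    have := e' (spart false f0).
    rewrite (parity_spart _ s0 p0) (parity_spart_negb _ s1 p1) mulr0 addr0.
    by move/eqP; rewrite mulf_eq0 (negPf nf0) orbF => /eqP.
  have c1 : c (lift ord0 ord0) = 0.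
    have := e' f1; rewrite c0 mul0r add0r.
    by move/eqP; rewrite mulf_eq0 (negPf nf1) orbF => /eqP.
  move=> i; have [->//|] := eqVneq i ord0.
  by case: (unliftP ord0 i) => [j ->|->//]; rewrite (ord1 j) c1.
apply/seteqP; split=> D.
  move=> [a [b ->]]; exists (fun i => if i == ord0 then a else b).
  by rewrite big_ord_recl big_ord1.
move=> [c ->]; exists (c ord0), (c (lift ord0 ord0)).
by rewrite big_ord_recl big_ord1.
Qed.

Lemma transported_sharp (P : set (schwartz R -> C)) D : tempered D -> P D ->
  transported P (wb_sharp D : SH -> C).
Proof. by move=> tD PD; exists D. Qed.

Lemma wb_sharp_neq0 D : (exists f, D f != 0) -> (wb_sharp D : SH -> C) <> 0.
Proof.
move=> [f hf] e; move: hf; rewrite -(wb_sharpE D f).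
by rewrite (congr1 (fun G => G (wb_map N chi f)) e) eqxx.
Qed.

End EigenspaceTransport.

(** * The power series of the complex exponential *)

Section ComplexExponentialSeries.
Context {R : realType}.
Local Notation C := R[i].
Implicit Types (c z : C) (f : R -> C).

Lemma exp_partial_le (a : R) m : 0 <= a ->
  \sum_(0 <= n < m) a ^+ n / n`!%:R <= expR a.
Proof.
move=> a0; have := @nondecreasing_cvgn_le R (series (exp_coeff a)) _ (is_cvg_series_exp_coeff a) m.
apply; apply/nondecreasing_seqP => n.
by rewrite /series /= big_nat_recr//= lerDl exp_coeff_ge0.
Qed.

Lemma exp_term_le (a : R) n : 0 <= a -> a ^+ n / n`!%:R <= expR a.
Proof.
move=> a0; apply: (le_trans _ (exp_partial_le n.+1 a0)).
rewrite big_nat_recr//= lerDr; apply: sumr_ge0 => i _.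
by rewrite divr_ge0// exprn_ge0.
Qed.

Lemma is_derive_realX n (x : R) :
  is_derive x 1 (fun y : R => y ^+ n.+1) (n.+1%:R * x ^+ n).
Proof.
apply: DeriveDef; first exact: exprn_derivable.
by rewrite exp_derive [LHS]mulr1.
Qed.

(** With p(t) = K t^(m+1) / (m+1)!, both p - u and p + u vanish at 0 and are nondecreasing on
    [0, 1]. This stands in for integrating the bound on u'. *)
Lemma iterated_bound (u u' : R -> R) (K : R) m :
  (forall x : R, is_derive x 1 u (u' x)) -> u 0 = 0 ->
  (forall t, 0 <= t <= 1 -> `|u' t| <= K * (t ^+ m / m`!%:R)) ->
  forall t, 0 <= t <= 1 -> `|u t| <= K * (t ^+ m.+1 / m.+1`!%:R).
Proof.
move=> du u0 hu t /andP[t0 t1].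
pose p (x : R) := K / m.+1`!%:R * x ^+ m.+1.
have dp (x : R) : is_derive x 1 p (K * (x ^+ m / m`!%:R)).
  have := is_deriveZ (K / m.+1`!%:R) (is_derive_realX m x).
  congr (is_derive _ _ _ _); rewrite scaleRE factS natrM.
  by field; rewrite nat1r !pnatr_eq0 -!lt0n fact_gt0.
have key (e : R) : (e = 1 \/ e = -1) -> e * u t <= p t.
  move=> he.
  have dq (x : R) : is_derive x 1 (fun y => p y - e * u y) (K * (x ^+ m / m`!%:R) - e * u' x).
    have h1 := dp x; have h2 := du x.
    by apply: is_derive_eq; rewrite scaleRE.
  have := @ger0_derive1_ndecr R (fun y => p y - e * u y) 0 1.
  have q1 : forall x : R, x \in `]0, 1[%R -> derivable (fun y => p y - e * u y) x 1.
    by move=> x _; have [] := dq x.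
  have q2 : forall x : R, x \in `]0, 1[%R -> 0 <= derive1 (fun y => p y - e * u y) x.
    move=> x; rewrite in_itv /= => /andP[x0 x1].
    rewrite derive1E; have [_ ->] := dq x; rewrite subr_ge0.
    apply: le_trans (hu x _); last by rewrite !ltW.
    by case: he => ->; rewrite ?mul1r ?mulN1r; [exact: ler_norm|rewrite -normrN; exact: ler_norm].
  have q3 : {within `[0, 1], continuous (fun y => p y - e * u y)}.
    apply: continuous_subspaceT => x; apply: differentiable_continuous.
    by apply/derivable1_diffP; have [] := dq x.
  move=> /(_ q1 q2 q3 0 t (lexx _) t0 t1).
  by rewrite u0 mulr0 subr0 /p expr0n /= mulr0 subr_ge0.
have -> : K * (t ^+ m.+1 / m.+1`!%:R) = p t by rewrite /p; ring.
rewrite ler_norml; have := key 1 (or_introl erefl); have := key (-1) (or_intror erefl).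
by rewrite mul1r mulN1r => h1 h2; apply/andP; split => //; lra.
Qed.

Definition expsum c m (y : R) : C := \sum_(0 <= n < m) (c ^+ n / n`!%:R) * (y ^+ n)%:C.

Lemma cder_realX n : cder (fun y : R => (y ^+ n.+1)%:C) (fun y => (n.+1%:R * y ^+ n)%:C).
Proof.
move=> x; split=> /=; last exact: is_derive_cst.
exact: is_derive_realX.
Qed.

Lemma cder_expsum c m : cder (expsum c m.+1) (fun y => c * expsum c m y).
Proof.
elim: m => [|m IH].
  apply: (cder_eq _ _ (cder_cst_fun 1)) => y.
    by rewrite /expsum big_nat1 !expr0 divr1 mul1r rmorph1.
  by rewrite /expsum big_geq// mulr0.
apply: (cder_eq _ _ (cderD IH (cderZ (c ^+ m.+1 / m.+1`!%:R) (cder_realX m)))) => y.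
  by rewrite [RHS]big_nat_recr.
rewrite [in RHS]/expsum [in RHS]big_nat_recr//= mulrDr; congr (_ + _).
rewrite rmorphM /= rmorph_nat factS natrM exprS.
by field; rewrite nat1r !pnatr_eq0 -!lt0n fact_gt0.
Qed.

(** The derivative of a Taylor remainder of y -> exp(cy) is c times the previous remainder, so
    induction with [iterated_bound] applies. The factor 2 per step comes from bounding real and
    imaginary parts separately and is harmless beside the factorial. *)
Lemma expsum_remainder c m (t : R) : 0 <= t <= 1 ->
  normc (cexp (c * t%:C) - expsum c m t) <=
  expR (normc c) * (2 * normc c) ^+ m * (t ^+ m / m`!%:R).
Proof.
elim: m t => [|m IH] t t01.
  have /andP[t0 t1] := t01.
  rewrite /expsum big_geq// subr0 !expr0 fact0 divr1 !mulr1 normc_cexp ler_expR.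
  apply: (le_trans (ler_norm _)); apply: (le_trans (normc_Re _)).
  by rewrite normcM normc_real ger0_norm// ler_piMr// normc_ge0.
set K := expR (normc c) * (2 * normc c) ^+ m.
have K0 : 0 <= K by rewrite mulr_ge0 ?expR_ge0// exprn_ge0// mulr_ge0 ?normc_ge0.
pose P m y := cexp (c * y%:C) - expsum c m y.
have dP : cder (P m.+1) (fun y => c * P m y).
  apply: (cder_eq _ _ (cderD (cder_cexp c) (cderZ (-1) (cder_expsum c m)))) => y.
    by rewrite mulN1r.
  by rewrite mulN1r mulrBr.
have P0 : P m.+1 0 = 0.
  rewrite /P rmorph0 mulr0 cexp0 /expsum big_nat_recl// big1 ?addr0; last first.
    by move=> i _; rewrite expr0n /= rmorph0 mulr0.
  by rewrite !expr0 fact0 divr1 mul1r rmorph1 subrr.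
have hu s : 0 <= s <= 1 -> normc (c * P m s) <= normc c * K * (s ^+ m / m`!%:R).
  by move=> s01; rewrite normcM -mulrA; apply: ler_wpM2l; [exact: normc_ge0|exact: IH].
have hR := @iterated_bound (fun y => Re (P m.+1 y)) (fun y => Re (c * P m y))
  (normc c * K) m (fun x => (dP x).1).
have hI := @iterated_bound (fun y => Im (P m.+1 y)) (fun y => Im (c * P m y))
  (normc c * K) m (fun x => (dP x).2).
apply: (le_trans (normc_le_ReIm _)).
have -> : expR (normc c) * (2 * normc c) ^+ m.+1 * (t ^+ m.+1 / m.+1`!%:R) =
    normc c * K * (t ^+ m.+1 / m.+1`!%:R) + normc c * K * (t ^+ m.+1 / m.+1`!%:R).
  by rewrite /K exprS; ring.
apply: lerD.
  apply: hR => //; first by rewrite P0.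
  by move=> s s01; apply: le_trans (normc_Re _) (hu s s01).
apply: hI => //; first by rewrite P0.
by move=> s s01; apply: le_trans (normc_Im _) (hu s s01).
Qed.

Lemma cexp_series c : ccvg (fun m => \sum_(0 <= n < m) c ^+ n / n`!%:R) (cexp c).
Proof.
apply/ccvg_normc.
have h : (fun m => expR (normc c) * exp_coeff (2 * normc c) m) @ \oo --> (0 : R).
  by rewrite -[X in _ --> X](mulr0 (expR (normc c))); apply: cvgMr; exact: cvg_exp_coeff.
apply: (@squeeze_cvgr _ _ _ _ (fun=> 0) _ _ _ _ (cvg_cst _) h).
apply: nearW => m; rewrite normc_ge0 /=.
rewrite normc_distC.
have := @expsum_remainder c m 1; rewrite ler01 lexx => /(_ isT).
rewrite rmorph1 mulr1 expr1n div1r /exp_coeff /= mulrA => le1.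
apply: le_trans le1.
rewrite le_eqVlt; apply/orP; left; apply/eqP; congr (normc (_ - _)).
by apply: eq_bigr => n _; rewrite expr1n rmorph1 mulr1.
Qed.

Lemma normc_exp_partial c m :
  normc (\sum_(0 <= n < m) c ^+ n / n`!%:R) <= expR (normc c).
Proof.
apply: (le_trans (normc_sum _ _ _)); apply: (le_trans _ (exp_partial_le m (normc_ge0 c))).
apply: ler_sum => n _; rewrite normcM normcX.
by rewrite -(rmorph_nat (real_complex R)) -fmorphV normc_real ger0_norm// invr_ge0.
Qed.

End ComplexExponentialSeries.

(** * Division and vanishing of complex power series *)

Section PowerSeries.
Context {R : realType}.
Local Notation C := R[i].
Implicit Types (a : nat -> C) (z : C).

Definition psum a z m : C := \sum_(0 <= n < m) a n * z ^+ n.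

Lemma ccvg_bounded (u : nat -> C) l : ccvg u l ->
  exists2 B : R, 0 <= B & forall n, normc (u n) <= B.
Proof.
move=> [h1 h2].
have key (v : nat -> R) (x : R) : v n @[n --> \oo] --> x -> exists2 B : R, 0 <= B & forall n, `|v n| <= B.
  move=> hv; have := @cvg_seq_bounded _ _ v (cvgP _ hv).
  move=> [B [_ hB]]; exists (Num.max B 0 + 1).
    by rewrite addr_ge0// le_max lexx orbT.
  by move=> n; apply: (hB (Num.max B 0 + 1)) => //; rewrite ltr_pwDr// le_max lexx.
have [B1 b1 hB1] := key _ _ h1; have [B2 b2 hB2] := key _ _ h2.
exists (B1 + B2); first exact: addr_ge0.
by move=> n; apply: (le_trans (normc_le_ReIm _)); apply: lerD.
Qed.

Lemma psumS a z m : psum a z m.+1 = psum a z m + a m * z ^+ m.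
Proof. by rewrite /psum big_nat_recr. Qed.

Lemma psum_coeff_bound a z l : ccvg (psum a z) l ->
  exists2 A : R, 0 <= A & forall n, normc (a n) * normc z ^+ n <= A.
Proof.
move=> /ccvg_bounded[B B0 hB]; exists (B + B); first exact: addr_ge0.
move=> n; rewrite -normcX -normcM.
have -> : a n * z ^+ n = psum a z n.+1 - psum a z n by rewrite psumS addrAC subrr add0r.
by apply: (le_trans (normcD _ _)); rewrite normcN; apply: lerD.
Qed.

(** Coefficients of the quotient of the series with coefficients a by b + z, found by comparing
    coefficients after multiplying out. *)
Fixpoint divseq a (b : C) n : C :=
  if n is m.+1 then (a n - divseq a b m) / b else a 0%N / b.

(** In the recursion the previous coefficient enters with weight rho / |b| <= 1/2, so the bound 2A /
    |b| reproduces itself. *)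
Lemma divseq_bound a b (A rho : R) : 0 < rho -> 2 * rho <= normc b ->
  (forall n, normc (a n) * rho ^+ n <= A) ->
  forall n, normc (divseq a b n) * rho ^+ n <= 2 * A / normc b.
Proof.
move=> r0 rb hA; have b0 : 0 < normc b by apply: lt_le_trans rb; rewrite mulr_gt0.
have A0 : 0 <= A by have := hA 0%N; rewrite expr0 mulr1; exact: le_trans (normc_ge0 _).
have nV : normc b^-1 = (normc b)^-1.
  have bn : b != 0 by rewrite -normc_gt0.
  apply: (mulfI (lt0r_neq0 b0)); by rewrite -normcM (mulfV bn) mulfV ?lt0r_neq0// normc1.
elim=> [|n IH].
  rewrite expr0 mulr1 /= normcM nV ler_pM2r ?invr_gt0//.
  by have := hA 0%N; rewrite expr0 mulr1; lra.
rewrite /= normcM nV mulrAC ler_pM2r ?invr_gt0//.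
apply: (@le_trans _ _ (A + rho * (2 * A / normc b))).
  apply: (@le_trans _ _ ((normc (a n.+1) + normc (divseq a b n)) * rho ^+ n.+1)).
    apply: ler_wpM2r; first by rewrite exprn_ge0// ltW.
    by apply: (le_trans (normcD _ _)); rewrite normcN.
  rewrite mulrDl; apply: lerD => //; rewrite exprS mulrCA.
  by apply: ler_wpM2l => //; exact: ltW.
have -> : rho * (2 * A / normc b) = A * (2 * rho / normc b) by ring.
have : A * (2 * rho / normc b) <= A * 1.
  by apply: ler_wpM2l => //; rewrite ler_pdivrMr// mul1r.
by rewrite mulr1; lra.
Qed.

Lemma psum_divseq a b z m : b != 0 ->
  (b + z) * psum (divseq a b) z m.+1 = psum a z m.+1 + divseq a b m * z ^+ m.+1.
Proof.
move=> b0; elim: m => [|m IH].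
  by rewrite !psumS /psum !big_geq// !add0r expr0 !mulr1 expr1 /=; field.
rewrite psumS mulrDr IH [psum a z m.+2]psumS /= !exprS.
by field.
Qed.

Lemma ccvgS_inv (u : nat -> C) l : ccvg (fun n => u n.+1) l -> ccvg u l.
Proof.
move=> [h1 h2]; split.
  by rewrite -(cvg_shiftS (fun n => Re (u n))).
by rewrite -(cvg_shiftS (fun n => Im (u n))).
Qed.

Lemma ccvg_geometric (u : nat -> C) (A q : R) : 0 <= q < 1 ->
  (forall n, normc (u n) <= A * q ^+ n) -> ccvg u 0.
Proof.
move=> /andP[q0 q1] hu; apply/ccvg_normc.
have h : (fun m => A * q ^+ m) @ \oo --> (0 : R).
  rewrite -[X in _ --> X](mulr0 A); apply: cvgMr; apply: cvg_expr.
  by rewrite ger0_norm.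
apply: (@squeeze_cvgr _ _ _ _ (fun=> 0) _ _ _ _ (cvg_cst _) h).
by apply: nearW => m; rewrite normc_ge0 subr0 hu.
Qed.

Lemma psum_div a b z (l : C) (A rho : R) : 0 < rho -> 2 * rho <= normc b ->
  (forall n, normc (a n) * rho ^+ n <= A) -> normc z < rho ->
  ccvg (psum a z) l -> ccvg (psum (divseq a b) z) (l / (b + z)).
Proof.
move=> r0 rb hA zr hl.
have b0 : b != 0 by rewrite -normc_gt0; apply: lt_le_trans rb; rewrite mulr_gt0.
have bz : b + z != 0.
  rewrite -normc_gt0; have := normcD (b + z) (- z); rewrite addrK normcN => h.
  by have := normc_gt0 b; rewrite b0; lra.
have hB := divseq_bound r0 rb hA.
apply: ccvgS_inv.
have -> : (fun m => psum (divseq a b) z m.+1) =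
    fun m => (psum a z m.+1 + divseq a b m * z ^+ m.+1) * (b + z)^-1.
  by apply/funext => m; rewrite -psum_divseq// mulrAC mulfV// mul1r.
apply: ccvgM (ccvg_cst _); rewrite -[l]addr0; apply: ccvgD; first exact: ccvgS.
apply: (@ccvg_geometric _ (2 * A / normc b * normc z) (normc z / rho)).
  by rewrite divr_ge0 ?normc_ge0 ?ltW//= ltr_pdivrMr// mul1r.
move=> n; rewrite normcM normcX exprS.
have -> : 2 * A / normc b * normc z * (normc z / rho) ^+ n =
    normc z * (normc z ^+ n * ((2 * A / normc b) * (rho ^+ n)^-1)).
  by rewrite exprMn exprVn; ring.
rewrite mulrCA; apply: ler_wpM2l; first exact: normc_ge0.
rewrite mulrC; apply: ler_wpM2l; first by rewrite exprn_ge0 ?normc_ge0.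
by rewrite ler_pdivlMr ?exprn_gt0.
Qed.

(** At a zero z the first surviving term a(n) z^n equals minus the tail, which has one more factor
    z. Letting zeros approach 0 then forces a(n) = 0. *)
Lemma psum_zero_coeff a (A rho : R) n z : 0 < rho ->
  (forall i, normc (a i) * rho ^+ i <= A) ->
  (forall i, (i < n)%N -> a i = 0) ->
  z != 0 -> 2 * normc z <= rho -> ccvg (psum a z) 0 ->
  normc (a n) <= 2 * A / rho ^+ n.+1 * normc z.
Proof.
move=> r0 hA h z0 zr h0.
have zn : 0 < normc z by rewrite normc_gt0.
have A0 : 0 <= A by have := hA 0%N; rewrite expr0 mulr1; exact: le_trans (normc_ge0 _).
pose q := normc z / rho.
have q0 : 0 <= q by rewrite divr_ge0 ?ltW.
have q2 : 2 * q <= 1 by rewrite /q mulrA ler_pdivrMr// mul1r.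
(* The factor 2 - 2 q^m bounds 1 + q + ... + q^(m-1) when q <= 1/2, in a form that carries the
   induction. *)
have tail m : \sum_(n.+1 <= i < n.+1 + m) normc (a i * z ^+ i) <=
    A * (2 - 2 * q ^+ m) * q ^+ n.+1.
  elim: m => [|m IH].
    by rewrite addn0 big_geq// expr0 mulr1 subrr mulr0 mul0r.
  rewrite addnS big_nat_recr ?leq_addr//=.
  have t : normc (a (n.+1 + m)%N * z ^+ (n.+1 + m)) <= A * q ^+ m * q ^+ n.+1.
    rewrite normcM normcX -mulrA -exprD [(m + _)%N]addnC /q exprMn exprVn.
    rewrite mulrCA [leLHS]mulrC; apply: ler_wpM2l; first by rewrite exprn_ge0 ?normc_ge0.
    by rewrite ler_pdivlMr ?exprn_gt0.
  apply: (le_trans (lerD IH t)).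
  rewrite -mulrDl; apply: ler_wpM2r; first exact: exprn_ge0.
  rewrite -mulrDr; apply: ler_wpM2l => //.
  have qm : 0 <= q ^+ m by exact: exprn_ge0.
  by rewrite exprS; nra.
have hlim : ccvg (fun m => \sum_(n.+1 <= i < n.+1 + m) a i * z ^+ i) (- (a n * z ^+ n)).
  have hS : ccvg (fun m => psum a z (m + n.+1)%N) 0.
    elim: (n.+1) => [|j IHj]; first by under eq_fun do rewrite addn0.
    by under eq_fun do rewrite addnS; exact: ccvgS IHj.
  have := ccvgD hS (ccvg_cst (- (a n * z ^+ n))); rewrite add0r.
  congr ccvg; apply/funext => m; rewrite addnC /psum.
  rewrite (@big_cat_nat _ _ _ n.+1)//= ?leq_addr// big_nat_recr//=.
  rewrite big_nat_cond big1; first by rewrite add0r addrAC subrr add0r.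
  by move=> i; rewrite andbT => /andP[_ /h ->]; rewrite mul0r.
have := ccvg_le (M := 2 * A * q ^+ n.+1) hlim.
rewrite normcN normcM normcX => hh.
have : normc (a n) * normc z ^+ n <= 2 * A * q ^+ n.+1.
  apply: hh => m; apply: (le_trans (normc_sum _ _ _)); apply: (le_trans (tail m)).
  apply: ler_wpM2r; first exact: exprn_ge0.
  by rewrite mulrC; apply: ler_wpM2r => //; rewrite gerBl mulr_ge0// exprn_ge0.
rewrite -ler_pdivlMr ?exprn_gt0// => /le_trans; apply.
rewrite le_eqVlt; apply/orP; left; apply/eqP.
rewrite /q exprMn exprVn [normc z ^+ n.+1]exprS.
by field; rewrite !expf_neq0 ?lt0r_neq0.
Qed.

End PowerSeries.

(** * Analytic and meromorphic functions; the identity theorem along segments *)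

Section Analyticity.
Context {R : realType}.
Local Notation C := R[i].
Implicit Types (F G : C -> C) (a : nat -> C) (s z w : C).

Lemma analyticB F G s0 : analytic_at F s0 -> analytic_at G s0 ->
  analytic_at (fun s => F s - G s) s0.
Proof.
move=> [a [r [r0 ha]]] [b [q [q0 hb]]].
exists (fun n => a n - b n), (Num.min r q); split; first by rewrite lt_min r0.
move=> s; rewrite lt_min => /andP[sr sq].
have := ccvg_lin (-1) (hb s sq) (ha s sr); rewrite mulN1r [- G s + _]addrC.
congr ccvg; apply/funext => m; rewrite mulN1r addrC -sumrB.
by apply: eq_bigr => n _; rewrite mulrBl.
Qed.

Lemma analytic_local F G s0 (r : R) : 0 < r ->
  (forall s, normc (s - s0) < r -> F s = G s) -> analytic_at F s0 -> analytic_at G s0.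
Proof.
move=> r0 e [a [q [q0 ha]]]; exists a, (Num.min r q); split; first by rewrite lt_min r0.
by move=> s; rewrite lt_min => /andP[sr sq]; rewrite -(e _ sr); exact: ha.
Qed.

Lemma meromorphic_local F G s0 (r : R) : 0 < r ->
  (forall s, normc (s - s0) < r -> F s = G s) ->
  meromorphic_at F s0 -> meromorphic_at G s0.
Proof.
move=> r0 e [k [a [q [q0 ha]]]]; exists k, a, (Num.min r q).
split; first by rewrite lt_min r0.
move=> s; rewrite lt_min => /andP[s0' /andP[sr sq]]; rewrite -(e _ sr).
by apply: ha; rewrite s0' sq.
Qed.

Lemma normc_half (r : R) : 0 < r -> normc ((r / 2)%:C) = r / 2.
Proof. by move=> r0; rewrite normc_real ger0_norm// divr_ge0// ltW. Qed.

(** The set P is left abstract to cover the full disc and the punctured disc of a meromorphic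
    function. Convergence at the one point s0 + r/2 of P bounds the coefficients. *)
Lemma power_series_div (P : set C) G a (r : R) s0 : 0 < r -> s0 != 0 ->
  P (s0 + (r / 2)%:C) ->
  (forall s, P s -> normc (s - s0) < r -> ccvg (psum a (s - s0)) (G s)) ->
  exists (a' : nat -> C) (r' : R), 0 < r' /\ forall s, P s -> normc (s - s0) < r' ->
    ccvg (psum a' (s - s0)) (G s / s).
Proof.
move=> r0 s00 Pr h.
have r2 : 0 < r / 2 by rewrite divr_gt0.
have := h _ Pr; rewrite addrAC subrr add0r normc_half// => /(_ ltac:(lra)).
move=> /psum_coeff_bound [A A0 hA]; rewrite normc_half// in hA.
have n0 : 0 < normc s0 by rewrite normc_gt0.
pose rho := Num.min (r / 2) (normc s0 / 2).
have rho0 : 0 < rho by rewrite lt_min r2 divr_gt0.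
have rho1 : rho <= r / 2 by rewrite ge_min lexx.
have rho2 : 2 * rho <= normc s0.
  have : rho <= normc s0 / 2 by rewrite ge_min lexx orbT.
  by lra.
have hA' n : normc (a n) * rho ^+ n <= A.
  apply: le_trans (hA n); apply: ler_wpM2l; first exact: normc_ge0.
  by apply: lerXn2r => //; rewrite nnegrE; exact: ltW.
exists (divseq a s0), rho; split=> // s Ps sr.
have hs : ccvg (psum a (s - s0)) (G s) by apply: h => //; lra.
by have := psum_div rho0 rho2 hA' sr hs; rewrite [s0 + _]addrC subrK.
Qed.

Lemma analytic_div F s0 : s0 != 0 -> analytic_at F s0 ->
  analytic_at (fun s => F s / s) s0.
Proof.
move=> s00 [a [r [r0 ha]]].
have [a' [r' [r'0 h]]] := @power_series_div setT F a r s0 r0 s00 Logic.I (fun s _ => ha s).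
by exists a', r'; split=> // s; exact: h.
Qed.

Lemma meromorphic_div F s0 : meromorphic_at F s0 ->
  meromorphic_at (fun s => F s / s) s0.
Proof.
move=> [k [a [r [r0 ha]]]]; have [s00|s00] := eqVneq s0 0.
  exists k.+1, a, r; split=> // s hs; have := ha s hs.
  have sn : s != 0 by move: hs; rewrite s00 subr0 normc_gt0 => /andP[].
  by rewrite s00 subr0 exprS mulrA divfK.
have Pr : 0 < normc (s0 + (r / 2)%:C - s0).
  by rewrite addrAC subrr add0r normc_half// divr_gt0.
have [a' [r' [r'0 h]]] := @power_series_div (fun s => 0 < normc (s - s0))
  (fun s => F s * (s - s0) ^+ k) a r s0 r0 s00 Pr
  (fun s h1 h2 => ha s (introT andP (conj h1 h2))).
exists k, a', r'; split=> // s /andP[s1 s2]; rewrite mulrAC; exact: h.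
Qed.

Lemma analytic_shift F s0 c : analytic_at F (s0 + c) -> analytic_at (fun s => F (s + c)) s0.
Proof.
move=> [a [r [r0 ha]]]; exists a, r; split=> // s sr.
have e : s + c - (s0 + c) = s - s0 by ring.
by have := ha (s + c); rewrite e; apply.
Qed.

Lemma meromorphic_shift F s0 c :
  meromorphic_at F (s0 + c) -> meromorphic_at (fun s => F (s + c)) s0.
Proof.
move=> [k [a [r [r0 ha]]]]; exists k, a, r; split=> // s sr.
have e : s + c - (s0 + c) = s - s0 by ring.
by have := ha (s + c); rewrite e; apply.
Qed.

Lemma analyticZ c F s0 : analytic_at F s0 -> analytic_at (fun s => c * F s) s0.
Proof.
move=> [a [r [r0 ha]]]; exists (fun n => c * a n), r; split=> // s sr.
have := ccvgM (ccvg_cst c) (ha s sr); congr ccvg; apply/funext => m.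
by rewrite mulr_sumr; apply: eq_bigr => n _; rewrite mulrA.
Qed.

Lemma meromorphicZ c F s0 : meromorphic_at F s0 -> meromorphic_at (fun s => c * F s) s0.
Proof.
move=> [k [a [r [r0 ha]]]]; exists k, (fun n => c * a n), r; split=> // s sr.
rewrite -mulrA; have := ccvgM (ccvg_cst c) (ha s sr); congr ccvg; apply/funext => m.
by rewrite mulr_sumr; apply: eq_bigr => n _; rewrite mulrA.
Qed.

Lemma analytic_meromorphic F s0 : analytic_at F s0 -> meromorphic_at F s0.
Proof.
move=> [a [r [r0 ha]]]; exists 0%N, a, r; split=> // s /andP[_ sr].
by rewrite expr0 mulr1; exact: ha.
Qed.

(** Zeros accumulate at s0 along the direction v, so by strong induction on n [psum_zero_coeff]
    makes each Taylor coefficient arbitrarily small, hence 0. *)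
Lemma analytic_zero_ball F s0 (v : C) (e : R) : v != 0 -> 0 < e ->
  analytic_at F s0 -> (forall t : R, 0 < t < e -> F (s0 + t%:C * v) = 0) ->
  exists2 r : R, 0 < r & forall s, normc (s - s0) < r -> F s = 0.
Proof.
move=> v0 e0 [a [r [r0 ha]]] hF.
have r2 : 0 < r / 2 by rewrite divr_gt0.
have := ha (s0 + (r / 2)%:C); rewrite addrAC subrr add0r normc_half// => /(_ ltac:(lra)).
move=> /psum_coeff_bound [A A0 hA]; rewrite normc_half// in hA.
have nv : 0 < normc v by rewrite normc_gt0.
have a0 n : a n = 0.
  elim/ltn_ind: n => n IH.
  apply/eqP; rewrite -normc_eq0 eq_le normc_ge0 andbT.
  apply/ler_addgt0Pr => y y0; rewrite add0r.
  pose K := 2 * A / (r / 2) ^+ n.+1.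
  have K0 : 0 <= K by rewrite divr_ge0 ?mulr_ge0// exprn_ge0// ltW.
  (* The three terms keep the point in the zero segment, keep |z| within half of the radius r/2 used
     for the coefficient bound, and push the resulting estimate below y. *)
  pose t := Num.min (e / 2) (Num.min (r / 4 / normc v) (y / (K + 1) / normc v)).
  have t0 : 0 < t by rewrite !lt_min !divr_gt0// ltr_wpDl.
  have te : t < e.
    have : t <= e / 2 by rewrite ge_min lexx.
    by lra.
  have tr : t * normc v <= r / 4.
    by rewrite -ler_pdivlMr// !ge_min lexx orbT.
  have ty : t * normc v <= y / (K + 1).
    by rewrite -ler_pdivlMr// !ge_min lexx !orbT.
  have nt : normc (t%:C * v) = t * normc v by rewrite normcM normc_real gtr0_norm.
  have z0 : t%:C * v != 0 by rewrite -normc_gt0 nt mulr_gt0.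
  have hz : ccvg (psum a (t%:C * v)) 0.
    have := ha (s0 + t%:C * v); rewrite addrAC subrr add0r nt hF ?t0//.
    by apply; lra.
  have hc := psum_zero_coeff r2 hA IH z0 _ hz.
  apply: (le_trans (hc _)); first by rewrite nt; lra.
  rewrite nt -/K; apply: (le_trans (ler_wpM2l K0 ty)).
  rewrite mulrA ler_pdivrMr ?ltr_wpDl// mulrC.
  by apply: ler_wpM2l; rewrite ?(ltW y0)// lerDl.
exists r => // s sr; apply: ccvg_unique (ha s sr) _.
have -> : (fun m => \sum_(0 <= n < m) a n * (s - s0) ^+ n) = fun=> 0.
  by apply/funext => m; apply: big1 => n _; rewrite a0 mul0r.
exact: ccvg_cst.
Qed.

(** A connectedness argument from s + v back to s: let t0 be the infimum of the parameters beyond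
    which F vanishes. At t0 the zeros accumulate, so F vanishes on a ball there, and a positive t0
    could be lowered. *)
Lemma analytic_line_zero F s (v : C) (t1 : R) : v != 0 -> t1 < 1 ->
  (forall t : R, 0 <= t <= 1 -> analytic_at F (s + t%:C * v)) ->
  (forall t : R, t1 < t <= 1 -> F (s + t%:C * v) = 0) -> F s = 0.
Proof.
move=> v0 t11 hF h1.
pose S : set R := [set t | 0 <= t <= 1 /\ forall t', t < t' <= 1 -> F (s + t'%:C * v) = 0].
have S0 : S !=set0.
  exists (Num.max t1 0); split.
    by rewrite le_max lexx orbT /= ge_max ler01 ltW.
  by move=> t' /andP[ht' t'1]; apply: h1; rewrite t'1 andbT (le_lt_trans _ ht')// le_max lexx.
have Sb : has_lbound S by exists 0 => t [/andP[]].
have hi : has_inf S by split.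
pose t0 := inf S.
have t0S t : S t -> t0 <= t by move=> /(ge_inf Sb).
have t00 : 0 <= t0 by apply: lb_le_inf => // t [/andP[]].
have t0t1 : t0 <= Num.max t1 0.
  apply: t0S; split; first by rewrite le_max lexx orbT /= ge_max ler01 ltW.
  by move=> t' /andP[ht' t'1]; apply: h1; rewrite t'1 andbT (le_lt_trans _ ht')// le_max lexx.
have t01 : t0 < 1 by rewrite (le_lt_trans t0t1)// gt_max t11 ltr01.
have zero t : t0 < t <= 1 -> F (s + t%:C * v) = 0.
  move=> /andP[tt t1'].
  have tt0 : 0 < t - t0 by rewrite subr_gt0.
  have [u [_ Su] ut] := inf_adherent tt0 hi.
  by apply: Su; rewrite t1' andbT; move: ut; rewrite addrCA subrr addr0.
have an : analytic_at F (s + t0%:C * v) by apply: hF; rewrite t00 ltW.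
have [r r0 hr] : exists2 r : R, 0 < r & forall w, normc (w - (s + t0%:C * v)) < r -> F w = 0.
  apply: (analytic_zero_ball (v := v) (e := 1 - t0) v0 _ an); first by rewrite subr_gt0.
  move=> t /andP[tp te]; rewrite -addrA -mulrDl -rmorphD; apply: zero.
  by rewrite ltrDl tp /= -lerBrDl ltW.
have nv : 0 < normc v by rewrite normc_gt0.
have ball t : `|t - t0| < r / normc v -> F (s + t%:C * v) = 0.
  move=> ht; apply: hr; rewrite opprD addrACA subrr add0r -mulrBl -rmorphB normcM normc_real.
  by rewrite -ltr_pdivlMr.
have [t0p|] := ltP 0 t0; last first.
  move=> t0n; have t0e : t0 = 0 by apply/eqP; rewrite eq_le t0n.
  have := ball 0; rewrite t0e subr0 normr0 divr_gt0// => /(_ isT).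
  by rewrite rmorph0 mul0r addr0.
pose eps := Num.min t0 (r / normc v / 2).
have rv : 0 < r / normc v by rewrite divr_gt0.
have e0 : 0 < eps by rewrite lt_min t0p divr_gt0.
have e1 : eps <= t0 by rewrite ge_min lexx.
have e2 : eps <= r / normc v / 2 by rewrite ge_min lexx orbT.
have : S (t0 - eps).
  split; first by apply/andP; split; lra.
  move=> t /andP[tt t1']; have [tl|tg] := leP t t0; last by apply: zero; rewrite tg.
  by apply: ball; rewrite ler0_norm; lra.
by move=> /t0S h; exfalso; lra.
Qed.

End Analyticity.

(** * Meromorphic continuation of the family in s *)

Section DeltaFamily.
Context {R : realType}.
Local Notation C := R[i].
Local Notation mu := (@lebesgue_measure R).
Implicit Types (f g : schwartz R) (w s : C) (k : bool).

Lemma expR_abs_ln (r x : R) : 0 <= r -> 0 < x ->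
  expR (r * `|ln x|) <= x `^ r + x `^ (- r).
Proof.
move=> r0 x0; rewrite /powR gt_eqF//.
have [l0|l0] := leP 0 (ln x); first by rewrite ger0_norm// lerDl expR_ge0.
by rewrite ltr0_norm// mulNr mulrN lerDr expR_ge0.
Qed.

(* The n-th Taylor coefficient at s = w of s |-> sgn(x)^k |x|^(s-1). *)
Definition delta_taylor k w n (x : R) : C :=
  delta_density k w x * ((ln `|x|) ^+ n / n`!%:R)%:C.

Lemma cmeasurable_delta_taylor k w n : cmeasurable (delta_taylor k w n).
Proof.
apply: cmeasurableM.
  by have := @cmeasurable_delta_density R k w idfun (@measurable_id _ _ setT).
apply: cmeasurable_real; apply: measurable_funM; last exact: measurable_cst.
apply: measurable_funX; apply: measurable_comp1; first exact: measurable_ln.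
by apply: continuous_measurable_fun; exact: norm_continuous.
Qed.

Lemma delta_kernel_bound k w (r : R) (c : C) (x : R) : 0 <= r -> x != 0 ->
  normc c <= expR (r * `|ln `|x| |) ->
  normc (delta_density k w x * c) <=
    `|x| `^ (Re w - r - 1) + `|x| `^ (Re w + r - 1).
Proof.
move=> r0 x0 hc; have xp : 0 < `|x| by rewrite normr_gt0.
rewrite normcM.
have h1 : normc (delta_density k w x) <= `|x| `^ (Re w - 1).
  rewrite /delta_density normcM -[leRHS]mul1r.
  apply: ler_pM; rewrite ?normc_ge0 ?normc_sgnpow_le//.
  by apply: (le_trans (normc_cpow_le _ (normr_ge0 _))); rewrite ReB.
have h2 := le_trans hc (expR_abs_ln r0 xp).
apply: (le_trans (ler_pM (normc_ge0 _) (normc_ge0 _) h1 h2)).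
rewrite mulrDr -!powRD; try by rewrite (gt_eqF xp) implybT.
rewrite [leLHS]addrC le_eqVlt; apply/orP; left; apply/eqP.
by congr (_ `^ _ + _ `^ _); lra.
Qed.

(** With r = Re w / 2, the term (r |ln |x||)^n / n! is at most exp(r |ln |x||) <= |x|^r + |x|^(-r).
    This explains the constant r^(-n) and the two exponents Re w - r and Re w + r, both positive. *)
Lemma kernel_delta_taylor k w n : 0 < Re w ->
  kernel (delta_taylor k w n) ((Re w / 2) ^- n) (Re w - Re w / 2) (Re w + Re w / 2).
Proof.
move=> w0; have r0 : 0 < Re w / 2 by rewrite divr_gt0.
split.
- exact: cmeasurable_delta_taylor.
- by rewrite subr_gt0 ltr_pdivrMr// ltr_pMr// ltr1n.
- by rewrite addr_gt0.
- by rewrite invr_ge0 exprn_ge0// ltW.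
split; first by rewrite /delta_taylor /delta_density normr0 cpow0 mulr0 mul0r.
move=> x x0; set r := Re w / 2; rewrite /delta_taylor.
have rn : 0 < r ^+ n by rewrite exprn_gt0.
have -> : delta_density k w x * ((ln `|x|) ^+ n / n`!%:R)%:C =
    (r ^- n)%:C * (delta_density k w x * ((r * ln `|x|) ^+ n / n`!%:R)%:C).
  rewrite mulrCA -rmorphM; congr (_ * _%:C).
  by rewrite [(r * _) ^+ n]exprMn -mulrA mulKf ?gt_eqF.
rewrite normcM normc_real ger0_norm ?invr_ge0 ?(ltW rn)//.
apply: ler_wpM2l; first by rewrite invr_ge0 ltW.
apply: delta_kernel_bound => //; first exact: ltW.
rewrite normc_real normrM normrX normrM (ger0_norm (ltW r0)).
rewrite [`|_^-1|]ger0_norm ?invr_ge0//.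
by apply: exp_term_le; rewrite mulr_ge0// ltW.
Qed.

Definition taylor_kernel k w (z : C) m (x : R) : C :=
  \sum_(0 <= n < m) z ^+ n * delta_taylor k w n x.

Lemma taylor_kernelE k w z m x : taylor_kernel k w z m x =
  delta_density k w x * \sum_(0 <= n < m) (z * (ln `|x|)%:C) ^+ n / n`!%:R.
Proof.
rewrite mulr_sumr; apply: eq_bigr => n _; rewrite /delta_taylor mulrCA; congr (_ * _).
by rewrite rmorphM rmorphXn /= fmorphV rmorph_nat exprMn mulrA.
Qed.

Lemma kernel_taylor_kernel k w z m : 0 < Re w -> normc z < Re w / 2 ->
  kernel (taylor_kernel k w z m) 1 (Re w - Re w / 2) (Re w + Re w / 2).
Proof.
move=> w0 zr; have r0 : 0 < Re w / 2 by rewrite divr_gt0.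
split=> //.
- by apply: cmeasurable_sum => n; apply: cmeasurableM;
    [exact: cmeasurable_cst|exact: cmeasurable_delta_taylor].
- by rewrite subr_gt0 ltr_pdivrMr// ltr_pMr// ltr1n.
- by rewrite addr_gt0.
- split.
    rewrite taylor_kernelE /delta_density normr0 cpow0 mulr0 mul0r//.
  move=> x x0; rewrite mul1r taylor_kernelE; apply: delta_kernel_bound => //.
    by rewrite divr_ge0// ltW.
  apply: (le_trans (normc_exp_partial _ _)).
  rewrite ler_expR normcM normc_real; apply: ler_wpM2r => //; exact: ltW.
Qed.

(** The factor |x|^z, z = s - w, is expanded in powers of z ln |x| under the integral. For |z| < Re
    w / 2 all partial sums are dominated by exp(r |ln |x||) with r = Re w / 2, so one integrable
    majorant serves them all. *)
Lemma sdelta_analytic k f w : 0 < Re w -> analytic_at (fun s => sdelta k s f) w.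
Proof.
move=> w0; have r0 : 0 < Re w / 2 by rewrite divr_gt0.
exists (fun n => kint (delta_taylor k w n) f), (Re w / 2); split=> // s sr.
set z := s - w in sr *.
have kT n := kernel_integrable (kernel_delta_taylor k n w0) f.
have -> : (fun m => \sum_(0 <= n < m) kint (delta_taylor k w n) f * z ^+ n) =
    fun m => kint (taylor_kernel k w z m) f.
  apply/funext => m; rewrite /kint /taylor_kernel.
  transitivity (cintegral mu setT (fun x : R =>
      \sum_(0 <= n < m) z ^+ n * (delta_taylor k w n x * f x))).
    rewrite cintegral_sum//; last by move=> n _; apply: cintegrableZ => //; exact: kT.
    apply: eq_bigr => n _; have e := cintegralZ measurableT (z ^+ n) (kT n).
    by rewrite e mulrC.
  by apply: cintegral_ext => x _; rewrite mulr_suml; apply: eq_bigr => n _; rewrite mulrA.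
pose N := maxn (Num.trunc (Re w - Re w / 2)).+2 (Num.trunc (Re w + Re w / 2)).+2.
have [B [B0 hB]] := sbounded_ex N f.
pose g x := B * jfun (Re w - Re w / 2) x + B * jfun (Re w + Re w / 2) x.
have mN : measurable_fun setT (fun x : R => x) by exact: measurable_id.
apply: (@cintegral_dominated_cvg _ _ _ mu setT measurableT _ _ g).
- by move=> m; exact: kernel_cmeasurable (kernel_taylor_kernel k m w0 sr) f.
- apply: cmeasurableM; last exact: cmeasurable_schwartz.
  exact: cmeasurable_delta_density mN.
- apply: (ae_imp _ ae_neq0) => x x0 _.
  apply: ccvgM (ccvg_cst _).
  have -> : delta_density k s x = delta_density k w x * cexp (z * (ln `|x|)%:C).
    rewrite /delta_density -mulrA; congr (_ * _).
    rewrite -cpowE ?normr_eq0// -cpowD ?normr_eq0//; congr cpow.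
    by rewrite /z; ring.
  under eq_fun do rewrite taylor_kernelE.
  by apply: ccvgM (ccvg_cst _) _; exact: cexp_series.
- apply: integrable_lin2 => //; apply: integrable_jfun; lra.
- apply: (ae_imp _ ae_neq0) => x x0 _ m.
  have := kernel_le (kernel_taylor_kernel k m w0 sr) hB x.
  by rewrite mulr1 mulrDr.
Qed.

Fixpoint dcont n k w f : C :=
  if n is m.+1 then - (dcont m (~~ k) (w + 1) (sderiv f) / w) else sdelta k w f.

(** In the half-plane Re w > 0, Euler's equation reads D_(w+1)(f') = D_w(x f') = - w D_w(f), so one
    more step changes nothing there; further left the steps are peeled off one at a time. *)
Lemma dcontS n k w f : 0 < Re w + n%:R -> dcont n.+1 k w f = dcont n k w f.
Proof.
elim: n k w f => [|n IH] k w f.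
  rewrite addr0 => w0 /=.
  have wn : w != 0 by apply: contraTneq w0 => ->; rewrite ltxx.
  rewrite -sdelta_smulx//; have [tD hD _] := homdist_sdelta k w0.
  have /= := hom_euler tD hD f; rewrite /stheta => ->.
  by field.
rewrite -natr1 => hw.
have hw' : 0 < Re (w + 1) + n%:R by rewrite ReD /= addrAC -addrA.
by rewrite -[LHS]/(- (dcont n.+1 (~~ k) (w + 1) (sderiv f) / w)) IH.
Qed.

Lemma dcont_stable n m k w f : 0 < Re w + n%:R -> (n <= m)%N ->
  dcont m k w f = dcont n k w f.
Proof.
move=> hw /subnK <-; elim: (m - n)%N => [//|j IH].
rewrite addSn dcontS// natrD; apply: (lt_le_trans hw).
by rewrite lerD2l lerDr.
Qed.

Lemma is_integerS w : is_integer (w + 1) -> is_integer w.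
Proof.
by move=> [n e]; exists (n - 1); rewrite intrB -e addrK.
Qed.

Lemma is_integer0 : is_integer (0 : C).
Proof. by exists 0. Qed.

Lemma dcont_analytic n k f w : 0 < Re w + n%:R -> ~ is_integer w ->
  analytic_at (fun s => dcont n k s f) w.
Proof.
elim: n k f w => [|n IH] k f w.
  by rewrite addr0 => w0 _; exact: sdelta_analytic.
rewrite -natr1 => hw wZ.
have hw' : 0 < Re (w + 1) + n%:R by rewrite ReD /= addrAC -addrA.
have wn : w != 0 by apply/eqP => e; apply: wZ; rewrite e; exact: is_integer0.
have h := IH (~~ k) (sderiv f) _ hw' (fun e => wZ (is_integerS e)).
have := analyticZ (-1) (analytic_div wn (analytic_shift h)).
apply: (analytic_local ltr01) => s _.
by rewrite mulN1r.
Qed.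

Lemma dcont_meromorphic n k f w : 0 < Re w + n%:R ->
  meromorphic_at (fun s => dcont n k s f) w.
Proof.
elim: n k f w => [|n IH] k f w.
  by rewrite addr0 => w0; apply: analytic_meromorphic; exact: sdelta_analytic.
rewrite -natr1 => hw.
have hw' : 0 < Re (w + 1) + n%:R by rewrite ReD /= addrAC -addrA.
have h := IH (~~ k) (sderiv f) _ hw'.
have := meromorphicZ (-1) (meromorphic_div (meromorphic_shift h)).
apply: (meromorphic_local ltr01) => s _.
by rewrite mulN1r.
Qed.

Lemma homdist_scale w k (c : C) D : homdist w k D -> homdist w k (fun f => c * D f).
Proof.
move=> h; have := homdist_lin (c - 1) h h.
by congr homdist; apply/funext => f; ring.
Qed.

Lemma homdist_dcont n k w : 0 < Re w + n%:R -> ~ is_integer w ->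
  homdist w k (dcont n k w) /\ exists f, dcont n k w f != 0.
Proof.
elim: n k w => [|n IH] k w.
  rewrite addr0 => w0 _; split; first exact: homdist_sdelta.
  by have [f hf] := sdelta_neq0 k w0; exists f.
rewrite -natr1 => hw wZ.
have hw' : 0 < Re (w + 1) + n%:R by rewrite ReD /= addrAC -addrA.
have wn : w != 0 by apply/eqP => e; apply: wZ; rewrite e; exact: is_integer0.
have [h [f hf]] := IH (~~ k) _ hw' (fun e => wZ (is_integerS e)).
split.
  have := homdist_scale (- w^-1) (homdist_sderiv h).
  by congr homdist; apply/funext => g /=; rewrite mulNr mulrC.
exists (smulx f) => /=; have [tD eD _] := h; have [sD _] := tD.
rewrite sderiv_smulx (scalar_add sD) (hom_euler tD eD).
have -> : dcont n (~~ k) (w + 1) f + - (w + 1) * dcont n (~~ k) (w + 1) f =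
  - w * dcont n (~~ k) (w + 1) f by ring.
by rewrite mulNr mulNr opprK mulrAC mulfV// mul1r.
Qed.

Definition delta_cont k s f : C := dcont (Num.bound `|Re s|) k s f.

Lemma bound_Re_gt0 s : 0 < Re s + (Num.bound `|Re s|)%:R.
Proof.
have := archi_boundP (normr_ge0 (Re s)).
by have := ler_norm (- Re s); rewrite normrN; lra.
Qed.

Lemma delta_contE n k s f : 0 < Re s + n%:R -> delta_cont k s f = dcont n k s f.
Proof.
move=> hn; have hb := bound_Re_gt0 s; rewrite /delta_cont.
have [le|/ltnW le] := leqP (Num.bound `|Re s|) n.
  by rewrite (dcont_stable _ _ hb le).
by rewrite (dcont_stable _ _ hn le).
Qed.

Lemma delta_cont_local k s0 f s : normc (s - s0) < Re s0 + (Num.bound `|Re s0|)%:R ->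
  dcont (Num.bound `|Re s0|) k s f = delta_cont k s f.
Proof.
move=> h; rewrite (@delta_contE (Num.bound `|Re s0|))//.
have := normc_Re (s - s0); rewrite ReB ler_norml => /andP[h1 _]; lra.
Qed.

Lemma delta_cont_family k : is_delta_family k (delta_cont k : C -> schwartz R -> C).
Proof.
split.
- by move=> s f s0; rewrite (@delta_contE 0) ?addr0.
- move=> s sZ; have [[tD _ _] _] := homdist_dcont k (bound_Re_gt0 s) sZ.
  exact: tD.
- move=> f s sZ.
  apply: analytic_local (bound_Re_gt0 s) (delta_cont_local k f) _.
  exact: dcont_analytic (bound_Re_gt0 s) sZ.
- move=> f s.
  apply: meromorphic_local (bound_Re_gt0 s) (delta_cont_local k f) _.
  exact: dcont_meromorphic (bound_Re_gt0 s).
Qed.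

Lemma delta_family k : is_delta_family k (delta k : C -> schwartz R -> C).
Proof. by rewrite /delta; apply: (xgetPex (fun _ _ => 0)); exists (delta_cont k); exact: delta_cont_family. Qed.

(** Two continuations agree for Re w > 0. The segments that carry this elsewhere must avoid the
    integers: off the real axis horizontal ones do, and a real non-integer is then reached along a
    vertical one. *)
Lemma delta_nonint k s : ~ is_integer s -> delta k s = delta_cont k s :> (schwartz R -> C).
Proof.
move=> sZ; apply/funext => f.
have [d1 _ d3 _] := delta_family k; have [e1 _ e3 _] := delta_cont_family k.
pose F w := delta k w f - delta_cont k w f.
have F0 w : 0 < Re w -> F w = 0 by move=> w0; rewrite /F d1// e1// subrr.
have FA w : ~ is_integer w -> analytic_at F w.
  by move=> wZ; apply: analyticB; [exact: d3|exact: e3].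
have FI w : Im w != 0 -> F w = 0.
  (* For t > 1 - 1/(2T) one has Re w + tT > Re w + T - 1/2 >= 1/2, so the far end of the segment
     lies in the right half-plane. *)
  move=> w0; pose T : R := `|Re w| + 1.
  have T0 : 0 < T by rewrite ltr_wpDl.
  apply: (@analytic_line_zero _ F w T%:C (1 - (2 * T)^-1)).
  - by rewrite -normc_gt0 normc_real normr_gt0 gt_eqF.
  - by rewrite gtrBl invr_gt0 mulr_gt0.
  - move=> t _; apply: FA => -[n e]; move/eqP: w0; apply.
    by have := congr1 (fun z : C => Im z) e; rewrite Im_int ImD -rmorphM /= addr0.
  - move=> t /andP[t1 t2]; apply: F0; rewrite ReD -rmorphM /=.
    have : (1 - (2 * T)^-1) * T < t * T by rewrite ltr_pM2r.
    have -> : (1 - (2 * T)^-1) * T = T - 2^-1 by field; rewrite gt_eqF.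
    have := ler_norm (- Re w); rewrite normrN /T; lra.
suff : F s = 0 by move/eqP; rewrite subr_eq0 => /eqP.
have [s0|] := eqVneq (Im s) 0; last exact: FI.
apply: (@analytic_line_zero _ F s 'i 0) => //.
- by rewrite eq_complex /= oner_eq0 andbF.
- move=> t _; have [->|t0] := eqVneq t 0; first by rewrite rmorph0 mul0r addr0; exact: FA.
  apply: FA => -[n e]; move/eqP: t0; apply.
  by have := congr1 (fun z : C => Im z) e; rewrite Im_int ImD s0 add0r /= mul0r addr0 mulr1.
- move=> t /andP[t0 _]; apply: FI.
  by rewrite ImD s0 add0r /= mul0r addr0 mulr1 gt_eqF.
Qed.

Lemma homdist_delta k s : ~ is_integer s ->
  homdist s k (delta k s : schwartz R -> C) /\ exists f : schwartz R, delta k s f != 0.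
Proof. by move=> sZ; rewrite delta_nonint//; exact: homdist_dcont (bound_Re_gt0 s) sZ. Qed.

Lemma delta_pos k s f : 0 < Re s -> delta k s f = sdelta k s f.
Proof. by move=> s0; have [d1 _ _ _] := delta_family k; exact: d1. Qed.

End DeltaFamily.

(** * Integrals of products over product measures *)

Section Tensor.
Context {R : realType} {d1 d2 : measure_display}.
Context {T1 : measurableType d1} {T2 : measurableType d2}.
Variable m1 : {sigma_finite_measure set T1 -> \bar R}.
Variable m2 : {sigma_finite_measure set T2 -> \bar R}.
Local Open Scope ereal_scope.

Let tensorT (u : T1 -> R) (v : T2 -> R) :
  m1.-integrable setT (EFin \o u) -> m2.-integrable setT (EFin \o v) ->
  (m1 \x m2).-integrable setT (fun p => (u p.1 * v p.2)%R%:E) /\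
  \int[m1 \x m2]_p (u p.1 * v p.2)%R%:E =
    (\int[m1]_x (u x)%:E) * (\int[m2]_y (v y)%:E).
Proof.
move=> iu iv.
have mu : measurable_fun setT u by apply/measurable_EFinP; exact: measurable_int iu.
have mv : measurable_fun setT v by apply/measurable_EFinP; exact: measurable_int iv.
have mf : measurable_fun setT (fun p : T1 * T2 => (u p.1 * v p.2)%R%:E).
  by apply/measurable_EFinP; apply: measurable_funM; exact: measurableT_comp.
have fv : \int[m2]_y (v y)%:E \is a fin_num by apply: integrable_fin_num iv.
have h1 : (m1 \x m2).-integrable setT (fun p => (u p.1 * v p.2)%R%:E).
  apply/(integrable12ltyP _ _ mf).
  have iav : m2.-integrable setT (fun y => `|(v y)%:E|) by exact: integrable_abse iv.
  have iau : m1.-integrable setT (fun y => `|(u y)%:E|) by exact: integrable_abse iu.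
  have e x : \int[m2]_y `|(u x * v y)%R%:E| = `|(u x)%:E| * \int[m2]_y `|(v y)%:E|.
    rewrite -ge0_integralZl//; last by apply/measurable_EFinP; exact: measurableT_comp.
    by apply: eq_integral => y _; rewrite EFinM abseM.
  under eq_integral do rewrite e.
  have fav : \int[m2]_y `|(v y)%:E| \is a fin_num by apply: integrable_fin_num iav.
  have := integrable_fin_num measurableT (integrableZr measurableT (fine (\int[m2]_y `|(v y)%:E|)) iau).
  rewrite fineK// => h; rewrite ltey_eq.
  by rewrite h.
split=> //; rewrite -integral12_prod_meas1// /fubini_F.
have e x : \int[m2]_y (u x * v y)%R%:E = (u x)%:E * \int[m2]_y (v y)%:E.
  by rewrite -integralZl.
under eq_integral do rewrite e.
rewrite -(fineK fv); exact: (integralZr measurableT iu).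
Qed.

Lemma tensor_integral (A : set T1) (B : set T2) (u : T1 -> R) (v : T2 -> R) :
  measurable A -> measurable B ->
  m1.-integrable A (EFin \o u) -> m2.-integrable B (EFin \o v) ->
  (m1 \x m2).-integrable (A `*` B) (EFin \o (fun p => (u p.1 * v p.2)%R)) /\
  Rintegral (m1 \x m2) (A `*` B) (fun p => (u p.1 * v p.2)%R) =
    (Rintegral m1 A u * Rintegral m2 B v)%R.
Proof.
move=> mA mB iu iv.
have mAB : measurable (A `*` B) by exact: measurableX.
have iu' : m1.-integrable setT (EFin \o (u \_ A)).
  by have /(integrable_mkcond _ mA) := iu; rewrite restrict_EFin.
have iv' : m2.-integrable setT (EFin \o (v \_ B)).
  by have /(integrable_mkcond _ mB) := iv; rewrite restrict_EFin.
have [h1 h2] := tensorT iu' iv'.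
have e : (fun p : T1 * T2 => (u p.1 * v p.2)%R) \_ (A `*` B) =
    fun p => ((u \_ A) p.1 * (v \_ B) p.2)%R.
  apply/funext => -[x y] /=; rewrite /patch.
  have [xA|xA] := boolP (x \in A); have [yB|yB] := boolP (y \in B).
  - by rewrite mem_set//; split; exact: set_mem.
  - rewrite memNset ?mulr0// => -[_ /= yB']; move/negP: yB; apply; exact: mem_set.
  - rewrite memNset ?mul0r// => -[/= xA' _]; move/negP: xA; apply; exact: mem_set.
  - rewrite memNset ?mul0r// => -[/= xA' _]; move/negP: xA; apply; exact: mem_set.
split.
  by apply/(integrable_mkcond _ mAB); rewrite restrict_EFin e.
rewrite Rintegral_mkcond e /Rintegral h2 fineM; last 2 first.
- exact: integrable_fin_num iu'.
- exact: integrable_fin_num iv'.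
by rewrite -!/(Rintegral _ _ _) -!Rintegral_mkcond.
Qed.

End Tensor.

(** * Boxes and null sets in the Heisenberg group *)

Section Box.
Context {R : realType}.
Local Notation mu := (@lebesgue_measure R).
Local Notation T3 := (measurableTypeR R * measurableTypeR R * measurableTypeR R)%type.
Local Notation leb3 := (@leb3 R).

Local Notation mR := (measurableTypeR R).

Definition rect3 (A B D : set (measurableTypeR R)) : set T3 := A `*` B `*` D.

(* The library's canonical product of sigma-finite measures is only inferred
   for subprobabilities, hence this copy. *)
Definition leb2 : set (mR * mR)%type -> \bar R := (mu \x mu)%E.

HB.instance Definition _ := Measure.copy leb2 (mu \x mu)%E.

Let leb2E (A B : set mR) : measurable A -> measurable B ->
  leb2 (A `*` B) = (mu A * mu B)%E.
Proof. by move=> mA mB; rewrite /leb2 product_measure1E. Qed.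

Let sigma_finite_leb2 : sigma_finite setT leb2.
Proof.
have /sigma_finiteP[F [TF ndF Foo]] := sigma_finiteT mu.
exists (fun n => F n `*` F n).
  rewrite -setXTT TF predeqE => -[x y]; split.
    move=> [/= [n _ Fnx] [k _ Fky]]; exists (maxn n k) => //; split.
    - by move: x Fnx; exact/subsetPset/ndF/leq_maxl.
    - by move: y Fky; exact/subsetPset/ndF/leq_maxr.
  by move=> [n _ []/= ? ?]; split; exists n.
move=> k; have [? ?] := Foo k.
split; first exact: measurableX.
by rewrite leb2E// lte_mul_pinfty// ge0_fin_numE.
Qed.

HB.instance Definition _ := Measure_isSigmaFinite.Build _ _ _ leb2 sigma_finite_leb2.

Lemma leb3_prodE (A : set (mR * mR)%type) (B : set mR) : measurable A -> measurable B ->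
  leb3 (A `*` B) = (leb2 A * mu B)%E.
Proof. by move=> mA mB; exact: (product_measure1E leb2 mu mA mB). Qed.

Lemma measurable_rect3 (A B D : set mR) : measurable A -> measurable B ->
  measurable D -> measurable (rect3 A B D).
Proof. by move=> mA mB mD; apply: measurableX => //; exact: measurableX. Qed.

Lemma rect3_integral (A B D : set mR) (u v w : mR -> R) :
  measurable A -> measurable B -> measurable D ->
  mu.-integrable A (EFin \o u) -> mu.-integrable B (EFin \o v) ->
  mu.-integrable D (EFin \o w) ->
  leb3.-integrable (rect3 A B D) (EFin \o (fun p => u p.1.1 * v p.1.2 * w p.2)) /\
  Rintegral leb3 (rect3 A B D) (fun p => u p.1.1 * v p.1.2 * w p.2) =
    Rintegral mu A u * Rintegral mu B v * Rintegral mu D w.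
Proof.
move=> mA mB mD iu iv iw.
have [h1 h2] := tensor_integral mA mB iu iv.
have [h3 h4] := tensor_integral (m1 := leb2) (measurableX mA mB) mD h1 iw.
by split=> //; rewrite [LHS]h4; congr (_ * _); exact: h2.
Qed.

Lemma ae3_1 (P : R -> Prop) : {ae mu, forall x, P x} ->
  {ae leb3, forall p : T3, P p.1.1}.
Proof.
move=> [A [mA A0 hA]]; exists (rect3 A setT setT); split.
- exact: measurable_rect3.
- by rewrite leb3_prodE ?leb2E ?A0 ?mul0e//; exact: measurableX.
- by move=> [[a c] z] /= h; split=> //; split=> //=; exact: hA.
Qed.

Lemma ae_countable (S : set R) : countable S -> {ae mu, forall x, ~ S x}.
Proof.
move=> cS; exists S; split.
- exact: countable_measurable.
- exact: countable_lebesgue_measure0.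
- by move=> x /= /contrapT.
Qed.

Lemma countable_affine_int (a b : R) : a != 0 ->
  countable [set x : R | exists n : int, a * x + b = n%:~R].
Proof.
move=> a0; apply: (@sub_countable _ _ _ ([set (n%:~R - b) / a | n in [set: int]])).
  apply: subset_card_le => x /= [n e]; exists n => //.
  by rewrite -e addrK mulrC mulKf.
exact: sub_countable (card_image_le _ _) (countableP _).
Qed.

Lemma ae_affine_nonint (a b : R) : a != 0 ->
  {ae mu, forall x, ~ exists n : int, a * x + b = n%:~R}.
Proof. by move=> a0; apply: ae_countable; exact: countable_affine_int. Qed.

End Box.

(** * The coefficients chi(nd/N) and their mean square *)

Section Weights.
Context {R : realType} (N : int) (d : nat) (chi : dirichlet_character R d).
Local Notation C := R[i].
Hypotheses (hN : N != 0) (hd : (d %| `|N|)%N).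

Definition wt (n : int) : C := chiQ chi (n%:Q * (d%:Z)%:Q / N%:Q).

(** Since nd/N = sgn(N) n/q, the coefficients live on the multiples of q and are periodic modulo N =
    sgn(N) q d. *)
Let q : nat := (`|N| %/ d)%N.

Let N_gt0 : (0 < `|N|)%N. Proof. by rewrite absz_gt0. Qed.

Lemma modulus_gt0 : (0 < d)%N.
Proof. by apply: dvdn_gt0 hd; rewrite absz_gt0. Qed.

Let qd : (q * d)%N = `|N|%N. Proof. exact: divnK. Qed.

Let q_gt0 : (0 < q)%N.
Proof. by have := N_gt0; rewrite -qd muln_gt0 => /andP[]. Qed.

Let NE : N = sgz N * (q%:Z * d%:Z).
Proof. by rewrite -PoszM qd -intEsg. Qed.

Let sgN2 : sgz N * sgz N = 1.
Proof. by case: sgzP (hN) => //; rewrite eqxx. Qed.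

Let rat_int (r : rat) (m : int) : r = m%:Q -> chiQ chi r = chi m.
Proof. by move=> ->; rewrite /chiQ denq_int eqxx numq_int. Qed.

Let ratE (n : int) : n%:Q * (d%:Z)%:Q / N%:Q = (sgz N)%:Q * (n%:Q / q%:Q).
Proof.
have q0 : q%:Q != 0 by rewrite intr_eq0 eqz_nat -lt0n.
have d0 : (d%:Z)%:Q != 0 by rewrite intr_eq0 eqz_nat -lt0n modulus_gt0.
have s2 : (sgz N)%:Q * (sgz N)%:Q = 1 by rewrite -intrM sgN2.
have s0 : (sgz N)%:Q != 0 by rewrite intr_eq0 sgz_eq0.
have sV : (sgz N)%:Q^-1 = (sgz N)%:Q by apply: (mulfI s0); rewrite mulfV// s2.
rewrite {1}NE !intrM !invfM sV.
by field; rewrite q0 d0.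
Qed.

Lemma wt_mul (m : int) : wt (m * q) = chi (sgz N * m).
Proof.
rewrite /wt ratE; apply: rat_int; rewrite !intrM mulfK//.
by rewrite intr_eq0 eqz_nat -lt0n.
Qed.

Lemma wt_ndvd (n : int) : ~~ (q %| n)%Z -> wt n = 0.
Proof.
move=> qn; rewrite /wt /chiQ; case: ifP => // /eqP dn.
exfalso; move/negP: qn; apply.
have q0 : q%:Q != 0 by rewrite intr_eq0 eqz_nat -lt0n.
have s2 : (sgz N)%:Q * (sgz N)%:Q = 1 by rewrite -intrM sgN2.
have := divq_num_den (n%:Q * (d%:Z)%:Q / N%:Q); rewrite dn divr1 ratE.
set m := numq _ => e.
have : n%:Q = (sgz N * m * q)%:Q.
  by rewrite !intrM e [X in X * _]mulrA s2 mul1r divfK.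
by move=> /intr_inj ->; exact: dvdz_mull.
Qed.

Lemma chi_mod (m k : int) : chi (m + k * d) = chi m.
Proof.
have per (j : nat) n : chi (n + (j * d)%:Z) = chi n.
  elim: j n => [|j IH] n; first by rewrite mul0n addr0.
  by rewrite mulSn PoszD addrA IH dchar_periodic.
case: k => j; first by rewrite -PoszM per.
by rewrite -[LHS](per j.+1) NegzE mulNr -PoszM subrK.
Qed.

Lemma wt_addN (n : int) : wt (n + N) = wt n.
Proof.
have [qn|qn] := boolP (q %| n)%Z; last first.
  rewrite !wt_ndvd// rpredDr// NE; apply/dvdz_mull; exact: dvdz_mulr.
have -> : n + N = ((n %/ q)%Z + sgz N * d) * q.
  by rewrite mulrDl divzK// [in LHS]NE; ring.
rewrite -[in RHS](divzK qn) !wt_mul mulrDr mulrA sgN2 mul1r.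
by have := chi_mod (sgz N * (n %/ q)%Z) 1; rewrite mul1r.
Qed.

Lemma wt_addMN (n k : int) : wt (n + k * N) = wt n.
Proof.
have h (m : nat) j : wt (j + m%:Z * N) = wt j.
  elim: m => [|m IH]; first by rewrite mul0r addr0.
  by rewrite -addn1 PoszD mulrDl mul1r addrA wt_addN.
case: k => m; first exact: h.
by rewrite -[LHS](h m.+1) NegzE mulNr subrK.
Qed.

Lemma chi1 : chi 1 = 1.
Proof.
have c0 : chi 1 != 0 by rewrite dchar_neq0 coprimez_sym /coprimez gcdz1.
by apply: (mulfI c0); rewrite -dcharM mulr1 mulr1.
Qed.

(** The powers of chi(m) are again values of chi, which is bounded; by Bernoulli's inequality the
    powers of a number of modulus above 1 are not. *)
Lemma normc_chi_le1 (m : int) : normc (chi m) <= 1.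
Proof.
have [K hK] := dchar_bounded chi.
have hp (n : nat) : normc (chi m) ^+ n <= K.
  apply: le_trans (hK (m ^+ n)); rewrite -normcX.
  suff -> : chi m ^+ n = chi (m ^+ n) by [].
  by elim: n => [|n IH]; rewrite ?expr0 ?chi1// !exprS dcharM IH.
rewrite leNgt; apply/negP => h.
have x0 : 0 < normc (chi m) - 1 by rewrite subr_gt0.
have bern (n : nat) : 1 + n%:R * (normc (chi m) - 1) <= normc (chi m) ^+ n.
  elim: n => [|n IH]; first by rewrite mul0r addr0 expr0.
  rewrite exprS -natr1; move: IH; set y := _ ^+ n; set x := normc _ in h x0 *.
  set k : R := n%:R; have k0 : 0 <= k by rewrite /k.
  move=> h1; have h2 : 0 <= x * (y - (1 + k * (x - 1))).
    by rewrite mulr_ge0// ?subr_ge0//; lra.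
  have h3 : 0 <= k * (x - 1) ^+ 2 by rewrite mulr_ge0// sqr_ge0.
  nra.
have K0 : 0 <= K by apply: le_trans (hp 0%N); rewrite expr0.
have := archi_boundP (divr_ge0 K0 (ltW x0)); set B := Num.bound _.
rewrite ltr_pdivrMr// => hB; have := bern B; have := hp B; lra.
Qed.

(** Bezout gives u with chi(u) chi(m) = 1, and two moduli at most 1 with product 1 both equal 1. *)
Lemma normc_chi_coprime (m : int) : coprimez m d -> normc (chi m) = 1.
Proof.
move=> md; apply/le_anti; rewrite normc_chi_le1 /=.
have [[u v] /= e] := coprimezP _ _ md.
have h : chi u * chi m = 1.
  rewrite -dcharM; have -> : u * m = 1 + (- v) * d by rewrite -e; ring.
  by rewrite chi_mod chi1.
have : normc (chi u) * normc (chi m) = 1 by rewrite -normcM h normc1.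
have := normc_chi_le1 u; have := normc_ge0 (chi u); have := normc_ge0 (chi m).
by nra.
Qed.

Lemma normc_wt_le1 (n : int) : normc (wt n) <= 1.
Proof. by rewrite /wt /chiQ; case: ifP => _; rewrite ?normc0// normc_chi_le1. Qed.

Definition wt2 (n : int) : R := normc (wt n) ^+ 2.

Lemma wt2_ge0 n : 0 <= wt2 n. Proof. by rewrite exprn_ge0// normc_ge0. Qed.

Lemma wt2_mul (i : nat) : wt2 (i%:Z * q) = (coprime d i)%:R.
Proof.
rewrite /wt2 wt_mul.
have co : coprimez (sgz N * i) d = coprime d i.
  have s1 : `|sgz N|%N = 1%N by case: sgzP (hN) => //; rewrite eqxx.
    rewrite coprimez_sym /coprimez /gcdz abszM s1 mul1n.
  by rewrite /coprime eqz_nat.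
have [c|c] := boolP (coprime d i).
  by rewrite normc_chi_coprime ?expr1n// co.
suff -> : chi (sgz N * i) = 0 by rewrite normc0 expr0n.
by apply/eqP; rewrite -[_ == 0]negbK dchar_neq0 co.
Qed.

(** By periodicity the window may start at 0. It then contains the multiples iq with 0 <= i < d, and
    |chi|^2 is the indicator of the i prime to d. *)
Lemma wt2_window (b : int) : \sum_(0 <= j < `|N|) wt2 (b + j%:Z) = (totient d)%:R.
Proof.
have per n : wt2 (n + `|N|%:Z) = wt2 n.
  rewrite /wt2; congr (normc _ ^+ 2).
  by rewrite abszEsg wt_addMN.
pose S (b : int) := \sum_(0 <= j < `|N|) wt2 (b + j%:Z).
have SS c : S (c + 1) = S c.
  rewrite /S; have := N_gt0; case: `|N|%N per => // m per _.
  rewrite big_nat_recr// [in RHS]big_nat_recl//= addr0 addrC; congr (_ + _).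
    by rewrite -[RHS]per -addrA; congr (wt2 (_ + _)); rewrite -PoszD add1n.
  by apply: eq_bigr => j _; rewrite -addrA -PoszD add1n.
have S0 : S b = S 0.
  case: b => m.
    by elim: m => [//|m IH]; rewrite -addn1 PoszD SS.
  elim: m => [|m IH]; first by rewrite -[LHS]SS.
  by rewrite -[LHS]SS -IH; congr S; rewrite !NegzE; lia.
rewrite -/(S b) S0 /S -qd.
have blk (m : nat) : \sum_(0 <= j < q * m) wt2 (0 + j%:Z) = \sum_(0 <= i < m) (coprime d i)%:R.
  elim: m => [|m IH]; first by rewrite muln0 !big_geq.
  rewrite (@big_cat_nat _ _ _ (q * m)%N) ?leq_mul//= IH [RHS]big_nat_recr//=; congr (_ + _).
  rewrite big_ltn; last by rewrite ltn_mul2l q_gt0 /=.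
  rewrite add0r mulnC PoszM wt2_mul big_nat_cond big1 ?addr0// => j.
  rewrite andbT => /andP[j1 j2]; rewrite add0r /wt2 wt_ndvd ?normc0 ?expr0n//.
  apply/negP => /dvdnP[t]; rewrite absz_nat => jE; move: j1 j2; rewrite jE.
  rewrite ltn_mul2r q_gt0 /= mulnC ltn_mul2l q_gt0 /= ltnS => h /(leq_trans h).
  by rewrite ltnn.
rewrite blk totient_count_coprime natr_sum; apply: eq_bigr => i _.
by [].
Qed.

Lemma normc_wb_const : normc (wb_const N d : C) ^+ 2 = `|N|%:R / (totient d)%:R.
Proof.
rewrite -normcX /wb_const sqr_sqrtc normc_real normrM normfV normr_nat.
by rewrite -intr_norm.
Qed.

End Weights.

(** * Symmetric ranges of integers *)

Section IntegerRanges.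
Context {V : nmodType}.

(** The integers from -M to M - 1: the indices of the M-th partial sums of both halves of [zseries],
    hence the asymmetry at the ends. *)
Definition zrange (M : nat) : seq int :=
  [seq Posz n | n <- iota 0 M] ++ [seq Negz n | n <- iota 0 M].

Lemma mem_zrange M (n : int) : (n \in zrange M) = (- M%:Z <= n < M%:Z).
Proof.
rewrite mem_cat; apply/orP/andP => [[/mapP[m]|/mapP[m]]|[h1 h2]].
- by rewrite mem_iota => mM ->; lia.
- by rewrite mem_iota => mM ->; lia.
case: n h1 h2 => m h1 h2; [left|right]; apply: map_f; rewrite mem_iota; lia.
Qed.

Lemma zrange_uniq M : uniq (zrange M).
Proof.
rewrite cat_uniq !map_inj_uniq ?iota_uniq//; try by move=> a b [].
by rewrite andbT; apply/hasPn => x /mapP[m _ ->]; apply/negP => /mapP[].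
Qed.

Lemma big_zrange M (F : int -> V) : \sum_(n <- zrange M) F n =
  \sum_(0 <= n < M) F (Posz n) + \sum_(0 <= n < M) F (Negz n).
Proof. by rewrite big_cat !big_map /index_iota subn0. Qed.

Lemma zrange_window M (b : int) (L : nat) (F : int -> V) :
  - M%:Z <= b -> b + L%:Z <= M%:Z ->
  \sum_(n <- zrange M | b <= n < b + L%:Z) F n = \sum_(0 <= j < L) F (b + j%:Z).
Proof.
move=> b1 b2; rewrite -big_filter.
have -> : \sum_(0 <= j < L) F (b + j%:Z) = \sum_(n <- [seq b + j%:Z | j <- iota 0 L]) F n.
  by rewrite big_map /index_iota subn0.
apply: perm_big; apply: uniq_perm.
- by rewrite filter_uniq// zrange_uniq.
- by rewrite map_inj_uniq ?iota_uniq// => x y /addrI [].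
move=> n; rewrite mem_filter mem_zrange; apply/idP/mapP.
  move=> h; exists (`|n - b|%N); first by rewrite mem_iota; lia.
  by lia.
by move=> [j]; rewrite mem_iota => hj ->; lia.
Qed.

End IntegerRanges.

(** * Integration over the unit cube and orthogonality of characters *)

Section CubeIntegrals.
Context {R : realType}.
Local Notation C := R[i].
Local Notation mu := (@lebesgue_measure R).
Local Notation leb3 := (@leb3 R).
Local Notation mR := (measurableTypeR R).
Local Notation T3 := (mR * mR * mR)%type.
Local Notation cube := (@unit_cube R).
Local Notation I01 := (`[0%R, 1%R]%classic : set mR).

Lemma measurable_cube : measurable (cube : set T3).
Proof. by apply: measurable_rect3; exact: measurable_itv. Qed.

Let mI : measurable I01. Proof. exact: measurable_itv. Qed.

Lemma lebesgue_I01 : mu I01 = 1%E.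
Proof. by rewrite lebesgue_measure_itv /= lte_fin ltr01 oppr0 adde0. Qed.

Lemma Rintegral_I01_cst (r : R) : Rintegral mu I01 (fun=> r) = r.
Proof.
transitivity (r * fine (mu I01)); first exact: Rintegral_cst.
by rewrite lebesgue_I01 mulr1.
Qed.

Lemma integrable_I01_cst (r : R) : mu.-integrable I01 (EFin \o (fun=> r)).
Proof.
apply/integrableP; split; first exact: measurable_cst.
have -> : (\int[mu]_(x in I01) `|(EFin \o (fun=> r)) x| = `|r%:E| * mu I01)%E.
  by rewrite integral_cst.
by rewrite lebesgue_I01 mule1 ltry.
Qed.

Lemma cube_tensor (u v : mR -> R) :
  mu.-integrable I01 (EFin \o u) -> mu.-integrable I01 (EFin \o v) ->
  leb3.-integrable cube (EFin \o (fun p => u p.1.1 * v p.1.2)) /\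
  Rintegral leb3 cube (fun p => u p.1.1 * v p.1.2) =
    Rintegral mu I01 u * Rintegral mu I01 v.
Proof.
move=> iu iv.
have [h1 h2] := rect3_integral mI mI mI iu iv (integrable_I01_cst 1).
have e : (fun p : T3 => u p.1.1 * v p.1.2 * 1) = (fun p : T3 => u p.1.1 * v p.1.2).
  by apply/funext => p; rewrite mulr1.
rewrite e Rintegral_I01_cst mulr1 in h1 h2; split=> //; exact: h2.
Qed.

Lemma cube_ctensor (U V : mR -> C) :
  cintegrable mu I01 U -> cintegrable mu I01 V ->
  cintegrable leb3 cube (fun p => U p.1.1 * V p.1.2) /\
  cintegral leb3 cube (fun p => U p.1.1 * V p.1.2) =
    cintegral mu I01 U * cintegral mu I01 V.
Proof.
move=> [u1 u2] [v1 v2].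
have [a1 b1] := cube_tensor u1 v1; have [a2 b2] := cube_tensor u2 v2.
have [a3 b3] := cube_tensor u1 v2; have [a4 b4] := cube_tensor u2 v1.
have eR : (fun p : T3 => Re (U p.1.1 * V p.1.2)) =
    fun p : T3 => 1 * (Re (U p.1.1) * Re (V p.1.2)) + (-1) * (Im (U p.1.1) * Im (V p.1.2)).
  by apply/funext => p; rewrite ReM; ring.
have eI : (fun p : T3 => Im (U p.1.1 * V p.1.2)) =
    fun p : T3 => 1 * (Re (U p.1.1) * Im (V p.1.2)) + 1 * (Im (U p.1.1) * Re (V p.1.2)).
  by apply/funext => p; rewrite ImM; ring.
split; first split.
- rewrite eR; exact: (integrable_lin2 measurable_cube 1 (-1) a1 a2).
- rewrite eI; exact: (integrable_lin2 measurable_cube 1 1 a3 a4).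
apply: complex_eqP; rewrite /cintegral ?ReM ?ImM /=.
  rewrite eR (Rintegral_lin2 measurable_cube 1 (-1) a1 a2) b1 b2; ring.
rewrite eI (Rintegral_lin2 measurable_cube 1 1 a3 a4) b3 b4; ring.
Qed.

Lemma e2pi_cderat (j : R) u : cderat (fun a => e2pi (j * a)) ((2 * pi * j)%:C * 'i * e2pi (j * u)) u.
Proof.
have h := cder_cexp ((2 * pi * j)%:C * 'i) u.
have e : (fun a => e2pi (j * a)) = fun a : R => cexp ((2 * pi * j)%:C * 'i * a%:C).
  apply/funext => a; rewrite /e2pi; congr cexp.
  by apply: complex_eqP; rewrite ?ReM ?ImM /=; ring.
by rewrite (congr1 (fun F => F u) e) e.
Qed.

Lemma cintegral_e2pi (j : int) :
  cintegral mu I01 (fun a => e2pi (j%:~R * a)) = (j == 0)%:R.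
Proof.
have [->|j0] := eqVneq j 0.
  have -> : (fun a : mR => e2pi (0%:~R * a)) = fun=> 1.
    by apply/funext => a; rewrite mul0r e2pi0.
  by apply: complex_eqP; rewrite /cintegral /= Rintegral_I01_cst.
pose c : C := (2 * pi * j%:~R)%:C * 'i.
have c0 : c != 0.
  rewrite mulf_neq0//; last by rewrite eq_complex /= oner_eq0 andbF.
  rewrite -normc_gt0 normc_real normr_gt0 !mulf_neq0 ?intr_eq0// gt_eqF// pi_gt0//.
have -> : (fun a : mR => e2pi (j%:~R * a)) = fun a => c^-1 * (c * e2pi (j%:~R * a)).
  by apply/funext => a; rewrite mulKf.
have dF u : cderat (fun a => c^-1 * e2pi (j%:~R * a)) (c^-1 * (c * e2pi (j%:~R * u))) u.
  have := cderatM (cder_cst_fun c^-1 u) (e2pi_cderat j%:~R u).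
  by apply: cderat_eq; rewrite mul0r add0r.
rewrite (@cFTC2 _ (fun a => c^-1 * e2pi (j%:~R * a)) _ 0 1 ltr01 (fun u _ => dF u)); last first.
  move=> u _; eexists.
  exact: (cderatM (cder_cst_fun c^-1 u) (cderatM (cder_cst_fun c u) (e2pi_cderat j%:~R u))).
by rewrite mulr1 mulr0 e2pi0 e2pi_int subrr.
Qed.

End CubeIntegrals.

(** * Partial sums of Weil-Brezin series of Schwartz functions *)

Section Pairing.
Context {R : realType} (N : int) (d : nat) (chi : dirichlet_character R d).
Local Notation C := R[i].
Local Notation leb3 := (@leb3 R).
Local Notation mR := (measurableTypeR R).
Local Notation T3 := (mR * mR * mR)%type.
Local Notation wt := (wt N chi).
Local Notation wt2 := (wt2 N chi).
Hypotheses (hN : N != 0) (hd : (d %| `|N|)%N).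
Implicit Types (phi : R -> C) (f g : schwartz R).

Definition wbterm phi (n : int) (p : T3) : C :=
  wt n * phi (n%:~R + N%:~R * p.1.2) * e2pi (n%:~R * p.1.1).

Definition wbpart phi M (p : T3) : C := \sum_(n <- zrange M) wbterm phi n p.

Lemma wbpartE phi M p : wbpart phi M p = \sum_(n <- zrange M) wbterm phi n p.
Proof. by []. Qed.

Definition wbsum phi (p : T3) : C := zseries (fun n => wbterm phi n p).

Lemma weil_brezinE phi (p : T3) :
  weil_brezin N chi phi p = wb_const N d * e2pi (N%:~R * p.2) * wbsum phi p.
Proof. by []. Qed.

Lemma lerch_funE k s (p : T3) :
  lerch_fun N chi k s p = e2pi (N%:~R * p.2) * wbsum (delta_density k (1 - s)) p.
Proof.
rewrite /lerch_fun /wbsum; congr (_ * zseries _); apply/funext => n.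
have AC (x y z t : C) : x * y * z * t = x * (y * t) * z by ring.
by rewrite AC /wbterm /delta_density addrAC subrr add0r.
Qed.

Let NR : (N%:~R : R) != 0. Proof. by rewrite intr_eq0. Qed.

Lemma cderiv_conj f k : cder (fun x => conjc (cderiv k f x)) (fun x => conjc (cderiv k.+1 f x)).
Proof.
move=> x; have [h1 h2] := schwartz_cder f k x; split.
  by under eq_fun do rewrite Re_conj; rewrite Re_conj.
by under eq_fun do rewrite Im_conj; rewrite Im_conj; exact: is_deriveN.
Qed.

Lemma is_schwartz_conj f : is_schwartz (fun x => conjc (f x)).
Proof.
have := @is_schwartz_family _ (fun k x => conjc (cderiv k f x)) (cderiv_conj f).
rewrite (_ : (fun x => conjc (cderiv 0 f x)) = fun x => conjc (f x)); last first.
  by apply/funext => x; rewrite cderiv0.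
apply => j k; have [M hM] := (schwartzP f).2 j k; exists M => x.
by rewrite normc_conj.
Qed.

Definition sconj f : schwartz R := mkS (is_schwartz_conj f).

Lemma sum_inv_sq M : \sum_(0 <= n < M) (1 + n%:R ^+ 2)^-1 <= 4 :> R.
Proof.
(* A telescoping strengthening: 1 / (1 + y^2) is at most 4/(y+1) - 4/(y+2). *)
suff : \sum_(0 <= n < M) (1 + n%:R ^+ 2)^-1 <= 4 - 4 / M.+1%:R :> R.
  by move/le_trans; apply; rewrite gerBl divr_ge0.
elim: M => [|M IH]; first by rewrite big_geq// divr1 subrr.
rewrite big_nat_recr//=; apply: (le_trans (lerD IH (lexx _))).
rewrite -(natr1 M.+1) -(natr1 M); have : 0 <= M%:R :> R by [].
move: (M%:R) => y y0; rewrite -lerBrDl.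
have -> : 4 - 4 / (y + 1 + 1) - (4 - 4 / (y + 1)) = 4 / ((y + 1) * (y + 1 + 1)).
  by field; apply/andP; split; apply: lt0r_neq0; lra.
have p1 : 0 < 1 + y ^+ 2 by rewrite ltr_pwDl// sqr_ge0.
have p2 : 0 < (y + 1) * (y + 1 + 1) by apply: mulr_gt0; lra.
rewrite ler_pdivlMr// mulrC ler_pdivrMr//.
have := sqr_ge0 (y - 1); have := sqr_ge0 y; rewrite !expr2; lra.
Qed.

Lemma schwartz_term_bound f (X : R) : exists2 K : R, 0 <= K &
  forall (n : int) (p : T3), `|p.1.2| <= X ->
  normc (wbterm f n p) <= K / (1 + n%:~R ^+ 2).
Proof.
have [M hM] := schwartz_decay f.
have M0 : 0 <= M.
  have := hM 0; rewrite expr0n /= addr0 divr1; exact/le_trans/normc_ge0.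
pose Y := `|N%:~R| * X.
(* From 1 + n^2 <= 2 (1 + x^2) (1 + (n + x)^2), where x = Nc has modulus at most Y. *)
exists (M * (2 * (1 + Y ^+ 2))).
  by rewrite mulr_ge0// mulr_ge0// addr_ge0// sqr_ge0.
move=> n p pX; rewrite /wbterm normcM normc_e2pi mulr1 normcM.
set x := N%:~R * p.1.2.
have xY : x ^+ 2 <= Y ^+ 2.
  have : `|x| <= Y by rewrite normrM ler_wpM2l.
  by move=> h; rewrite -[x ^+ 2]real_normK ?num_real//; apply: lerXn2r => //;
    rewrite nnegrE//; apply: le_trans h.
apply: (@le_trans _ _ (1 * (M / (1 + (n%:~R + x) ^+ 2)))).
  apply: ler_pM; rewrite ?normc_ge0//.
  exact: normc_wt_le1.
rewrite mul1r -mulrA; apply: ler_wpM2l => //.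
have p0 (t : R) : 0 < 1 + t ^+ 2 by rewrite ltr_pwDl ?sqr_ge0.
rewrite ler_pdivlMr// ler_pdivrMl//; move: (n%:~R : R) => m.
apply: (@le_trans _ _ ((1 + (m + x) ^+ 2) * (2 * (1 + x ^+ 2)))).
  have := sqr_ge0 (m + 2 * x); have := sqr_ge0 (x * (m + x)); rewrite !expr2; lra.
by apply: ler_wpM2l; [exact: ltW|lra].
Qed.

Lemma half_sums_bound (u : int -> C) (K : R) : 0 <= K ->
  (forall n, normc (u n) <= K / (1 + n%:~R ^+ 2)) ->
  forall M, normc (\sum_(0 <= n < M) u (Posz n)) <= 4 * K /\
    normc (\sum_(0 <= n < M) u (Negz n)) <= 4 * K.
Proof.
move=> K0 hu M; split; apply: (le_trans (normc_sum _ _ _)).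
  apply: (@le_trans _ _ (\sum_(0 <= n < M) K * (1 + n%:R ^+ 2)^-1)).
    by apply: ler_sum => n _; exact: hu.
  by rewrite -mulr_sumr mulrC; apply: ler_wpM2r => //; exact: sum_inv_sq.
apply: (@le_trans _ _ (\sum_(0 <= n < M) K * (1 + n%:R ^+ 2)^-1)).
  apply: ler_sum => n _; apply: (le_trans (hu _)); apply: ler_wpM2l => //.
  rewrite lef_pV2 ?posrE ?ltr_pwDl ?sqr_ge0// lerD2l.
  by rewrite NegzE mulrNz sqrrN ler_sqr ?nnegrE// ler_nat.
by rewrite -mulr_sumr mulrC; apply: ler_wpM2r => //; exact: sum_inv_sq.
Qed.

Lemma abs_ccvg (u : nat -> C) (K : R) :
  (forall n, normc (u n) <= K / (1 + n%:R ^+ 2)) ->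
  ccvg (fun M => \sum_(0 <= n < M) u n) (clim (fun M => \sum_(0 <= n < M) u n)).
Proof.
move=> hu.
have key (v : nat -> R) : (forall n, `|v n| <= K / (1 + n%:R ^+ 2)) -> cvgn (series v).
  move=> hv; apply: normed_cvg.
  have K0 : 0 <= K.
    by have := hv 0%N; rewrite expr0n /= addr0 divr1; exact: le_trans (normr_ge0 _).
  have e M : [normed series v] M = \sum_(0 <= n < M) `|v n| by [].
  apply: nondecreasing_is_cvgn.
    by apply/nondecreasing_seqP => n; rewrite !e big_nat_recr//= lerDl.
  exists (K * 4) => _ [M _ <-]; rewrite e.
  apply: (@le_trans _ _ (\sum_(0 <= n < M) K * (1 + n%:R ^+ 2)^-1)).
    by apply: ler_sum => n _; exact: hv.
  by rewrite -mulr_sumr; apply: ler_wpM2l => //; exact: sum_inv_sq.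
split=> /=.
  under eq_fun do rewrite Re_sum.
  have : cvgn (series (fun n => Re (u n))).
    by apply: key => n; apply: le_trans (normc_Re _) (hu n).
  exact.
under eq_fun do rewrite Im_sum.
have : cvgn (series (fun n => Im (u n))).
  by apply: key => n; apply: le_trans (normc_Im _) (hu n).
exact.
Qed.

Lemma wbpart_ccvg_half phi p (l1 l2 : C) :
  ccvg (fun M => \sum_(0 <= n < M) wbterm phi (Posz n) p) l1 ->
  ccvg (fun M => \sum_(0 <= n < M) wbterm phi (Negz n) p) l2 ->
  ccvg (fun M => wbpart phi M p) (wbsum phi p).
Proof.
move=> h1 h2; rewrite /wbsum /zseries (ccvg_lim h1) (ccvg_lim h2).
by under eq_fun do rewrite /wbpart big_zrange; exact: ccvgD.
Qed.

Lemma wbpart_schwartz_cvg f p : ccvg (fun M => wbpart f M p) (wbsum f p).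
Proof.
have [K K0 hK] := schwartz_term_bound f `|p.1.2|.
apply: wbpart_ccvg_half; apply: (@abs_ccvg _ K) => n; first exact: hK.
apply: (le_trans (hK _ _ (lexx _))); apply: ler_wpM2l => //.
rewrite lef_pV2 ?posrE ?ltr_pwDl ?sqr_ge0// lerD2l.
by rewrite NegzE mulrNz sqrrN ler_sqr ?nnegrE// ler_nat.
Qed.

Lemma wbpart_schwartz_bound f (X : R) : exists2 K : R, 0 <= K &
  forall M (p : T3), `|p.1.2| <= X -> normc (wbpart f M p) <= K.
Proof.
have [K K0 hK] := schwartz_term_bound f X.
exists (4 * K + 4 * K); first by rewrite addr_ge0 ?mulr_ge0.
move=> M p pX; have [h1 h2] := half_sums_bound K0 (fun n => hK n p pX) M.
by rewrite /wbpart big_zrange; apply: (le_trans (normcD _ _)); exact: lerD.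
Qed.

Lemma cmeasurable_comp3 (phi : mR -> C) (b : R) : cmeasurable phi ->
  cmeasurable (fun p : T3 => phi (b + N%:~R * p.1.2)).
Proof.
move=> [m1 m2]; have ml : measurable_fun setT (fun p : T3 => b + N%:~R * p.1.2 : mR).
  apply: measurable_funD; first exact: measurable_cst.
  apply: measurable_funM; first exact: measurable_cst.
  by apply: measurableT_comp; [exact: measurable_snd|exact: measurable_fst].
by split; [exact: (measurableT_comp m1 ml)|exact: (measurableT_comp m2 ml)].
Qed.

Lemma cmeasurable_wbterm (phi : mR -> C) n : cmeasurable phi -> cmeasurable (wbterm phi n).
Proof.
move=> mphi; apply: cmeasurableM.
  by apply: cmeasurableM; [exact: cmeasurable_cst|exact: cmeasurable_comp3].
apply: cmeasurable_e2pi; apply: measurable_funM; first exact: measurable_cst.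
by apply: measurableT_comp; [exact: measurable_fst|exact: measurable_fst].
Qed.

Lemma cmeasurable_wbpart (phi : mR -> C) M : cmeasurable phi -> cmeasurable (wbpart phi M).
Proof. by move=> mphi; apply: cmeasurable_sum => n; exact: cmeasurable_wbterm. Qed.

Lemma cmeasurable_ccvg (u : nat -> T3 -> C) v : (forall n, cmeasurable (u n)) ->
  (forall p, ccvg (u^~ p) (v p)) -> cmeasurable v.
Proof.
move=> mu_ uv; split.
  apply: (@measurable_fun_cvg _ _ _ _ (fun n p => Re (u n p))).
    by move=> n; exact: (mu_ n).1.
  by move=> p _; exact: (uv p).1.
apply: (@measurable_fun_cvg _ _ _ _ (fun n p => Im (u n p))).
  by move=> n; exact: (mu_ n).2.
by move=> p _; exact: (uv p).2.
Qed.

Lemma cmeasurable_wbsum_schwartz f : cmeasurable (wbsum f).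
Proof.
apply: (cmeasurable_ccvg (u := fun M => wbpart f M)); last exact: wbpart_schwartz_cvg.
by move=> M; apply: cmeasurable_wbpart; exact: cmeasurable_schwartz.
Qed.

End Pairing.

Lemma conjc_mul (R : realType) (z w : R[i]) : conjc (z * w) = conjc z * conjc w.
Proof. exact: rmorphM. Qed.

(** * Pairing over the unit cube as an integral over the real line *)

Section PairingFormula.
Context {R : realType} (N : int) (d : nat) (chi : dirichlet_character R d).
Local Notation C := R[i].
Local Notation mu := (@lebesgue_measure R).
Local Notation leb3 := (@leb3 R).
Local Notation mR := (measurableTypeR R).
Local Notation T3 := (mR * mR * mR)%type.
Local Notation cube := (@unit_cube R).
Local Notation I01 := (`[0%R, 1%R]%classic : set mR).
Local Notation wt := (wt N chi).
Local Notation wt2 := (wt2 N chi).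
Local Notation wbpart := (wbpart N chi).
Local Notation wbsum := (wbsum N chi).
Hypotheses (hN : N != 0) (hd : (d %| `|N|)%N).
Implicit Types (f g : schwartz R).

Let NR : (N%:~R : R) != 0. Proof. by rewrite intr_eq0. Qed.
Let mI : measurable I01. Proof. exact: measurable_itv. Qed.
Let mC : measurable (cube : set T3). Proof. exact: measurable_cube. Qed.

Section Kernel.
Variable phi : mR -> C.
Hypothesis mphi : cmeasurable phi.
Hypothesis iphi : forall g, cintegrable mu setT (fun x => phi x * g x).

Let shift_integrable f (n m : int) : cintegrable mu I01
  (fun c => phi (n%:~R + N%:~R * c) * f (m%:~R + N%:~R * c)).
Proof.
have sg := @is_schwartz_affine R f 1 ((m - n)%:~R) (oner_neq0 _).
have [i1 i2] := cintegrable_affine n%:~R NR (iphi (mkS sg)).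
have e : (fun c : mR => phi (n%:~R + N%:~R * c) * f (m%:~R + N%:~R * c)) =
    fun c => phi (N%:~R * c + n%:~R) * mkS sg (N%:~R * c + n%:~R).
  apply/funext => c; rewrite [n%:~R + _]addrC; congr (_ * _).
  rewrite -[RHS]/(f (1 * (N%:~R * c + n%:~R) + (m - n)%:~R)); congr (f _).
  by rewrite intrB; ring.
by rewrite e; split; apply: (integrableS measurableT mI _ _) => //.
Qed.

Let e2pi_integrable (j : int) : cintegrable mu I01 (fun a => e2pi (j%:~R * a)).
Proof.
apply: (@cintegrable_le _ _ _ mu I01 mI _ (fun=> 1)).
- by apply: cmeasurable_e2pi; apply: measurable_funM => //; exact: measurable_cst.
- by move=> x _; rewrite normc_e2pi.
- exact: integrable_I01_cst.
Qed.

Let termE f n m (p : T3) :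
  wbterm N chi phi n p * conjc (wbterm N chi (fun x => conjc (f x)) m p) =
  (wt n * conjc (wt m)) * (e2pi ((n - m)%:~R * p.1.1) *
    (phi (n%:~R + N%:~R * p.1.2) * f (m%:~R + N%:~R * p.1.2))).
Proof.
rewrite /wbterm (conjc_mul (wt m * _)) (conjc_mul (wt m)) conjcK -e2piN intrB mulrBl e2piD; ring.
Qed.

(** The conjugate inside and the one outside leave f itself, with characters e((n - m) a).
    Integration over a keeps only the diagonal n = m. *)
Lemma wbpart_product_integral f M :
  let F := fun p : T3 => wbpart phi M p * conjc (wbpart (fun x => conjc (f x)) M p) in
  cintegrable leb3 cube F /\
  cintegral leb3 cube F = \sum_(n <- zrange M) (wt2 n)%:C *
    cintegral mu I01 (fun c => phi (n%:~R + N%:~R * c) * f (n%:~R + N%:~R * c)).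
Proof.
pose T n m (p : T3) := e2pi ((n - m)%:~R * p.1.1) *
    (phi (n%:~R + N%:~R * p.1.2) * f (m%:~R + N%:~R * p.1.2)).
have hT n m := cube_ctensor (e2pi_integrable (n - m)) (shift_integrable f n m).
have iT n m : cintegrable leb3 cube (fun p => (wt n * conjc (wt m)) * T n m p).
  by apply: cintegrableZ => //; exact: (hT n m).1.
have FE : (fun p : T3 => wbpart phi M p * conjc (wbpart (fun x => conjc (f x)) M p)) =
    fun p => \sum_(n <- zrange M) \sum_(m <- zrange M) (wt n * conjc (wt m)) * T n m p.
  apply/funext => p; rewrite !wbpartE rmorph_sum mulr_suml.
  apply: eq_bigr => n _; rewrite mulr_sumr; apply: eq_bigr => m _.
  exact: termE.
have iS n : cintegrable leb3 cube (fun p => \sum_(m <- zrange M) (wt n * conjc (wt m)) * T n m p).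
  by apply: cintegrable_sum => // m _; exact: iT.
rewrite /= FE; split; first by apply: cintegrable_sum => // n _; exact: iS.
rewrite cintegral_sum//.
rewrite big_seq [RHS]big_seq; apply: eq_bigr => n nM.
rewrite cintegral_sum//.
rewrite (bigD1_seq n) ?zrange_uniq//= big1 ?addr0; last first.
  move=> m mn; rewrite cintegralZ//; last exact: (hT n m).1.
  rewrite (hT n m).2 cintegral_e2pi subr_eq0 eq_sym (negPf mn).
  by rewrite mul0r mulr0.
rewrite cintegralZ//; last exact: (hT n n).1.
by rewrite (hT n n).2 cintegral_e2pi subrr eqxx mul1r mulc_conj.
Qed.

(** As c runs over [0, 1], n + Nc runs over the interval between n and n + N. For a non-integer x
    the n whose interval contains x are |N| consecutive integers, with no ambiguity at the ends. *)
Lemma window_affine (x : R) : ~ (exists n : int, 1 * x + 0 = n%:~R) ->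
  exists b : int, forall n : int,
    (0 <= (x - n%:~R) / N%:~R <= 1) = (b <= n < b + `|N|%N%:Z).
Proof.
rewrite mul1r addr0 => xZ; pose m := Num.floor x.
have k1 (n : int) : (n%:~R <= x) = (n <= m) by rewrite floor_ge_int.
have k2 (n : int) : (x <= n%:~R) = (m < n).
  rewrite le_eqVlt floor_lt_int; have [e|//] := eqVneq x n%:~R.
  by exfalso; apply: xZ; exists n.
have [N0|N0] := ltP 0 N.
  exists (m + 1 - N) => n.
  have NR0 : 0 < N%:~R :> R by rewrite ltr0z.
  rewrite ler_pdivlMr// mul0r subr_ge0 k1 ler_pdivrMr// mul1r lerBlDr -intrD k2.
  by rewrite gtz0_abs//; lia.
exists (m + 1) => n.
have N1 : N < 0 by rewrite lt_neqAle hN.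
have NR0 : N%:~R < 0 :> R by rewrite ltrz0.
rewrite ler_ndivlMr// mul0r subr_le0 k2 ler_ndivrMr// mul1r lerBrDr -intrD k1.
by rewrite ltz0_abs//; lia.
Qed.

(** After the substitution x = n + Nc the diagonal terms become integrals over overlapping
    intervals. This is the total weight that they put on x; off the integers it increases to its
    final value phi(d). *)
Definition window_weight M (x : R) : R :=
  \sum_(n <- zrange M) wt2 n * (0 <= (x - n%:~R) / N%:~R <= 1)%R%:R.

Lemma window_weight_ge0 M x : 0 <= window_weight M x.
Proof. by apply: sumr_ge0 => n _; rewrite mulr_ge0 ?wt2_ge0. Qed.

Lemma window_weight_ev (x : R) : ~ (exists n : int, 1 * x + 0 = n%:~R) ->
  exists M0, forall M, (M0 <= M)%N -> window_weight M x = (totient d)%:R.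
Proof.
move=> /window_affine[b hb]; exists (`|b| + `|N|)%N => M hM.
rewrite /window_weight -(wt2_window chi hN hd b) -(zrange_window (M := M)); try lia.
rewrite [RHS]big_mkcond; apply: eq_bigr => n _; rewrite hb.
by case: ifP; rewrite ?mulr1 ?mulr0.
Qed.

Lemma window_weight_le (x : R) : ~ (exists n : int, 1 * x + 0 = n%:~R) ->
  forall M, window_weight M x <= (totient d)%:R.
Proof.
move=> /window_weight_ev[M0 hM0] M.
rewrite -(hM0 (maxn M0 M)) ?leq_maxl//.
have nd : nondecreasing_seq (fun M => window_weight M x).
  apply/nondecreasing_seqP => n; rewrite /window_weight !big_zrange !big_nat_recr//=.
  rewrite addrACA lerDl addr_ge0// mulr_ge0 ?wt2_ge0//.
by apply: nd; rewrite leq_maxr.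
Qed.

Let affine_piece f (n : int) :
  cintegral mu I01 (fun c => phi (n%:~R + N%:~R * c) * f (n%:~R + N%:~R * c)) =
  `|N%:~R^-1|%:C * cintegral mu setT (fun x =>
    ((0 <= (x - n%:~R) / N%:~R <= 1)%R%:R)%:C * (phi x * f x)).
Proof.
pose F (c : mR) := phi (n%:~R + N%:~R * c) * f (n%:~R + N%:~R * c).
have iF : cintegrable mu setT (fun c => (\1_I01 c)%:C * F c).
  have [i1 i2] := shift_integrable f n n.
  split.
    have := (integrable_mkcond _ mI).1 i1; rewrite restrict_EFin.
    congr (_.-integrable _ (EFin \o _)); apply/funext => c; rewrite ReMl.
    by rewrite patchE indicE; case: ifP; rewrite ?mul1r ?mul0r.
  have := (integrable_mkcond _ mI).1 i2; rewrite restrict_EFin.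
  congr (_.-integrable _ (EFin \o _)); apply/funext => c; rewrite ImMl.
  by rewrite patchE indicE; case: ifP; rewrite ?mul1r ?mul0r.
have -> : cintegral mu I01 F = cintegral mu setT (fun c => (\1_I01 c)%:C * F c).
  apply: complex_eqP; rewrite /cintegral /= Rintegral_mkcond; apply: eq_Rintegral => c _;
    by rewrite ?ReMl ?ImMl patchE indicE; case: ifP; rewrite ?mul1r ?mul0r.
have NV : N%:~R^-1 != 0 :> R by rewrite invr_eq0.
rewrite (cintegral_affine (- n%:~R / N%:~R) NV iF); congr (_ * _).
apply: cintegral_ext => x _.
have e : N%:~R^-1 * x + - n%:~R / N%:~R = (x - n%:~R) / N%:~R by ring.
rewrite e /F; congr (_ %:C * _).
  by rewrite indicE mem_setE in_itv.
by congr (phi _ * f _); rewrite mulrCA mulfV// mulr1 addrCA subrr addr0.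
Qed.

Lemma wbpart_product_cvg f :
  ccvg (fun M => \sum_(n <- zrange M) (wt2 n)%:C *
    cintegral mu I01 (fun c => phi (n%:~R + N%:~R * c) * f (n%:~R + N%:~R * c)))
  ((`|N%:~R^-1| * (totient d)%:R)%:C * cintegral mu setT (fun x => phi x * f x)).
Proof.
pose h x := phi x * f x.
have ih : cintegrable mu setT h by exact: iphi.
have mh : cmeasurable h by apply: cmeasurableM => //; exact: cmeasurable_schwartz.
have mind (n : int) : measurable_fun setT (fun x : mR => (0 <= (x - n%:~R) / N%:~R <= 1)%R%:R : R).
  have -> : (fun x : mR => (0 <= (x - n%:~R) / N%:~R <= 1)%R%:R : R) =
      (\1_I01 : mR -> R) \o (fun x => (x - n%:~R) / N%:~R).
    by apply/funext => x /=; rewrite indicE mem_setE in_itv.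
  apply: measurableT_comp; first exact: measurable_indic.
  by apply: measurable_funM; [apply: measurable_funB => //; exact: measurable_cst|exact: measurable_cst].
have iw n : cintegrable mu setT (fun x => ((0 <= (x - n%:~R) / N%:~R <= 1)%R%:R)%:C * h x).
  apply: (@cintegrable_le _ _ _ mu setT measurableT _ (fun x => 1 * `|Re (h x)| + 1 * `|Im (h x)|)).
  - by apply: cmeasurableM => //; apply: cmeasurable_real.
  - move=> x _; rewrite normcM normc_real normr_nat.
    apply: (@le_trans _ _ (1 * normc (h x))).
      by apply: ler_wpM2r; [exact: normc_ge0|case: (_ <= _ <= _)].
    by rewrite !mul1r; exact: normc_le_ReIm.
  - by apply: integrable_lin2 => //; apply: integrable_norm; [exact: ih.1|exact: ih.2].
have -> : (fun M => \sum_(n <- zrange M) (wt2 n)%:C *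
    cintegral mu I01 (fun c => phi (n%:~R + N%:~R * c) * f (n%:~R + N%:~R * c))) =
    fun M => `|N%:~R^-1|%:C * cintegral mu setT (fun x => (window_weight M x)%:C * h x).
  apply/funext => M.
  transitivity (`|N%:~R^-1|%:C * cintegral mu setT (fun x => \sum_(n <- zrange M) (wt2 n)%:C *
      (((0 <= (x - n%:~R) / N%:~R <= 1)%R%:R)%:C * h x))).
    rewrite cintegral_sum//; last by move=> n _; apply: cintegrableZ.
    rewrite mulr_sumr; apply: eq_bigr => n _; rewrite affine_piece cintegralZ//.
    by rewrite mulrCA.
  congr (_ * _); apply: cintegral_ext => x _; rewrite /window_weight rmorph_sum mulr_suml.
  by apply: eq_bigr => n _; rewrite [in RHS](rmorphM _ (wt2 n)) mulrA.
rewrite rmorphM -mulrA; apply: ccvgM (ccvg_cst _) _.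
rewrite -cintegralZ//.
apply: (@cintegral_dominated_cvg _ _ _ mu setT measurableT _ _
  (fun x => (totient d)%:R * `|Re (h x)| + (totient d)%:R * `|Im (h x)|)).
- move=> M; apply: cmeasurableM => //; apply: cmeasurable_real.
  rewrite /window_weight; apply: measurable_sum => n.
  by apply: measurable_funM => //; exact: measurable_cst.
- by apply: cmeasurableM => //; exact: cmeasurable_cst.
- apply: (ae_imp _ (ae_affine_nonint 0 (oner_neq0 R))) => x xZ _.
  apply: ccvgM (ccvg_cst _); have [M0 hM0] := window_weight_ev xZ.
  apply/ccvg_normc; apply: cvg_near_cst; exists M0 => // M hM.
  by rewrite (hM0 M hM) subrr normc0.
- apply: integrable_lin2 => //; apply: integrable_norm; [exact: ih.1|exact: ih.2].
- apply: (ae_imp _ (ae_affine_nonint 0 (oner_neq0 R))) => x xZ _ M.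
  rewrite normcM normc_real ger0_norm ?window_weight_ge0// -mulrDr.
  apply: ler_pM; rewrite ?normc_ge0 ?window_weight_ge0 ?window_weight_le//.
  exact: normc_le_ReIm.
Qed.

(** Dominated convergence needs a majorant for the partial sums of phi only, since those of f are
    bounded on the cube. The squared modulus |N| / phi(d) of the constant, the Jacobian 1 / |N| and
    the window weight phi(d) multiply to 1. Stated for general phi, it serves both injectivity of
    the Weil-Brezin map and the Lerch functions. *)
Theorem wb_pairing (A : T3 -> C) (G : T3 -> R) f : cmeasurable A ->
  {ae leb3, forall p, cube p -> ccvg (fun M => wbpart phi M p) (A p)} ->
  leb3.-integrable cube (EFin \o G) ->
  {ae leb3, forall p, cube p -> forall M, normc (wbpart phi M p) <= G p} ->
  cintegral leb3 cube (fun p => wb_const N d * e2pi (N%:~R * p.2) * A p *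
    conjc (weil_brezin N chi (fun x => conjc (f x)) p)) =
  cintegral mu setT (fun x => phi x * f x).
Proof.
move=> mA cA iG bG.
pose c0 : R := normc (wb_const N d : C) ^+ 2.
have c00 : 0 <= c0 by rewrite exprn_ge0// normc_ge0.
pose Q M := wbpart (fun x => conjc (f x)) M.
pose v (p : T3) := c0%:C * (A p * conjc (wbsum (fun x => conjc (f x)) p)).
have vE p : wb_const N d * e2pi (N%:~R * p.2) * A p *
    conjc (weil_brezin N chi (fun x => conjc (f x)) p) = v p.
  rewrite weil_brezinE (conjc_mul (_ * _) (wbsum _ _)) (conjc_mul (wb_const N d)) /v /c0 -mulc_conj.
  have h : e2pi (N%:~R * p.2) * conjc (e2pi (N%:~R * p.2)) = 1 :> C.
    by rewrite mulc_conj normc_e2pi expr1n.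
  transitivity (wb_const N d * conjc (wb_const N d) * (e2pi (N%:~R * p.2) *
    conjc (e2pi (N%:~R * p.2))) * (A p * conjc (wbsum (fun x => conjc (f x)) p))).
    by ring.
  by rewrite h mulr1.
rewrite (@cintegral_ext _ _ _ leb3 cube _ v); last by move=> p _; exact: vE.
have [K K0 hK] := @wbpart_schwartz_bound _ N d chi (sconj f) 1.
have cQ p : ccvg (fun M => Q M p) (wbsum (fun x => conjc (f x)) p).
  exact: (@wbpart_schwartz_cvg _ N d chi (sconj f) p).
have mQ M : cmeasurable (Q M).
  by apply: (@cmeasurable_wbpart _ N d chi); exact: (cmeasurable_schwartz (sconj f)).
have h1 : ccvg (fun M => cintegral leb3 cube (fun p => c0%:C * (wbpart phi M p * conjc (Q M p))))
    (cintegral leb3 cube v).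
  apply: (@cintegral_dominated_cvg _ _ _ leb3 cube mC _ _
    (fun p => c0 * K * G p + 0 * G p)).
  - move=> M; apply: cmeasurableM; first exact: cmeasurable_cst.
    apply: cmeasurableM; last by apply: cmeasurable_conj.
    exact: cmeasurable_wbpart.
  - apply: cmeasurableM; first exact: cmeasurable_cst.
    apply: cmeasurableM => //; apply: cmeasurable_conj.
    exact: (@cmeasurable_wbsum_schwartz _ N d chi (sconj f)).
  - apply: (ae_imp _ cA) => p h /h cp.
    by apply: ccvgM (ccvg_cst _) _; apply: ccvgM => //; exact: ccvg_conj.
  - exact: integrable_lin2.
  - apply: (ae_imp _ bG) => p h cp M; have hp := h cp M.
    rewrite mul0r addr0 !normcM normc_real ger0_norm// -mulrA; apply: ler_wpM2l => //.
    rewrite mulrC normc_conj; apply: ler_pM; rewrite ?normc_ge0//.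
    apply: hK; case: cp => -[_ /=]; rewrite in_itv /= => /andP[p0 p1] _.
    by rewrite ger0_norm.
have h2 := ccvgM (ccvg_cst c0%:C) (wbpart_product_cvg f).
apply: ccvg_unique h1 _.
have e M : cintegral leb3 cube (fun p => c0%:C * (wbpart phi M p * conjc (Q M p))) =
    c0%:C * (\sum_(n <- zrange M) (wt2 n)%:C *
    cintegral mu I01 (fun c => phi (n%:~R + N%:~R * c) * f (n%:~R + N%:~R * c))).
  have [i1 i2] := wbpart_product_integral f M.
  by rewrite cintegralZ// i2.
under eq_fun do rewrite e.
move: h2; congr ccvg; rewrite mulrA -rmorphM /= /c0 normc_wb_const.
have t0 : (totient d)%:R != 0 :> R.
  by rewrite pnatr_eq0 -lt0n totient_gt0; exact: modulus_gt0 hN hd.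
have -> : `|N|%:R / (totient d)%:R * (`|N%:~R^-1| * (totient d)%:R) = 1 :> R.
  have nN : (`|N|%N)%:R != 0 :> R by rewrite pnatr_eq0 -lt0n absz_gt0.
  rewrite normfV -intr_norm -abszE -pmulrn.
  by field; rewrite t0 nN.
by rewrite rmorph1 mul1r.
Qed.

End Kernel.

Lemma continuous_ae0 (h : mR -> R) : continuous (h : R -> R) -> {ae mu, forall x, h x = 0} ->
  forall x, h x = 0.
Proof.
move=> ch [A [mA A0 hA]] x; apply/eqP; apply: contraT => hx.
have hp : 0 < `|h x| by rewrite normr_gt0.
have /cvgrPdist_lt /(_ _ hp) := ch x.
move=> [e /= e0 he].
pose J : set mR := `[x, x + e / 2]%classic.
have sub : J `<=` A.
  move=> y; rewrite /J /= in_itv /= => /andP[y1 y2]; apply: hA => /= hy.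
  have := he y; rewrite /ball_ /= hy subr0 ltxx => h1; apply: notF; apply: h1.
  by rewrite distrC ger0_norm; lra.
have : (mu J <= mu A)%E.
  by apply: le_measure; rewrite ?inE//; exact: measurable_itv.
rewrite A0 (lebesgue_measure_itv `[x, x + e / 2]) /= lte_fin ltrDl divr_gt0//.
by rewrite -EFinD lee_fin; lra.
Qed.

Lemma schwartz_conj_integral_eq0 f : cintegrable mu setT (fun x => f x * conjc (f x)) ->
  cintegral mu setT (fun x => f x * conjc (f x)) = 0 -> f = 0.
Proof.
move=> [iF _] e.
pose F (x : mR) : R := Re (f x * conjc (f x)).
have FE x : F x = normc (f x) ^+ 2 by rewrite /F mulc_conj.
have F0 x : 0 <= F x by rewrite FE exprn_ge0// normc_ge0.
have fi := integrable_fin_num measurableT iF.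
have h0 : (\int[mu]_x (F x)%:E = 0)%E.
  rewrite -(fineK fi); congr (_%:E).
  exact: (congr1 (fun z : C => Re z) e).
have mF := measurable_int _ iF.
have := @ae_eq_integral_abs _ _ R mu setT measurableT (EFin \o F) mF.
under eq_integral do rewrite /= ger0_norm ?F0//.
move=> hiff; have /hiff ae0 := h0.
have cF : continuous (F : R -> R).
  have := schwartz_cder f 0; rewrite cderiv0 => /cder_continuous[c1 c2] x.
  rewrite (_ : (F : R -> R) = fun x => Re (f x) * Re (f x) + Im (f x) * Im (f x)); last first.
    by apply/funext => y; rewrite /F ReM Im_conj Re_conj; ring.
  by apply: cvgD; apply: cvgM; [exact: c1|exact: c1|exact: c2|exact: c2].
have Fz : forall x, F x = 0.
  apply: continuous_ae0 => //; apply: (ae_imp _ ae0) => x /(_ Logic.I) /= /eqP.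
  by rewrite eqe => /eqP.
apply: schwartz_eqP => x; have := Fz x; rewrite FE => /eqP.
by rewrite expf_eq0 /= normc_eq0 => /eqP.
Qed.

(** For h in the kernel, the pairing formula with phi = h and test function the conjugate of h gives
    0 for the integral of |h|^2, and h is continuous. *)
Lemma wb_map_inj : injective (@wb_map R N d chi).
Proof.
move=> f g fg; apply/eqP; rewrite -subr_eq0; apply/eqP.
have [h hE] : exists h, h = f - g by exists (f - g).
rewrite -hE.
have hW : weil_brezin N chi h = 0.
  have -> : (h : R -> C) = ((-1) *: g + f : schwartz R).
    by rewrite hE scaleN1r addrC.
  rewrite weil_brezin_lin; have := congr1 (fun F : schwartzH N chi => F : heisenberg R -> C) fg.
  by rewrite /= => ->; rewrite scaleN1r addNr.
have mh : cmeasurable (h : mR -> C) by exact: cmeasurable_schwartz.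
have ih g' : cintegrable mu setT (fun x => h x * g' x).
  have [B [B0 hB]] := sbounded_ex 0 h.
  have [i1 i2] := cintegrable_schwartz g'.
  apply: (@cintegrable_le _ _ _ mu setT measurableT _
      (fun x => B * `|Re (g' x)| + B * `|Im (g' x)|)).
  - by apply: cmeasurableM => //; exact: cmeasurable_schwartz.
  - move=> x _; rewrite normcM -mulrDr; apply: ler_pM; rewrite ?normc_ge0//.
      by have := hB 0%N 0%N x isT isT; rewrite expr0 mul1r cderiv0.
    exact: normc_le_ReIm.
  - by apply: integrable_lin2 => //; apply: integrable_norm.
have [K K0 hK] := @wbpart_schwartz_bound _ N d chi h 1.
have cp : {ae leb3, forall p : T3, cube p -> ccvg (fun M => wbpart h M p) (wbsum h p)}.
  exists set0; split=> // p /= hp; exfalso; apply: hp => _.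
  exact: (@wbpart_schwartz_cvg _ N d chi h p).
have iK : leb3.-integrable cube (EFin \o (fun=> K)).
  have [h1 _] := cube_tensor (integrable_I01_cst K) (integrable_I01_cst 1).
  by move: h1; congr (_.-integrable _ (EFin \o _)); apply/funext => p; rewrite mulr1.
have bK : {ae leb3, forall p : T3, cube p -> forall M, normc (wbpart h M p) <= K}.
  exists set0; split=> // p /= hp; exfalso; apply: hp => pc M; apply: hK.
  case: pc => -[_ /=]; rewrite in_itv /= => /andP[p0 p1] _.
  by rewrite ger0_norm.
have mW : cmeasurable (wbsum h) by exact: (@cmeasurable_wbsum_schwartz _ N d chi h).
apply: schwartz_conj_integral_eq0; first exact: (ih (sconj h)).
apply: etrans (esym (wb_pairing mh ih (sconj h) mW cp iK bK)) _.
transitivity (cintegral leb3 cube (fun=> 0 : C)); last exact: cintegral0.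
apply: (@cintegral_ext _ _ _ leb3 cube) => p _.
by rewrite -weil_brezinE hW mul0r.
Qed.

End PairingFormula.

(** * Completeness for real and complex sequences *)

Section CauchySequences.
Context {R : realType}.
Local Notation C := R[i].

Lemma real_cauchy_cvg (u : nat -> R) :
  (forall e, 0 < e -> exists n0, forall n, (n0 <= n)%N -> `|u n0 - u n| < e) ->
  cvgn u.
Proof.
move=> h; apply/cauchy_cvgP; apply: cauchy_exP => e e0.
by have [n0 hn0] := h e e0; exists (u n0); exists n0.
Qed.

Lemma complex_cauchy_ccvg (u : nat -> C) :
  (forall e, 0 < e -> exists n0, forall n, (n0 <= n)%N -> normc (u n0 - u n) < e) ->
  exists l, ccvg u l.
Proof.
move=> h.
have c1 : cvgn (fun n => Re (u n)).
  apply: real_cauchy_cvg => e e0; have [n0 hn0] := h e e0; exists n0 => n n0n.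
  by rewrite -ReB; apply: le_lt_trans (normc_Re _) (hn0 n n0n).
have c2 : cvgn (fun n => Im (u n)).
  apply: real_cauchy_cvg => e e0; have [n0 hn0] := h e e0; exists n0 => n n0n.
  by rewrite -ImB; apply: le_lt_trans (normc_Im _) (hn0 n n0n).
by exists (limn (fun n => Re (u n)) +i* limn (fun n => Im (u n))).
Qed.

End CauchySequences.

(** * Measurability of limits that need not exist everywhere *)

Section MeasurableLimits.
Context {R : realType} {dT : measure_display} {T : measurableType dT}.
Local Notation C := R[i].

(** Cauchy's criterion expresses the set of convergence through countable unions and intersections,
    hence as a measurable set. It is needed because [zseries] takes a value also where the series
    diverges. *)
Definition cauchy_set (u : nat -> T -> R) : set T :=
  \bigcap_k \bigcup_n0 \bigcap_n [set x | `|u n0 x - u (n0 + n)%N x| <= k.+1%:R^-1].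

Lemma cauchy_setP (u : nat -> T -> R) x : cauchy_set u x <-> cvgn (u^~ x).
Proof.
split=> [h|].
  apply: real_cauchy_cvg => e e0.
  have [k hk] : exists k : nat, k.+1%:R^-1 < e.
    exists (Num.bound e^-1); rewrite invf_plt ?posrE//.
    apply: lt_trans (archi_boundP _) _; first by rewrite invr_ge0 ltW.
    by rewrite ltr_nat.
  have [n0 _ hn0] := h k Logic.I; exists n0 => n n0n.
  apply: le_lt_trans hk; rewrite -(subnKC n0n).
  exact: hn0.
move=> /cauchy_cvgP /cauchy_ballP h k _.
have k0 : (0 : R) < k.+1%:R^-1 by rewrite invr_gt0.
have [[A B] [[n1 _ hA] [n2 _ hB]] hAB] := h _ k0.
exists (maxn n1 n2) => // n _ /=; apply/ltW.
apply: (hAB (u (maxn n1 n2) x, u (maxn n1 n2 + n)%N x)); split=> /=.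
  by apply: hA => /=; rewrite leq_maxl.
by apply: hB => /=; apply: leq_trans (leq_maxr n1 n2) (leq_addr _ _).
Qed.

Lemma measurable_cauchy_set (u : nat -> T -> R) :
  (forall n, measurable_fun setT (u n)) -> measurable (cauchy_set u).
Proof.
move=> mu_; apply: bigcapT_measurable => k; apply: bigcupT_measurable => n0.
apply: bigcapT_measurable => n.
have mf : measurable_fun setT (fun x => `|u n0 x - u (n0 + n)%N x|).
  by apply: measurableT_comp => //; exact: measurable_funB.
have := mf measurableT `]-oo, k.+1%:R^-1]%classic (measurable_itv _).
by rewrite setTI; congr measurable; apply/seteqP; split=> x /=; rewrite in_itv.
Qed.

Lemma measurable_lim (u : nat -> T -> R) : (forall n, measurable_fun setT (u n)) ->
  measurable_fun setT (fun x => limn (u^~ x)).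
Proof.
move=> mu_; have mC := measurable_cauchy_set mu_.
(* Off the set of convergence [lim] takes the default value [point]. With u replaced there by this
   constant, the sequence converges everywhere to the function in question. *)
pose v n x := \1_(cauchy_set u) x * u n x + (point : R) * \1_(~` cauchy_set u) x.
apply: (@measurable_fun_cvg _ _ _ _ v).
  move=> n; apply: measurable_funD; apply: measurable_funM => //.
  by apply: measurable_indic; exact: measurableC.
move=> x _; rewrite /v !indicE; have [xC|xC] := pselect (cauchy_set u x).
  rewrite mem_set// memNset; last by move=> /(_ xC).
  under eq_fun do rewrite mul1r mulr0 addr0.
  exact/cauchy_setP.
rewrite memNset// mem_set//.
under eq_fun do rewrite mul0r mulr1 add0r.
suff -> : limn (u^~ x) = point by exact: cvg_cst.
by apply: getPN => l hl; apply: xC; apply/cauchy_setP; apply/cvg_ex; exists l.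
Qed.

Lemma cmeasurable_clim (u : nat -> T -> C) : (forall n, cmeasurable (u n)) ->
  cmeasurable (fun x => clim (u^~ x)).
Proof.
move=> mu_; split.
  by have := @measurable_lim (fun n x => Re (u n x)) (fun n => (mu_ n).1).
by have := @measurable_lim (fun n x => Im (u n x)) (fun n => (mu_ n).2).
Qed.

Lemma cmeasurable_zseries (u : int -> T -> C) : (forall n, cmeasurable (u n)) ->
  cmeasurable (fun x => zseries (u^~ x)).
Proof.
move=> mu_; apply: cmeasurableD.
  by apply: cmeasurable_clim => m; exact: cmeasurable_sum.
by apply: cmeasurable_clim => m; exact: cmeasurable_sum.
Qed.

Variable mu : {measure set T -> \bar R}.

Lemma ae_cintegrable_le (D : set T) (f : T -> C) (g : T -> R) : measurable D ->
  cmeasurable f -> {ae mu, forall x, D x -> normc (f x) <= g x} ->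
  mu.-integrable D (EFin \o g) -> cintegrable mu D f.
Proof.
move=> mD [m1 m2] fg ig.
have key (h : T -> R) : measurable_fun setT h ->
    {ae mu, forall x, D x -> `|h x| <= g x} -> mu.-integrable D (EFin \o h).
  move=> mh hg; apply/integrableP.
  have mh' : measurable_fun D (EFin \o h) by apply/measurable_EFinP; exact: measurable_funTS.
  split=> //; have /integrableP[mg ig'] := ig.
  apply: le_lt_trans ig'; apply: ae_ge0_le_integral => //.
  - exact: measurableT_comp.
  - exact: measurableT_comp.
  - apply: (ae_imp _ hg) => x hx Dx /=; rewrite lee_fin.
    by apply: (le_trans (hx Dx)); exact: ler_norm.
split; apply: key => //; apply: (ae_imp _ fg) => x hx Dx.
  exact: le_trans (normc_Re _) (hx Dx).
exact: le_trans (normc_Im _) (hx Dx).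
Qed.

End MeasurableLimits.

(** * Conditionally convergent two-sided series *)

Section TwoSidedSeries.
Context {R : realType}.
Local Notation C := R[i].
Implicit Types (u v : int -> C) (a : C).

Definition pos_half u M : C := \sum_(0 <= n < M) u (Posz n).
Definition neg_half u M : C := \sum_(0 <= n < M) u (Negz n).

Definition zcvg u : Prop :=
  (exists l, ccvg (pos_half u) l) /\ (exists l, ccvg (neg_half u) l).

Definition zhas_sum u (l : C) : Prop := exists l1 l2,
  [/\ ccvg (pos_half u) l1, ccvg (neg_half u) l2 & l = l1 + l2].

Lemma zhas_sumP u l : zhas_sum u l -> zseries u = l.
Proof.
by move=> [l1 [l2 [h1 h2 ->]]]; rewrite /zseries -/(pos_half u) -/(neg_half u) (ccvg_lim h1) (ccvg_lim h2).
Qed.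

Lemma zcvg_has_sum u : zcvg u -> zhas_sum u (zseries u).
Proof.
move=> [[l1 h1] [l2 h2]]; exists l1, l2; split=> //.
by rewrite /zseries -/(pos_half u) -/(neg_half u) (ccvg_lim h1) (ccvg_lim h2).
Qed.

Lemma zhas_sum_cvg u l : zhas_sum u l -> zcvg u.
Proof. by move=> [l1 [l2 [h1 h2 _]]]; split; [exists l1|exists l2]. Qed.

Lemma zhas_sum_lin a u v l l' : zhas_sum u l -> zhas_sum v l' ->
  zhas_sum (fun n => a * u n + v n) (a * l + l').
Proof.
move=> [l1 [l2 [h1 h2 ->]]] [m1 [m2 [k1 k2 ->]]].
exists (a * l1 + m1), (a * l2 + m2); split; last by ring.
  have := ccvg_lin a h1 k1; congr ccvg; apply/funext => M.
  by rewrite /pos_half big_split -mulr_sumr.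
have := ccvg_lin a h2 k2; congr ccvg; apply/funext => M.
by rewrite /neg_half big_split -mulr_sumr.
Qed.

Lemma zhas_sum0 : zhas_sum (fun=> 0) 0.
Proof.
exists 0, 0; split; last by rewrite addr0.
  by have := ccvg_cst (0 : C); congr ccvg; apply/funext => M; rewrite /pos_half big1.
by have := ccvg_cst (0 : C); congr ccvg; apply/funext => M; rewrite /neg_half big1.
Qed.

Lemma zhas_sumZ a u l : zhas_sum u l -> zhas_sum (fun n => a * u n) (a * l).
Proof.
move=> h; have := zhas_sum_lin a h zhas_sum0; rewrite addr0.
by congr zhas_sum; apply/funext => n; rewrite addr0.
Qed.

Lemma zhas_sum_big (I : eqType) (r : seq I) (u : I -> int -> C) (l : I -> C) :
  (forall i, i \in r -> zhas_sum (u i) (l i)) ->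
  zhas_sum (fun n => \sum_(i <- r) u i n) (\sum_(i <- r) l i).
Proof.
elim: r => [|i r IH] h.
  rewrite big_nil; have := zhas_sum0; congr zhas_sum; apply/funext => n.
  by rewrite big_nil.
rewrite big_cons; have hr : forall k, k \in r -> zhas_sum (u k) (l k).
  by move=> k kr; apply: h; rewrite inE kr orbT.
have := zhas_sum_lin 1 (h i (mem_head _ _)) (IH hr); rewrite mul1r.
by congr zhas_sum; apply/funext => n; rewrite big_cons mul1r.
Qed.

Lemma zhas_sum_delta (w : C) : zhas_sum (fun n => w * (n == 0)%:R) w.
Proof.
exists w, 0; split; last by rewrite addr0.
- apply: ccvgS_inv; have := ccvg_cst w; congr ccvg; apply/funext => M.
  rewrite /pos_half big_nat_recl//= mulr1 big1 ?addr0// => i _.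
  by rewrite mulr0.
- have := ccvg_cst (0 : C); congr ccvg; apply/funext => M.
  by rewrite /neg_half big1// => i _; rewrite mulr0.
Qed.

(** The shift moves the single term u(0) from the nonnegative half to the negative half, so
    conditional convergence of the halves is enough. *)
Lemma zhas_sum_succ u l : zhas_sum u l -> zhas_sum (fun n => u (n + 1)) l.
Proof.
move=> [l1 [l2 [h1 h2 ->]]]; exists (l1 - u 0), (l2 + u 0); split; last by ring.
- have := ccvgD (ccvgS h1) (ccvg_cst (- u 0)); congr ccvg; apply/funext => M.
  rewrite /pos_half big_nat_recl//= addrAC subrr add0r.
  by apply: eq_bigr => n _; congr u; rewrite -PoszD addn1.
- apply: ccvgS_inv.
  have := ccvgD h2 (ccvg_cst (u 0)); congr ccvg; apply/funext => M.
  rewrite /neg_half [RHS]big_nat_recl//= addrC; congr (_ + _).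
  by apply: eq_bigr => n _; congr u; rewrite !NegzE; lia.
Qed.

Lemma zhas_sum_pred u l : zhas_sum u l -> zhas_sum (fun n => u (n - 1)) l.
Proof.
move=> [l1 [l2 [h1 h2 ->]]]; exists (l1 + u (-1)), (l2 - u (-1)); split; last by ring.
- apply: ccvgS_inv.
  have := ccvgD h1 (ccvg_cst (u (-1))); congr ccvg; apply/funext => M.
  rewrite /pos_half [RHS]big_nat_recl//= addrC; congr (_ + _).
  by apply: eq_bigr => n _; congr u; lia.
- have := ccvgD (ccvgS h2) (ccvg_cst (- u (-1))); congr ccvg; apply/funext => M.
  rewrite /neg_half big_nat_recl//= addrAC subrr add0r.
  by apply: eq_bigr => n _; congr u; rewrite !NegzE; lia.
Qed.

Lemma zhas_sum_shift u l (j : int) : zhas_sum u l -> zhas_sum (fun n => u (n + j)) l.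
Proof.
have S (m : nat) v : zhas_sum v l -> zhas_sum (fun n => v (n + m%:Z)) l.
  elim: m v => [|m IH] v h; first by under eq_fun do rewrite addr0.
  have := IH _ (zhas_sum_succ h); congr zhas_sum; apply/funext => n.
  by congr v; lia.
have P (m : nat) v : zhas_sum v l -> zhas_sum (fun n => v (n - m%:Z)) l.
  elim: m v => [|m IH] v h; first by under eq_fun do rewrite subr0.
  have := IH _ (zhas_sum_pred h); congr zhas_sum; apply/funext => n.
  by congr v; lia.
case: j => m h; first exact: S.
by have := P m.+1 u h; congr zhas_sum; apply/funext => n; congr u; rewrite NegzE.
Qed.

Lemma zhas_sum_dominated u (K : R) : (forall n, normc (u n) <= K / (1 + n%:~R ^+ 2)) ->
  zhas_sum u (zseries u) /\ normc (zseries u) <= 8 * K.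
Proof.
move=> hu; have K0 : 0 <= K.
  have := hu 0; rewrite expr0n /= addr0 divr1; exact/le_trans/normc_ge0.
have hN n : normc (u (Negz n)) <= K / (1 + n%:R ^+ 2).
  apply: (le_trans (hu _)); apply: ler_wpM2l => //.
  rewrite lef_pV2 ?posrE ?ltr_pwDl ?sqr_ge0// lerD2l.
  by rewrite NegzE mulrNz sqrrN ler_sqr ?nnegrE// ler_nat.
have c1 := @abs_ccvg _ (fun n => u (Posz n)) K (fun n => hu n).
have c2 := @abs_ccvg _ (fun n => u (Negz n)) K hN.
have b := half_sums_bound K0 hu.
split; first by apply: zcvg_has_sum; split; eexists; [exact: c1|exact: c2].
apply: (le_trans (normcD _ _)).
have -> : 8 * K = 4 * K + 4 * K by ring.
apply: lerD; first by apply: ccvg_le c1 _ => M; exact: (b M).1.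
by apply: ccvg_le c2 _ => M; exact: (b M).2.
Qed.

End TwoSidedSeries.

(** * Left translates of Weil-Brezin series *)

Section Translation.
Context {R : realType} (N : int) (d : nat) (chi : dirichlet_character R d).
Local Notation C := R[i].
Local Notation leb3 := (@leb3 R).
Local Notation mR := (measurableTypeR R).
Local Notation T3 := (mR * mR * mR)%type.
Local Notation cube := (@unit_cube R).
Local Notation wt := (wt N chi).
Local Notation wbterm := (wbterm N chi).
Local Notation wbsum := (wbsum N chi).
Hypotheses (hN : N != 0) (hd : (d %| `|N|)%N).
Implicit Types (f : schwartz R) (g p : heisenberg R) (phi : R -> C).

Definition wbfun phi p : C := e2pi (N%:~R * p.2) * wbsum phi p.

Lemma wbfunE phi p : wbfun phi p = e2pi (N%:~R * p.2) * wbsum phi p.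
Proof. by []. Qed.

Definition translate_coeff g (m n : int) : C :=
  e2pi (N%:~R * g.2) * (wt (n - m) * e2pi ((n - m)%:~R * g.1.1)).

(** Translation by g adds N g.1.2 = rho + m to the argument of phi. The integer m is absorbed by
    reindexing, where it cancels the character e(ma) coming from the group law; only rho remains, as
    a shift of phi and a character. Translates with equal rho can thus be compared coefficient by
    coefficient. *)
Lemma wbfun_translate phi g p (rho : R) (m : int) :
  N%:~R * g.1.2 = rho + m%:~R ->
  zcvg (fun n => wbterm phi n (hmul g p)) ->
  zhas_sum (fun n => e2pi (N%:~R * p.2) * (translate_coeff g m n *
      (e2pi (rho * p.1.1) * phi (n%:~R + N%:~R * p.1.2 + rho)) *
      e2pi (n%:~R * p.1.1)))
    (wbfun phi (hmul g p)).
Proof.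
move=> hm /zcvg_has_sum h.
have := zhas_sumZ (e2pi (N%:~R * (hmul g p).2)) (zhas_sum_shift (- m) h).
congr zhas_sum; apply/funext => n.
rewrite /wbterm /translate_coeff /hmul /=.
have -> : (n - m)%:~R + N%:~R * (g.1.2 + p.1.2) = n%:~R + N%:~R * p.1.2 + rho.
  by rewrite mulrDr hm intrB; ring.
have -> : N%:~R * (g.2 + p.2 + g.1.2 * p.1.1) =
    N%:~R * g.2 + N%:~R * p.2 + (rho * p.1.1 + m%:~R * p.1.1).
  by rewrite -mulrDl -hm; ring.
have -> : (n - m)%:~R * (g.1.1 + p.1.1) =
    (n - m)%:~R * g.1.1 + (n%:~R * p.1.1 + - (m%:~R * p.1.1)).
  by rewrite intrB; ring.
rewrite !e2piD.
have : e2pi (m%:~R * p.1.1) * e2pi (- (m%:~R * p.1.1)) = 1 :> C.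
  by rewrite -e2piD subrr e2pi0.
move: (e2pi (m%:~R * p.1.1)) (e2pi (- (m%:~R * p.1.1))) => x y xy.
transitivity (e2pi (N%:~R * p.2) *
  (e2pi (N%:~R * g.2) * (wt (n - m) * e2pi ((n - m)%:~R * g.1.1)) *
   (e2pi (rho * p.1.1) * phi (n%:~R + N%:~R * p.1.2 + rho)) *
   e2pi (n%:~R * p.1.1)) * (x * y)); first by ring.
by rewrite xy mulr1.
Qed.

(** Here rho = 0 and m is a multiple of N, which the periodic coefficients do not see. *)
Lemma wbfun_int phi g p : heisenberg_int g ->
  zcvg (fun n => wbterm phi n (hmul g p)) -> wbfun phi (hmul g p) = wbfun phi p.
Proof.
move=> [i [j [k ->]]] hz.
pose g0 : heisenberg R := (i%:~R, j%:~R, k%:~R).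
have hm : N%:~R * g0.1.2 = 0 + (j * N)%:~R.
  by rewrite add0r intrM mulrC.
have h := wbfun_translate hm hz.
have e : (fun n : int => e2pi (N%:~R * p.2) * (translate_coeff (i%:~R, j%:~R, k%:~R) (j * N) n *
      (e2pi (0 * p.1.1) * phi (n%:~R + N%:~R * p.1.2 + 0)) *
      e2pi (n%:~R * p.1.1))) = fun n => e2pi (N%:~R * p.2) * wbterm phi n p.
  apply/funext => n; congr (_ * _); rewrite /translate_coeff /= -!intrM !e2pi_int.
  rewrite mul1r mulr1 mul0r e2pi0 mul1r addr0 /wbterm; congr (_ * _ * _).
  by rewrite -mulNr wt_addMN.
rewrite e in h.
have h' := zhas_sumZ (e2pi (- (N%:~R * p.2))) h.
have e1 (x : C) : e2pi (- (N%:~R * p.2)) * (e2pi (N%:~R * p.2) * x) = x.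
  by rewrite mulrA -e2piD addNr e2pi0 mul1r.
rewrite (_ : (fun n => _) = fun n => wbterm phi n p) in h'; last first.
  by apply/funext => n; rewrite e1.
transitivity (e2pi (N%:~R * p.2) * (e2pi (- (N%:~R * p.2)) * wbfun phi (hmul g0 p))).
  by rewrite mulrA -e2piD subrr e2pi0 mul1r.
by congr (_ * _); exact: esym (zhas_sumP h').
Qed.

Lemma wbfun_central phi p : wbfun phi p = e2pi (N%:~R * p.2) * wbfun phi (p.1, 0).
Proof. by rewrite /wbfun /= mulr0 e2pi0 mul1r. Qed.

Lemma wbterm_schwartz_zcvg f p : zcvg (fun n => wbterm f n p).
Proof.
have [K K0 hK] := @schwartz_term_bound _ N d chi f `|p.1.2|.
have [h _] := zhas_sum_dominated (fun n => hK n p (lexx _)).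
exact: zhas_sum_cvg h.
Qed.

Lemma weil_brezin_wbfun f p : weil_brezin N chi f p = wb_const N d * wbfun f p.
Proof. by rewrite weil_brezinE; exact: esym (mulrA _ _ _). Qed.

Lemma cmeasurable_e2piz : cmeasurable (fun p : T3 => e2pi (N%:~R * p.2) : C).
Proof.
apply: cmeasurable_e2pi; apply: measurable_funM; first exact: measurable_cst.
exact: measurable_snd.
Qed.

Lemma cmeasurable_weil_brezin f : cmeasurable (weil_brezin N chi f : T3 -> C).
Proof.
apply: cmeasurableM; last exact: (@cmeasurable_wbsum_schwartz _ N d chi f).
by apply: cmeasurableM; [exact: cmeasurable_cst|exact: cmeasurable_e2piz].
Qed.

Lemma integrable_cube_cst (r : R) : leb3.-integrable cube (EFin \o (fun=> r)).
Proof.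
have [h1 _] := cube_tensor (integrable_I01_cst r) (integrable_I01_cst 1).
by move: h1; congr (_.-integrable _ (EFin \o _)); apply/funext => p; rewrite mulr1.
Qed.

Lemma ae_all (P : T3 -> Prop) : (forall p, P p) -> {ae leb3, forall p, P p}.
Proof. by move=> h; exists set0; split=> // p /= hp; exfalso; exact: hp. Qed.

Lemma in_HNd_weil_brezin f : in_HNd N chi (weil_brezin N chi f).
Proof.
have [K K0 hK] := @wbpart_schwartz_bound _ N d chi f 1.
split; first split.
- exact: cmeasurable_weil_brezin.
- move=> g hg; apply: ae_all => p; rewrite !weil_brezin_wbfun; congr (_ * _).
  by apply: wbfun_int => //; exact: wbterm_schwartz_zcvg.
- apply: ae_all => p; rewrite !weil_brezin_wbfun wbfun_central mulrCA.
  by rewrite [wbfun f (p.1, 0)]wbfun_central /= mulr0 e2pi0 mul1r.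
- rewrite /sq_dist; pose B := (normc (wb_const N d : C) * K) ^+ 2.
  have fi := integrable_fin_num measurable_cube (integrable_cube_cst B).
  apply: (@le_lt_trans _ _ (\int[leb3]_(p in cube) B%:E)%E); last first.
    by rewrite ltey_eq fi.
  apply: ge0_le_integral => //.
  + exact: measurable_cube.
  + by move=> p _; rewrite lee_fin exprn_ge0// normc_ge0.
  + apply/measurable_EFinP; apply: measurable_funTS; apply: measurable_funX.
    apply: measurable_normc; under eq_fun do rewrite subr0.
    exact: cmeasurable_weil_brezin.
  + move=> p cp; rewrite lee_fin subr0; apply: lerXn2r.
    * by rewrite nnegrE normc_ge0.
    * by rewrite nnegrE mulr_ge0// normc_ge0.
    rewrite weil_brezin_wbfun normcM; apply: ler_wpM2l; first exact: normc_ge0.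
    rewrite /wbfun normcM normc_e2pi mul1r.
    apply: ccvg_le (@wbpart_schwartz_cvg _ N d chi f p) _ => M; apply: hK.
    case: cp => -[_ /=]; rewrite in_itv /= => /andP[p0 p1] _.
    by rewrite ger0_norm.
- exists (fun=> f).
  have -> : sq_dist (weil_brezin N chi f) (weil_brezin N chi f) = 0%E.
    rewrite /sq_dist; under eq_integral do rewrite subrr normc0 expr0n /=.
    exact: integral0.
  exact: cvg_cst.
Qed.

End Translation.

(** * Linear relations between left translates *)

Section Relations.
Context {R : realType} (N : int) (d : nat) (chi : dirichlet_character R d).
Local Notation C := R[i].
Local Notation mu := (@lebesgue_measure R).
Local Notation leb3 := (@leb3 R).
Local Notation mR := (measurableTypeR R).
Local Notation T3 := (mR * mR * mR)%type.
Local Notation I01 := (`[0%R, 1%R]%classic : set mR).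
Local Notation wt := (wt N chi).
Local Notation wbterm := (wbterm N chi).
Local Notation wbfun := (wbfun N chi).
Hypotheses (hN : N != 0) (hd : (d %| `|N|)%N).
Implicit Types (f : schwartz R) (p : heisenberg R) (phi : R -> C).
Implicit Types (x : C * heisenberg R) (rel : seq (C * heisenberg R)).

Let NR : (N%:~R : R) != 0. Proof. by rewrite intr_eq0. Qed.

Definition rel_shift x : int := Num.floor (N%:~R * x.2.1.2).
Definition rel_frac x : R := N%:~R * x.2.1.2 - (rel_shift x)%:~R.
Definition rel_coeff x (n : int) : C := x.1 * translate_coeff N chi x.2 (rel_shift x) n.

Lemma rel_frac_itv x : 0 <= rel_frac x < 1.
Proof.
rewrite /rel_frac subr_ge0 floor_le ltrBlDl.
by rewrite -(intrD _ _ 1) floorD1_gt.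
Qed.

Lemma normc_rel_coeff x n : normc (rel_coeff x n) <= normc x.1.
Proof.
rewrite /rel_coeff /translate_coeff (normcM x.1) (normcM (e2pi _) (_ * _)) (normcM (wt _)).
rewrite !normc_e2pi mul1r mulr1.
by apply: ler_piMr; [exact: normc_ge0|exact: normc_wt_le1].
Qed.

Lemma relation_sum phi rel p :
  (forall x, x \in rel -> zcvg (fun n => wbterm phi n (hmul x.2 p))) ->
  zhas_sum (fun n => e2pi (N%:~R * p.2) * e2pi (n%:~R * p.1.1) *
    \sum_(x <- rel) rel_coeff x n *
      (e2pi (rel_frac x * p.1.1) * phi (n%:~R + N%:~R * p.1.2 + rel_frac x)))
    (\sum_(x <- rel) x.1 * wbfun phi (hmul x.2 p)).
Proof.
move=> hz.
pose u x n := x.1 * (e2pi (N%:~R * p.2) * (translate_coeff N chi x.2 (rel_shift x) n *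
      (e2pi (rel_frac x * p.1.1) * phi (n%:~R + N%:~R * p.1.2 + rel_frac x)) *
      e2pi (n%:~R * p.1.1))).
have := @zhas_sum_big _ _ rel u (fun x => x.1 * wbfun phi (hmul x.2 p)).
have hu x : x \in rel -> zhas_sum (u x) (x.1 * wbfun phi (hmul x.2 p)).
  move=> xr; apply: zhas_sumZ.
  have hm : N%:~R * x.2.1.2 = rel_frac x + (rel_shift x)%:~R by rewrite /rel_frac subrK.
  exact: wbfun_translate hm (hz x xr).
move=> /(_ hu); congr zhas_sum; apply/funext => n.
rewrite mulr_sumr; apply: eq_bigr => x _; rewrite /u /rel_coeff.
by ring.
Qed.

(** Terms with the same fractional part share the value of Phi, which factors out of the
    corresponding vanishing sum. *)
Lemma group_by_key (rel : seq (C * heisenberg R)) (F : C * heisenberg R -> C) (Phi : R -> C) :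
  (forall r, \sum_(x <- rel | rel_frac x == r) F x = 0) ->
  \sum_(x <- rel) F x * Phi (rel_frac x) = 0.
Proof.
move=> h; pose ks := undup (map rel_frac rel).
have -> : \sum_(x <- rel) F x * Phi (rel_frac x) =
    \sum_(r <- ks) \sum_(x <- rel | rel_frac x == r) F x * Phi (rel_frac x).
  under [RHS]eq_bigr do rewrite big_mkcond.
  rewrite exchange_big /= big_seq [RHS]big_seq; apply: eq_bigr => x xr.
  have xk : rel_frac x \in ks by rewrite mem_undup map_f.
  rewrite (bigD1_seq _ xk) ?undup_uniq//= eqxx big1 ?addr0// => r rx.
  by rewrite eq_sym (negPf rx).
apply: big1 => r _.
rewrite (eq_bigr (fun x => F x * Phi r)); last by move=> x /eqP ->.
by rewrite -mulr_suml h mul0r.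
Qed.

(** Only finitely many fractional parts occur, so their integer translates other than r itself keep
    a common positive distance from r. *)
Lemma separation rel (r : R) : 0 <= r < 1 ->
  exists eta : R, 0 < eta <= 1 /\ forall x, x \in rel -> forall j : int,
    (j != 0) || (rel_frac x != r) -> eta <= `|j%:~R + (rel_frac x - r)|.
Proof.
move=> /andP[r0 r1]; elim: rel => [|y rel [eta [/andP[e0 e1] IH]]].
  by exists 1; rewrite ltr01 lexx.
have /andP[y0 y1] := rel_frac_itv y.
have [yr|yr] := eqVneq (rel_frac y) r.
  exists eta; split; first by rewrite e0.
  move=> x; rewrite inE => /predU1P[->|xr]; last exact: IH.
  move=> j; rewrite yr eqxx orbF subrr addr0 => j0.
  by apply: (le_trans e1); rewrite -intr_norm -[1]/(1%:~R) ler_int; lia.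
pose t := rel_frac y - r; have t0 : 0 < `|t| by rewrite normr_gt0 subr_eq0.
have t1 : `|t| < 1 by rewrite ltr_norml /t; lra.
exists (Num.min eta (Num.min `|t| (1 - `|t|))); split.
  by rewrite !lt_min e0 t0 subr_gt0 t1 ge_min e1.
move=> x; rewrite inE => /predU1P[->|xr] j hj; last first.
  by rewrite ge_min IH.
rewrite -/t !ge_min; apply/orP; right; apply/orP.
have [->|j0] := eqVneq j 0; first by left; rewrite add0r.
right; have j1 : 1 <= `|j%:~R| :> R by rewrite -intr_norm -[1]/(1%:~R) ler_int; lia.
have := ler_normB (j%:~R + t) t; rewrite addrK; lra.
Qed.

Lemma expRN_le (u : R) : 0 < u -> expR (- u) <= u^-1.
Proof.
move=> u0; rewrite expRN lef_pV2 ?posrE ?expR_gt0//.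
by apply: le_trans (expR_ge1Dx u); rewrite lerDr.
Qed.

Definition gauss_dil (T : nat) : schwartz R := sdil sgauss (ln T.+1%:R).

Lemma gauss_dilE T (t : R) : gauss_dil T t = (expR (- (T.+1%:R * t) ^+ 2))%:C.
Proof.
by rewrite -[LHS]/((gauss_fun (expR (ln T.+1%:R) * t))%:C) lnK ?posrE.
Qed.

(** As 4 |y| <= |tau|, one has (y + tau)^2 - y^2 >= tau^2 / 2, and exp(-u) <= 1/u turns this into 2
    / ((T+1)^2 tau^2). The bound 1 + j^2 <= 8 tau^2 / eta^2 then supplies summability in j and the
    constant 16. *)
Lemma gauss_term_bound (eta y tau : R) (j : int) T : 0 < eta <= 1 ->
  eta <= `|tau| -> `|j%:~R| <= `|tau| + 1 -> 4 * `|y| <= eta ->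
  expR ((T.+1%:R * y) ^+ 2) * expR (- (T.+1%:R * (y + tau)) ^+ 2) <=
  16 / eta ^+ 2 / T.+1%:R ^+ 2 / (1 + j%:~R ^+ 2).
Proof.
move=> /andP[e0 e1] ht hj hy; rewrite -expRD.
have T0 : 0 < T.+1%:R :> R by [].
have t0 : 0 < `|tau| by exact: lt_le_trans ht.
have t2 : tau ^+ 2 = `|tau| ^+ 2 by rewrite real_normK ?num_real.
have y2 : - (y * tau) <= `|y| * `|tau|.
  by rewrite -normrM -normrN; exact: ler_norm.
have tp : 0 < tau ^+ 2 / 2 by rewrite t2 divr_gt0// exprn_gt0.
have hexp : (T.+1%:R * y) ^+ 2 + - (T.+1%:R * (y + tau)) ^+ 2 <=
    - (T.+1%:R ^+ 2 * (tau ^+ 2 / 2)).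
  have -> : (T.+1%:R * y) ^+ 2 + - (T.+1%:R * (y + tau)) ^+ 2 =
      - (T.+1%:R ^+ 2 * (tau ^+ 2 + 2 * (y * tau))) by ring.
  rewrite lerN2; apply: ler_wpM2l; first exact: sqr_ge0.
  have : `|y| * `|tau| <= tau ^+ 2 / 4.
    rewrite t2 expr2 mulrAC; apply: ler_wpM2r; first exact: normr_ge0.
    lra.
  lra.
apply: (@le_trans _ _ (expR (- (T.+1%:R ^+ 2 * (tau ^+ 2 / 2))))); first by rewrite ler_expR.
apply: (le_trans (expRN_le _)); first by rewrite mulr_gt0// exprn_gt0.
have j2 : 1 + j%:~R ^+ 2 <= 8 / eta ^+ 2 * tau ^+ 2.
  have jj : j%:~R ^+ 2 <= (`|tau| + 1) ^+ 2.
    rewrite -[j%:~R ^+ 2]real_normK ?num_real//; apply: lerXn2r => //.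
    by rewrite nnegrE addr_ge0.
  have h1 : 1 <= `|tau| / eta by rewrite ler_pdivlMr// mul1r.
  have -> : 8 / eta ^+ 2 * tau ^+ 2 = 8 * (`|tau| / eta) ^+ 2.
    by rewrite t2 exprMn exprVn; ring.
  have h2 : `|tau| <= `|tau| / eta by rewrite ler_pdivlMr// ler_piMr.
  move: h1 h2; set z := `|tau| / eta => h1 h2.
  apply: (le_trans (lerD (lexx 1) jj)).
  have : (`|tau| + 1) ^+ 2 <= (z + z) ^+ 2.
    apply: lerXn2r; rewrite ?nnegrE; try lra.
  have : 1 <= z ^+ 2 by rewrite exprn_ege1.
  by rewrite !expr2; lra.
have p1 : 0 < 1 + j%:~R ^+ 2 :> R by rewrite ltr_pwDl// sqr_ge0.
rewrite ler_pdivlMr// mulrC ler_pdivrMr; last by rewrite mulr_gt0// exprn_gt0.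
apply: (le_trans j2); rewrite le_eqVlt; apply/orP; left; apply/eqP.
by field; rewrite !gt_eqF.
Qed.

Lemma ae_countable_all (P : nat -> T3 -> Prop) :
  (forall n, {ae leb3, forall p, P n p}) -> {ae leb3, forall p, forall n, P n p}.
Proof.
move=> h; have [A [mA A0 hA]] := negligible_bigcup h.
exists A; split=> // p /= /existsNP[n hn]; apply: hA.
by exists n.
Qed.

(** At a point where n0 + r + Nc is nearly 0, a narrow Gaussian makes the terms with index n0 and
    fractional part r dominate. Normalised by the Gaussian at the offset y, they add up to exactly
    the coefficient sum, while the rest is at most a multiple of (T+1)^(-2). *)
Lemma rel_coeff_vanish rel :
  (forall G, in_HNd N chi G -> satisfies rel G) ->
  forall (r : R) (n0 : int), \sum_(x <- rel | rel_frac x == r) rel_coeff x n0 = 0.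
Proof.
move=> hrel r n0.
have [r01|rn] := boolP (0 <= r < 1); last first.
  rewrite big1// => x /eqP xr; exfalso; move/negP: rn; apply.
  by rewrite -xr; exact: rel_frac_itv.
have [eta [e01 sep]] := separation rel r01.
have /andP[e0 e1] := e01.
have wc0 : wb_const N d != 0 :> C.
  rewrite -normc_gt0 lt_neqAle normc_ge0 andbT eq_sym -sqrf_eq0 normc_wb_const.
  by rewrite mulf_neq0 ?invr_eq0 ?pnatr_eq0 ?absz_eq0// -lt0n totient_gt0 (modulus_gt0 hN hd).
have aeT : {ae leb3, forall p : T3, forall T,
    \sum_(x <- rel) x.1 * wbfun (gauss_dil T) (hmul x.2 p) = 0}.
  apply: ae_countable_all => T.
  apply: (ae_imp _ (hrel _ (in_HNd_weil_brezin chi hN hd (gauss_dil T)))) => p hp.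
  apply: (mulfI wc0); rewrite mulr0 -[RHS]hp mulr_sumr; apply: eq_bigr => x _.
  by rewrite weil_brezin_wbfun mulrCA.
(* The relation holds almost everywhere for each T, hence for all T at once off one null set. That
   set cannot contain a box of positive measure around the required c, so a single p serves every
   T. *)
have [p [py hp]] : exists p : T3, 4 * `|n0%:~R + r + N%:~R * p.1.2| <= eta /\
    forall T, \sum_(x <- rel) x.1 * wbfun (gauss_dil T) (hmul x.2 p) = 0.
  have [A [mA A0 hA]] := aeT.
  pose c0 := - (n0%:~R + r) / N%:~R.
  pose e := eta / (4 * `|N%:~R|).
  have ep : 0 < e by rewrite divr_gt0// mulr_gt0// normr_gt0.
  pose J : set mR := `[c0, c0 + e]%classic.
  have [//|np] := pselect (exists p : T3, 4 * `|n0%:~R + r + N%:~R * p.1.2| <= eta /\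
    forall T, \sum_(x <- rel) x.1 * wbfun (gauss_dil T) (hmul x.2 p) = 0).
  have mJ : measurable J by exact: measurable_itv.
  have mI : measurable I01 by exact: measurable_itv.
  have sub : rect3 I01 J I01 `<=` A.
    move=> p [[_ /= pJ] _]; apply: hA => /= hpT; apply: np; exists p; split=> //.
    move: pJ; rewrite /J /= in_itv /= => /andP[j1 j2].
    have -> : n0%:~R + r + N%:~R * p.1.2 = N%:~R * (p.1.2 - c0).
      by rewrite /c0 mulrBr mulrCA mulfV// mulr1; ring.
    have pc : 0 <= p.1.2 - c0 by rewrite subr_ge0.
    rewrite normrM (ger0_norm pc).
    have : p.1.2 - c0 <= e by rewrite lerBlDl.
    rewrite /e ler_pdivlMr ?mulr_gt0 ?normr_gt0//.
    by have -> : 4 * (`|N%:~R| * (p.1.2 - c0)) = (p.1.2 - c0) * (4 * `|N%:~R|) by ring.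
  have : (leb3 (rect3 I01 J I01) <= leb3 A)%E.
    by apply: le_measure; rewrite ?inE//; exact: measurable_rect3.
  rewrite A0 /rect3 leb3_prodE//; last exact: measurableX.
  have -> : leb2 (I01 `*` J) = (mu I01 * mu J)%E by exact: product_measure1E.
  rewrite !lebesgue_I01 mul1e mule1.
  rewrite (lebesgue_measure_itv `[c0, c0 + e]) /= lte_fin ltrDl ep.
  by rewrite -EFinD lee_fin; lra.
pose y := n0%:~R + r + N%:~R * p.1.2.
pose W := \sum_(x <- rel | rel_frac x == r) rel_coeff x n0.
pose B : R := \sum_(x <- rel) normc x.1.
have B0 : 0 <= B by apply: sumr_ge0 => x _; exact: normc_ge0.
pose K := B * (16 / eta ^+ 2).
have K0 : 0 <= K by rewrite mulr_ge0// divr_ge0// sqr_ge0.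
have key T : normc W <= 8 * (K / T.+1%:R ^+ 2).
  pose E : C := (expR ((T.+1%:R * y) ^+ 2))%:C.
  have hz x : x \in rel -> zcvg (fun n => wbterm (gauss_dil T) n (hmul x.2 p)).
    by move=> _; exact: wbterm_schwartz_zcvg.
  have h0 := relation_sum hz; rewrite hp in h0.
  (* The index is shifted by n0, and E and the characters normalise the terms with j = 0 and
     fractional part r. The series V of [h2] subtracts these terms and has the sum - W. *)
  have h1 := zhas_sumZ (E * e2pi (- (N%:~R * p.2)) * e2pi (- ((n0%:~R + r) * p.1.1)))
    (zhas_sum_shift n0 h0).
  rewrite mulr0 in h1.
  have h2 := zhas_sum_lin (-1) (zhas_sum_delta W) h1; rewrite addr0 mulN1r in h2.
  set V := (fun n : int => _ : C) in h2.
  have hV (j : int) : normc (V j) <= K / T.+1%:R ^+ 2 / (1 + j%:~R ^+ 2).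
    pose tau x : R := j%:~R + (rel_frac x - r).
    pose g x : R := expR ((T.+1%:R * y) ^+ 2) * expR (- (T.+1%:R * (y + tau x)) ^+ 2).
    have S1 : -1 * (W * (j == 0)%:R) =
        \sum_(x <- rel) (if rel_frac x == r then - (rel_coeff x n0 * (j == 0)%:R) else 0).
      rewrite /W mulr_suml mulr_sumr big_mkcond; apply: eq_bigr => x _.
      by case: ifP; rewrite ?mulN1r.
    have S2 : E * e2pi (- (N%:~R * p.2)) * e2pi (- ((n0%:~R + r) * p.1.1)) *
        (e2pi (N%:~R * p.2) * e2pi ((j + n0)%:~R * p.1.1) *
          \sum_(x <- rel) rel_coeff x (j + n0) * (e2pi (rel_frac x * p.1.1) *
             gauss_dil T ((j + n0)%:~R + N%:~R * p.1.2 + rel_frac x))) =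
        \sum_(x <- rel) rel_coeff x (j + n0) * (e2pi (tau x * p.1.1) * (g x)%:C).
      rewrite mulr_sumr mulr_sumr; apply: eq_bigr => x _.
      have -> : (j + n0)%:~R + N%:~R * p.1.2 + rel_frac x = y + tau x.
        by rewrite /y /tau intrD; ring.
      rewrite gauss_dilE /g rmorphM -/E.
      have -> : e2pi (tau x * p.1.1) = e2pi (- (N%:~R * p.2)) * e2pi (- ((n0%:~R + r) * p.1.1)) *
          (e2pi (N%:~R * p.2) * e2pi ((j + n0)%:~R * p.1.1)) * e2pi (rel_frac x * p.1.1) :> C.
        by rewrite -!e2piD; congr e2pi; rewrite /tau intrD; ring.
      by ring.
    have VE : V j = \sum_(x <- rel) rel_coeff x (j + n0) *
        (if (j == 0) && (rel_frac x == r) then 0 else e2pi (tau x * p.1.1) * (g x)%:C).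
      rewrite /V S1 S2 -big_split; apply: eq_bigr => x _ /=.
      have [jz|jz] := eqVneq j 0; have [xr|xr] := eqVneq (rel_frac x) r => /=.
      - have t0 : tau x = 0 by rewrite /tau jz xr subrr addr0.
        rewrite /g t0 addr0 mul0r e2pi0 -expRD subrr expR0 jz add0r mulr1 mul1r mulr1.
        by rewrite mulr0 addNr.
      - by rewrite add0r.
      - by rewrite mulr0 oppr0 add0r.
      - by rewrite add0r.
    rewrite VE; apply: (le_trans (normc_sum _ _ _)).
    have -> : K / T.+1%:R ^+ 2 / (1 + j%:~R ^+ 2) =
        \sum_(x <- rel) normc x.1 * (16 / eta ^+ 2 / T.+1%:R ^+ 2 / (1 + j%:~R ^+ 2)).
      by rewrite -mulr_suml /K /B !mulrA.
    rewrite big_seq [leRHS]big_seq; apply: ler_sum => x xr.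
    have p1 : 0 < 1 + j%:~R ^+ 2 :> R by rewrite ltr_pwDl// sqr_ge0.
    have q0 : 0 <= 16 / eta ^+ 2 / T.+1%:R ^+ 2 / (1 + j%:~R ^+ 2) :> R.
      by rewrite !divr_ge0 ?sqr_ge0// ltW.
    rewrite normcM; apply: ler_pM; rewrite ?normc_ge0 ?normc_rel_coeff//.
    case: ifPn => [_|]; first by rewrite normc0.
    rewrite negb_and => hj.
    rewrite normcM normc_e2pi mul1r normc_real ger0_norm; last first.
      by rewrite mulr_ge0 ?expR_ge0.
    apply: gauss_term_bound => //; first exact: sep hj.
    have /andP[f0 f1] := rel_frac_itv x.
    have := ler_normB (tau x) (rel_frac x - r); rewrite addrK.
    have : `|rel_frac x - r| <= 1.
      by move: r01 => /andP[r0 r1]; rewrite ler_norml; apply/andP; split; lra.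
    lra.
  have [_ h3] := zhas_sum_dominated hV.
  by rewrite (zhas_sumP h2) normcN in h3.
apply/eqP; rewrite -normc_eq0 eq_le normc_ge0 andbT -/W.
apply/ler_addgt0Pr => e ep; rewrite add0r.
have b := archi_boundP (divr_ge0 (mulr_ge0 (ler0n _ 8) K0) (ltW ep)).
set T := Num.bound _ in b.
apply: (le_trans (key T)).
rewrite mulrA ler_pdivrMr ?exprn_gt0// [e * _]mulrC -ler_pdivrMr//.
apply: ltW; apply: (lt_le_trans b).
apply: (@le_trans _ _ T.+1%:R); first by rewrite ler_nat.
by rewrite expr2 ler_peMr// ler1n.
Qed.

(** The coefficient sums do not involve phi, so once they vanish the relation holds for every phi
    whose translated series converge, Schwartz or not. *)
Lemma relation_general phi rel p :
  (forall (r : R) (n : int), \sum_(x <- rel | rel_frac x == r) rel_coeff x n = 0) ->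
  (forall x, x \in rel -> zcvg (fun n => wbterm phi n (hmul x.2 p))) ->
  \sum_(x <- rel) x.1 * wbfun phi (hmul x.2 p) = 0.
Proof.
move=> hr hz; rewrite -(zhas_sumP (relation_sum hz)).
rewrite (_ : (fun n => _) = fun=> 0); first exact: zhas_sumP zhas_sum0.
apply/funext => n; rewrite (@group_by_key _ (fun x => rel_coeff x n)
  (fun r => e2pi (r * p.1.1) * phi (n%:~R + N%:~R * p.1.2 + r))) ?mulr0//.
Qed.

End Relations.

(** * Bounds for sine and for |1 - e(x)| *)

Section TrigonometricBounds.
Context {R : realType}.
Local Notation C := R[i].
Implicit Types (x y t : R).

Let mvt_sin x : 0 <= x -> exists2 c : R, 0 <= c <= x & sin x = cos c * x.
Proof.
move=> x0; have [|c] := @MVT_segment R sin cos 0 x x0.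
  by apply: continuous_subspaceT => z; exact: continuous_sin.
by rewrite in_itv /= sin0 !subr0 => hc e; exists c.
Qed.

Lemma sin_norm_le x : `|sin x| <= `|x|.
Proof.
wlog x0 : x / 0 <= x => [h|].
  have [|x0] := leP 0 x; first exact: h.
  by have := h (- x); rewrite sinN !normrN; apply; lra.
have [c _ ->] := mvt_sin x0.
by rewrite normrM ler_piMl// cos_max.
Qed.

Lemma cos_norm_le x : `|1 - cos x| <= `|x|.
Proof.
have -> : 1 - cos x = sin (x / 2) ^+ 2 *+ 2.
  have {1}-> : x = (x / 2) *+ 2 by rewrite mulr2n; lra.
  by rewrite cos_mulr2n sin2cos2; lra.
rewrite normrMn normrX mulr2n.
have h1 := sin_norm_le (x / 2); have h2 : `|sin (x / 2)| <= 1 := sin_max _.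
have h3 : `|x / 2| = `|x| / 2 by rewrite normrM normfV (ger0_norm (ler0n _ 2)).
rewrite h3 in h1; have h0 := normr_ge0 (sin (x / 2)); nra.
Qed.

(** A weak form of Jordan's inequality. On [0, pi/4] the double-angle formula and cos(2c) >= 0 give
    cos c >= 1/2; then sin x = 2 sin(x/2) cos(x/2) and the mean value theorem give the factor
    1/4. *)
Lemma sin_ge_quarter x : 0 <= x <= pi / 2 -> x / 4 <= sin x.
Proof.
move=> /andP[x0 xp].
have half c : 0 <= c <= x / 2 -> 2^-1 <= cos c.
  move=> /andP[c0 cx].
  have h1 : 0 <= cos c by apply: cos_ge0_pihalf; apply/andP; split; lra.
  have h2 : 0 <= cos (c *+ 2).
    by apply: cos_ge0_pihalf; rewrite (mulr2n c); apply/andP; split; lra.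
  rewrite cos_mulr2n in h2; nra.
have x20 : 0 <= x / 2 by lra.
have {1}-> : x = (x / 2) *+ 2 by rewrite mulr2n; lra.
have e : x = (x / 2) *+ 2 by rewrite mulr2n; lra.
rewrite [in sin x]e sin_mulr2n.
have [c hc ->] := mvt_sin x20.
have h1 := half _ hc.
have h2 : 2^-1 <= cos (x / 2) by apply: half; rewrite x20 lexx.
have h3 : 4^-1 <= cos (x / 2) * cos c by nra.
rewrite !(mulr2n (x / 2)) (mulr2n (cos (x / 2) * _)) mulrA; nra.
Qed.

Lemma normc_1Be2pi x : normc (1 - e2pi x) = 2 * `|sin (pi * x)|.
Proof.
apply/eqP; rewrite -(@eqrXn2 _ 2) ?normc_ge0 ?mulr_ge0//; apply/eqP.
rewrite sqr_normcE e2piE ReB ImB /= exprMn -normrX ger0_norm ?sqr_ge0//.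
have -> : 2 * pi * x = (pi * x) *+ 2 by rewrite mulr2n; lra.
have := cos2Dsin2 (pi * x); rewrite cos_mulr2n sin_mulr2n !mulr2n.
move: (cos _) (sin _) => a b h.
have -> : b ^+ 2 = 1 - a ^+ 2 by lra.
have hb : b ^+ 2 = 1 - a ^+ 2 by lra.
have -> : (1 - (a ^+ 2 + a ^+ 2 - 1)) ^+ 2 + (0 - (a * b + a * b)) ^+ 2 =
  4 * (1 - a ^+ 2) ^+ 2 + 4 * a ^+ 2 * b ^+ 2 by ring.
rewrite hb; ring.
Qed.

Lemma normc_1Be2pi_ge x : `|x| <= 2^-1 -> `|x| <= normc (1 - e2pi x).
Proof.
move=> hx; rewrite normc_1Be2pi.
have -> : `|sin (pi * x)| = `|sin (pi * `|x|)|.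
  by have [->//|->] : `|x| = x \/ `|x| = - x; [case: (ger0P x); auto|rewrite mulrN sinN normrN].
have p2 := @pi_ge2 R.
have x0 := normr_ge0 x.
have h : 0 <= pi * `|x| <= pi / 2 by apply/andP; split; nra.
have := sin_ge_quarter h; have := ler_norm (sin (pi * `|x|)); nra.
Qed.

Lemma normc_cexp_iB1 x : normc (cexp (x *i) - 1 : C) <= 2 * `|x|.
Proof.
apply: (le_trans (normc_le_ReIm _)); rewrite ReB ImB /cexp /= expR0 mul0r mul1r.
rewrite mul1r !mul0r subr0 subr0 addr0.
have := sin_norm_le x; have := cos_norm_le x; rewrite distrC; lra.
Qed.

End TrigonometricBounds.

(** * Summation by parts *)

Section AbelSummation.
Context {R : realType}.
Local Notation C := R[i].

(** The weights psi are complex, so their variation is measured against a decreasing real sequence r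
    whose differences telescope. In the constant, 2 stands for the two boundary terms and K for the
    variation. *)
Lemma abel_bound (b psi : nat -> C) (r : nat -> R) (A K : R) (i : nat) :
  (forall m, normc (\sum_(0 <= n < m) b n) <= A) ->
  (forall n, (i <= n)%N -> normc (psi n - psi n.+1) <= K * (r n - r n.+1)) ->
  (forall n, (i <= n)%N -> normc (psi n) <= r n) ->
  0 <= K -> (forall n, (i <= n)%N -> r n.+1 <= r n) ->
  forall m, (i <= m)%N -> normc (\sum_(i <= n < m) b n * psi n) <= A * (2 + K) * r i.
Proof.
move=> hb hd hr K0 mr m im; pose B m := \sum_(0 <= n < m) b n.
have A0 : 0 <= A by apply: le_trans (hb 0%N); exact: normc_ge0.
have key k : r (i + k)%N <= r i /\ normc (\sum_(i <= n < i + k) b n * psi n -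
    B (i + k)%N * psi (i + k)%N + B i * psi i) <= A * K * (r i - r (i + k)%N).
  elim: k => [|k [IH1 IH2]].
    by rewrite addn0 big_geq// sub0r addNr normc0 subrr mulr0 lexx.
  rewrite addnS big_nat_recr ?leq_addr//=; split.
    by apply: le_trans IH1; apply: mr; rewrite leq_addr.
  have -> : B (i + k).+1 = B (i + k)%N + b (i + k)%N by rewrite /B big_nat_recr.
  set S := \sum_(_ <= _ < _) _ in IH2 *.
  have -> : S + b (i + k)%N * psi (i + k)%N -
      (B (i + k)%N + b (i + k)%N) * psi (i + k).+1 + B i * psi i =
    (S - B (i + k)%N * psi (i + k)%N + B i * psi i) +
    (B (i + k)%N + b (i + k)%N) * (psi (i + k)%N - psi (i + k).+1) by ring.
  apply: (le_trans (normcD _ _)).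
  have -> : A * K * (r i - r (i + k).+1) =
    A * K * (r i - r (i + k)%N) + A * (K * (r (i + k)%N - r (i + k).+1)) by ring.
  apply: lerD => //; rewrite normcM; apply: ler_pM; rewrite ?normc_ge0//.
    by have := hb (i + k).+1; rewrite big_nat_recr.
  by apply: hd; rewrite leq_addr.
have [k ->] : exists k, m = (i + k)%N by exists (m - i)%N; rewrite subnKC.
have [h1 h2] := key k; set S := \sum_(_ <= _ < _) _ in h2 *.
have -> : S = (S - B (i + k)%N * psi (i + k)%N + B i * psi i) +
   (B (i + k)%N * psi (i + k)%N - B i * psi i) by ring.
apply: (le_trans (normcD _ _)).
have h3 j : (i <= j)%N -> normc (B j * psi j) <= A * r j.
  by move=> ij; rewrite normcM; apply: ler_pM; rewrite ?normc_ge0 ?hr// hb.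
have h4 := h3 _ (leq_addr k i); have h5 := h3 _ (leqnn i).
have h6 : normc (B (i + k)%N * psi (i + k)%N - B i * psi i) <= A * r (i + k)%N + A * r i.
  by apply: (le_trans (normcD _ _)); rewrite normcN lerD.
have h7 : 0 <= r (i + k)%N by apply: le_trans (hr _ (leq_addr _ _)); exact: normc_ge0.
have h8 : A * r (i + k)%N <= A * r i by apply: ler_wpM2l.
have h9 : 0 <= A * K * r (i + k)%N by rewrite !mulr_ge0.
lra.
Qed.

(** Multiplication by e(q beta) shifts the partial sums by a period, so multiplication by 1 - e(q
    beta) leaves only two blocks of q terms. Written as a product, the bound needs no division by a
    possible 0. *)
Lemma twisted_periodic_sum_bound (v : nat -> C) (q : nat) (beta : R) :
  (forall n, v (n + q)%N = v n) -> (forall n, normc (v n) <= 1) ->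
  forall m, normc (1 - e2pi (q%:R * beta)) *
    normc (\sum_(0 <= n < m) v n * e2pi (n%:R * beta)) <= 2 * q%:R.
Proof.
move=> vq v1 m; rewrite -normcM.
pose b n := v n * e2pi (n%:R * beta) : C; pose B m := \sum_(0 <= n < m) b n.
have b1 n : normc (b n) <= 1 by rewrite normcM normc_e2pi mulr1.
have bound (j : nat) : normc (\sum_(j <= n < j + q) b n) <= q%:R.
  apply: (le_trans (normc_sum _ _ _)).
  apply: (@le_trans _ _ (\sum_(j <= n < j + q) 1)); first exact: ler_sum.
  by rewrite sumr_const_nat addKn.
have shift : e2pi (q%:R * beta) * B m = B (m + q)%N - B q.
  have -> : B (m + q)%N = B q + \sum_(q <= n < m + q) b n.
    by rewrite /B -big_cat_nat// leq_addl.
  rewrite addrC addKr -[X in \sum_(X <= _ < _) _]add0n big_addn addnK mulr_sumr.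
  apply: eq_bigr => n _; rewrite /b vq natrD mulrDl e2piD; ring.
have -> : (1 - e2pi (q%:R * beta)) * \sum_(0 <= n < m) b n =
    B q - (B (m + q)%N - B m).
  by rewrite mulrBl mul1r -/(B m) shift; ring.
have -> : B (m + q)%N - B m = \sum_(m <= n < m + q) b n.
  by apply/eqP; rewrite subr_eq addrC; apply/eqP; rewrite /B -big_cat_nat// leq_addr.
apply: (le_trans (normcD _ _)); rewrite normcN mulr_natl mulr2n.
by apply: lerD (bound m); have := bound 0%N; rewrite add0n.
Qed.

(** With v = u e^h, the oscillating factor contributes at most 2 |Im s| h, and h exp(- sigma h) <=
    (1 - exp(- sigma h)) / sigma. The complex differences are thus controlled by the telescoping
    real ones. *)
Lemma cpow_diff_bound (s : C) (u v : R) : 0 < complex.Re s -> 0 < u -> u <= v ->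
  normc (cpow u (- s) - cpow v (- s)) <=
  (1 + 2 * `|complex.Im s| / complex.Re s) * (u `^ (- complex.Re s) - v `^ (- complex.Re s)).
Proof.
move=> s0 u0 uv; have v0 : 0 < v := lt_le_trans u0 uv.
set sg := complex.Re s in s0 *; set ta := complex.Im s.
pose h := ln v - ln u.
have h0 : 0 <= h by rewrite subr_ge0 ler_ln.
rewrite !cpowE ?gt_eqF// /powR !gt_eqF//.
have hv : ln v = ln u + h by rewrite /h addrC subrK.
have -> : - s * (ln v)%:C = - s * (ln u)%:C + ((- sg * h)%:C + (- ta * h) *i).
  apply: complex_eqP; rewrite hv.
    by rewrite ReD ReD ReM ReM ReN /= /sg; ring.
  by rewrite ImD ImD ImM ImM ImN ReN /= /ta; ring.
rewrite cexpD -{1}[cexp (- s * _)]mulr1 -mulrBr normcM normc_cexp.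
have -> : complex.Re (- s * (ln u)%:C) = - sg * ln u by rewrite ReM ReN /= mulr0 subr0.
rewrite hv (mulrDr (- sg) (ln u) h) expRD -{2}[expR (- sg * ln u)]mulr1 -mulrBr mulrCA.
apply: ler_wpM2l; first exact: expR_ge0.
rewrite cexpD cexp_real.
set E := expR (- sg * h); set z := cexp _.
have -> : 1 - E%:C * z = (1 - E)%:C + E%:C * (1 - z).
  by rewrite rmorphB rmorph1; ring.
have E1 : E <= 1 by rewrite /E -expR0 ler_expR mulNr oppr_le0 mulr_ge0// ltW.
have E0 : 0 <= E := expR_ge0 _.
have hz : normc (1 - z) <= 2 * (`|ta| * h).
  by rewrite normc_distC; have := normc_cexp_iB1 (- ta * h); rewrite normrM normrN (ger0_norm h0).
have hE : E * (sg * h) <= 1 - E.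
  have := expR_ge1Dx (sg * h) => e1.
  have e2 : E * expR (sg * h) = 1 by rewrite /E -expRD mulNr addNr expR0.
  by have := ler_wpM2l E0 e1; rewrite mulrDr mulr1 e2; lra.
apply: (le_trans (normcD _ _)); rewrite normc_real ger0_norm ?subr_ge0//.
rewrite mulrDl mul1r lerD2l (normcM E%:C) normc_real (ger0_norm E0).
apply: (le_trans (ler_wpM2l E0 hz)).
have -> : E * (2 * (`|ta| * h)) = 2 * `|ta| / sg * (E * (sg * h)).
  by field; rewrite gt_eqF.
by apply: ler_wpM2l => //; rewrite !mulr_ge0// invr_ge0 ltW.
Qed.

End AbelSummation.

(** * One-sided Lerch series: convergence and a uniform bound *)

Section HalfSums.
Context {R : realType}.
Local Notation C := R[i].
Variables (s : C) (k : bool).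
Local Notation sg := (complex.Re s).
Hypothesis sg01 : 0 < sg < 1.
Local Notation phi := (delta_density k (1 - s)).

Let sg0 : 0 < sg. Proof. by case/andP: sg01. Qed.

Lemma powR_anti (a u v : R) : 0 <= a -> 0 < u -> u <= v -> v `^ (- a) <= u `^ (- a).
Proof.
move=> a0 u0 uv; have v0 := lt_le_trans u0 uv.
rewrite !powRN lef_pV2 ?posrE ?powR_gt0//.
by apply: ge0_ler_powR; rewrite ?nnegrE//; apply: ltW.
Qed.

Lemma lerch_density_pos x : 0 < x -> phi x = cpow x (- s).
Proof.
move=> x0; rewrite /delta_density sgnpow_pos// mul1r gtr0_norm//; congr cpow.
by rewrite addrAC subrr add0r.
Qed.

Lemma normc_lerch_density_le x : normc (phi x) <= `|x| `^ (- sg).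
Proof.
rewrite /delta_density normcM -[leRHS]mul1r; apply: ler_pM; rewrite ?normc_ge0 ?normc_sgnpow_le//.
have -> : - sg = complex.Re (1 - s - 1) by rewrite addrAC subrr add0r ReN.
exact: normc_cpow_le.
Qed.

Variables (v : nat -> C) (q : nat) (beta t : R) (n0 : nat).
Hypothesis vq : forall n, v (n + q)%N = v n.
Hypothesis v1 : forall n, normc (v n) <= 1.
Hypothesis n0t : 1 <= n0%:R + t.
Let del := normc (1 - e2pi (q%:R * beta)).
Hypothesis del0 : 0 < del.

Let u n : C := v n * e2pi (n%:R * beta) * phi (n%:R + t).
Let K := 1 + 2 * `|complex.Im s| / sg.
Let A := 2 * q%:R / del.

Let K0 : 0 <= K.
Proof. by rewrite addr_ge0// !mulr_ge0// invr_ge0 ltW. Qed.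

Let K20 : 0 <= 2 + K. Proof. by rewrite addr_ge0. Qed.
Let q20 : 0 <= 2 * q%:R :> R. Proof. by rewrite mulr_ge0. Qed.

Let arg_ge n : (n0 <= n)%N -> (n - n0)%:R + 1 <= n%:R + t.
Proof. by move=> h; rewrite natrB//; have := n0t; lra. Qed.

Let arg_gt0 n : (n0 <= n)%N -> 0 < n%:R + t.
Proof. by move=> /arg_ge; apply: lt_le_trans; rewrite ltr_wpDl. Qed.

Lemma half_tail_bound i m : (n0 <= i)%N -> (i <= m)%N ->
  normc (\sum_(i <= n < m) u n) <= A * (2 + K) * (i%:R + t) `^ (- sg).
Proof.
move=> ni im.
have mono n : (i <= n)%N -> 0 < n%:R + t /\ n%:R + t <= n.+1%:R + t.
  by move=> h; split; [apply: arg_gt0; exact: leq_trans h|rewrite lerD2r ler_nat].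
apply: (@abel_bound _ (fun n => v n * e2pi (n%:R * beta)) (fun n => phi (n%:R + t))
  (fun n => (n%:R + t) `^ (- sg)) A K i) => //.
- move=> j; rewrite /A ler_pdivlMr// mulrC.
  exact: twisted_periodic_sum_bound.
- move=> n /mono[p1 p2].
  rewrite !lerch_density_pos//; last exact: lt_le_trans p2.
  exact: cpow_diff_bound.
- move=> n /mono[p1 _]; apply: (le_trans (normc_lerch_density_le _)).
  by rewrite gtr0_norm.
- by move=> n /mono[p1 p2]; apply: powR_anti => //; exact: ltW.
Qed.

Lemma half_sum_cvg : exists l, ccvg (fun M => \sum_(0 <= n < M) u n) l.
Proof.
have B0 : 0 <= A * (2 + K) :=  mulr_ge0 (divr_ge0 q20 (ltW del0)) K20.
apply: complex_cauchy_ccvg => e e0.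
(* Chosen so that y^(- sigma) = e / (A (2 + K) + 1), which puts the tail bound strictly below e. *)
pose y := ((A * (2 + K) + 1) / e) `^ (sg^-1).
have y0 : 0 < y by rewrite powR_gt0// divr_gt0// ltr_wpDl.
have b := archi_boundP (ltW y0); set T := Num.bound y in b.
exists (n0 + T)%N => n hn.
have -> : \sum_(0 <= j < n0 + T) u j - \sum_(0 <= j < n) u j = - \sum_(n0 + T <= j < n) u j.
  by rewrite (@big_cat_nat _ _ _ (n0 + T) 0 n)//= opprD addrA subrr sub0r.
rewrite normcN; apply: (le_lt_trans (half_tail_bound (leq_addr _ _) hn)).
have h1 : y <= (n0 + T)%:R + t.
  by rewrite natrD; have := n0t; lra.
have h2 := powR_anti (ltW sg0) y0 h1.
have h3 : y `^ (- sg) = e / (A * (2 + K) + 1).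
  rewrite /y -powRrM mulrN mulVf ?gt_eqF// powRN powRr1 ?invf_div//.
  by rewrite divr_ge0 ?ltW// ltr_wpDl.
rewrite h3 in h2; apply: (le_lt_trans (ler_wpM2l B0 h2)).
by rewrite mulrA ltr_pdivrMr ?ltr_wpDl// mulrC ltr_pM2l// ltrDl.
Qed.

(** The first n0 terms, where n + t may be near 0, are kept as they are. Of the others, about y =
    del^(- 1 / (1 + sigma)) terms are bounded by 1 each and the rest by partial summation; this y
    solves y = y^(- sigma) / del, so both parts have the same order. *)
Lemma half_sum_bound M : normc (\sum_(0 <= n < M) u n) <=
  \sum_(0 <= n < n0) normc (phi (n%:R + t)) +
  (1 + 2 * q%:R * (2 + K)) * del `^ (- (1 + sg)^-1).
Proof.
have u_le n : normc (u n) <= normc (phi (n%:R + t)).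
  by rewrite (normcM (_ * _)) (normcM (v n)) normc_e2pi mulr1 ler_piMl ?normc_ge0.
have s1 : 0 < 1 + sg by rewrite ltr_wpDl// ltW.
set y := del `^ _; have y0 : 0 < y by exact: powR_gt0.
have cK : 0 <= 2 * q%:R * (2 + K) * y.
  exact: mulr_ge0 (mulr_ge0 q20 K20) (ltW y0).
have [Mn|Mn] := leqP M n0.
  apply: (le_trans (normc_sum _ _ _)).
  apply: (@le_trans _ _ (\sum_(0 <= n < M) normc (phi (n%:R + t)))); first exact: ler_sum.
  rewrite (@big_cat_nat _ _ _ M 0 n0)//= -addrA lerDl addr_ge0//.
    by apply: sumr_ge0 => *; exact: normc_ge0.
  by rewrite mulrDl mul1r addr_ge0// ltW.
rewrite (@big_cat_nat _ _ _ n0 0 M)//=; last exact: ltnW.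
apply: (le_trans (normcD _ _)); apply: lerD.
  by apply: (le_trans (normc_sum _ _ _)); exact: ler_sum.
have short (j : nat) : (n0 <= j)%N -> normc (\sum_(n0 <= n < j) u n) <= (j - n0)%:R.
  move=> nj; apply: (le_trans (normc_sum _ _ _)).
  rewrite -sumr_const_nat big_nat_cond [leRHS]big_nat_cond; apply: ler_sum => n.
  rewrite andbT => /andP[h _]; apply: (le_trans (u_le n)).
  apply: (le_trans (normc_lerch_density_le _)); rewrite gtr0_norm ?arg_gt0//.
  have h1 : 1 <= n%:R + t by apply: le_trans (arg_ge h); rewrite lerDr.
  by have := powR_anti (ltW sg0) ltr01 h1; rewrite powR1.
have /andP[T1 T2] := trunc_itv (ltW y0); set T := Num.trunc y in T1 T2.
have [MT|MT] := leqP M (n0 + T).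
  apply: (le_trans (short _ (ltnW Mn))).
  apply: (@le_trans _ _ T%:R); first by rewrite ler_nat leq_subLR.
  by rewrite mulrDl mul1r (le_trans T1)// lerDl.
rewrite (@big_cat_nat _ _ _ (n0 + T) n0 M)//= ?leq_addr//; last exact: ltnW.
apply: (le_trans (normcD _ _)); rewrite mulrDl mul1r; apply: lerD.
  by apply: (le_trans (short _ (leq_addr _ _))); rewrite addKn.
apply: (le_trans (half_tail_bound (leq_addr _ _) (ltnW MT))).
have h1 : y <= (n0 + T)%:R + t.
  by rewrite natrD; have := n0t; rewrite -natr1 in T2; lra.
have h2 := powR_anti (ltW sg0) y0 h1.
have h3 : del^-1 * y `^ (- sg) = y.
  rewrite /y -powRrM -(powR_inv1 (ltW del0)) -powRD; last by apply/implyP => _; rewrite gt_eqF.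
  by congr powR; field; rewrite gt_eqF.
have c0 : 0 <= 2 * q%:R / del * (2 + K).
  exact: mulr_ge0 (divr_ge0 q20 (ltW del0)) K20.
apply: (le_trans (ler_wpM2l c0 h2)).
rewrite [X in X <= _](_ : _ = 2 * q%:R * (2 + K) * (del^-1 * y `^ (- sg))); first by rewrite h3.
by rewrite !mulrA (mulrAC (2 * q%:R)).
Qed.

End HalfSums.

(** * An integrable majorant for the partial sums of Lerch series *)

Section LerchMajorant.
Context {R : realType}.
Local Notation C := R[i].
Local Notation mu := (@lebesgue_measure R).
Local Notation mR := (measurableTypeR R).

Lemma nearest_int (y : R) : exists j : int, `|y - j%:~R| <= 2^-1.
Proof.
exists (Num.floor (y + 2^-1)).
have /andP[h1 h2] : (Num.floor (y + 2^-1))%:~R <= y + 2^-1 < (Num.floor (y + 2^-1) + 1)%:~R.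
  by rewrite floor_le floorD1_gt.
rewrite intrD in h2; rewrite ler_norml; apply/andP; split; lra.
Qed.

Lemma normc_1Be2pi_nearest (y : R) : exists j : int,
  `|y - j%:~R| <= 2^-1 /\ `|y - j%:~R| <= normc (1 - e2pi y).
Proof.
have [j hj] := nearest_int y; exists j; split => //.
have -> : e2pi y = e2pi (y - j%:~R).
  by rewrite e2piD e2piN e2pi_int conjc1 mulr1.
exact: normc_1Be2pi_ge.
Qed.

Lemma normc_1Be2pi_gt0 (y : R) : (~ exists n : int, y = n%:~R) -> 0 < normc (1 - e2pi y).
Proof.
move=> hy; have [j [_]] := normc_1Be2pi_nearest y; apply: lt_le_trans.
by rewrite normr_gt0 subr_eq0; apply/eqP => e; apply: hy; exists j.
Qed.

Lemma normc_1Be2piN (y : R) : normc (1 - e2pi (- y)) = normc (1 - e2pi y).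
Proof. by rewrite !normc_1Be2pi mulrN sinN normrN. Qed.

Lemma integrable_itv_cst (X r : R) : mu.-integrable (`[- X, X]%classic : set mR) (EFin \o (fun=> r)).
Proof.
apply/integrableP; split; first exact: measurable_cst.
pose I : set mR := `[- X, X]%classic.
have -> : (\int[mu]_(x in I) `|(EFin \o (fun=> r)) x| = `|r%:E| * mu I)%E.
  by apply: integral_cst; exact: measurable_itv.
rewrite (lebesgue_measure_itv `[- X, X]) /=; case: ifP => _; last by rewrite mule0 ltry.
by rewrite -EFinD -EFinM ltry.
Qed.

Lemma integrable_sumR (A : set mR) (I : Type) (r : seq I) (F : I -> mR -> R) : measurable A ->
  (forall i, mu.-integrable A (EFin \o F i)) ->
  mu.-integrable A (EFin \o (fun x => \sum_(i <- r) F i x)).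
Proof.
move=> mA h; elim: r => [|i r IH].
  under [X in EFin \o X]eq_fun do rewrite big_nil.
  by have := integrable_lin2 mA 0 0; move=> H; apply: integrable0.
under [X in EFin \o X]eq_fun do rewrite big_cons.
have := integrable_lin2 mA 1 1 (h i) IH.
by under [X in EFin \o X]eq_fun do rewrite !mul1r.
Qed.

Lemma integrable_powR_affine (tau a b X : R) : 0 < tau < 1 -> a != 0 ->
  mu.-integrable (`[- X, X]%classic : set mR) (EFin \o (fun x : mR => `|a * x + b| `^ (- tau))).
Proof.
move=> /andP[t0 t1] a0.
have mI : measurable (`[- X, X]%classic : set mR) by exact: measurable_itv.
pose B : R := `|a| * `|X| + `|b|.
have B0 : 0 <= B by rewrite addr_ge0// mulr_ge0.
pose m := (Num.trunc (1 - tau)).+2.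
have i1 : mu.-integrable setT (EFin \o (fun x : mR => jfun (1 - tau) (a * x + b))).
  by apply: integrable_affine => //; apply: integrable_jfun; rewrite subr_gt0.
have i2 := integrableS measurableT mI (@subsetT _ _) i1.
have i3 := integrable_lin2 mI (1 + B ^+ m) 0 i2 i2.
apply: (le_integrable mI _ _ i3).
  apply/measurable_EFinP; apply: (@measurableT_comp _ _ _ _ _ _ (fun y : R => y `^ (- tau))).
    exact: measurable_powR.
  apply: measurableT_comp => //; apply: measurable_funTS.
  exact: measurable_affine.
move=> x /=; rewrite in_itv /= => /andP[x1 x2]; rewrite lee_fin mul0r addr0.
have c0 : 0 <= 1 + B ^+ m by rewrite addr_ge0// exprn_ge0.
rewrite (ger0_norm (powR_ge0 _ _)) (ger0_norm (mulr_ge0 c0 (jfun_ge0 _ _))).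
have [->|y0] := eqVneq (a * x + b) 0.
  by rewrite normr0 powR0 ?oppr_eq0 ?gt_eqF// mulr_ge0 ?jfun_ge0.
have := @jfun_ge _ (1 - tau) _ 1 (1 + B ^+ m) y0 ler01.
rewrite addrAC subrr add0r mulr1; apply.
  by rewrite lerDl exprn_ge0.
rewrite mul1r ler_wpDl//; apply: lerXn2r; rewrite ?nnegrE//.
apply: (le_trans (ler_normD _ _)); rewrite lerD2r normrM ler_wpM2l//.
rewrite ler_norml; apply/andP; split; have := ler_norm X; lra.
Qed.

Variables (N : int) (d : nat) (chi : dirichlet_character R d).
Local Notation leb3 := (@leb3 R).
Local Notation T3 := (mR * mR * mR)%type.
Local Notation wt := (wt N chi).
Hypotheses (hN : N != 0) (hd : (d %| `|N|)%N).
Variables (s : C) (k : bool).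
Local Notation sg := (complex.Re s).
Hypothesis sg01 : 0 < sg < 1.
Local Notation phi := (delta_density k (1 - s)).
Local Notation wbterm := (wbterm N chi phi).
Local Notation wbpart := (wbpart N chi phi).
Implicit Types p : T3.

Let NR : (N%:~R : R) != 0. Proof. by rewrite intr_eq0. Qed.

(** With n replaced by -(n+1), the negative half becomes a one-sided series of the same kind, with
    -a for a and 1 - Nc for the shift. The sign (-1)^k and the phase e(-a) go into the coefficients,
    which stay periodic and of modulus at most 1. *)
Let negv (a : R) (n : nat) : C := (-1) ^+ k * wt (Negz n) * e2pi (- a).

Let negvE p n : wbterm (Negz n) p =
  negv p.1.1 n * e2pi (n%:R * - p.1.1) * phi (n%:R + (1 - N%:~R * p.1.2)).
Proof.
rewrite /wbterm /negv NegzE.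
have -> : (- (n.+1)%:Z)%:~R + N%:~R * p.1.2 = - (n%:R + (1 - N%:~R * p.1.2)) :> R.
  by rewrite mulrNz -pmulrn -natr1; ring.
have -> : (- (n.+1)%:Z)%:~R * p.1.1 = - p.1.1 + n%:R * - p.1.1 :> R.
  by rewrite mulrNz -pmulrn -natr1; ring.
by rewrite delta_densityN e2piD; ring.
Qed.

Let posvE p n : wbterm (Posz n) p =
  wt (Posz n) * e2pi (n%:R * p.1.1) * phi (n%:R + N%:~R * p.1.2).
Proof. by rewrite /wbterm -pmulrn mulrAC. Qed.

Let normc_negv a n : normc (negv a n) <= 1.
Proof.
rewrite /negv (normcM (_ * _)) normc_e2pi mulr1 (normcM (_ ^+ _)) normcX normcN normc1 expr1n mul1r.
exact: normc_wt_le1.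
Qed.

Let normc_posv (n : nat) : normc (wt (Posz n)) <= 1.
Proof. exact: normc_wt_le1. Qed.

Let wt_periodic (n : int) (j : int) : j = `|N|%N%:Z \/ j = - `|N|%N%:Z -> wt (n + j) = wt n.
Proof.
move=> h; have [e ->] : exists e : int, j = e * N.
  case: h => ->; first by exists (sgz N); exact: abszEsg.
  by exists (- sgz N); rewrite mulNr -abszEsg.
exact: wt_addMN.
Qed.

Let posv_periodic n : wt (Posz (n + `|N|)) = wt (Posz n).
Proof. by rewrite PoszD wt_periodic//; left. Qed.

Let negv_periodic a n : negv a (n + `|N|)%N = negv a n.
Proof.
rewrite /negv; congr (_ * _ * _).
have -> : Negz (n + `|N|) = Negz n + - `|N|%N%:Z by rewrite !NegzE -addSn PoszD opprD.
by rewrite wt_periodic//; right.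
Qed.

Definition lerch_gap (a : R) : R := normc (1 - e2pi (N%:~R * a)).

Let gapE (a : R) : normc (1 - e2pi (`|N|%:R * a)) = lerch_gap a.
Proof.
rewrite /lerch_gap; have [->//|->] : `|N|%:R = N%:~R :> R \/ `|N|%:R = - N%:~R :> R.
  case: (N) => n; [left; by rewrite -pmulrn|right].
  by rewrite NegzE mulrNz opprK -pmulrn.
by rewrite mulNr normc_1Be2piN.
Qed.

Let gapNE (a : R) : normc (1 - e2pi (`|N|%:R * - a)) = lerch_gap a.
Proof. by rewrite mulrN normc_1Be2piN gapE. Qed.

Definition nonint (a : R) : Prop := ~ exists n : int, N%:~R * a + 0 = n%:~R.

Lemma lerch_gap_gt0 a : nonint a -> 0 < lerch_gap a.
Proof. by move=> h; apply: normc_1Be2pi_gt0; rewrite -[_ * a]addr0. Qed.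

Let shift_bound (t X : R) : `|t| <= X -> 1 <= (Num.bound (X + 1))%:R + t.
Proof.
move=> h; have X0 : 0 <= X + 1 by rewrite addr_ge0//; apply: le_trans h.
by have := archi_boundP X0; move: h; rewrite ler_norml => /andP[]; lra.
Qed.

Lemma lerch_zcvg p : nonint p.1.1 -> zcvg (fun n => wbterm n p).
Proof.
move=> /lerch_gap_gt0 g0; split.
  rewrite (_ : pos_half _ = fun M => \sum_(0 <= n < M)
    wt (Posz n) * e2pi (n%:R * p.1.1) * phi (n%:R + N%:~R * p.1.2)); last first.
    by apply/funext => M; apply: eq_bigr => n _; exact: posvE.
  apply: (half_sum_cvg k sg01 posv_periodic _ (shift_bound (lexx _))); last by rewrite gapE.
  exact: normc_posv.
rewrite (_ : neg_half _ = fun M => \sum_(0 <= n < M)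
  negv p.1.1 n * e2pi (n%:R * - p.1.1) * phi (n%:R + (1 - N%:~R * p.1.2))); last first.
  by apply/funext => M; apply: eq_bigr => n _; exact: negvE.
apply: (half_sum_cvg k sg01 (negv_periodic p.1.1) _ (shift_bound (lexx _))); last by rewrite gapNE.
exact: normc_negv.
Qed.

Lemma lerch_part_bound (X : R) : exists (n0 : nat) (K : R), 0 <= K /\
  forall p, `|p.1.2| <= X -> nonint p.1.1 -> forall M,
    normc (wbpart M p) <=
      (\sum_(0 <= n < n0) `|N%:~R * p.1.2 + n%:R| `^ (- sg) +
       \sum_(0 <= n < n0) `|- N%:~R * p.1.2 + (n%:R + 1)| `^ (- sg)) +
      K * lerch_gap p.1.1 `^ (- (1 + sg)^-1).
Proof.
pose Y := `|N%:~R| * X + 1 : R.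
pose K := (1 + 2 * `|N|%:R * (2 + (1 + 2 * `|complex.Im s| / sg))) : R.
have K0 : 0 <= K.
  have /andP[s0 _] := sg01.
  by rewrite /K !(addr_ge0, mulr_ge0)// invr_ge0 ltW.
exists (Num.bound (Y + 1)), (2 * K); split; first by rewrite mulr_ge0.
move=> p pX hp M.
have g0 := lerch_gap_gt0 hp.
have t1 : `|N%:~R * p.1.2| <= Y.
  by rewrite normrM /Y ler_wpDr// ler_wpM2l.
have t2 : `|1 - N%:~R * p.1.2| <= Y.
  by apply: (le_trans (ler_normB _ _)); rewrite normr1 addrC lerD2r normrM ler_wpM2l.
rewrite /wbpart big_zrange; apply: (le_trans (normcD _ _)).
have -> : 2 * K * lerch_gap p.1.1 `^ (- (1 + sg)^-1) =
  K * lerch_gap p.1.1 `^ (- (1 + sg)^-1) + K * lerch_gap p.1.1 `^ (- (1 + sg)^-1) by ring.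
rewrite addrACA; apply: lerD.
  under eq_bigr do rewrite posvE.
  have h := half_sum_bound k sg01 posv_periodic normc_posv (shift_bound t1).
  have {}h := h p.1.1; rewrite gapE in h; apply: (le_trans (h g0 M)).
  rewrite lerD2r; apply: ler_sum => n _.
  by rewrite (addrC (N%:~R * _)); exact: normc_lerch_density_le.
under eq_bigr do rewrite negvE.
have h := half_sum_bound k sg01 (negv_periodic p.1.1) (normc_negv p.1.1) (shift_bound t2).
have {}h := h (- p.1.1); rewrite gapNE in h; apply: (le_trans (h g0 M)).
rewrite lerD2r; apply: ler_sum => n _.
have -> : - N%:~R * p.1.2 + (n%:R + 1) = n%:R + (1 - N%:~R * p.1.2) by ring.
exact: normc_lerch_density_le.
Qed.

(** The gap is at least the distance of Na to its nearest integer. That integer varies with a, so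
    all integers within reach are summed over, which leaves finitely many powers of affine
    functions. *)
Lemma lerch_gap_le (X : R) : exists J : nat, forall (a tau : R), 0 <= tau -> `|a| <= X -> nonint a ->
  lerch_gap a `^ (- tau) <= \sum_(j <- zrange J) `|N%:~R * a + (- j%:~R)| `^ (- tau).
Proof.
exists (Num.bound (`|N%:~R| * `|X| + 1 : R)) => a tau tau0 aX ha.
have [j [j1 j2]] := normc_1Be2pi_nearest (N%:~R * a).
have y0 : 0 < `|N%:~R * a - j%:~R|.
  rewrite normr_gt0 subr_eq0; apply/eqP => e; apply: ha; exists j.
  by rewrite addr0.
have jJ : j \in zrange (Num.bound (`|N%:~R| * `|X| + 1 : R)).
  have b0 : 0 <= `|N%:~R| * `|X| + 1 :> R by rewrite addr_ge0// mulr_ge0.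
  have b := archi_boundP b0; set J := Num.bound _ in b *.
  have h1 : `|j%:~R| < J%:R :> R.
    apply: le_lt_trans b.
    have -> : j%:~R = N%:~R * a - (N%:~R * a - j%:~R) :> R by ring.
    apply: (le_trans (ler_normB _ _)); apply: lerD; last by lra.
    by rewrite normrM ler_wpM2l// (le_trans aX)// ler_norm.
  rewrite mem_zrange; move: h1; rewrite ltr_norml => /andP[h1 h2].
  by apply/andP; split; [rewrite -(ler_int R) mulrNz -pmulrn ltW|rewrite -(ltr_int R) -pmulrn].
rewrite (bigD1_seq j jJ (zrange_uniq _))/=.
apply: (le_trans (powR_anti tau0 y0 j2)); rewrite lerDl.
by apply: sumr_ge0 => i _; exact: powR_ge0.
Qed.

(** The bound is a function of c plus a function of a, made of powers with exponents - sigma and - 1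
    / (1 + sigma). Both exponents exceed -1, so the singularities are integrable on bounded
    boxes. *)
Lemma lerch_majorant (X : R) : exists G : T3 -> R,
  leb3.-integrable (box X) (EFin \o G) /\
  forall p, box X p -> nonint p.1.1 -> forall M, normc (wbpart M p) <= G p.
Proof.
have [n0 [K [K0 hK]]] := lerch_part_bound X; have [J hJ] := lerch_gap_le X.
pose tau := (1 + sg)^-1.
have /andP[s0 s1] := sg01.
have t01 : 0 < tau < 1.
  by rewrite /tau invr_gt0 invf_lt1 ?ltrDl ?s0 ?addr_gt0.
pose I : set mR := `[- X, X]%classic.
have mI : measurable I by exact: measurable_itv.
pose V (c : mR) : R := \sum_(0 <= n < n0) `|N%:~R * c + n%:R| `^ (- sg) +
       \sum_(0 <= n < n0) `|- N%:~R * c + (n%:R + 1)| `^ (- sg).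
pose U (a : mR) : R := \sum_(j <- zrange J) `|N%:~R * a + (- j%:~R)| `^ (- tau).
have iU : mu.-integrable I (EFin \o U).
  by apply: integrable_sumR => // j; exact: integrable_powR_affine.
have iV : mu.-integrable I (EFin \o V).
  have h1 : mu.-integrable I (EFin \o (fun c : mR => \sum_(0 <= n < n0) `|N%:~R * c + n%:R| `^ (- sg))).
    by apply: integrable_sumR => // j; exact: integrable_powR_affine.
  have h2 : mu.-integrable I (EFin \o (fun c : mR =>
      \sum_(0 <= n < n0) `|- N%:~R * c + (n%:R + 1)| `^ (- sg))).
    by apply: integrable_sumR => // j; apply: integrable_powR_affine; rewrite ?oppr_eq0.
  have := integrable_lin2 mI 1 1 h1 h2.
  by under [X in EFin \o X]eq_fun do rewrite !mul1r.
have i1 : mu.-integrable I (EFin \o (fun=> 1 : R)) by exact: integrable_itv_cst.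
have [g1 _] := rect3_integral mI mI mI iU i1 i1.
have [g2 _] := rect3_integral mI mI mI i1 iV i1.
have mB : measurable (box X : set T3) by exact: measurable_rect3.
exists (fun p => 1 * (1 * V p.1.2 * 1) + K * (U p.1.1 * 1 * 1)); split.
  exact: integrable_lin2.
move=> p [[p1 p2] _] hp M; rewrite !mulr1 !mul1r.
have n1 : `|p.1.1| <= X by move: p1 => /=; rewrite in_itv /= ler_norml.
have n2 : `|p.1.2| <= X by move: p2 => /=; rewrite in_itv /= ler_norml.
apply: (le_trans (hK p n2 hp M)); rewrite lerD2l ler_wpM2l//.
by apply: hJ => //; case/andP: t01 => /ltW.
Qed.

End LerchMajorant.

(** * Lerch functions: transformation laws and induced distributions *)

Section LerchFunctions.
Context {R : realType} (N : int) (d : nat) (chi : dirichlet_character R d).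
Local Notation C := R[i].
Local Notation mu := (@lebesgue_measure R).
Local Notation leb3 := (@leb3 R).
Local Notation mR := (measurableTypeR R).
Local Notation T3 := (mR * mR * mR)%type.
Local Notation cube := (@unit_cube R).
Hypotheses (hN : N != 0) (hd : (d %| `|N|)%N).
Variables (s : C) (k : bool).
Hypothesis sg01 : 0 < complex.Re s < 1.
Local Notation phi := (delta_density k (1 - s)).
Local Notation wbterm := (wbterm N chi phi).
Local Notation wbpart := (wbpart N chi phi).
Local Notation wbsum := (wbsum N chi phi).
Local Notation wbfun := (wbfun N chi phi).
Local Notation nonint := (nonint N).
Implicit Types p : T3.

Let NR : (N%:~R : R) != 0. Proof. by rewrite intr_eq0. Qed.

Let w0 : 0 < complex.Re (1 - s).
Proof. by have /andP[_ h] := sg01; rewrite ReB /= subr_gt0. Qed.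

Let mphi : cmeasurable (phi : mR -> C).
Proof. by case: (kernel_delta k w0). Qed.

Let msum : cmeasurable (wbsum : T3 -> C).
Proof. by apply: cmeasurable_zseries => n; exact: cmeasurable_wbterm. Qed.

Let ae_nonint (x : R) : {ae leb3, forall p : T3, nonint (x + p.1.1)}.
Proof.
have h := ae3_1 (ae_affine_nonint (N%:~R * x) NR).
by apply: ae_imp h => p hp; rewrite /nonint mulrDr [_ * x + _]addrC addr0.
Qed.

Let ae_nonint0 : {ae leb3, forall p : T3, nonint p.1.1}.
Proof. by apply: ae_imp (ae_nonint 0) => p; rewrite add0r. Qed.

Lemma lerch_part_cvg p : nonint p.1.1 -> ccvg (fun M => wbpart M p) (wbsum p).
Proof. by move=> /(lerch_zcvg chi hN hd k sg01)[[l1 h1] [l2 h2]]; exact: wbpart_ccvg_half h1 h2. Qed.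

Lemma lerch_fun_wbfun : lerch_fun N chi k s = wbfun.
Proof. by apply/funext => p; rewrite lerch_funE. Qed.

Lemma lerch_in_L1 : in_L1HNd N chi (lerch_fun N chi k s).
Proof.
rewrite lerch_fun_wbfun; have mw : cmeasurable (wbfun : T3 -> C).
  by apply: cmeasurableM => //; exact: cmeasurable_e2piz.
split.
- split=> // M; have [G [iG hG]] := lerch_majorant chi hN hd k sg01 M.
  apply: (ae_cintegrable_le _ mw _ iG); first exact: measurable_rect3.
  apply: ae_imp ae_nonint0 => p hp pM.
  rewrite wbfunE normcM normc_e2pi mul1r.
  by apply: ccvg_le (lerch_part_cvg hp) _ => n; exact: hG.
- move=> g hg; apply: ae_imp (ae_nonint g.1.1) => p hp.
  by apply: wbfun_int => //; exact: (lerch_zcvg chi hN hd k sg01 (p := hmul g p)).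
- by apply: ae_all => p; exact: wbfun_central.
- move=> rel hrel; have hv := rel_coeff_vanish hN hd hrel.
  (* A relation has finitely many translates, each shifting a by a constant; off a finite union of
     null sets all the translated series converge. *)
  have h : {ae leb3, forall p : T3, forall x, x \in rel -> nonint (hmul x.2 p).1.1}.
    elim: rel {hrel hv} => [|y rel IH]; first exact: ae_all.
    apply: ae_imp (ae_and (ae_nonint y.2.1.1) IH) => p [h1 h2] x.
    by rewrite inE => /orP[/eqP ->|/h2].
  apply: ae_imp h => p hp; apply: relation_general => // x /hp.
  exact: (lerch_zcvg chi hN hd k sg01 (p := hmul x.2 p)).
Qed.

(** For Re s < 1 the distribution [delta k (1 - s)] is an absolutely convergent integral, to which
    the pairing formula applies. The factor [wb_const] restores the normalisation of the Weil-Brezin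
    map, which the Lerch series omits. *)
Lemma lerch_dist_induced :
  lerch_dist N chi k s = induced_dist N chi (wb_const N d *: lerch_fun N chi k s).
Proof.
apply/funext => F; rewrite /lerch_dist /wb_sharp /induced_dist.
set f := wb_inv F; rewrite delta_pos//.
have [G [iG hG]] := lerch_majorant chi hN hd k sg01 1.
have cubeS : cube `<=` box 1.
  have I1 : (`[0, 1]%classic : set mR) `<=` `[- 1, 1]%classic.
    by move=> x /=; rewrite !in_itv /= => /andP[x0 ->]; rewrite andbT (le_trans _ x0)// lerN10.
  by move=> p [[p1 p2] p3]; split; [split|]; exact: I1.
have mbox : measurable (box 1 : set T3) by exact: measurable_rect3.
have iphi g : cintegrable mu setT (fun x => phi x * (g : schwartz R) x).
  exact: kernel_integrable (kernel_delta k w0) g.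
have h1 : {ae leb3, forall p, cube p -> ccvg (fun M => wbpart M p) (wbsum p)}.
  by apply: ae_imp ae_nonint0 => p hp _; exact: lerch_part_cvg.
have h2 : {ae leb3, forall p, cube p -> forall M, normc (wbpart M p) <= G p}.
  by apply: ae_imp ae_nonint0 => p hp pc; apply: hG => //; exact: cubeS.
have iGc := integrableS mbox (@measurable_cube R) cubeS iG.
have e := wb_pairing hN hd mphi iphi f msum h1 iGc h2.
rewrite /sdelta /kint -e; congr cintegral; apply/funext => p.
rewrite lerch_fun_wbfun -[(wb_const N d *: wbfun) p]/(wb_const N d * wbfun p).
by rewrite wbfunE mulrA.
Qed.

End LerchFunctions.

(** * Hecke eigenspaces and their bases of Lerch distributions *)

Theorem theorem9p9 (R : realType) (N : int) (d : nat)
    (chi : dirichlet_character R d) (hN : N != 0) (hd : (d %| `|N|)%N) :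
  (forall s : R[i],
     has_dimension 2 (hecke_eigenspace N chi s) /\
     exists De Do : schwartzH N chi -> R[i],
       [/\ transported even_dist De,
           transported (homogeneous (quasichar false (1 - s))) De,
           transported odd_dist Do,
           transported (homogeneous (quasichar true (1 - s))) Do
         & hecke_eigenspace N chi s = span2 De Do]) /\
  (forall s : R[i], ~ is_integer s ->
     let Lp := lerch_dist N chi false s in
     let Lm := lerch_dist N chi true s in
     [/\ [/\ Lp <> 0, transported even_dist Lp
           & transported (homogeneous (quasichar false (1 - s))) Lp],
         [/\ Lm <> 0, transported odd_dist Lm
           & transported (homogeneous (quasichar true (1 - s))) Lm]
       & hecke_eigenspace N chi s = span2 Lp Lm]) /\
  (forall (s : R[i]) (k : bool), 0 < complex.Re s < 1 ->
     in_L1HNd N chi (lerch_fun N chi k s) /\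
     lerch_dist N chi k s =
       induced_dist N chi (wb_const N d *: lerch_fun N chi k s)).
Proof.
have injW : injective (@wb_map R N d chi) by exact: wb_map_inj.
split; [|split].
- move=> s; have hn := bound_Re_gt0 (1 - s).
  have [E0 [hE0 E0n]] := homdist_exists false hn.
  have [E1 [hE1 E1n]] := homdist_exists true hn.
  split; first exact: eigenspace_dim hE0 E0n hE1 E1n.
  exists (wb_sharp E0), (wb_sharp E1).
  have [t0 _ _] := hE0; have [t1 _ _] := hE1; split.
  + exact: transported_sharp t0 (homdist_even hE0).
  + exact: transported_sharp t0 (homdist_homogeneous hE0).
  + exact: transported_sharp t1 (homdist_odd hE1).
  + exact: transported_sharp t1 (homdist_homogeneous hE1).
  + exact: eigenspace_span hE0 E0n hE1 E1n.
- move=> s sZ Lp Lm.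
  have wZ : ~ is_integer (1 - s).
    move=> [n en]; apply: sZ; exists (1 - n).
    by rewrite rmorphB /= -en rmorph1 subKr.
  have [h0 n0] := homdist_delta false wZ; have [h1 n1] := homdist_delta true wZ.
  have [t0 _ _] := h0; have [t1 _ _] := h1; split; [split|split|].
  + exact: wb_sharp_neq0.
  + exact: transported_sharp t0 (homdist_even h0).
  + exact: transported_sharp t0 (homdist_homogeneous h0).
  + exact: wb_sharp_neq0.
  + exact: transported_sharp t1 (homdist_odd h1).
  + exact: transported_sharp t1 (homdist_homogeneous h1).
  + exact: eigenspace_span h0 n0 h1 n1.
- move=> s k s01; split; first exact: lerch_in_L1.
  exact: lerch_dist_induced.
Qed.
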